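(* Let $N$ be a natural number ($N\ge 1$) and let $k$ be any rational number. If the Kaneko--Zagier (KZ) equation of weight $k$, $$f''(\tau)-\frac{k+1}{6}E_2(\tau)f'(\tau)+\frac{k(k+1)}{12}E_2'(\tau)f(\tau)=0,$$ has a fundamental system of solutions (two linearly independent solutions) each of which is a modular form for the principal congruence subgroup $\Gamma(N)$, then $$k\equiv \tfrac12,\ \tfrac72,\ 1,\ 2,\ 3 \pmod 6\qquad\text{or}\qquad k=\frac{6n+1}{5}\ \text{ for some } n\in\mathbb{Z}.$$
   Context: Here $\tau$ lies in the upper half-plane $\mathbb{H}$, $'=\frac{1}{2\pi i}\frac{d}{d\tau}$, and $E_2(\tau)=1-24\sum_{n\ge1}\sigma_1(n)q^n$, $q=e^{2\pi i\tau}$, is the weight $2$ Eisenstein series. For rational $k,a$, ''$k\equiv a \pmod 6$'' means $k-a\in 6\mathbb{Z}$. $\Gamma(N)$ is the group of matrices in $\mathrm{SL}_2(\mathbb{Z})$ congruent to the identity modulo $N$. ''Modular form'' is meant in a broad sense: a nonzero meromorphic function $f$ on $\mathbb{H}$, with (finite-order) poles allowed in $\mathbb{H}$ and at the cusps, for which there are a rational number $w$ (the weight, any rational number allowed) and nonzero constants $v(\gamma)$ (a possibly non-trivial multiplier system) such that $f(\gamma\tau)=v(\gamma)(c\tau+d)^{w}f(\tau)$ for all $\gamma=\begin{pmatrix}a&b\\c&d\end{pmatrix}\in\Gamma(N)$ (with a fixed branch of $(c\tau+d)^w$). The two solutions of the fundamental system are not required to share the same multiplier system. *)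

(* Defs.v *)
From Stdlib Require Export Reals ZArith QArith Qreals List.
From Coquelicot Require Export Coquelicot.

Local Open Scope C_scope.

Definition upper_half_plane (tau : C) : Prop := (0 < Im tau)%R.

Definition Cexp (z : C) : C := RtoC (exp (Re z)) * (cos (Im z), sin (Im z)).

(* Principal argument, with values in (-PI, PI] for z <> 0. *)
Definition Carg (z : C) : R :=
  if Rle_dec 0 (Im z) then acos (Re z / Cmod z) else (- acos (Re z / Cmod z))%R.

Definition Clog (z : C) : C := (ln (Cmod z), Carg z).

(* Principal branch of z ^ w for a real exponent. On the set of all c tau + d
   with (c, d) a fixed nonzero pair of integers it is holomorphic in tau: this
   set is a single point or lies in an open half-plane bounded by the real
   axis. *)
Definition Crpower (z : C) (w : R) : C := Cexp (RtoC w * Clog z).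

Definition two_pi_i : C := RtoC (2 * PI)%R * Ci.

(* q = exp (2 pi i tau) *)
Definition nome (tau : C) : C := Cexp (two_pi_i * tau).

(* Series is real-valued and total; on a convergent complex series this is its
   sum. *)
Definition Cseries (a : nat -> C) : C :=
  (Series (fun n => Re (a n)), Series (fun n => Im (a n))).

Definition sigma1 (n : nat) : nat :=
  list_sum (filter (fun d => Nat.eqb (Nat.modulo n d) 0) (seq 1 n)).

Definition E2 (tau : C) : C :=
  1 - 24 * Cseries (fun n => RtoC (INR (sigma1 (S n))) * nome tau ^ S n).

(* The derivation (2 pi i)^-1 d/dtau. *)
Definition Dtau (f : C -> C) (tau : C) : C := C_derive f tau / two_pi_i.

(* A meromorphic function on the upper half-plane is encoded by a total function
   C -> C; its values at poles (and, possibly, on a discrete set of removable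
   singularities) carry no information. Every identity between meromorphic
   functions is therefore only required at the points where the functions
   involved are holomorphic. *)
Definition holomorphic_at (f : C -> C) (z0 : C) : Prop :=
  exists a : nat -> C,
    locally z0 (fun z =>
      is_pseries (K := C_AbsRing) (V := C_NormedModule) a (z - z0) (f z)).

(* The Laurent expansion at z0 has a finite principal part. *)
Definition meromorphic_at (f : C -> C) (z0 : C) : Prop :=
  exists (m : nat) (a : nat -> C),
    locally' z0 (fun z =>
      is_pseries (K := C_AbsRing) (V := C_NormedModule) a (z - z0)
        ((z - z0) ^ m * f z)).

Definition meromorphic_on_H (f : C -> C) : Prop :=
  forall tau : C, upper_half_plane tau -> meromorphic_at f tau.

Definition nonzero_on_H (f : C -> C) : Prop :=
  exists tau : C, upper_half_plane tau /\ holomorphic_at f tau /\ f tau <> 0.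

Record SL2Z : Set := mkSL2Z {
  sl_a : Z; sl_b : Z; sl_c : Z; sl_d : Z;
  sl_det : (sl_a * sl_d - sl_b * sl_c = 1)%Z }.

Definition in_Gamma (N : nat) (g : SL2Z) : Prop :=
  (Z.of_nat N | sl_a g - 1)%Z /\ (Z.of_nat N | sl_b g)%Z /\
  (Z.of_nat N | sl_c g)%Z /\ (Z.of_nat N | sl_d g - 1)%Z.

Definition autom (g : SL2Z) (tau : C) : C :=
  RtoC (IZR (sl_c g)) * tau + RtoC (IZR (sl_d g)).

Definition moebius (g : SL2Z) (tau : C) : C :=
  (RtoC (IZR (sl_a g)) * tau + RtoC (IZR (sl_b g))) / autom g tau.

Definition slash (w : R) (f : C -> C) (g : SL2Z) (tau : C) : C :=
  Crpower (autom g tau) (- w) * f (moebius g tau).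

Definition transforms_under_Gamma (N : nat) (w : R) (f : C -> C) : Prop :=
  exists v : SL2Z -> C, forall g : SL2Z, in_Gamma N g ->
    v g <> 0 /\
    forall tau : C, upper_half_plane tau ->
      holomorphic_at f tau -> holomorphic_at f (moebius g tau) ->
      f (moebius g tau) = v g * Crpower (autom g tau) w * f tau.

(* The cusp is g(oo). For f with a multiplier system on Gamma(N), slash w f g is
   multiplied by a nonzero constant exp (2 pi i kappa N) under tau -> tau + N, so
   that exp (- 2 pi i kappa tau) * slash w f g tau has a Laurent expansion in
   q_N = exp (2 pi i tau / N); the multiplier need not be unitary, whence kappa
   is complex. The principal part of this expansion is required to be finite. *)
Definition meromorphic_at_cusp (N : nat) (w : R) (f : C -> C) (g : SL2Z) : Prop :=
  exists (kappa : C) (m : nat) (a : nat -> C) (A : R),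
    (0 < A)%R /\
    forall tau : C, (A < Im tau)%R -> holomorphic_at f (moebius g tau) ->
      is_pseries (K := C_AbsRing) (V := C_NormedModule) a
        (nome (tau / RtoC (INR N)))
        (nome (tau / RtoC (INR N)) ^ m *
         (Cexp (- (two_pi_i * kappa * tau)) * slash w f g tau)).

Definition is_modular_form (N : nat) (f : C -> C) : Prop :=
  meromorphic_on_H f /\ nonzero_on_H f /\
  exists w : Q,
    transforms_under_Gamma N (Q2R w) f /\
    forall g : SL2Z, meromorphic_at_cusp N (Q2R w) f g.

Definition KZ_solution (k : Q) (f : C -> C) : Prop :=
  forall tau : C, upper_half_plane tau -> holomorphic_at f tau ->
    Dtau (Dtau f) tau
    - RtoC (Q2R ((k + 1) / 6)) * E2 tau * Dtau f tau
    + RtoC (Q2R (k * (k + 1) / 12)) * Dtau E2 tau * f tau = 0.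

Definition linearly_independent_on_H (f1 f2 : C -> C) : Prop :=
  forall c1 c2 : C,
    (forall tau : C, upper_half_plane tau ->
      holomorphic_at f1 tau -> holomorphic_at f2 tau ->
      c1 * f1 tau + c2 * f2 tau = 0) ->
    c1 = 0 /\ c2 = 0.

(* Congruence of rational numbers: k - a is in 6 Z. *)
Definition congr6 (k a : Q) : Prop :=
  exists n : Z, (k - a == 6 * inject_Z n)%Q.

(* Main.v *)
Require Import Defs.
From Stdlib Require Import Lra Lia Psatz Classical FunctionalExtensionality ClassicalEpsilon.
From Stdlib Require Import Znumtheory(rel_prime, Bezout(..), rel_prime_bezout, bezout_rel_prime, rel_prime_mult, rel_prime_sym, Zgcd_1_rel_prime, Gauss).
From Stdlib Require Lqa.

(* Write (k+1)/6 = j/m in lowest terms; the claim says exactly that m <= 5. Solutions of the equation extend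
   holomorphically to the half-plane, and SL_2(Z) acts on them projectively because E_2 satisfies its weight 2
   transformation law with the anomaly 6 c (c tau + d) / (pi i). If m >= 6, the exponents 0 and j/m at the cusp
   give a basis on which T = diag(1, zeta), zeta = e(j/m), while S has trace 0 and (ST)^3 is scalar; this fixes the
   product yz of the off-diagonal entries of S. Modularity of the two given solutions makes the image of Gamma(N)
   simultaneously diagonalizable.
   If exactly one of y, z vanishes, a commutator in Gamma(N) is unipotent up to a scalar, a contradiction. If
   y = z = 0, the solutions are eigenfunctions of S, and a monotonicity argument on the imaginary axis forces one of
   them to vanish. If yz <> 0, Gamma(N) acts by scalars, so that m divides N; comparing words in S and T which agree
   modulo N shows that c(s) = 2 cos(2 pi s) - 1 satisfies c(a j/m) = c(j/m) or c(a j/m) c(j/m) = 1 for every unit a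
   modulo N, and c(j/m) <> 0. No m >= 6 allows this. *)

Local Open Scope C_scope.

(** * Limits and series of complex numbers *)

(** The weights and multiplier systems of the two given forms are unknown and may differ; they serve
    only to diagonalize the matrices by which $\Gamma(N)$ acts on the two-dimensional solution
    space. To avoid branch cocycles of $(c\tau+d)^k$ for rational $k$, these matrices are kept up to
    scalars, and an automorphy factor is pinned down by its logarithmic derivative $kc/(c\tau+d)$
    alone. If $S$ has rows $(x,y)$ and $(z,-x)$, scalarity of $(ST)^3$ reads $yz=-x^2\,c(j/m)$ with
    $c(s)=2\cos 2\pi s-1$; this is where $c$ comes from. The bound $6$ is the value from which on
    $2\pi/m\le\pi/3$, that is $0\le c(1/m)<1$. When $y=z=0$, $S$ and $T$ commute and $e(j/m)$ is a
    primitive sixth root of unity. Abelian quotients of $SL_2(\mathbb{Z})$ do realize this, so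
    algebra cannot exclude it and the differential equation itself has to be used. The given
    functions may take meaningless values on a discrete set. They are therefore replaced by their
    holomorphic extensions, and identities known off that set are carried over by continuity. *)

Definition CL (u : nat -> C) (l : C) : Prop :=
  forall eps : R, (0 < eps)%R ->
    exists N, forall n, (N <= n)%nat -> (Cmod (u n - l) < eps)%R.

Fixpoint psum (a : nat -> C) (n : nat) : C :=
  match n with O => 0 | S m => psum a m + a m end.

Fixpoint rsum (a : nat -> R) (n : nat) : R :=
  match n with O => 0%R | S m => (rsum a m + a m)%R end.

Definition CS (a : nat -> C) (l : C) : Prop := CL (psum a) l.

Lemma Cmod_minus_sym (a b : C) : Cmod (a - b) = Cmod (b - a).
Proof. replace (a - b) with (- (b - a)) by ring. apply Cmod_opp. Qed.

Lemma Cmod_sub_tri (a b c : C) : (Cmod (a - c) <= Cmod (a - b) + Cmod (b - c))%R.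
Proof. replace (a - c) with ((a - b) + (b - c)) by ring. apply Cmod_triangle. Qed.

Lemma Cmod_sub_le (a b : C) : (Cmod (a - b) <= Cmod a + Cmod b)%R.
Proof. replace (a - b) with (a + (- b)) by ring. rewrite <- (Cmod_opp b). apply Cmod_triangle. Qed.

Lemma Cmod_rev_tri (a b : C) : (Cmod a - Cmod b <= Cmod (a - b))%R.
Proof.
  assert (H := Cmod_triangle (a - b) b). replace (a - b + b) with a in H by ring. lra.
Qed.

Lemma Cmod_rev_tri_plus (a b : C) : (Cmod a - Cmod b <= Cmod (a + b))%R.
Proof.
  assert (H := Cmod_rev_tri a (- b)). rewrite Cmod_opp in H.
  replace (a - - b) with (a + b) in H by ring. lra.
Qed.

Lemma Cmod_small_eq (a b : C) : (forall eps, 0 < eps -> Cmod (a - b) < eps)%R -> a = b.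
Proof.
  intros H. assert (E : Cmod (a - b) = 0%R).
  { destruct (Rle_lt_or_eq_dec _ _ (Cmod_ge_0 (a - b))) as [h|h]; [|auto].
    specialize (H _ h). lra. }
  apply Cmod_eq_0 in E. replace a with ((a - b) + b) by ring. rewrite E. ring.
Qed.

Lemma CL_unique (u : nat -> C) (l l' : C) : CL u l -> CL u l' -> l = l'.
Proof.
  intros H H'. apply Cmod_small_eq. intros eps he.
  destruct (H (eps / 2)%R ltac:(lra)) as [N hN].
  destruct (H' (eps / 2)%R ltac:(lra)) as [N' hN'].
  specialize (hN (max N N') ltac:(lia)). specialize (hN' (max N N') ltac:(lia)).
  rewrite Cmod_minus_sym in hN.
  assert (h := Cmod_sub_tri l (u (max N N')) l'). lra.
Qed.

Lemma CL_eventually (u v : nat -> C) (l : C) (K : nat) :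
  (forall n, (K <= n)%nat -> u n = v n) -> CL u l -> CL v l.
Proof.
  intros E H eps he. destruct (H eps he) as [N hN]. exists (max N K). intros n hn.
  rewrite <- E by lia. apply hN. lia.
Qed.

Lemma CL_ext (u v : nat -> C) (l : C) : (forall n, u n = v n) -> CL u l -> CL v l.
Proof. intros E. apply (CL_eventually u v l 0). auto. Qed.

Lemma CL_const (l : C) : CL (fun _ => l) l.
Proof.
  intros eps he. exists 0%nat. intros n _. replace (l - l) with (RtoC 0) by ring.
  rewrite Cmod_0. exact he.
Qed.

Lemma CL_plus (u v : nat -> C) (l m : C) :
  CL u l -> CL v m -> CL (fun n => u n + v n) (l + m).
Proof.
  intros H H' eps he.
  destruct (H (eps / 2)%R ltac:(lra)) as [N hN].
  destruct (H' (eps / 2)%R ltac:(lra)) as [N' hN'].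
  exists (max N N'). intros n hn.
  specialize (hN n ltac:(lia)). specialize (hN' n ltac:(lia)).
  replace (u n + v n - (l + m)) with ((u n - l) + (v n - m)) by ring.
  assert (h := Cmod_triangle (u n - l) (v n - m)). lra.
Qed.

Lemma CL_bounded (u : nat -> C) (l : C) :
  CL u l -> exists K, forall n, (K <= n)%nat -> (Cmod (u n) <= Cmod l + 1)%R.
Proof.
  intros H. destruct (H 1%R ltac:(lra)) as [N hN]. exists N. intros n hn.
  specialize (hN n hn). assert (h := Cmod_triangle (u n - l) l).
  replace (u n - l + l) with (u n) in h by ring. lra.
Qed.

Lemma CL_squeeze (u : nat -> C) (l : C) (e : nat -> R) (K : nat) :
  (forall n, (K <= n)%nat -> (Cmod (u n - l) <= e n)%R) -> is_lim_seq e 0 -> CL u l.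
Proof.
  intros H He eps heps.
  apply is_lim_seq_spec in He. destruct (He (mkposreal eps heps)) as [N hN]. simpl in hN.
  exists (max N K). intros n hn. specialize (H n ltac:(lia)). specialize (hN n ltac:(lia)).
  rewrite Rminus_0_r in hN. apply Rabs_def2 in hN. lra.
Qed.

Lemma CL_lim (u : nat -> C) (l : C) : CL u l -> is_lim_seq (fun n => Cmod (u n - l)) 0.
Proof.
  intros H. apply is_lim_seq_spec. intros [eps he]. destruct (H eps he) as [N hN].
  exists N. intros n hn. simpl. rewrite Rminus_0_r, Rabs_right; [auto|].
  apply Rle_ge, Cmod_ge_0.
Qed.

Lemma CL_mult (u v : nat -> C) (l m : C) :
  CL u l -> CL v m -> CL (fun n => u n * v n) (l * m).
Proof.
  intros H H'. destruct (CL_bounded _ _ H) as [K hK].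
  apply (CL_squeeze _ _ (fun n => (Cmod l + 1) * Cmod (v n - m) + Cmod m * Cmod (u n - l))%R K).
  - intros n hn. replace (u n * v n - l * m) with (u n * (v n - m) + m * (u n - l)) by ring.
    eapply Rle_trans; [apply Cmod_triangle|]. rewrite !Cmod_mult.
    apply Rplus_le_compat_r. apply Rmult_le_compat_r; [apply Cmod_ge_0|auto].
  - replace (Finite 0) with (Rbar_plus (Rbar_mult (Cmod l + 1)%R 0%R) (Rbar_mult (Cmod m) 0%R)).
    + apply is_lim_seq_plus'; apply (is_lim_seq_scal_l _ _ (Finite 0)); apply CL_lim; auto.
    + simpl. f_equal. ring.
Qed.

Lemma CL_scal (c : C) (u : nat -> C) (l : C) : CL u l -> CL (fun n => c * u n) (c * l).
Proof. intros H. apply (CL_mult (fun _ => c)); [apply CL_const|exact H]. Qed.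

Lemma CL_minus (u v : nat -> C) (l m : C) :
  CL u l -> CL v m -> CL (fun n => u n - v n) (l - m).
Proof.
  intros H H'. replace (l - m) with (l + (- (1)) * m) by ring.
  apply CL_ext with (fun n => u n + (- (1)) * v n); [intros; ring|].
  apply CL_plus; [auto|apply CL_scal; auto].
Qed.

Lemma CL_inv (u : nat -> C) (l : C) : l <> 0 -> CL u l -> CL (fun n => / u n) (/ l).
Proof.
  intros hl H. assert (hl' := proj1 (Cmod_gt_0 l) hl).
  destruct (H (Cmod l / 2)%R ltac:(lra)) as [N hN].
  assert (B : forall n, (N <= n)%nat -> (Cmod l / 2 <= Cmod (u n))%R).
  { intros n hn. specialize (hN n hn). rewrite Cmod_minus_sym in hN.
    assert (h := Cmod_rev_tri l (l - u n)). replace (l - (l - u n)) with (u n) in h by ring. lra. }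
  apply (CL_squeeze _ _ (fun n => (2 / (Cmod l * Cmod l)) * Cmod (u n - l))%R N).
  - intros n hn. specialize (B n hn).
    assert (hu : u n <> 0). { apply Cmod_gt_0. lra. }
    replace (/ u n - / l) with ((l - u n) / (u n * l)) by (field; auto).
    rewrite Cmod_div by (apply Cmult_neq_0; auto). rewrite Cmod_mult, (Cmod_minus_sym l).
    unfold Rdiv. rewrite Rmult_comm. apply Rmult_le_compat_r; [apply Cmod_ge_0|].
    apply Rmult_le_reg_l with (Cmod (u n) * Cmod l)%R; [apply Rmult_lt_0_compat; lra|].
    rewrite Rinv_r by (apply Rgt_not_eq, Rmult_lt_0_compat; lra).
    replace (Cmod (u n) * Cmod l * (2 * / (Cmod l * Cmod l)))%R with (Cmod (u n) * 2 / Cmod l)%R by (field; lra).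
    apply Rmult_le_reg_r with (Cmod l); [lra|].
    replace (Cmod (u n) * 2 / Cmod l * Cmod l)%R with (Cmod (u n) * 2)%R by (field; lra). lra.
  - replace (Finite 0) with (Rbar_mult (2 / (Cmod l * Cmod l))%R 0%R) by (simpl; f_equal; ring).
    apply is_lim_seq_scal_l, CL_lim; auto.
Qed.

Lemma CL_S (u : nat -> C) (l : C) : CL u l <-> CL (fun n => u (S n)) l.
Proof.
  split; intros H eps he; destruct (H eps he) as [N hN].
  - exists N. intros. apply hN. lia.
  - exists (S N). intros [|n] hn; [lia|]. apply hN. lia.
Qed.

Lemma CL_sub (u : nat -> C) (l : C) (f : nat -> nat) :
  (forall n, (n <= f n)%nat) -> CL u l -> CL (fun n => u (f n)) l.
Proof.
  intros hf H eps he. destruct (H eps he) as [N hN]. exists N. intros n hn.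
  apply hN. specialize (hf n). lia.
Qed.

Lemma CL_mod_le (u : nat -> C) (l : C) (B : R) (K : nat) :
  (forall n, (K <= n)%nat -> (Cmod (u n) <= B)%R) -> CL u l -> (Cmod l <= B)%R.
Proof.
  intros hB H. apply Rnot_lt_le. intros h.
  destruct (H (Cmod l - B)%R ltac:(lra)) as [N hN].
  specialize (hN (max N K) ltac:(lia)). specialize (hB (max N K) ltac:(lia)).
  rewrite Cmod_minus_sym in hN. assert (t := Cmod_rev_tri l (u (max N K))). lra.
Qed.

(** * Finite sums, majorants and tails *)

Lemma psum_ext (a b : nat -> C) (n : nat) :
  (forall i, (i < n)%nat -> a i = b i) -> psum a n = psum b n.
Proof.
  induction n as [|n IH]; intros H; simpl; [auto|]. rewrite IH by (intros; apply H; lia).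
  rewrite H by lia. auto.
Qed.

Lemma psum_plus (a b : nat -> C) (n : nat) :
  psum (fun i => a i + b i) n = psum a n + psum b n.
Proof. induction n as [|n IH]; simpl; [ring|rewrite IH; ring]. Qed.

Lemma psum_scal (c : C) (a : nat -> C) (n : nat) : psum (fun i => c * a i) n = c * psum a n.
Proof. induction n as [|n IH]; simpl; [ring|rewrite IH; ring]. Qed.

Lemma psum_S (a : nat -> C) (n : nat) : psum a (S n) = a 0%nat + psum (fun i => a (S i)) n.
Proof. induction n as [|n IH]; [simpl; ring|]. simpl in *. rewrite IH. ring. Qed.

Lemma psum_add (a : nat -> C) (n m : nat) :
  psum a (n + m) = psum a n + psum (fun i => a (n + i)%nat) m.
Proof.
  induction m as [|m IH]; [rewrite Nat.add_0_r; simpl; ring|].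
  rewrite Nat.add_succ_r. simpl. rewrite IH. ring.
Qed.

Lemma psum_zero (a : nat -> C) (n : nat) : (forall i, (i < n)%nat -> a i = 0) -> psum a n = 0.
Proof.
  induction n as [|n IH]; intros H; simpl; [auto|].
  rewrite IH by (intros; apply H; lia). rewrite H by lia. ring.
Qed.

Lemma psum_rev (a : nat -> C) (n : nat) : psum (fun i => a (n - 1 - i)%nat) n = psum a n.
Proof.
  induction n as [|n IH]; [auto|]. rewrite psum_S. simpl psum at 2. rewrite <- IH.
  replace (S n - 1 - 0)%nat with n by lia. rewrite Cplus_comm. f_equal.
  apply psum_ext. intros i hi. f_equal. lia.
Qed.

Lemma rsum_ge0 (a : nat -> R) (n : nat) : (forall i, 0 <= a i)%R -> (0 <= rsum a n)%R.
Proof. intros H. induction n as [|n IH]; simpl; [lra|]. specialize (H n). lra. Qed.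

Lemma rsum_le (a b : nat -> R) (n : nat) :
  (forall i, (i < n)%nat -> (a i <= b i)%R) -> (rsum a n <= rsum b n)%R.
Proof.
  induction n as [|n IH]; intros H; simpl; [lra|].
  assert (h := H n ltac:(lia)). assert (rsum a n <= rsum b n)%R by (apply IH; intros; apply H; lia).
  lra.
Qed.

Lemma rsum_scal (c : R) (a : nat -> R) (n : nat) : (rsum (fun i => c * a i) n = c * rsum a n)%R.
Proof. induction n as [|n IH]; simpl; [ring|rewrite IH; ring]. Qed.

Lemma rsum_add (a : nat -> R) (n m : nat) :
  (rsum a (n + m) = rsum a n + rsum (fun i => a (n + i)%nat) m)%R.
Proof.
  induction m as [|m IH]; [rewrite Nat.add_0_r; simpl; ring|].
  rewrite Nat.add_succ_r. simpl. rewrite IH. ring.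
Qed.

Lemma rsum_incr (a : nat -> R) (n m : nat) :
  (forall i, 0 <= a i)%R -> (n <= m)%nat -> (rsum a n <= rsum a m)%R.
Proof.
  intros H h. replace m with (n + (m - n))%nat by lia. rewrite rsum_add.
  assert (t := rsum_ge0 (fun i => a (n + i)%nat) (m - n) ltac:(intros; apply H)). lra.
Qed.

Lemma rsum_term (a : nat -> R) (n i : nat) :
  (forall j, 0 <= a j)%R -> (i < n)%nat -> (a i <= rsum a n)%R.
Proof.
  intros H h. apply Rle_trans with (rsum a (S i)).
  - simpl. assert (t := rsum_ge0 a i H). lra.
  - apply rsum_incr; auto.
Qed.

Lemma psum_mod (a : nat -> C) (n : nat) : (Cmod (psum a n) <= rsum (fun i => Cmod (a i)) n)%R.
Proof.
  induction n as [|n IH]; simpl; [rewrite Cmod_0; lra|].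
  eapply Rle_trans; [apply Cmod_triangle|]. lra.
Qed.

(** Bounded increasing partial sums converge, so blocks far out are small; this is the form in which
    majorants are used below. *)
Lemma rsum_tail (B : nat -> R) (SB : R) :
  (forall i, 0 <= B i)%R -> (forall n, rsum B n <= SB)%R ->
  forall eps, (0 < eps)%R -> exists N, forall n, (N <= n)%nat -> (rsum B n - rsum B N <= eps)%R.
Proof.
  intros hB hS eps he.
  destruct (ex_finite_lim_seq_incr (rsum B) SB) as [l hl].
  - intros n. simpl. specialize (hB n). lra.
  - exact hS.
  - apply is_lim_seq_spec in hl. destruct (hl (mkposreal (eps / 2) ltac:(lra))) as [N hN].
    simpl in hN. exists N. intros n hn.
    assert (h1 := hN N ltac:(lia)). assert (h2 := hN n hn).
    apply Rabs_def2 in h1. apply Rabs_def2 in h2. lra.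
Qed.

Lemma psum_diff_mod (a : nat -> C) (B : nat -> R) (N n : nat) :
  (forall i, Cmod (a i) <= B i)%R -> (N <= n)%nat ->
  (Cmod (psum a n - psum a N) <= rsum B n - rsum B N)%R.
Proof.
  intros hB h. replace n with (N + (n - N))%nat by lia. rewrite psum_add, rsum_add.
  replace (psum a N + psum (fun i => a (N + i)%nat) (n - N) - psum a N)
    with (psum (fun i => a (N + i)%nat) (n - N)) by ring.
  eapply Rle_trans; [apply psum_mod|].
  replace (rsum B N + rsum (fun i => B (N + i)%nat) (n - N) - rsum B N)%R
    with (rsum (fun i => B (N + i)%nat) (n - N)) by ring.
  apply rsum_le. auto.
Qed.

(** * Comparison with filter limits, [is_series] and [Cseries] *)

Lemma filterlim_CL (u : nat -> C) (l : C) :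
  filterlim u eventually (locally (T := C_UniformSpace) l) <-> CL u l.
Proof.
  split.
  - intros H eps he.
    assert (s2 : (0 < sqrt 2)%R) by (apply sqrt_lt_R0; lra).
    assert (he' : (0 < eps / sqrt 2)%R) by (apply Rdiv_lt_0_compat; auto).
    assert (Hl : locally (T := C_UniformSpace) l (ball (M := C_UniformSpace) l (mkposreal _ he'))).
    { exists (mkposreal _ he'). auto. }
    destruct (H _ Hl) as [N hN]. exists N. intros n hn. specialize (hN n hn).
    apply C_NormedModule_mixin_compat2 in hN. simpl in hN.
    replace (sqrt 2 * (eps / sqrt 2))%R with eps in hN by (field; lra). exact hN.
  - intros H P [eps hP]. destruct (H eps (cond_pos eps)) as [N hN]. exists N. intros n hn.
    apply hP. apply C_NormedModule_mixin_compat1. apply (hN n hn).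
Qed.

(** [sum_n] includes its upper index while [psum] stops before it, hence the successor. *)
Lemma sum_n_psum (a : nat -> C) (n : nat) :
  sum_n (G := C_AbelianMonoid) a n = psum a (S n).
Proof.
  induction n as [|n IH].
  - rewrite sum_O. simpl. rewrite Cplus_0_l. reflexivity.
  - rewrite sum_Sn, IH. reflexivity.
Qed.

Lemma is_series_CS (a : nat -> C) (l : C) :
  is_series (K := C_AbsRing) (V := C_NormedModule) a l <-> CS a l.
Proof.
  unfold is_series, CS. rewrite CL_S. rewrite <- filterlim_CL.
  split; apply filterlim_ext; intros n; [|symmetry]; apply sum_n_psum.
Qed.

Lemma CS_abs (a : nat -> C) (B : R) :
  (forall n, rsum (fun i => Cmod (a i)) n <= B)%R -> exists l, CS a l.
Proof.
  intros H.
  assert (E : ex_series (K := C_AbsRing) (V := C_CompleteNormedModule) a).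
  { apply (ex_series_le (K := C_AbsRing) (V := C_CompleteNormedModule) a (fun i => Cmod (a i))).
    - intros n. apply Rle_refl.
    - destruct (ex_finite_lim_seq_incr (rsum (fun i => Cmod (a i))) B) as [l hl].
      + intros n. simpl. assert (h := Cmod_ge_0 (a n)). lra.
      + exact H.
      + exists l. apply is_lim_seq_incr_1 in hl. unfold is_series.
        eapply filterlim_ext; [|exact hl]. intros n. simpl.
        induction n as [|n IH]; [rewrite sum_O; simpl; ring|].
        rewrite sum_Sn, <- IH. reflexivity. }
  destruct E as [l hl]. exists l. apply is_series_CS. exact hl.
Qed.

Lemma CS_dom (a : nat -> C) (b : nat -> R) (B : R) :
  (forall i, Cmod (a i) <= b i)%R -> (forall n, rsum b n <= B)%R -> exists l, CS a l.
Proof.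
  intros h H. apply CS_abs with B. intros n. eapply Rle_trans; [|apply (H n)].
  apply rsum_le. auto.
Qed.

Lemma CS_mod_le (a : nat -> C) (b : nat -> R) (B : R) (l : C) :
  (forall i, Cmod (a i) <= b i)%R -> (forall n, rsum b n <= B)%R -> CS a l -> (Cmod l <= B)%R.
Proof.
  intros h H Hl. apply (CL_mod_le (psum a) l B 0); [|exact Hl]. intros n _.
  eapply Rle_trans; [apply psum_mod|]. eapply Rle_trans; [|apply (H n)]. apply rsum_le; auto.
Qed.

Lemma CS_ext (a b : nat -> C) (l : C) : (forall n, a n = b n) -> CS a l -> CS b l.
Proof. intros E. apply CL_ext. intros n. apply psum_ext. auto. Qed.

Lemma CS_plus (a b : nat -> C) (l m : C) : CS a l -> CS b m -> CS (fun n => a n + b n) (l + m).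
Proof.
  intros H H'. eapply CL_ext; [|apply (CL_plus _ _ _ _ H H')]. intros n. simpl.
  symmetry. apply psum_plus.
Qed.

Lemma CS_scal (c : C) (a : nat -> C) (l : C) : CS a l -> CS (fun n => c * a n) (c * l).
Proof.
  intros H. eapply CL_ext; [|apply (CL_scal c _ _ H)]. intros n. simpl.
  symmetry. apply psum_scal.
Qed.

Lemma CS_minus (a b : nat -> C) (l m : C) : CS a l -> CS b m -> CS (fun n => a n - b n) (l - m).
Proof.
  intros H H'. replace (l - m) with (l + (- (1)) * m) by ring.
  apply CS_ext with (fun n => a n + (- (1)) * b n); [intros; ring|].
  apply CS_plus; [auto|apply CS_scal; auto].
Qed.

Lemma CS_unique (a : nat -> C) (l l' : C) : CS a l -> CS a l' -> l = l'.
Proof. apply CL_unique. Qed.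

Lemma CS_S (a : nat -> C) (l : C) : CS a l <-> CS (fun n => a (S n)) (l - a 0%nat).
Proof.
  unfold CS. rewrite (CL_S (psum a)). split; intros H.
  - apply CL_ext with (fun n => psum a (S n) - a 0%nat).
    + intros n. rewrite psum_S. ring.
    + apply CL_minus; [exact H|apply CL_const].
  - apply CL_ext with (fun n => psum (fun i => a (S i)) n + a 0%nat).
    + intros n. rewrite psum_S. ring.
    + replace l with (l - a 0%nat + a 0%nat) by ring. apply CL_plus; [exact H|apply CL_const].
Qed.

Lemma CS_finite (a : nat -> C) (n : nat) :
  (forall i, (n <= i)%nat -> a i = 0) -> CS a (psum a n).
Proof.
  intros H. apply (CL_eventually (fun _ => psum a n) _ _ n).
  - intros m hm. replace m with (n + (m - n))%nat by lia. rewrite psum_add.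
    rewrite (psum_zero (fun i => a (n + i)%nat)); [ring|]. intros; apply H; lia.
  - apply CL_const.
Qed.

(** * Dominated convergence and interchange of sums *)

Lemma CL_psum (u : nat -> nat -> C) (v : nat -> C) (n : nat) :
  (forall i, CL (fun K => u K i) (v i)) -> CL (fun K => psum (u K) n) (psum v n).
Proof.
  intros H. induction n as [|n IH]; simpl; [apply CL_const|]. apply CL_plus; auto.
Qed.

Lemma CS_psum (a : nat -> nat -> C) (c : nat -> C) (n : nat) :
  (forall j, CS (fun i => a i j) (c j)) -> CS (fun i => psum (a i) n) (psum c n).
Proof.
  intros H. induction n as [|n IH]; simpl.
  - apply (CS_finite _ 0). auto.
  - apply CS_plus; auto.
Qed.

(** Dominated convergence for series: the head up to a fixed index converges term by term, and the
    tails are small uniformly in [K] because of the majorant [B]. Domination from [K0] on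
    suffices. *)
Lemma tannery (u : nat -> nat -> C) (v : nat -> C) (B : nat -> R) (SB : R) (K0 : nat)
  (s : nat -> C) (t : C) :
  (forall i, 0 <= B i)%R -> (forall n, rsum B n <= SB)%R ->
  (forall K i, (K0 <= K)%nat -> (Cmod (u K i) <= B i)%R) ->
  (forall i, CL (fun K => u K i) (v i)) ->
  (forall K, (K0 <= K)%nat -> CS (u K) (s K)) -> CS v t -> CL s t.
Proof.
  intros hB hS hu hv hs ht eps he.
  assert (hvB : forall i, (Cmod (v i) <= B i)%R).
  { intros i. apply (CL_mod_le (fun K => u K i) _ _ K0); auto. }
  destruct (rsum_tail B SB hB hS (eps / 4)%R ltac:(lra)) as [N hN].
  destruct (CL_psum u v N hv (eps / 4)%R ltac:(lra)) as [K1 hK1].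
  assert (T : forall a l, (forall i, (Cmod (a i) <= B i)%R) -> CS a l ->
              (Cmod (l - psum a N) <= eps / 4)%R).
  { intros a l ha hl. apply (CL_mod_le (fun n => psum a n - psum a N) _ _ N).
    - intros n hn. eapply Rle_trans; [apply (psum_diff_mod a B); auto|]. apply hN; auto.
    - apply CL_minus; [exact hl|apply CL_const]. }
  exists (max K0 K1). intros K hK.
  assert (h1 := T (u K) (s K) ltac:(intros; apply hu; lia) ltac:(apply hs; lia)).
  assert (h2 := T v t hvB ht). rewrite Cmod_minus_sym in h2.
  assert (h3 := hK1 K ltac:(lia)).
  assert (t1 := Cmod_sub_tri (s K) (psum (u K) N) t).
  assert (t2 := Cmod_sub_tri (psum (u K) N) (psum v N) t). lra.
Qed.

(** Summing the first [K] columns row by row gives a series dominated by [B] whose terms tend to the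
    row sums; [tannery] turns this into convergence of the column sums to the same total. *)
Lemma fubini (a : nat -> nat -> C) (B : nat -> R) (SB : R) (r c : nat -> C) :
  (forall i n, rsum (fun j => Cmod (a i j)) n <= B i)%R -> (forall n, rsum B n <= SB)%R ->
  (forall i, CS (a i) (r i)) -> (forall j, CS (fun i => a i j) (c j)) ->
  exists t, CS r t /\ CS c t.
Proof.
  intros hB hS hr hc.
  assert (hB0 : forall i, (0 <= B i)%R) by (intros i; apply (hB i 0%nat)).
  assert (hrB : forall i, (Cmod (r i) <= B i)%R).
  { intros i. apply (CS_mod_le (a i) (fun j => Cmod (a i j)) _ _); auto. intros; lra. }
  destruct (CS_dom r B SB hrB hS) as [t ht]. exists t. split; [exact ht|].
  apply (tannery (fun K i => psum (a i) K) r B SB 0); auto.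
  - intros K i _. eapply Rle_trans; [apply psum_mod|apply hB].
  - intros K _. apply CS_psum. auto.
Qed.

Lemma fubini_col (a : nat -> nat -> C) (B : nat -> R) (SB : R) (j : nat) :
  (forall i n, rsum (fun j => Cmod (a i j)) n <= B i)%R -> (forall n, rsum B n <= SB)%R ->
  exists c, CS (fun i => a i j) c.
Proof.
  intros hB hS. apply (CS_dom _ B SB); auto. intros i.
  eapply Rle_trans; [|apply (hB i (S j))].
  apply (rsum_term (fun j => Cmod (a i j)) (S j) j); [intros; apply Cmod_ge_0|lia].
Qed.

Lemma geom_CS (z : C) : (Cmod z < 1)%R -> CS (fun n => z ^ n) (/ (1 - z)).
Proof.
  intros hz.
  assert (h1 : 1 - z <> 0).
  { intros E. assert (z = 1) by (replace z with (1 - (1 - z)) by ring; rewrite E; ring).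
    subst z. rewrite Cmod_1 in hz. lra. }
  assert (P : forall n, psum (fun n => z ^ n) n = (1 - z ^ n) / (1 - z)).
  { induction n as [|n IH]; simpl; [field; auto|]. rewrite IH. field. auto. }
  apply CL_ext with (fun n => (1 - z ^ n) * / (1 - z)); [intros; rewrite P; reflexivity|].
  replace (/ (1 - z)) with ((1 - 0) * / (1 - z)) at 1 by (field; auto).
  apply CL_mult; [|apply CL_const]. apply CL_minus; [apply CL_const|].
  apply (CL_squeeze _ _ (fun n => (Cmod z) ^ n)%R 0).
  - intros n _. replace (z ^ n - 0) with (z ^ n) by ring. rewrite Cmod_pow. lra.
  - apply is_lim_seq_geom. rewrite Rabs_right; auto. apply Rle_ge, Cmod_ge_0.
Qed.

Lemma rgeom_bound (x : R) (n : nat) : (0 <= x < 1)%R -> (rsum (fun i => x ^ i) n <= / (1 - x))%R.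
Proof.
  intros hx.
  assert (E : (rsum (fun i => x ^ i) n = (1 - x ^ n) / (1 - x))%R).
  { induction n as [|n IH]; simpl; [field; lra|]. rewrite IH. field. lra. }
  rewrite E. unfold Rdiv. rewrite <- (Rmult_1_l (/ (1 - x))) at 2.
  apply Rmult_le_compat_r; [left; apply Rinv_0_lt_compat; lra|].
  assert (0 <= x ^ n)%R by (apply pow_le; lra). lra.
Qed.

Lemma Cseries_CS (a : nat -> C) (l : C) : CS a l -> Cseries a = l.
Proof.
  intros H.
  assert (D : forall n, Re (psum a (S n)) = sum_n (fun i => Re (a i)) n /\
                        Im (psum a (S n)) = sum_n (fun i => Im (a i)) n).
  { induction n as [|n [h1 h2]].
    - rewrite !sum_O. unfold Re, Im. simpl. split; apply Rplus_0_l.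
    - rewrite !sum_Sn, <- h1, <- h2. split; reflexivity. }
  assert (L := CL_lim _ _ (proj1 (CL_S _ _) H)).
  unfold Cseries. destruct l as [lr li]. f_equal; apply is_series_unique.
  - change (is_lim_seq (sum_n (fun i => Re (a i))) lr).
    apply (is_lim_seq_ext (fun n => Re (psum a (S n)))); [intros n; apply D|].
    apply is_lim_seq_spec. intros eps. apply is_lim_seq_spec in L. destruct (L eps) as [N hN].
    exists N. intros n hn. specialize (hN n hn). rewrite Rminus_0_r in hN.
    rewrite Rabs_right in hN by apply Rle_ge, Cmod_ge_0.
    eapply Rle_lt_trans; [|exact hN]. apply (re_le_Cmod (psum a (S n) - (lr, li))).
  - change (is_lim_seq (sum_n (fun i => Im (a i))) li).
    apply (is_lim_seq_ext (fun n => Im (psum a (S n)))); [intros n; apply D|].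
    apply is_lim_seq_spec. intros eps. apply is_lim_seq_spec in L. destruct (L eps) as [N hN].
    exists N. intros n hn. specialize (hN n hn). rewrite Rminus_0_r in hN.
    rewrite Rabs_right in hN by apply Rle_ge, Cmod_ge_0.
    eapply Rle_lt_trans; [|exact hN].
    eapply Rle_trans; [|apply (Rmax_Cmod (psum a (S n) - (lr, li)))]. apply Rmax_r.
Qed.

(** * Complex power series *)

(** Boundedness of $|a_n|R^n$ is weaker than convergence on the circle of radius [R] but gives
    geometric majorants on every smaller disc, and it is stable under the operations below at the
    cost of shrinking [R]. *)
Definition PSR (a : nat -> C) (R : R) : Prop :=
  (0 < R)%R /\ exists B, forall n, (Cmod (a n) * R ^ n <= B)%R.

Definition PSum (a : nat -> C) (z : C) : C := Cseries (fun n => a n * z ^ n).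

Lemma CL_bounded_all (u : nat -> C) (l : C) : CL u l -> exists B, forall n, (Cmod (u n) <= B)%R.
Proof.
  intros H. destruct (CL_bounded _ _ H) as [K hK].
  exists (Cmod l + 1 + rsum (fun i => Cmod (u i)) K)%R. intros n.
  assert (h0 := rsum_ge0 (fun i => Cmod (u i)) K ltac:(intros; apply Cmod_ge_0)).
  destruct (le_lt_dec K n) as [h|h].
  - specialize (hK n h). lra.
  - assert (t := rsum_term (fun i => Cmod (u i)) K n ltac:(intros; apply Cmod_ge_0) h).
    assert (t2 := Cmod_ge_0 l). simpl in t. lra.
Qed.

Lemma CS_terms_bounded (a : nat -> C) (l : C) : CS a l -> exists B, forall n, (Cmod (a n) <= B)%R.
Proof.
  intros H. destruct (CL_bounded_all _ _ H) as [B hB]. exists (B + B)%R. intros n.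
  replace (a n) with (psum a (S n) - psum a n) by (simpl; ring).
  eapply Rle_trans; [apply Cmod_sub_le|]. assert (h1 := hB (S n)). assert (h2 := hB n). lra.
Qed.

Lemma PSR_le (a : nat -> C) (R r : R) : PSR a R -> (0 < r <= R)%R -> PSR a r.
Proof.
  intros [hR [B hB]] hr. split; [lra|]. exists B. intros n. eapply Rle_trans; [|apply (hB n)].
  apply Rmult_le_compat_l; [apply Cmod_ge_0|]. apply pow_incr. lra.
Qed.

Lemma PSR_rsum (a : nat -> C) (R r : R) : PSR a R -> (0 <= r < R)%R ->
  exists B, forall n, (rsum (fun i => Cmod (a i) * r ^ i) n <= B)%R.
Proof.
  intros [hR [B hB]] hr. exists (B * / (1 - r / R))%R. intros n.
  assert (hq : (0 <= r / R < 1)%R).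
  { split; [apply Rdiv_le_0_compat; lra|]. apply Rlt_div_l; lra. }
  assert (hB0 : (0 <= B)%R).
  { eapply Rle_trans; [|apply (hB 0%nat)]. simpl. assert (h := Cmod_ge_0 (a 0%nat)). lra. }
  eapply Rle_trans; [|apply Rmult_le_compat_l; [exact hB0|apply (rgeom_bound (r / R) n hq)]].
  rewrite <- rsum_scal. apply rsum_le. intros i _.
  replace (r ^ i)%R with (R ^ i * (r / R) ^ i)%R.
  - rewrite <- Rmult_assoc. apply Rmult_le_compat_r; [apply pow_le; lra|apply hB].
  - rewrite <- Rpow_mult_distr. f_equal. field. lra.
Qed.

Lemma PSR_CS (a : nat -> C) (R : R) (z : C) : PSR a R -> (Cmod z < R)%R ->
  CS (fun n => a n * z ^ n) (PSum a z).
Proof.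
  intros H hz. destruct (PSR_rsum a R (Cmod z) H (conj (Cmod_ge_0 z) hz)) as [B hB].
  destruct (CS_dom (fun n => a n * z ^ n) (fun i => Cmod (a i) * Cmod z ^ i)%R B) as [l hl].
  - intros i. rewrite Cmod_mult, Cmod_pow. lra.
  - exact hB.
  - unfold PSum. rewrite (Cseries_CS _ _ hl). exact hl.
Qed.

Lemma PSum_eq (a : nat -> C) (z l : C) : CS (fun n => a n * z ^ n) l -> PSum a z = l.
Proof. apply Cseries_CS. Qed.

Lemma PSum_bound (a : nat -> C) (R r : R) : PSR a R -> (0 <= r < R)%R ->
  exists B, forall z, (Cmod z <= r)%R -> (Cmod (PSum a z) <= B)%R.
Proof.
  intros H hr. destruct (PSR_rsum a R r H hr) as [B hB]. exists B. intros z hz.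
  apply (CS_mod_le (fun n => a n * z ^ n) (fun i => Cmod (a i) * r ^ i)%R).
  - intros i. rewrite Cmod_mult, Cmod_pow. apply Rmult_le_compat_l; [apply Cmod_ge_0|].
    apply pow_incr. split; [apply Cmod_ge_0|exact hz].
  - exact hB.
  - apply (PSR_CS a R); [exact H|lra].
Qed.

Lemma CS_PSR (a : nat -> C) (r : R) (l : C) : (0 < r)%R ->
  CS (fun n => a n * RtoC r ^ n) l -> PSR a r.
Proof.
  intros hr H. split; [exact hr|]. destruct (CS_terms_bounded _ _ H) as [B hB]. exists B.
  intros n. specialize (hB n). rewrite Cmod_mult, Cmod_pow, Cmod_R, Rabs_right in hB by lra. exact hB.
Qed.

Lemma CS_PSR_C (a : nat -> C) (z l : C) : z <> 0 ->
  CS (fun n => a n * z ^ n) l -> PSR a (Cmod z).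
Proof.
  intros hz H. split; [apply Cmod_gt_0, hz|]. destruct (CS_terms_bounded _ _ H) as [B hB].
  exists B. intros n. specialize (hB n). rewrite Cmod_mult, Cmod_pow in hB. exact hB.
Qed.

Definition dps (a : nat -> C) (n : nat) : C := RtoC (INR (S n)) * a (S n).

(** Each of the [n] terms $1,x,\dots,x^{n-1}$ is at least $x^n$, so $nx^n$ is bounded by the
    geometric sum. *)
Lemma n_pow_bound (x : R) (n : nat) : (0 <= x < 1)%R -> (INR n * x ^ n <= / (1 - x))%R.
Proof.
  intros hx. eapply Rle_trans; [|apply (rgeom_bound x n hx)].
  assert (G : forall m, (m <= n)%nat -> (INR m * x ^ n <= rsum (fun i => x ^ i) m)%R).
  { induction m as [|m IH]; intros hm; [simpl; lra|].
    rewrite S_INR. simpl rsum. specialize (IH ltac:(lia)).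
    assert (x ^ n <= x ^ m)%R.
    { replace n with (m + (n - m))%nat by lia. rewrite pow_add.
      rewrite <- (Rmult_1_r (x ^ m)) at 2. apply Rmult_le_compat_l; [apply pow_le; lra|].
      rewrite <- (pow1 (n - m)). apply pow_incr. lra. }
    lra. }
  apply G. lia.
Qed.

Lemma PSR_dps (a : nat -> C) (R r : R) : PSR a R -> (0 < r < R)%R -> PSR (dps a) r.
Proof.
  intros [hR [B hB]] hr. split; [lra|]. exists (B * / (1 - r / R) / r)%R. intros n.
  unfold dps. rewrite Cmod_mult, Cmod_R, Rabs_right by (apply Rle_ge, pos_INR).
  assert (hq : (0 <= r / R < 1)%R).
  { split; [apply Rdiv_le_0_compat; lra|]. apply Rlt_div_l; lra. }
  apply Rmult_le_reg_r with r; [lra|].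
  replace (B * / (1 - r / R) / r * r)%R with (B * / (1 - r / R))%R by (field; repeat split; lra).
  replace (INR (S n) * Cmod (a (S n)) * r ^ n * r)%R with (INR (S n) * (Cmod (a (S n)) * r ^ (S n)))%R
    by (simpl; ring).
  replace (r ^ S n)%R with (R ^ S n * (r / R) ^ S n)%R
    by (rewrite <- Rpow_mult_distr; f_equal; field; lra).
  replace (INR (S n) * (Cmod (a (S n)) * (R ^ S n * (r / R) ^ S n)))%R
    with ((Cmod (a (S n)) * R ^ S n) * (INR (S n) * (r / R) ^ S n))%R by ring.
  apply Rmult_le_compat; [apply Rmult_le_pos; [apply Cmod_ge_0|apply pow_le; lra]| |apply hB|].
  - apply Rmult_le_pos; [apply pos_INR|apply pow_le; lra].
  - apply n_pow_bound. exact hq.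
Qed.

Lemma PSR_shift (a : nat -> C) (R : R) : PSR a R -> PSR (fun n => a (S n)) R.
Proof.
  intros [hR [B hB]]. split; [exact hR|]. exists (B / R)%R. intros n.
  specialize (hB (S n)). simpl in hB. apply (Rle_div_r (Cmod (a (S n)) * R ^ n)%R B R); [exact hR|].
  rewrite Rmult_assoc, (Rmult_comm _ R). exact hB.
Qed.

Lemma PSum_shift (a : nat -> C) (R : R) (z : C) : PSR a R -> (Cmod z < R)%R ->
  PSum a z = a 0%nat + z * PSum (fun n => a (S n)) z.
Proof.
  intros H hz. apply PSum_eq. apply CS_S.
  replace (a 0%nat + z * PSum (fun n => a (S n)) z - a 0%nat * z ^ 0) with
    (z * PSum (fun n => a (S n)) z) by (simpl; ring).
  apply CS_ext with (fun n => z * (a (S n) * z ^ n)); [intros; simpl; ring|].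
  apply CS_scal. apply (PSR_CS _ R); [apply PSR_shift; auto|auto].
Qed.

Lemma PSum_0 (a : nat -> C) : PSum a 0 = a 0%nat.
Proof.
  apply PSum_eq. replace (a 0%nat) with (psum (fun n => a n * 0 ^ n) 1) by (simpl; ring).
  apply CS_finite. intros [|i] hi; [lia|]. simpl. ring.
Qed.

(* [pw w n j] is the coefficient of [h ^ j] in [(w + h) ^ n]. *)
Fixpoint pw (w : C) (n j : nat) : C :=
  match n with
  | O => match j with O => 1 | S _ => 0 end
  | S n' => w * pw w n' j + match j with O => 0 | S j' => pw w n' j' end
  end.

Fixpoint pwR (w : R) (n j : nat) : R :=
  match n with
  | O => match j with O => 1%R | S _ => 0%R end
  | S n' => (w * pwR w n' j + match j with O => 0%R | S j' => pwR w n' j' end)%R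
  end.

Lemma pw_mod (w : C) (n j : nat) : (Cmod (pw w n j) <= pwR (Cmod w) n j)%R.
Proof.
  revert j. induction n as [|n IH]; intros [|j]; simpl.
  - rewrite Cmod_1. lra.
  - rewrite Cmod_0. lra.
  - eapply Rle_trans; [apply Cmod_triangle|]. rewrite Cmod_mult, Cmod_0.
    apply Rplus_le_compat_r, Rmult_le_compat_l; [apply Cmod_ge_0|auto].
  - eapply Rle_trans; [apply Cmod_triangle|]. rewrite Cmod_mult.
    apply Rplus_le_compat; [apply Rmult_le_compat_l; [apply Cmod_ge_0|auto]|auto].
Qed.

Lemma pw_sum (w h : C) (n m : nat) : (n < m)%nat -> psum (fun j => pw w n j * h ^ j) m = (w + h) ^ n.
Proof.
  revert m. induction n as [|n IH]; intros m hm.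
  - destruct m as [|m]; [lia|]. rewrite psum_S. rewrite psum_zero; [simpl; ring|].
    intros; simpl; ring.
  - destruct m as [|m]; [lia|].
    transitivity (psum (fun j => w * (pw w n j * h ^ j)
       + match j with O => 0 | S j' => pw w n j' end * h ^ j) (S m)).
    { apply psum_ext. intros; simpl; ring. }
    rewrite psum_plus, psum_scal, IH by lia.
    rewrite psum_S.
    rewrite (psum_ext _ (fun i => h * (pw w n i * h ^ i))) by (intros; simpl; ring).
    rewrite psum_scal, IH by lia. simpl. ring.
Qed.

Lemma pw_gt (w : C) (n j : nat) : (n < j)%nat -> pw w n j = 0.
Proof.
  revert j. induction n as [|n IH]; intros [|j] hj; simpl; try lia; auto.
  rewrite !IH by lia. ring.
Qed.

Lemma pwR_sum (w x : R) (n m : nat) : (0 <= w)%R -> (0 <= x)%R ->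
  (rsum (fun j => pwR w n j * x ^ j) m <= (w + x) ^ n)%R.
Proof.
  intros hw hx. revert m. induction n as [|n IH]; intros m.
  - destruct m as [|m]; [simpl; lra|].
    replace (S m) with (1 + m)%nat by lia. rewrite rsum_add. simpl.
    assert (E : rsum (fun i => 0 * (x * x ^ i))%R m = 0%R).
    { clear. induction m as [|m IH]; simpl; [auto|rewrite IH; ring]. }
    rewrite E. lra.
  - destruct m as [|m].
    { simpl. apply Rmult_le_pos; [lra|apply pow_le; lra]. }
    assert (E : (rsum (fun j => pwR w (S n) j * x ^ j) (S m) =
       w * rsum (fun j => pwR w n j * x ^ j) (S m) + x * rsum (fun j => pwR w n j * x ^ j) m)%R).
    { rewrite <- (rsum_scal w), <- (rsum_scal x).
      replace (S m) with (1 + m)%nat by lia. rewrite !rsum_add.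
      assert (G : forall k, (rsum (fun i => pwR w (S n) (1 + i)%nat * x ^ (1 + i)) k =
         rsum (fun i => w * (pwR w n (1 + i)%nat * x ^ (1 + i))) k + rsum (fun i => x * (pwR w n i * x ^ i)) k)%R).
      { induction k as [|k IHk]; [simpl; lra|]. cbn [rsum]. rewrite IHk. simpl. ring. }
      rewrite G. simpl. ring. }
    rewrite E. simpl pow. rewrite Rmult_plus_distr_r.
    apply Rplus_le_compat; apply Rmult_le_compat_l; auto.
Qed.

Lemma pw_0 (w : C) (n : nat) : pw w n 0 = w ^ n.
Proof. induction n as [|n IH]; simpl; [auto|rewrite IH; ring]. Qed.

Lemma pw_1 (w : C) (n : nat) : pw w (S n) 1 = RtoC (INR (S n)) * w ^ n.
Proof.
  induction n as [|n IH]; [simpl; ring|].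
  change (pw w (S (S n)) 1) with (w * pw w (S n) 1 + pw w (S n) 0).
  rewrite IH, pw_0. rewrite (S_INR (S n)), RtoC_plus. simpl Cpow. ring.
Qed.

(** Expand every $(w+h)^n$ binomially and interchange the sums, which is legitimate because the
    moduli sum to the series at $|w|+|h|<R$. The first two new coefficients are recorded: they are
    the value and the derivative at [w]. *)
Lemma recenter (a : nat -> C) (R r : R) (w : C) :
  PSR a R -> (0 < r)%R -> (Cmod w + r < R)%R ->
  exists b, PSR b r /\ (forall h, (Cmod h <= r)%R -> CS (fun n => b n * h ^ n) (PSum a (w + h)))
    /\ b 0%nat = PSum a w /\ b 1%nat = PSum (dps a) w.
Proof.
  intros H hr hwr. assert (hw := Cmod_ge_0 w).
  destruct (PSR_rsum a R (Cmod w + r) H ltac:(lra)) as [B hB].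
  assert (hB' : forall h, (Cmod h <= r)%R ->
    forall n, (rsum (fun i => Cmod (a i) * (Cmod w + Cmod h) ^ i) n <= B)%R).
  { intros h hh n. eapply Rle_trans; [|apply (hB n)]. apply rsum_le. intros i _.
    apply Rmult_le_compat_l; [apply Cmod_ge_0|]. apply pow_incr. assert (t := Cmod_ge_0 h). lra. }
  assert (row : forall h i n, (rsum (fun j => Cmod (a i * pw w i j * h ^ j)) n
                   <= Cmod (a i) * (Cmod w + Cmod h) ^ i)%R).
  { intros h i n. eapply Rle_trans;
      [|apply Rmult_le_compat_l; [apply Cmod_ge_0|apply (pwR_sum _ _ i n hw (Cmod_ge_0 h))]].
    rewrite <- rsum_scal. apply rsum_le. intros j _. rewrite !Cmod_mult, Cmod_pow, Rmult_assoc.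
    apply Rmult_le_compat_l; [apply Cmod_ge_0|]. apply Rmult_le_compat_r.
    - apply pow_le, Cmod_ge_0.
    - apply pw_mod. }
  assert (hcol : forall j, exists c, CS (fun i => a i * pw w i j) c).
  (* Columns converge once weighted by $r^j$; dividing by this nonzero constant gives the bare
     coefficient. *)
  { intros j. destruct (fubini_col (fun i j => a i * pw w i j * RtoC r ^ j)
       (fun i => Cmod (a i) * (Cmod w + Cmod (RtoC r)) ^ i)%R B j) as [c hc].
    - intros i n. apply row.
    - apply hB'. rewrite Cmod_R, Rabs_right; lra.
    - exists (/ (RtoC r ^ j) * c).
      assert (hrj : RtoC r ^ j <> 0).
      { apply Cmod_gt_0. rewrite Cmod_pow, Cmod_R, Rabs_right by lra. apply pow_lt. lra. }
      apply CS_ext with (fun i => / (RtoC r ^ j) * (a i * pw w i j * RtoC r ^ j)).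
      + intros i. field. auto.
      + apply CS_scal. exact hc. }
  set (b := fun j => Cseries (fun i => a i * pw w i j)).
  assert (hb : forall j, CS (fun i => a i * pw w i j) (b j)).
  { intros j. destruct (hcol j) as [c hc]. unfold b. rewrite (Cseries_CS _ _ hc). exact hc. }
  assert (hsum : forall h, (Cmod h <= r)%R -> CS (fun n => b n * h ^ n) (PSum a (w + h))).
  { intros h hh.
    destruct (fubini (fun i j => a i * pw w i j * h ^ j)
       (fun i => Cmod (a i) * (Cmod w + Cmod h) ^ i)%R B
       (fun i => a i * (w + h) ^ i) (fun j => b j * h ^ j)) as [t [h1 h2]].
    - intros i n. apply row.
    - apply hB'. exact hh.
    - intros i. rewrite <- (pw_sum w h i (S i)) by lia. rewrite <- psum_scal.
      apply CS_ext with (fun j => a i * (pw w i j * h ^ j)); [intros; ring|].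
      apply CS_finite. intros j hj. rewrite pw_gt by lia. ring.
    - intros j. replace (b j * h ^ j) with (h ^ j * b j) by ring.
      apply CS_ext with (fun i => h ^ j * (a i * pw w i j)); [intros; ring|].
      apply CS_scal. apply hb.
    - rewrite (PSum_eq _ _ _ h1). exact h2. }
  exists b. split; [|split; [exact hsum|split]].
  - apply (CS_PSR b r (PSum a (w + RtoC r))); [exact hr|]. apply hsum.
    rewrite Cmod_R, Rabs_right; lra.
  - unfold b, PSum. f_equal. apply functional_extensionality. intros i. rewrite pw_0. auto.
  - apply (CS_unique _ _ _ (hb 1%nat)). apply CS_S.
    replace (PSum (dps a) w - a 0%nat * pw w 0 1) with (PSum (dps a) w) by (simpl; ring).
    apply CS_ext with (fun n => dps a n * w ^ n).
    + intros n. rewrite pw_1. unfold dps. ring.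
    + apply (PSR_CS _ (Cmod w + r)); [|lra]. apply (PSR_dps a R); [exact H|lra].
Qed.

(** * Complex derivatives and analytic functions *)

(** Complex differentiability with the increment on the right-hand side: no division, and [h = 0]
    needs no exception. *)
Definition cder (f : C -> C) (z l : C) : Prop :=
  forall eps : R, (0 < eps)%R -> exists del : R, (0 < del)%R /\
    forall h, (Cmod h < del)%R -> (Cmod (f (z + h)%C - f z - l * h)%C <= eps * Cmod h)%R.

Definition HA (f : C -> C) (z0 : C) : Prop :=
  exists (a : nat -> C) (R : R), PSR a R /\ forall h, (Cmod h < R)%R -> f (z0 + h) = PSum a h.

(** After removing two terms the remainder is $h^2$ times a power series bounded on the half
    disc. *)
Lemma expansion_cder (f : C -> C) (z : C) (b : nat -> C) (R : R) :
  PSR b R -> (forall h, (Cmod h < R)%R -> f (z + h) = PSum b h) -> cder f z (b 1%nat).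
Proof.
  intros H hf eps he.
  assert (hR := proj1 H).
  assert (H2 : PSR (fun n => b (S (S n))) R) by (apply (PSR_shift (fun n => b (S n))), PSR_shift; exact H).
  destruct (PSum_bound _ R (R / 2) H2 ltac:(lra)) as [B hB].
  assert (hB0 : (0 <= B)%R).
  { eapply Rle_trans; [apply Cmod_ge_0|apply (hB 0)]. rewrite Cmod_0. lra. }
  exists (Rmin (R / 2) (eps / (B + 1)))%R. split.
  { apply Rmin_pos; [lra|]. apply Rdiv_lt_0_compat; lra. }
  intros h hh.
  assert (h1 := Rlt_le_trans _ _ _ hh (Rmin_l _ _)).
  assert (h2 := Rlt_le_trans _ _ _ hh (Rmin_r _ _)).
  replace (f z) with (f (z + 0)) by (f_equal; ring).
  rewrite !hf by (rewrite ?Cmod_0; lra). rewrite PSum_0.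
  rewrite (PSum_shift b R h H) by lra.
  rewrite (PSum_shift (fun n => b (S n)) R h) by (try lra; apply PSR_shift; exact H).
  replace (b 0%nat + h * (b 1%nat + h * PSum (fun n => b (S (S n))) h) - b 0%nat - b 1%nat * h)
    with ((h * PSum (fun n => b (S (S n))) h) * h) by ring.
  rewrite !Cmod_mult. apply Rmult_le_compat_r; [apply Cmod_ge_0|].
  specialize (hB h ltac:(lra)). assert (t := Cmod_ge_0 h).
  apply Rlt_div_r in h2; [|lra]. nra.
Qed.

Lemma PSum_cder (a : nat -> C) (R : R) (w : C) : PSR a R -> (Cmod w < R)%R ->
  cder (PSum a) w (PSum (dps a) w).
Proof.
  intros H hw. destruct (recenter a R ((R - Cmod w) / 2) w H ltac:(lra) ltac:(lra)) as [b [h1 [h2 [_ h4]]]].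
  rewrite <- h4. apply (expansion_cder _ _ b ((R - Cmod w) / 2) h1).
  intros h hh. symmetry. apply PSum_eq, h2. lra.
Qed.

Lemma HA_ext (f g : C -> C) (z0 : C) (r : R) : (0 < r)%R ->
  (forall h, (Cmod h < r)%R -> f (z0 + h) = g (z0 + h)) -> HA f z0 -> HA g z0.
Proof.
  intros hr E [a [R [H hf]]]. assert (hR := proj1 H).
  assert (m1 := Rmin_l r R). assert (m2 := Rmin_r r R).
  assert (m0 : (0 < Rmin r R)%R) by (apply Rmin_pos; auto).
  exists a, (Rmin r R). split; [apply (PSR_le a R); [auto|lra]|].
  intros h hh. rewrite <- E by lra. apply hf. lra.
Qed.

Lemma CS_drop (x : nat -> C) (i : nat) (l : C) : (forall n, (n < i)%nat -> x n = 0) ->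
  CS (fun n => x (i + n)%nat) l -> CS x l.
Proof.
  intros Z H eps he. destruct (H eps he) as [N hN]. exists (i + N)%nat. intros n hn.
  replace n with (i + (n - i))%nat by lia. rewrite psum_add, (psum_zero x i Z), Cplus_0_l.
  apply hN. lia.
Qed.

(** Interchange of sums for the array with entries $a_ih^i\,b_{n-i}h^{n-i}$ for $n\ge i$ and $0$
    otherwise: rows give $a_ih^i$ times the second series, and columns are the finite convolution
    sums. *)
Lemma cauchy_product (a b : nat -> C) (R : R) (h : C) : PSR a R -> PSR b R -> (Cmod h < R)%R ->
  CS (fun n => psum (fun i => a i * b (n - i)%nat) (S n) * h ^ n) (PSum a h * PSum b h).
Proof.
  intros Ha Hb hh.
  destruct (PSR_rsum a R (Cmod h) Ha (conj (Cmod_ge_0 h) hh)) as [Ba hBa].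
  destruct (PSR_rsum b R (Cmod h) Hb (conj (Cmod_ge_0 h) hh)) as [Bb hBb].
  assert (hBb0 : (0 <= Bb)%R) by apply (hBb 0%nat).
  set (A := fun i n => if le_lt_dec i n then (a i * h ^ i) * (b (n - i)%nat * h ^ (n - i)) else 0).
  assert (A1 : forall i m, A i (i + m)%nat = (a i * h ^ i) * (b m * h ^ m)).
  { intros i m. unfold A. destruct (le_lt_dec i (i + m)); [|lia].
    replace (i + m - i)%nat with m by lia. auto. }
  assert (A2 : forall i n, (n < i)%nat -> A i n = 0).
  { intros i n hn. unfold A. destruct (le_lt_dec i n); [lia|auto]. }
  destruct (fubini A (fun i => Bb * (Cmod (a i) * Cmod h ^ i))%R (Bb * Ba)
    (fun i => PSum b h * (a i * h ^ i))
    (fun n => psum (fun i => a i * b (n - i)%nat) (S n) * h ^ n)) as [t [h1 h2]].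
  - intros i n.
    apply Rle_trans with (rsum (fun j => Cmod (A i j)) (i + n)).
    { apply rsum_incr; [intros; apply Cmod_ge_0|lia]. }
    rewrite rsum_add.
    replace (rsum (fun j => Cmod (A i j)) i) with 0%R.
    2:{ symmetry. apply Rle_antisym; [|apply rsum_ge0; intros; apply Cmod_ge_0].
        replace 0%R with (0 * rsum (fun _ => 0%R) i)%R by ring. rewrite <- rsum_scal.
        apply rsum_le. intros j hj. rewrite A2 by lia. rewrite Cmod_0. lra. }
    rewrite Rplus_0_l, Rmult_comm.
    eapply Rle_trans; [|apply Rmult_le_compat_l;
      [apply Rmult_le_pos; [apply Cmod_ge_0|apply pow_le, Cmod_ge_0]|apply (hBb n)]].
    rewrite <- rsum_scal. apply rsum_le. intros j _. rewrite A1, !Cmod_mult, !Cmod_pow. lra.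
  - intros n. rewrite rsum_scal. apply Rmult_le_compat_l; auto.
  - intros i. apply (CS_drop _ i); [intros; apply A2; auto|].
    apply CS_ext with (fun n => (a i * h ^ i) * (b n * h ^ n)); [intros; rewrite A1; auto|].
    replace (PSum b h * (a i * h ^ i)) with (a i * h ^ i * PSum b h) by ring.
    apply CS_scal, (PSR_CS b R); auto.
  - intros n.
    replace (psum (fun i => a i * b (n - i)%nat) (S n) * h ^ n) with (psum (fun i => A i n) (S n)).
    + apply CS_finite. intros i hi. apply A2. lia.
    + rewrite (Cmult_comm _ (h ^ n)), <- psum_scal. apply psum_ext. intros i hi.
      unfold A. destruct (le_lt_dec i n); [|lia].
      replace (h ^ n) with (h ^ i * h ^ (n - i)).
      * ring.
      * rewrite <- Cpow_add_r. f_equal. lia.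
  - replace (PSum a h * PSum b h) with t; [exact h2|].
    apply (CS_unique _ _ _ h1). rewrite Cmult_comm. apply CS_scal. apply (PSR_CS a R); auto.
Qed.

Lemma HA_mult (f g : C -> C) (z0 : C) : HA f z0 -> HA g z0 -> HA (fun z => f z * g z) z0.
Proof.
  intros [a [R1 [Ha hf]]] [b [R2 [Hb hg]]].
  assert (r1 := proj1 Ha). assert (r2 := proj1 Hb).
  assert (m1 := Rmin_l R1 R2). assert (m2 := Rmin_r R1 R2).
  assert (m0 : (0 < Rmin R1 R2)%R) by (apply Rmin_pos; auto).
  set (R := Rmin R1 R2) in *.
  assert (Ha' : PSR a R) by (apply (PSR_le a R1); [auto|lra]).
  assert (Hb' : PSR b R) by (apply (PSR_le b R2); [auto|lra]).
  assert (hc := cauchy_product a b R).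
  exists (fun n => psum (fun i => a i * b (n - i)%nat) (S n)), (R / 2)%R. split.
  - eapply CS_PSR; [lra|]. apply hc; auto. rewrite Cmod_R, Rabs_right; lra.
  - intros h hh. rewrite hf, hg by lra. symmetry. apply PSum_eq. apply hc; auto. lra.
Qed.

(** With $w=z_1-z_0$ this is the geometric series of ratio $-h/w$, valid for $|h|<|w|$. *)
Lemma HA_inv (z0 z1 : C) : z1 <> z0 -> HA (fun z => / (z - z0)) z1.
Proof.
  intros hz. set (w := z1 - z0).
  assert (hw : w <> 0).
  { intros E. apply hz. replace z1 with (w + z0) by (unfold w; ring). rewrite E. ring. }
  assert (hw' := proj1 (Cmod_gt_0 w) hw).
  exists (fun n => / w * (- / w) ^ n), (Cmod w). split.
  - split; [exact hw'|]. exists (/ Cmod w)%R. intros n.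
    rewrite Cmod_mult, Cmod_pow, Cmod_opp, !Cmod_inv by auto.
    rewrite Rmult_assoc, <- Rpow_mult_distr, Rinv_l, pow1 by lra. lra.
  - intros h hh. symmetry. apply PSum_eq.
    apply CS_ext with (fun n => / w * (- h / w) ^ n).
    + intros n. rewrite <- Cmult_assoc. f_equal. rewrite <- Cpow_mult_l. f_equal. field. auto.
    + assert (hwh : w + h <> 0).
      { intros E. assert (h = - w) by (replace h with (w + h - w) by ring; rewrite E; ring).
        subst h. rewrite Cmod_opp in hh. lra. }
      replace (/ (z1 + h - z0)) with (/ w * / (1 - - h / w)).
      * apply CS_scal, geom_CS. replace (- h / w) with (- (h / w)) by (field; auto).
        rewrite Cmod_opp, Cmod_div by auto. apply Rlt_div_l; lra.
      * replace (z1 + h - z0) with (w + h) by (unfold w; ring). field. repeat split; auto.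
Qed.

(** * Comparison with [holomorphic_at] and [C_derive] *)

Lemma pow_n_Cpow (x : C) (n : nat) : pow_n (K := C_AbsRing) x n = x ^ n.
Proof. induction n as [|n IH]; simpl; [reflexivity|]. rewrite IH. reflexivity. Qed.

Lemma is_pseries_CS (a : nat -> C) (x l : C) :
  is_pseries (K := C_AbsRing) (V := C_NormedModule) a x l <-> CS (fun n => a n * x ^ n) l.
Proof.
  unfold is_pseries. rewrite is_series_CS.
  assert (E : forall n, scal (K := C_AbsRing) (V := C_NormedModule) (pow_n (K := C_AbsRing) x n) (a n) = a n * x ^ n).
  { intros n. rewrite pow_n_Cpow. apply Cmult_comm. }
  split; apply CS_ext; intros n; [|symmetry]; apply E.
Qed.

Lemma locally_C_disc (z0 : C) (P : C -> Prop) : locally z0 P ->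
  exists d, (0 < d)%R /\ forall h, (Cmod h < d)%R -> P (z0 + h).
Proof.
  intros [eps H]. exists eps. split; [apply cond_pos|]. intros h hh. apply H.
  apply C_NormedModule_mixin_compat1. replace (minus (z0 + h) z0) with h; [exact hh|].
  change (h = (z0 + h) - z0). ring.
Qed.

Lemma disc_locally_C (z0 : C) (P : C -> Prop) (d : R) : (0 < d)%R ->
  (forall h, (Cmod h < d)%R -> P (z0 + h)) -> locally z0 P.
Proof.
  intros hd H. assert (s2 : (0 < sqrt 2)%R) by (apply sqrt_lt_R0; lra).
  assert (hd' : (0 < d / sqrt 2)%R) by (apply Rdiv_lt_0_compat; auto).
  exists (mkposreal _ hd'). intros y hy.
  apply (C_NormedModule_mixin_compat2 z0 y) in hy. simpl in hy.
  replace (sqrt 2 * (d / sqrt 2))%R with d in hy by (field; lra).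
  replace y with (z0 + (y - z0)) by ring. apply H. exact hy.
Qed.

Lemma holomorphic_HA (f : C -> C) (z0 : C) : holomorphic_at f z0 <-> HA f z0.
Proof.
  split.
  - intros [a H]. apply locally_C_disc in H. destruct H as [d [hd H]].
    assert (H' : forall h, (Cmod h < d)%R -> CS (fun n => a n * h ^ n) (f (z0 + h))).
    { intros h hh. specialize (H h hh). apply is_pseries_CS in H.
      replace (z0 + h - z0) with h in H by ring. exact H. }
    exists a, (d / 2)%R. split.
    + eapply CS_PSR; [lra|]. apply H'. rewrite Cmod_R, Rabs_right; lra.
    + intros h hh. symmetry. apply PSum_eq, H'. lra.
  - intros [a [R [H hf]]]. exists a. apply (disc_locally_C _ _ R (proj1 H)). intros h hh.
    apply is_pseries_CS. replace (z0 + h - z0) with h by ring. rewrite hf by auto.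
    apply (PSR_CS a R); auto.
Qed.

Lemma cder_C_derive (f : C -> C) (z l : C) : cder f z l -> C_derive f z = l.
Proof.
  intros H. unfold C_derive. apply is_C_lim_unique.
  intros P [eps hP].
  destruct (H (eps / 2)%R ltac:(destruct eps; simpl; lra)) as [d [hd hd']].
  unfold filtermap, locally', within. apply (disc_locally_C _ _ d hd). intros h hh hne.
  apply hP. apply C_NormedModule_mixin_compat1.
  assert (h0 : h <> 0) by (intros E; apply hne; rewrite E; apply Cplus_0_r).
  assert (h0' := proj1 (Cmod_gt_0 h) h0).
  change (minus ((f (z + h) - f z) / (z + h - z)) l) with ((f (z + h) - f z) / (z + h - z) - l).
  replace ((f (z + h) - f z) / (z + h - z) - l) with ((f (z + h) - f z - l * h) / h).
  - rewrite Cmod_div by auto. apply Rlt_div_l; [lra|]. specialize (hd' h hh).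
    destruct eps as [e he]. simpl in *. nra.
  - replace (z + h - z) with h by ring. field. auto.
Qed.

Lemma cder_cont (f : C -> C) (z l : C) : cder f z l ->
  forall eps, (0 < eps)%R -> exists del, (0 < del)%R /\
    forall h, (Cmod h < del)%R -> (Cmod (f (z + h)%C - f z) < eps)%R.
Proof.
  intros H eps he. destruct (H 1%R ltac:(lra)) as [d [hd H1]].
  assert (hl := Cmod_ge_0 l).
  exists (Rmin d (eps / (Cmod l + 2))). split.
  { apply Rmin_pos; [auto|apply Rdiv_lt_0_compat; lra]. }
  intros h hh. assert (m1 := Rmin_l d (eps / (Cmod l + 2))). assert (m2 := Rmin_r d (eps / (Cmod l + 2))).
  specialize (H1 h ltac:(lra)).
  assert (E : f (z + h)%C - f z = (f (z + h)%C - f z - l * h) + l * h) by ring. rewrite E.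
  eapply Rle_lt_trans; [apply Cmod_triangle|]. rewrite Cmod_mult.
  assert (h3 : (Cmod h < eps / (Cmod l + 2))%R) by lra.
  apply Rlt_div_r in h3; [|lra]. assert (t := Cmod_ge_0 h). nra.
Qed.

Lemma cder_CL (f : C -> C) (z l : C) (u : nat -> C) : cder f z l -> CL u z ->
  CL (fun n => f (u n)) (f z).
Proof.
  intros H Hu eps he. destruct (cder_cont f z l H eps he) as [d [hd hf]].
  destruct (Hu d hd) as [N hN]. exists N. intros n hn.
  replace (u n) with (z + (u n - z)) by ring. apply hf. auto.
Qed.

Lemma cder_eq (f : C -> C) (z l l' : C) : l = l' -> cder f z l -> cder f z l'.
Proof. intros ->. auto. Qed.

Lemma cder_unique (f : C -> C) (z l l' : C) : cder f z l -> cder f z l' -> l = l'.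
Proof. intros H H'. apply cder_C_derive in H, H'. congruence. Qed.

(** * Rules of differentiation *)

Lemma cder_const (c z : C) : cder (fun _ => c) z 0.
Proof.
  intros eps he. exists 1%R. split; [lra|]. intros h _.
  replace (c - c - 0 * h) with (RtoC 0) by ring. rewrite Cmod_0.
  apply Rmult_le_pos; [lra|apply Cmod_ge_0].
Qed.

Lemma cder_id (z : C) : cder (fun x => x) z 1.
Proof.
  intros eps he. exists 1%R. split; [lra|]. intros h _.
  replace (z + h - z - 1 * h) with (RtoC 0) by ring. rewrite Cmod_0.
  apply Rmult_le_pos; [lra|apply Cmod_ge_0].
Qed.

Lemma cder_plus (f g : C -> C) (z l m : C) : cder f z l -> cder g z m ->
  cder (fun x => f x + g x) z (l + m).
Proof.
  intros H H' eps he. destruct (H (eps / 2)%R ltac:(lra)) as [d [hd Hd]].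
  destruct (H' (eps / 2)%R ltac:(lra)) as [d' [hd' Hd']].
  exists (Rmin d d'). split; [apply Rmin_pos; auto|]. intros h hh.
  assert (m1 := Rmin_l d d'). assert (m2 := Rmin_r d d').
  specialize (Hd h ltac:(lra)). specialize (Hd' h ltac:(lra)).
  replace (f (z + h)%C + g (z + h)%C - (f z + g z) - (l + m) * h)
    with ((f (z + h)%C - f z - l * h) + (g (z + h)%C - g z - m * h)) by ring.
  eapply Rle_trans; [apply Cmod_triangle|]. lra.
Qed.

Lemma cder_mult (f g : C -> C) (z l m : C) : cder f z l -> cder g z m ->
  cder (fun x => f x * g x) z (l * g z + f z * m).
Proof.
  intros H H' eps he.
  set (K := (Cmod (f z) + Cmod (g z) + Cmod m + 2)%R).
  assert (hf0 := Cmod_ge_0 (f z)). assert (hg0 := Cmod_ge_0 (g z)). assert (hm0 := Cmod_ge_0 m).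
  assert (hK : (0 < K)%R) by (unfold K; lra).
  set (e := Rmin 1 (eps / (3 * K))).
  assert (he1 : (e <= 1)%R) by apply Rmin_l.
  assert (he2 : (e <= eps / (3 * K))%R) by apply Rmin_r.
  assert (he0 : (0 < e)%R) by (apply Rmin_pos; [lra|apply Rdiv_lt_0_compat; lra]).
  assert (he3 : (e * K <= eps / 3)%R).
  { apply Rle_trans with (eps / (3 * K) * K)%R; [apply Rmult_le_compat_r; lra|]. right. field. lra. }
  destruct (H e he0) as [d [hd Hd]]. destruct (H' e he0) as [d' [hd' Hd']].
  destruct (cder_cont f z l H e he0) as [d2 [hd2 Hd2]].
  exists (Rmin (Rmin d d') d2). split; [repeat apply Rmin_pos; auto|]. intros h hh.
  assert (m0 := Rmin_l (Rmin d d') d2). assert (m3 := Rmin_r (Rmin d d') d2).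
  assert (m1 := Rmin_l d d'). assert (m2 := Rmin_r d d').
  specialize (Hd h ltac:(lra)). specialize (Hd' h ltac:(lra)). specialize (Hd2 h ltac:(lra)).
  replace (f (z + h)%C * g (z + h)%C - f z * g z - (l * g z + f z * m) * h)
    with ((f (z + h)%C - f z - l * h) * g z + (f (z + h)%C * (g (z + h)%C - g z - m * h)
          + (f (z + h)%C - f z) * m * h)) by ring.
  assert (hh0 := Cmod_ge_0 h).
  assert (B : (Cmod (f (z + h)%C) <= Cmod (f z) + 1)%R).
  { replace (f (z + h)%C) with (f z + (f (z + h)%C - f z)) by ring.
    eapply Rle_trans; [apply Cmod_triangle|]. lra. }
  eapply Rle_trans; [apply Cmod_triangle|]. rewrite Cmod_mult.
  apply Rle_trans with (e * Cmod h * Cmod (g z) + ((Cmod (f z) + 1) * (e * Cmod h) + e * Cmod m * Cmod h))%R.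
  - apply Rplus_le_compat; [apply Rmult_le_compat_r; auto|].
    eapply Rle_trans; [apply Cmod_triangle|]. rewrite !Cmod_mult.
    apply Rplus_le_compat.
    + apply Rmult_le_compat; auto using Cmod_ge_0.
    + apply Rmult_le_compat_r; auto. apply Rmult_le_compat_r; auto. lra.
  - replace (e * Cmod h * Cmod (g z) + ((Cmod (f z) + 1) * (e * Cmod h) + e * Cmod m * Cmod h))%R
      with (e * (Cmod (g z) + Cmod (f z) + 1 + Cmod m) * Cmod h)%R by ring.
    apply Rmult_le_compat_r; auto. unfold K in *. nra.
Qed.

Lemma cder_scal (c : C) (f : C -> C) (z l : C) : cder f z l -> cder (fun x => c * f x) z (c * l).
Proof.
  intros H. apply cder_eq with (0 * f z + c * l); [ring|].
  apply (cder_mult (fun _ => c)); [apply cder_const|auto].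
Qed.

Lemma cder_minus (f g : C -> C) (z l m : C) : cder f z l -> cder g z m ->
  cder (fun x => f x - g x) z (l - m).
Proof.
  intros H H'. apply cder_eq with (l + (-(1)) * m); [ring|].
  assert (E : (fun x => f x - g x) = (fun x => f x + (-(1)) * g x)).
  { apply functional_extensionality. intros; ring. }
  rewrite E. apply cder_plus; [auto|apply cder_scal; auto].
Qed.

Lemma cder_comp (f g : C -> C) (z l m : C) : cder f (g z) l -> cder g z m ->
  cder (fun x => f (g x)) z (l * m).
Proof.
  intros H H' eps he.
  assert (hm0 := Cmod_ge_0 m). assert (hl0 := Cmod_ge_0 l).
  set (K := (Cmod l + Cmod m + 2)%R).
  set (e := Rmin 1 (eps / (2 * K))).
  assert (hK : (0 < K)%R) by (unfold K; lra).
  assert (he1 : (e <= 1)%R) by apply Rmin_l.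
  assert (he2 : (e <= eps / (2 * K))%R) by apply Rmin_r.
  assert (he0 : (0 < e)%R) by (apply Rmin_pos; [lra|apply Rdiv_lt_0_compat; lra]).
  assert (he3 : (e * K <= eps / 2)%R).
  { apply Rle_trans with (eps / (2 * K) * K)%R; [apply Rmult_le_compat_r; lra|]. right. field. lra. }
  destruct (H e he0) as [d [hd Hd]]. destruct (H' e he0) as [d' [hd' Hd']].
  destruct (cder_cont g z m H' d hd) as [d2 [hd2 Hd2]].
  exists (Rmin d' d2). split; [apply Rmin_pos; auto|]. intros h hh.
  assert (m1 := Rmin_l d' d2). assert (m2 := Rmin_r d' d2).
  specialize (Hd' h ltac:(lra)). specialize (Hd2 h ltac:(lra)).
  specialize (Hd _ Hd2).
  replace (g z + (g (z + h)%C - g z)) with (g (z + h)%C) in Hd by ring.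
  replace (f (g (z + h)%C) - f (g z) - l * m * h)
    with ((f (g (z + h)%C) - f (g z) - l * (g (z + h)%C - g z)) + l * (g (z + h)%C - g z - m * h)) by ring.
  assert (hh0 := Cmod_ge_0 h).
  assert (B : (Cmod (g (z + h)%C - g z) <= (Cmod m + 1) * Cmod h)%R).
  { replace (g (z + h)%C - g z) with ((g (z + h)%C - g z - m * h) + m * h) by ring.
    eapply Rle_trans; [apply Cmod_triangle|]. rewrite Cmod_mult. nra. }
  eapply Rle_trans; [apply Cmod_triangle|]. rewrite Cmod_mult.
  apply Rle_trans with (e * ((Cmod m + 1) * Cmod h) + Cmod l * (e * Cmod h))%R.
  - apply Rplus_le_compat.
    + eapply Rle_trans; [exact Hd|]. apply Rmult_le_compat_l; lra.
    + apply Rmult_le_compat_l; auto.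
  - replace (e * ((Cmod m + 1) * Cmod h) + Cmod l * (e * Cmod h))%R
      with (e * (Cmod m + 1 + Cmod l) * Cmod h)%R by ring.
    apply Rmult_le_compat_r; auto. unfold K in *. nra.
Qed.

Lemma cder_ext_loc (f g : C -> C) (z l : C) (r : R) : (0 < r)%R ->
  (forall h, (Cmod h < r)%R -> f (z + h)%C = g (z + h)%C) -> cder f z l -> cder g z l.
Proof.
  intros hr E H eps he. destruct (H eps he) as [d [hd Hd]].
  exists (Rmin r d). split; [apply Rmin_pos; auto|]. intros h hh.
  assert (m1 := Rmin_l r d). assert (m2 := Rmin_r r d).
  assert (E0 : f z = g z). { replace z with (z + 0) by ring. apply E. rewrite Cmod_0. auto. }
  rewrite <- E0, <- E by lra. apply Hd. lra.
Qed.

(** Existence of the derivative comes from the geometric expansion; its value then follows by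
    differentiating $x\cdot x^{-1}=1$. *)
Lemma cder_Cinv (z : C) : z <> 0 -> cder (fun x => / x) z (- / (z * z)).
Proof.
  intros hz.
  assert (hz' := proj1 (Cmod_gt_0 z) hz).
  destruct (HA_inv 0 z hz) as [a [R [H hf]]].
  assert (hf' : forall h, (Cmod h < R)%R -> (fun x => / x) (z + h) = PSum a h).
  { intros h hh. rewrite <- (hf h hh). f_equal. ring. }
  assert (D := expansion_cder _ _ _ _ H hf').
  apply cder_eq with (a 1%nat); [|exact D].
  assert (P := cder_mult _ _ _ _ _ (cder_id z) D). simpl in P.
  assert (Q : cder (fun x => x * / x) z 0).
  { apply (cder_ext_loc (fun _ => 1) _ z 0 (Cmod z) hz'); [|apply cder_const].
    intros h hh. simpl. symmetry. apply Cinv_r. intros E.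
    assert (h = - z) by (replace h with (z + h - z) by ring; rewrite E; ring).
    subst h. rewrite Cmod_opp in hh. lra. }
  assert (E := cder_unique _ _ _ _ P Q).
  replace (a 1%nat) with ((1 * / z + z * a 1%nat) / z - / (z * z)) by (field; auto).
  rewrite E. field. auto.
Qed.

Lemma cder_inv (f : C -> C) (z l : C) : f z <> 0 -> cder f z l ->
  cder (fun x => / f x) z (- l / (f z * f z)).
Proof.
  intros h H. apply cder_eq with (- / (f z * f z) * l); [field; auto|].
  apply (cder_comp (fun x => / x) f); [apply cder_Cinv; auto|auto].
Qed.

Lemma cder_div (f g : C -> C) (z l m : C) : g z <> 0 -> cder f z l -> cder g z m ->
  cder (fun x => f x / g x) z ((l * g z - f z * m) / (g z * g z)).
Proof.
  intros h H H'. apply cder_eq with (l * / g z + f z * (- m / (g z * g z))); [field; auto|].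
  apply (cder_mult f (fun x => / g x)); [auto|apply cder_inv; auto].
Qed.

(** Restriction to a real line, where the mean value theorem and real monotonicity are available.
    Both components are handled at once through an abstract real-linear map [p] that does not
    increase moduli. *)
Lemma cder_Re_line (f : C -> C) (z0 d l : C) (t : R) : cder f (z0 + RtoC t * d) l ->
  is_derive (fun s : R => Re (f (z0 + RtoC s * d))) t (Re (l * d)) /\
  is_derive (fun s : R => Im (f (z0 + RtoC s * d))) t (Im (l * d)).
Proof.
  intros H.
  assert (G : forall (p : C -> R), (forall a b : C, p (a - b)%C = p a - p b)%R ->
     (forall (r : R) (a : C), p (RtoC r * a)%C = r * p a)%R -> (forall a, Rabs (p a) <= Cmod a)%R ->
     is_derive (fun s : R => p (f (z0 + RtoC s * d))) t (p (l * d))).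
  { intros p p1 p2 p3. apply is_derive_Reals. intros eps he.
    assert (hd := Cmod_ge_0 d).
    destruct (H (eps / (2 * (Cmod d + 1)))%R) as [del [hdel Hd]]; [apply Rdiv_lt_0_compat; lra|].
    assert (hq : (0 < del / (Cmod d + 1))%R) by (apply Rdiv_lt_0_compat; lra).
    exists (mkposreal _ hq). intros h hh0 hh. simpl in hh.
    assert (hm : Cmod (RtoC h * d) = (Rabs h * Cmod d)%R) by (rewrite Cmod_mult, Cmod_R; auto).
    assert (hh1 : (0 < Rabs h)%R) by (apply Rabs_pos_lt; auto).
    assert (hlt : (Cmod (RtoC h * d) < del)%R).
    { rewrite hm. apply Rlt_div_r in hh; [|lra]. nra. }
    specialize (Hd _ hlt). rewrite hm in Hd.
    assert (E : ((p (f (z0 + RtoC (t + h) * d)%C) - p (f (z0 + RtoC t * d)%C)) / h - p (l * d)%C)%R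
       = (p (f (z0 + RtoC t * d + RtoC h * d) - f (z0 + RtoC t * d) - l * (RtoC h * d))%C / h)%R).
    { rewrite RtoC_plus. replace (z0 + (RtoC t + RtoC h) * d) with (z0 + RtoC t * d + RtoC h * d) by ring.
      replace (l * (RtoC h * d)) with (RtoC h * (l * d)) by ring. rewrite !p1, p2. field. auto. }
    rewrite E. unfold Rdiv. rewrite Rabs_mult, Rabs_inv. apply Rlt_div_l; [auto|].
    eapply Rle_lt_trans; [apply p3|]. eapply Rle_lt_trans; [exact Hd|].
    apply Rle_lt_trans with (eps / 2 * Rabs h)%R; [|nra].
    replace (eps / (2 * (Cmod d + 1)) * (Rabs h * Cmod d))%R
      with (eps / 2 * Rabs h * (Cmod d / (Cmod d + 1)))%R by (field; lra).
    rewrite <- (Rmult_1_r (eps / 2 * Rabs h)) at 2. apply Rmult_le_compat_l; [nra|].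
    apply Rle_div_l; lra. }
  split; apply G; try (intros; unfold Re, Im; simpl; ring).
  - apply re_le_Cmod.
  - intros a. eapply Rle_trans; [|apply (Rmax_Cmod a)]. apply Rmax_r.
Qed.

Lemma H_convex (z w : C) (t : R) : (0 < Im z)%R -> (0 < Im w)%R -> (0 <= t <= 1)%R ->
  (0 < Im (z + RtoC t * (w - z)))%R.
Proof.
  intros hz hw ht. unfold Im, Re in *. destruct z as [a b], w as [c d]; simpl in *.
  replace (b + (t * (d + - b) + 0 * (c + - a)))%R with ((1 - t) * b + t * d)%R by ring. nra.
Qed.

(** The half-plane is convex, so the mean value theorem applies to both components on the segment
    from [z] to [w]. *)
Lemma cder0_const (f : C -> C) (z w : C) :
  (forall x, (0 < Im x)%R -> cder f x 0) -> (0 < Im z)%R -> (0 < Im w)%R -> f z = f w.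
Proof.
  intros H hz hw.
  assert (D : forall t, (0 <= t <= 1)%R -> 
    is_derive (fun s : R => Re (f (z + RtoC s * (w - z)))) t 0%R /\
    is_derive (fun s : R => Im (f (z + RtoC s * (w - z)))) t 0%R).
  { intros t ht. assert (h := cder_Re_line f z (w - z) 0 t (H _ (H_convex z w t hz hw ht))).
    replace (0 * (w - z)) with (RtoC 0) in h by ring. exact h. }
  assert (E : forall g : R -> R, (forall t, (0 <= t <= 1)%R -> is_derive g t 0%R) -> g 0%R = g 1%R).
  { intros g hg. destruct (MVT_gen g 0 1 (fun _ => 0%R)) as [c [_ hc]].
    - intros x hx. rewrite Rmin_left, Rmax_right in hx by lra. apply hg. lra.
    - intros x hx. rewrite Rmin_left, Rmax_right in hx by lra.
      apply derivable_continuous_pt. exists 0%R. apply is_derive_Reals. apply hg. lra.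
    - lra. }
  assert (E1 := E _ (fun t ht => proj1 (D t ht))). assert (E2 := E _ (fun t ht => proj2 (D t ht))).
  simpl in E1, E2.
  replace (z + RtoC 0 * (w - z)) with z in E1, E2 by ring.
  replace (z + RtoC 1 * (w - z)) with w in E1, E2 by ring.
  rewrite (surjective_pairing (f z)), (surjective_pairing (f w)). f_equal; auto.
Qed.

(** * Exponential, logarithm, real powers *)

Lemma Cmod_le_sum (z : C) : (Cmod z <= Rabs (Re z) + Rabs (Im z))%R.
Proof.
  replace z with (RtoC (Re z) + RtoC (Im z) * Ci) at 1.
  - eapply Rle_trans; [apply Cmod_triangle|]. rewrite Cmod_mult, !Cmod_R, Cmod_Ci. lra.
  - destruct z as [a b]. unfold RtoC, Ci, Cplus, Cmult, Re, Im. simpl. f_equal; ring.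
Qed.

Lemma im_le_Cmod (z : C) : (Rabs (Im z) <= Cmod z)%R.
Proof. eapply Rle_trans; [|apply (Rmax_Cmod z)]. apply Rmax_r. Qed.

Lemma Cexp_plus (z w : C) : Cexp (z + w) = Cexp z * Cexp w.
Proof.
  destruct z as [a b], w as [c d]. unfold Cexp, Re, Im. simpl. rewrite exp_plus, cos_plus, sin_plus.
  unfold Cmult, RtoC. simpl. f_equal; ring.
Qed.

Lemma Cexp_0 : Cexp 0 = 1.
Proof.
  unfold Cexp, Re, Im. simpl. rewrite exp_0, cos_0, sin_0. unfold Cmult, RtoC. simpl. f_equal; ring.
Qed.

Lemma Cmod_Cexp (z : C) : Cmod (Cexp z) = exp (Re z).
Proof.
  unfold Cexp. rewrite Cmod_mult, Cmod_R. unfold Cmod at 1. simpl.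
  replace (cos (Im z) * (cos (Im z) * 1) + sin (Im z) * (sin (Im z) * 1))%R with 1%R.
  - rewrite sqrt_1, Rmult_1_r, Rabs_right; auto. left. apply exp_pos.
  - assert (h := sin2_cos2 (Im z)). unfold Rsqr in h. lra.
Qed.

Lemma Cexp_nz (z : C) : Cexp z <> 0.
Proof. apply Cmod_gt_0. rewrite Cmod_Cexp. apply exp_pos. Qed.

Lemma Cexp_opp (z : C) : Cexp (- z) = / Cexp z.
Proof.
  assert (h := Cexp_nz z).
  assert (E : Cexp z * Cexp (- z) = 1) by (rewrite <- Cexp_plus, Cplus_opp_r; apply Cexp_0).
  replace (Cexp (- z)) with (/ Cexp z * (Cexp z * Cexp (- z))) by (field; auto).
  rewrite E. ring.
Qed.

Lemma Cexp_nat (z : C) (n : nat) : Cexp (RtoC (INR n) * z) = Cexp z ^ n.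
Proof.
  induction n as [|n IH].
  - simpl. replace (RtoC 0 * z) with (RtoC 0) by ring. apply Cexp_0.
  - rewrite S_INR, RtoC_plus. replace ((RtoC (INR n) + 1) * z) with (z + RtoC (INR n) * z) by ring.
    rewrite Cexp_plus, IH. reflexivity.
Qed.

Lemma derivable_pt_lim_0 (f : R -> R) (l : R) : derivable_pt_lim f 0 l ->
  forall eps, (0 < eps)%R -> exists d, (0 < d)%R /\
    forall h, (Rabs h < d -> Rabs (f h - f 0 - l * h) <= eps * Rabs h)%R.
Proof.
  intros H eps he. destruct (H eps he) as [d Hd]. exists d. split; [apply cond_pos|].
  intros h hh. destruct (Req_dec h 0) as [->|h0].
  - replace (f 0 - f 0 - l * 0)%R with 0%R by ring. rewrite Rabs_R0. lra.
  - specialize (Hd h h0 hh). rewrite Rplus_0_l in Hd.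
    replace (f h - f 0 - l * h)%R with (((f h - f 0) / h - l) * h)%R by (field; auto).
    rewrite Rabs_mult. apply Rmult_le_compat_r; [apply Rabs_pos|lra].
Qed.

Lemma cder_Cexp_0 : cder Cexp 0 1.
Proof.
  (* The real part of the remainder costs at most $3e|h|$ and the imaginary part $4e|h|$; hence the
     7. *)
  intros eps he. set (e := Rmin 1 (eps / 7)).
  assert (e1 : (e <= 1)%R) by apply Rmin_l. assert (e2 : (e <= eps / 7)%R) by apply Rmin_r.
  assert (e0 : (0 < e)%R) by (apply Rmin_pos; lra).
  destruct (derivable_pt_lim_0 exp 1) with (eps := e) as [d1 [hd1 H1]]; auto.
  { rewrite <- exp_0. apply derivable_pt_lim_exp. }
  destruct (derivable_pt_lim_0 cos 0) with (eps := e) as [d2 [hd2 H2]]; auto.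
  { assert (P := derivable_pt_lim_cos 0). rewrite sin_0, Ropp_0 in P. exact P. }
  destruct (derivable_pt_lim_0 sin 1) with (eps := e) as [d3 [hd3 H3]]; auto.
  { rewrite <- cos_0. apply derivable_pt_lim_sin. }
  rewrite exp_0 in H1. rewrite cos_0 in H2. rewrite sin_0 in H3.
  exists (Rmin (Rmin d1 d2) (Rmin d3 e)). split; [apply Rmin_pos; apply Rmin_pos; auto|].
  intros h hh.
  assert (m1 := Rmin_l (Rmin d1 d2) (Rmin d3 e)). assert (m2 := Rmin_r (Rmin d1 d2) (Rmin d3 e)).
  assert (m3 := Rmin_l d1 d2). assert (m4 := Rmin_r d1 d2).
  assert (m5 := Rmin_l d3 e). assert (m6 := Rmin_r d3 e).
  rewrite Cplus_0_l, Cexp_0.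
  assert (hx := re_le_Cmod h). assert (hy := im_le_Cmod h).
  destruct h as [x y]. unfold Re, Im in hx, hy. simpl in hx, hy. set (r := Cmod (x, y)) in *.
  specialize (H1 x ltac:(lra)). specialize (H2 y ltac:(lra)). specialize (H3 y ltac:(lra)).
  eapply Rle_trans; [apply Cmod_le_sum|]. unfold Cexp, Re, Im. simpl.
  replace (exp x * cos y - 0 * sin y + - (1) + - (1 * x - 0 * y))%R
    with ((exp x - 1 - 1 * x) * cos y + (1 + x) * (cos y - 1 - 0 * y))%R by ring.
  replace (exp x * sin y + 0 * cos y + - 0 + - (1 * y + 0 * x))%R
    with ((exp x - 1 - 1 * x) * sin y + (1 + x) * (sin y - 0 - 1 * y) + x * y)%R by ring.
  assert (hc : (Rabs (cos y) <= 1)%R) by (apply Rabs_le, COS_bound).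
  assert (hs : (Rabs (sin y) <= 1)%R) by (apply Rabs_le, SIN_bound).
  assert (h1x : (Rabs (1 + x) <= 2)%R).
  { eapply Rle_trans; [apply Rabs_triang|]. rewrite Rabs_R1. lra. }
  assert (hr : (0 <= r)%R) by apply Cmod_ge_0.
  assert (A1 : (Rabs ((exp x - 1 - 1 * x) * cos y) <= e * r)%R).
  { rewrite Rabs_mult. rewrite <- (Rmult_1_r (e * r)). apply Rmult_le_compat; auto using Rabs_pos. nra. }
  assert (A2 : (Rabs ((exp x - 1 - 1 * x) * sin y) <= e * r)%R).
  { rewrite Rabs_mult. rewrite <- (Rmult_1_r (e * r)). apply Rmult_le_compat; auto using Rabs_pos. nra. }
  assert (A3 : (Rabs ((1 + x) * (cos y - 1 - 0 * y)) <= 2 * (e * r))%R).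
  { rewrite Rabs_mult. apply Rmult_le_compat; auto using Rabs_pos. nra. }
  assert (A4 : (Rabs ((1 + x) * (sin y - 0 - 1 * y)) <= 2 * (e * r))%R).
  { rewrite Rabs_mult. apply Rmult_le_compat; auto using Rabs_pos. nra. }
  assert (A5 : (Rabs (x * y) <= e * r)%R).
  { rewrite Rabs_mult. apply Rmult_le_compat; auto using Rabs_pos. lra. }
  assert (T1 := Rabs_triang ((exp x - 1 - 1 * x) * cos y) ((1 + x) * (cos y - 1 - 0 * y))).
  assert (T2 := Rabs_triang ((exp x - 1 - 1 * x) * sin y + (1 + x) * (sin y - 0 - 1 * y)) (x * y)).
  assert (T3 := Rabs_triang ((exp x - 1 - 1 * x) * sin y) ((1 + x) * (sin y - 0 - 1 * y))).
  nra.
Qed.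

Lemma cder_Cexp (z : C) : cder Cexp z (Cexp z).
Proof.
  assert (hz := proj1 (Cmod_gt_0 _) (Cexp_nz z)).
  intros eps he. destruct (cder_Cexp_0 (eps / Cmod (Cexp z))%R) as [d [hd H]].
  { apply Rdiv_lt_0_compat; auto. }
  exists d. split; auto. intros h hh. specialize (H h hh).
  rewrite Cplus_0_l, Cexp_0 in H.
  rewrite Cexp_plus. replace (Cexp z * Cexp h - Cexp z - Cexp z * h) with (Cexp z * (Cexp h - 1 - 1 * h)) by ring.
  rewrite Cmod_mult. apply Rle_trans with (Cmod (Cexp z) * (eps / Cmod (Cexp z) * Cmod h))%R.
  - apply Rmult_le_compat_l; lra.
  - right. field. lra.
Qed.

(** * The principal logarithm and real powers *)

Lemma Re_div_Cmod (z : C) : z <> 0 -> (-1 <= Re z / Cmod z <= 1)%R.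
Proof.
  intros hz. assert (h := proj1 (Cmod_gt_0 z) hz). assert (t := re_le_Cmod z).
  apply Rabs_le_between in t. split; [apply Rle_div_r|apply Rle_div_l]; lra.
Qed.

Lemma Cexp_Clog (z : C) : z <> 0 -> Cexp (Clog z) = z.
Proof.
  intros hz. assert (hr := proj1 (Cmod_gt_0 z) hz). assert (hs := Re_div_Cmod z hz).
  unfold Clog, Cexp, Carg. cbn [Re Im fst snd].
  rewrite exp_ln by auto.
  assert (E : sqrt (1 - (Re z / Cmod z)²) = (Rabs (Im z) / Cmod z)%R).
  { replace (1 - (Re z / Cmod z)²)%R with ((Im z / Cmod z)²)%R.
    - rewrite sqrt_Rsqr_abs. unfold Rdiv. rewrite Rabs_mult. f_equal.
      rewrite Rabs_inv. f_equal. apply Rabs_right. lra.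
    - unfold Rsqr. assert (M := Cmod2_alt z).
      apply Rmult_eq_reg_r with (Cmod z ^ 2)%R; [|apply Rgt_not_eq; apply pow_lt; auto].
      transitivity (Im z ^ 2)%R; [field; lra|]. transitivity (Cmod z ^ 2 - Re z ^ 2)%R; [lra|]. field; lra. }
  destruct z as [x y]. unfold Re, Im in *. cbn [fst snd] in *.
  destruct (Rle_dec 0 y) as [h|h].
  - rewrite cos_acos, sin_acos, E by auto. rewrite Rabs_right by lra.
    unfold Cmult, RtoC. cbn [fst snd]. f_equal; field; lra.
  - rewrite cos_neg, sin_neg, cos_acos, sin_acos, E by auto. rewrite Rabs_left by lra.
    unfold Cmult, RtoC. cbn [fst snd]. f_equal; field; lra.
Qed.

Definition rcont (f : C -> R) (z0 : C) : Prop :=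
  forall eps, (0 < eps)%R -> exists d, (0 < d)%R /\
    forall h, (Cmod h < d)%R -> (Rabs (f (z0 + h)%C - f z0) < eps)%R.

Lemma rcont_comp (g : R -> R) (f : C -> R) (z0 : C) :
  continuity_pt g (f z0) -> rcont f z0 -> rcont (fun z => g (f z)) z0.
Proof.
  intros Hg Hf eps he. destruct (Hg eps he) as [d [hd H]].
  destruct (Hf d hd) as [d' [hd' H']]. exists d'. split; auto. intros h hh.
  destruct (Req_dec (f z0) (f (z0 + h)%C)) as [E|E].
  - rewrite <- E. rewrite Rminus_diag, Rabs_R0. auto.
  - apply H. split; [split; [exact I|auto]|]. apply H'. auto.
Qed.

Lemma rcont_mult (f g : C -> R) (z0 : C) : rcont f z0 -> rcont g z0 -> rcont (fun z => f z * g z)%R z0.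
Proof.
  intros Hf Hg eps he.
  set (K := (Rabs (f z0) + Rabs (g z0) + 2)%R).
  assert (p1 := Rabs_pos (f z0)). assert (p2 := Rabs_pos (g z0)).
  set (e := Rmin 1 (eps / (2 * K))).
  assert (hK : (0 < K)%R) by (unfold K; lra).
  assert (he1 : (e <= 1)%R) by apply Rmin_l.
  assert (he2 : (e <= eps / (2 * K))%R) by apply Rmin_r.
  assert (he0 : (0 < e)%R) by (apply Rmin_pos; [lra|apply Rdiv_lt_0_compat; lra]).
  assert (he3 : (e * K <= eps / 2)%R).
  { apply Rle_trans with (eps / (2 * K) * K)%R; [apply Rmult_le_compat_r; lra|]. right. field. lra. }
  destruct (Hf e he0) as [d [hd H]]. destruct (Hg e he0) as [d' [hd' H']].
  exists (Rmin d d'). split; [apply Rmin_pos; auto|]. intros h hh.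
  assert (m1 := Rmin_l d d'). assert (m2 := Rmin_r d d').
  specialize (H h ltac:(lra)). specialize (H' h ltac:(lra)).
  set (a := (f (z0 + h)%C - f z0)%R) in *. set (b := (g (z0 + h)%C - g z0)%R) in *.
  replace (f (z0 + h)%C * g (z0 + h)%C - f z0 * g z0)%R with (a * b + (a * g z0 + f z0 * b))%R
    by (unfold a, b; ring).
  assert (T1 := Rabs_triang (a * b) (a * g z0 + f z0 * b)).
  assert (T2 := Rabs_triang (a * g z0) (f z0 * b)).
  rewrite !Rabs_mult in *. assert (q1 := Rabs_pos a). assert (q2 := Rabs_pos b). unfold K in *. nra.
Qed.

Lemma rcont_Re (z0 : C) : rcont Re z0.
Proof.
  intros eps he. exists eps. split; auto. intros h hh. eapply Rle_lt_trans; [|exact hh].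
  replace (Re (z0 + h)%C - Re z0)%R with (Re h) by (unfold Re; simpl; ring). apply re_le_Cmod.
Qed.

Lemma rcont_Im (z0 : C) : rcont Im z0.
Proof.
  intros eps he. exists eps. split; auto. intros h hh. eapply Rle_lt_trans; [|exact hh].
  replace (Im (z0 + h)%C - Im z0)%R with (Im h) by (unfold Im; simpl; ring). apply im_le_Cmod.
Qed.

Lemma rcont_Cmod (z0 : C) : rcont Cmod z0.
Proof.
  intros eps he. exists eps. split; auto. intros h hh. eapply Rle_lt_trans; [|exact hh].
  apply Rabs_le. assert (t1 := Cmod_triangle z0 h). assert (t2 := Cmod_rev_tri (z0 + h) h).
  replace (z0 + h - h) with z0 in t2 by ring.
  assert (t3 := Cmod_triangle (z0 + h) (- h)). replace (z0 + h + - h) with z0 in t3 by ring.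
  rewrite Cmod_opp in t3. lra.
Qed.

(** Off the real axis the sign test in [Carg] is locally constant, and [acos] is only evaluated
    inside $(-1,1)$, where it is differentiable. *)
Lemma Carg_cont (z0 : C) : Im z0 <> 0%R -> rcont Carg z0.
Proof.
  intros hi.
  assert (hz : z0 <> 0) by (intros E; apply hi; rewrite E; reflexivity).
  assert (hr := proj1 (Cmod_gt_0 z0) hz).
  assert (hs : (-1 < Re z0 / Cmod z0 < 1)%R).
  { assert (M := Cmod2_alt z0). assert (0 < Im z0 ^ 2)%R by nra.
    split; [apply Rlt_div_r|apply Rlt_div_l]; nra. }
  assert (H1 : rcont (fun z => Re z / Cmod z)%R z0).
  { apply (rcont_mult Re (fun z => / Cmod z)%R); [apply rcont_Re|].
    apply (rcont_comp Rinv); [|apply rcont_Cmod].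
    apply (continuity_pt_inv id); [apply derivable_continuous_pt, derivable_pt_id|unfold id; lra]. }
  assert (H2 : rcont (fun z => acos (Re z / Cmod z))%R z0).
  { apply (rcont_comp acos); [|exact H1]. apply derivable_continuous_pt, derivable_pt_acos. auto. }
  intros eps he. destruct (H2 eps he) as [d [hd H]].
  destruct (rcont_Im z0 (Rabs (Im z0)) (Rabs_pos_lt _ hi)) as [d' [hd' H']].
  exists (Rmin d d'). split; [apply Rmin_pos; auto|]. intros h hh.
  assert (m1 := Rmin_l d d'). assert (m2 := Rmin_r d d').
  specialize (H h ltac:(lra)). specialize (H' h ltac:(lra)). unfold Carg.
  apply Rabs_def2 in H'.
  destruct (Rle_dec 0 (Im z0)) as [c|c]; destruct (Rle_dec 0 (Im (z0 + h)%C)) as [c'|c'].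
  - exact H.
  - rewrite Rabs_right in H' by lra. exfalso. lra.
  - rewrite Rabs_left in H' by lra. exfalso. lra.
  - replace (- acos (Re (z0 + h)%C / Cmod (z0 + h)%C) - - acos (Re z0 / Cmod z0))%R
      with (- (acos (Re (z0 + h)%C / Cmod (z0 + h)%C) - acos (Re z0 / Cmod z0)))%R by ring.
    rewrite Rabs_Ropp. exact H.
Qed.

Lemma Clog_cont (z0 : C) : Im z0 <> 0%R -> forall eps, (0 < eps)%R -> exists d, (0 < d)%R /\
  forall h, (Cmod h < d)%R -> (Cmod (Clog (z0 + h)%C - Clog z0) < eps)%R.
Proof.
  intros hi eps he.
  assert (hz : z0 <> 0) by (intros E; apply hi; rewrite E; reflexivity).
  assert (hr := proj1 (Cmod_gt_0 z0) hz).
  destruct (Carg_cont z0 hi (eps / 2)%R ltac:(lra)) as [d [hd H]].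
  destruct (rcont_comp ln Cmod z0) with (eps := (eps / 2)%R) as [d' [hd' H']];
    [|apply rcont_Cmod|lra|].
  { apply derivable_continuous_pt. exists (/ Cmod z0)%R. apply derivable_pt_lim_ln. auto. }
  exists (Rmin d d'). split; [apply Rmin_pos; auto|]. intros h hh.
  assert (m1 := Rmin_l d d'). assert (m2 := Rmin_r d d').
  specialize (H h ltac:(lra)). specialize (H' h ltac:(lra)).
  eapply Rle_lt_trans; [apply Cmod_le_sum|]. unfold Clog, Re, Im. simpl. unfold Rminus in *. lra.
Qed.

(** Inverse function argument: [Clog] is continuous at [z0] and [Cexp] is differentiable with
    nonzero derivative at [Clog z0]. *)
Lemma cder_Clog (z0 : C) : Im z0 <> 0%R -> cder Clog z0 (/ z0).
Proof.
  intros hi eps he.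
  assert (hz : z0 <> 0) by (intros E; apply hi; rewrite E; reflexivity).
  assert (hr := proj1 (Cmod_gt_0 z0) hz).
  set (r := Cmod z0) in *.
  set (e := Rmin (r / 2) (eps * (r * r) / 2)).
  assert (he1 : (e <= r / 2)%R) by apply Rmin_l.
  assert (he2 : (e <= eps * (r * r) / 2)%R) by apply Rmin_r.
  assert (he0 : (0 < e)%R).
  { apply Rmin_pos; [lra|]. apply Rdiv_lt_0_compat; [|lra]. repeat apply Rmult_lt_0_compat; auto. }
  destruct (cder_Cexp (Clog z0) e he0) as [d [hd H]].
  destruct (Clog_cont z0 hi d hd) as [d1 [hd1 H1]].
  exists (Rmin d1 r). split; [apply Rmin_pos; auto|]. intros h hh.
  assert (m1 := Rmin_l d1 r). assert (m2 := Rmin_r d1 r).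
  specialize (H1 h ltac:(lra)). specialize (H _ H1).
  assert (hzh : z0 + h <> 0).
  { intros E. assert (h = - z0) by (replace h with (z0 + h - z0) by ring; rewrite E; ring).
    subst h. rewrite Cmod_opp in hh. unfold r in *. lra. }
  replace (Clog z0 + (Clog (z0 + h)%C - Clog z0)) with (Clog (z0 + h)%C) in H by ring.
  rewrite !Cexp_Clog in H by auto.
  set (k := Clog (z0 + h)%C - Clog z0) in *.
  assert (E : k - / z0 * h = - ((z0 + h - z0 - z0 * k) / z0)) by (field; auto).
  rewrite E, Cmod_opp, Cmod_div by auto. fold r.
  assert (hk := Cmod_ge_0 k). assert (hh0 := Cmod_ge_0 h).
  (* Since $e\le r/2$ this gives $r|k|\le 2|h|$, so the error in terms of the increment [k] of the
     logarithm becomes one in terms of [h]. *)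
  assert (B : (r * Cmod k <= Cmod h + e * Cmod k)%R).
  { unfold r. rewrite <- Cmod_mult.
    replace (z0 * k) with (h - (z0 + h - z0 - z0 * k)) by ring.
    eapply Rle_trans; [apply Cmod_sub_le|]. lra. }
  apply Rle_div_l; [auto|]. eapply Rle_trans; [exact H|].
  assert (B2 : (r * Cmod k <= 2 * Cmod h)%R) by nra.
  apply Rle_trans with (eps * (r * r) / 2 * Cmod k)%R; [apply Rmult_le_compat_r; auto|].
  replace (eps * (r * r) / 2 * Cmod k)%R with (eps * r / 2 * (r * Cmod k))%R by field.
  replace (eps * Cmod h * r)%R with (eps * r / 2 * (2 * Cmod h))%R by field.
  apply Rmult_le_compat_l; [|auto]. apply Rmult_le_pos; [|lra]. apply Rmult_le_pos; lra.
Qed.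

Lemma Crpower_nz (z : C) (w : R) : Crpower z w <> 0.
Proof. apply Cexp_nz. Qed.

Lemma cder_affine (a b z : C) : cder (fun x => a * x + b) z a.
Proof.
  apply cder_eq with (a * 1 + 0); [ring|].
  apply cder_plus; [apply cder_scal, cder_id|apply cder_const].
Qed.

Lemma autom_nz (c d : R) (tau : C) : (0 < Im tau)%R -> (c <> 0 \/ d <> 0)%R -> RtoC c * tau + RtoC d <> 0.
Proof.
  intros ht h E. destruct tau as [x y]. unfold Im in ht. simpl in ht.
  unfold Cmult, Cplus, RtoC in E. simpl in E. injection E as E1 E2.
  assert (c = 0)%R by nra. subst c. destruct h as [h|h]; [auto|]. apply h. lra.
Qed.

(** An affine function with $c\ne0$ maps the half-plane off the real axis, where the logarithm is
    differentiable; for $c=0$ the power is constant, even when [d] is negative and lies on the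
    cut. *)
Lemma cder_Crpower (c d w : R) (tau : C) : (0 < Im tau)%R ->
  cder (fun x => Crpower (RtoC c * x + RtoC d) w) tau
    (RtoC w * RtoC c / (RtoC c * tau + RtoC d) * Crpower (RtoC c * tau + RtoC d) w).
Proof.
  intros ht. destruct (Req_dec c 0) as [->|hc].
  - apply cder_eq with (RtoC 0); [unfold Cdiv; ring|].
    assert (E : (fun x => Crpower (RtoC 0 * x + RtoC d) w) = (fun _ => Crpower (RtoC d) w)).
    { apply functional_extensionality. intros x. f_equal. ring. }
    rewrite E. apply cder_const.
  - assert (hnz := autom_nz c d tau ht (or_introl hc)).
    unfold Crpower.
    apply cder_eq with (Cexp (RtoC w * Clog (RtoC c * tau + RtoC d)) * (RtoC w * (/ (RtoC c * tau + RtoC d) * RtoC c))).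
    { field. auto. }
    apply (cder_comp Cexp); [apply cder_Cexp|]. apply cder_scal.
    apply (cder_comp Clog); [|apply cder_affine]. apply cder_Clog.
    destruct tau as [x y]. unfold Im, Cmult, Cplus, RtoC in *. simpl in *. nra.
Qed.

(** * Partial fractions of 1/sin^2 and of the cotangent *)

Definition nR (n : nat) : C := RtoC (INR n).

Lemma nR_S (n : nat) : nR (S n) = nR n + 1.
Proof. unfold nR. rewrite S_INR, RtoC_plus. auto. Qed.

Lemma nR_nz (n : nat) : nR (S n) <> 0.
Proof. unfold nR. intros E. apply (f_equal fst) in E. simpl fst in E. apply (not_0_INR (S n)); [lia|exact E]. Qed.

Lemma RtoC_nz (r : R) : r <> 0%R -> RtoC r <> 0.
Proof. intros h E. apply (f_equal fst) in E. simpl in E. auto. Qed.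

Lemma Ci_sq : Ci * Ci = - (1).
Proof. unfold Ci, Cmult, Copp, RtoC. simpl. f_equal; ring. Qed.

Lemma Ci_nz : Ci <> 0.
Proof. intros E. apply (f_equal snd) in E. simpl in E. lra. Qed.

Lemma tpi_nz : two_pi_i <> 0.
Proof. unfold two_pi_i. apply Cmult_neq_0; [apply RtoC_nz; assert (h := PI_RGT_0); lra|apply Ci_nz]. Qed.

Lemma nome_plus (z w : C) : nome (z + w) = nome z * nome w.
Proof. unfold nome. rewrite Cmult_plus_distr_l. apply Cexp_plus. Qed.

Lemma nome_0 : nome 0 = 1.
Proof. unfold nome. rewrite Cmult_0_r. apply Cexp_0. Qed.

Lemma nome_1 : nome 1 = 1.
Proof.
  unfold nome, two_pi_i, Cexp. rewrite Cmult_1_r. unfold Re, Im. simpl.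
  replace (2 * PI * 0 - 0 * 1)%R with 0%R by ring. replace (2 * PI * 1 + 0 * 0)%R with (2 * PI)%R by ring.
  rewrite exp_0, cos_2PI, sin_2PI. unfold Cmult, RtoC. simpl. f_equal; ring.
Qed.

Lemma nome_half : nome (/ 2) = - (1).
Proof.
  unfold nome. replace (two_pi_i * / 2) with (RtoC PI * Ci).
  - unfold Cexp, Re, Im. simpl.
    replace (PI * 0 - 0 * 1)%R with 0%R by ring. replace (PI * 1 + 0 * 0)%R with PI by ring.
    rewrite exp_0, cos_PI, sin_PI. unfold Cmult, RtoC, Copp. simpl. f_equal; ring.
  - unfold two_pi_i. rewrite RtoC_mult. field.
Qed.

Lemma nome_nz (z : C) : nome z <> 0.
Proof. apply Cexp_nz. Qed.

Lemma nome_opp (z : C) : nome (- z) = / nome z.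
Proof. unfold nome. rewrite <- Cexp_opp. f_equal. ring. Qed.

Lemma nome_nR (n : nat) (z : C) : nome (nR n * z) = nome z ^ n.
Proof. unfold nome. rewrite <- Cexp_nat. f_equal. unfold nR. ring. Qed.

Lemma nome_int (n : nat) : nome (nR n) = 1.
Proof. replace (nR n) with (nR n * 1) by ring. rewrite nome_nR, nome_1. apply Cpow_1_l. Qed.

Lemma Re_tpi (z : C) : Re (two_pi_i * z) = (- (2 * PI * Im z))%R.
Proof. destruct z as [x y]. unfold two_pi_i, Re, Im. simpl. ring. Qed.

Lemma Im_tpi (z : C) : Im (two_pi_i * z) = (2 * PI * Re z)%R.
Proof. destruct z as [x y]. unfold two_pi_i, Re, Im. simpl. ring. Qed.

Lemma Cmod_nome (z : C) : Cmod (nome z) = exp (- (2 * PI * Im z)).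
Proof. unfold nome. rewrite Cmod_Cexp, Re_tpi. auto. Qed.

Lemma Cmod_nome_lt (z : C) : (0 < Im z)%R -> (Cmod (nome z) < 1)%R.
Proof.
  intros h. rewrite Cmod_nome, <- exp_0. apply exp_increasing.
  assert (0 < PI)%R by apply PI_RGT_0. nra.
Qed.

(** States that [z] is not an integer, in the form in which the denominators of [sfun] and [ctf]
    need it. *)
Definition ok (z : C) : Prop := nome z <> 1.

Lemma ok_Im (z : C) : Im z <> 0%R -> ok z.
Proof.
  intros h E. apply (f_equal Cmod) in E. rewrite Cmod_nome, Cmod_1 in E.
  rewrite <- exp_0 in E. apply exp_inv in E. assert (0 < PI)%R by apply PI_RGT_0. apply h. nra.
Qed.

Lemma ok_add (z : C) (n : nat) : ok z -> ok (z + nR n).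
Proof. unfold ok. rewrite nome_plus, nome_int, Cmult_1_r. auto. Qed.

Lemma ok_sub (z : C) (n : nat) : ok z -> ok (z - nR n).
Proof. unfold ok, Cminus. rewrite nome_plus, nome_opp, nome_int. intros h E. apply h. rewrite <- E. field. Qed.

Lemma ok_nz (z : C) : ok z -> z <> 0.
Proof. intros h E. apply h. rewrite E. apply nome_0. Qed.

Lemma ok_div (z : C) (n : nat) : ok z -> ok (z / nR (S n)).
Proof.
  intros h E. apply h. replace z with (nR (S n) * (z / nR (S n))) by (field; apply nR_nz).
  rewrite nome_nR, E. apply Cpow_1_l.
Qed.

Definition p2 (K : nat) : C := nR (2 ^ K).

Lemma p2_S (K : nat) : p2 (S K) = 2 * p2 K.
Proof.
  unfold p2, nR. change (2 ^ S K)%nat with (2 * 2 ^ K)%nat. rewrite mult_INR, RtoC_mult. reflexivity.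
Qed.

Lemma p2_pos (K : nat) : exists n, (2 ^ K = S n)%nat.
Proof. assert (h := Nat.pow_nonzero 2 K ltac:(lia)). destruct (2 ^ K)%nat; [lia|eauto]. Qed.

Lemma p2_nz (K : nat) : p2 K <> 0.
Proof. unfold p2. destruct (p2_pos K) as [n ->]. apply nR_nz. Qed.

Lemma ok_p2 (z : C) (K : nat) : ok z -> ok (z / p2 K).
Proof. intros h. unfold p2. destruct (p2_pos K) as [n ->]. apply ok_div; auto. Qed.

(** This is $\pi^2/\sin^2\pi z$ written in $q=e^{2\pi iz}$; [ctf] below is $\pi\cot\pi z$. *)
Definition sfun (z : C) : C := (two_pi_i * two_pi_i) * nome z / ((1 - nome z) * (1 - nome z)).
Definition ctf (z : C) : C := two_pi_i / 2 * (nome z + 1) / (nome z - 1).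

Lemma sub1_nz (z : C) : ok z -> 1 - nome z <> 0.
Proof. intros h E. apply h. replace (nome z) with (1 - (1 - nome z)) by ring. rewrite E. ring. Qed.

Lemma sub1_nz' (z : C) : ok z -> nome z - 1 <> 0.
Proof. intros h E. apply h. replace (nome z) with ((nome z - 1) + 1) by ring. rewrite E. ring. Qed.

Lemma half_data (z : C) : ok z -> nome z = nome (z / 2) * nome (z / 2) /\
  nome (z / 2 + / 2) = - nome (z / 2) /\ nome (z / 2 - / 2) = - nome (z / 2) /\
  1 - nome (z / 2) <> 0 /\ 1 + nome (z / 2) <> 0.
Proof.
  intros h. assert (E : nome z = nome (z / 2) * nome (z / 2)).
  { rewrite <- nome_plus. f_equal. field. }
  assert (h1 := sub1_nz z h). rewrite E in h1.
  replace (1 - nome (z / 2) * nome (z / 2)) with ((1 - nome (z / 2)) * (1 + nome (z / 2))) in h1 by ring.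
  repeat split; auto.
  - rewrite nome_plus, nome_half. ring.
  - unfold Cminus. rewrite nome_plus, nome_opp, nome_half. field.
  - intros F. apply h1. rewrite F. ring.
  - intros F. apply h1. rewrite F. ring.
Qed.

Lemma sfun_dbl (z : C) : ok z -> sfun z = / 4 * (sfun (z / 2) + sfun (z / 2 + / 2)) /\
  sfun z = / 4 * (sfun (z / 2) + sfun (z / 2 - / 2)).
Proof.
  intros h. destruct (half_data z h) as [E [E1 [E2 [n1 n2]]]]. unfold sfun. rewrite E, E1, E2.
  assert (n3 : 1 - - nome (z / 2) <> 0) by (replace (1 - - nome (z / 2)) with (1 + nome (z / 2)) by ring; auto).
  assert (n4 : 1 - nome (z / 2) * nome (z / 2) <> 0).
  { replace (1 - nome (z / 2) * nome (z / 2)) with ((1 - nome (z / 2)) * (1 + nome (z / 2))) by ring.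
    apply Cmult_neq_0; auto. }
  split; field; repeat split; auto.
Qed.

Lemma ctf_dbl (z : C) : ok z -> ctf z = / 2 * (ctf (z / 2) + ctf (z / 2 + / 2)) /\
  ctf z = / 2 * (ctf (z / 2) + ctf (z / 2 - / 2)).
Proof.
  intros h. destruct (half_data z h) as [E [E1 [E2 [n1 n2]]]]. unfold ctf. rewrite E, E1, E2.
  assert (n0 : nome (z / 2) - 1 <> 0).
  { intros F. apply n1. replace (1 - nome (z / 2)) with (- (nome (z / 2) - 1)) by ring. rewrite F. ring. }
  assert (n3 : - nome (z / 2) - 1 <> 0).
  { intros F. apply n2. replace (1 + nome (z / 2)) with (- (- nome (z / 2) - 1)) by ring. rewrite F. ring. }
  assert (n4 : nome (z / 2) * nome (z / 2) - 1 <> 0).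
  { replace (nome (z / 2) * nome (z / 2) - 1) with ((nome (z / 2) - 1) * (1 + nome (z / 2))) by ring.
    apply Cmult_neq_0; auto. }
  split; field; repeat split; auto.
Qed.

Definition tK (F : C -> C) (p : nat) (K : nat) (z : C) : C := / (p2 K) ^ p * F (z / p2 K).

(** Duplication formula at scale $2^K$, in two variants: since the second argument matters only
    modulo $2^{K+1}$, either sign of the shift may be used. *)
Definition dbl (t : nat -> C -> C) : Prop :=
  forall K z, ok z -> t K z = t (S K) z + t (S K) (z + p2 K) /\ t K z = t (S K) z + t (S K) (z - p2 K).

Lemma tK_dbl (F : C -> C) (p : nat) :
  (forall z, ok z -> F z = / 2 ^ p * (F (z / 2) + F (z / 2 + / 2)) /\
                     F z = / 2 ^ p * (F (z / 2) + F (z / 2 - / 2))) -> dbl (tK F p).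
Proof.
  intros H K z h. unfold tK. destruct (H _ (ok_p2 z K h)) as [H1 H2].
  assert (n2 := p2_nz K). rewrite p2_S.
  assert (n3 : p2 K ^ p <> 0) by (apply Cpow_nz; auto).
  assert (n4 : (RtoC 2) ^ p <> 0) by (apply Cpow_nz, RtoC_nz; lra).
  replace ((2 * p2 K) ^ p) with (2 ^ p * p2 K ^ p) by (rewrite Cpow_mult_l; auto).
  replace (z / (2 * p2 K)) with (z / p2 K / 2) by (field; auto).
  replace ((z + p2 K) / (2 * p2 K)) with (z / p2 K / 2 + / 2) by (field; auto).
  replace ((z - p2 K) / (2 * p2 K)) with (z / p2 K / 2 - / 2) by (field; auto).
  split; [rewrite H1|rewrite H2]; field; auto.
Qed.

(** Iterated duplication replaces the value at [z] by a sum over the window $-2^K\le n<2^K$ of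
    integer shifts, with $j$ paired to $-1-j$. In the induction, the partner of $z+j$ falls on the
    negative side and conversely, so the outer half of the new window appears in reversed order. *)
Lemma dbl_sum (t : nat -> C -> C) (K : nat) (z : C) : dbl t -> ok z ->
  t 0%nat z = psum (fun j => t (S K) (z + nR j) + t (S K) (z - 1 - nR j)) (2 ^ K).
Proof.
  intros H h. induction K as [|K IH].
  - simpl. destruct (H 0%nat z h) as [_ H2]. rewrite H2.
    replace (p2 0) with (RtoC 1) by reflexivity.
    replace (z + nR 0) with z by (unfold nR; simpl; ring).
    replace (z - 1 - nR 0) with (z - 1) by (unfold nR; simpl; ring). ring.
  - rewrite IH. clear IH. set (n := (2 ^ K)%nat).
    replace (2 ^ S K)%nat with (n + n)%nat by (simpl; lia).
    rewrite psum_add.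
    rewrite <- (psum_rev (fun i => t (S (S K)) (z + nR (n + i)) + t (S (S K)) (z - 1 - nR (n + i)))).
    rewrite <- psum_plus. apply psum_ext. intros j hj.
    destruct (H (S K) (z + nR j) (ok_add _ _ h)) as [_ E1].
    assert (h' : ok (z - 1 - nR j)).
    { apply ok_sub. replace (z - 1) with (z - nR 1) by (unfold nR; simpl; ring). apply ok_sub; auto. }
    destruct (H (S K) (z - 1 - nR j) h') as [E2 _]. rewrite E1, E2.
    assert (E : p2 (S K) = nR (n + (n - 1 - j)) + 1 + nR j).
    { unfold p2. replace (2 ^ S K)%nat with (n + n)%nat by (simpl; lia).
      unfold nR. rewrite <- !RtoC_plus. f_equal. rewrite <- (S_INR (n + (n - 1 - j))), <- plus_INR. f_equal. lia. }
    rewrite E.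
    replace (z + nR j - (nR (n + (n - 1 - j)) + 1 + nR j)) with (z - 1 - nR (n + (n - 1 - j))) by ring.
    replace (z - 1 - nR j + (nR (n + (n - 1 - j)) + 1 + nR j)) with (z + nR (n + (n - 1 - j))) by ring.
    ring.
Qed.

Lemma inv_sq_sum (n : nat) : (rsum (fun i => / (INR (S i) * INR (S i))) n <= 2)%R.
Proof.
  assert (H : forall n, (rsum (fun i => / (INR (S i) * INR (S i))) (S n) <= 2 - / INR (S n))%R).
  { clear. induction n as [|n IH]; [simpl; lra|]. cbn [rsum] in *.
    eapply Rle_trans; [apply Rplus_le_compat_r, IH|].
    assert (h : (0 < INR (S n))%R) by (apply lt_0_INR; lia). rewrite (S_INR (S n)).
    set (x := INR (S n)) in *.
    assert (E : (/ x - / (x + 1) - / ((x + 1) * (x + 1)) = / (x * ((x + 1) * (x + 1))))%R) by (field; lra).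
    assert (P : (0 < / (x * ((x + 1) * (x + 1))))%R) by (apply Rinv_0_lt_compat; repeat apply Rmult_lt_0_compat; lra).
    lra. }
  destruct n as [|n]; [simpl; lra|]. eapply Rle_trans; [apply H|].
  assert (h : (0 < / INR (S n))%R) by (apply Rinv_0_lt_compat, lt_0_INR; lia). lra.
Qed.

Definition Bsq (b0 Cst : R) (j : nat) : R :=
  match j with O => b0 | S i => (Cst * / (INR (S i) * INR (S i)))%R end.

Lemma Bsq_ge0 (b0 Cst : R) (j : nat) : (0 <= b0)%R -> (0 <= Cst)%R -> (0 <= Bsq b0 Cst j)%R.
Proof.
  intros h0 hC. destruct j as [|i]; [exact h0|]. apply Rmult_le_pos; [auto|]. left.
  apply Rinv_0_lt_compat. assert (0 < INR (S i))%R by (apply lt_0_INR; lia). nra.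
Qed.

Lemma Bsq_sum (b0 Cst : R) (n : nat) : (0 <= b0)%R -> (0 <= Cst)%R -> (rsum (Bsq b0 Cst) n <= b0 + 2 * Cst)%R.
Proof.
  intros h0 hC. destruct n as [|n]; [simpl; lra|].
  replace (S n) with (1 + n)%nat by lia. rewrite rsum_add.
  replace (rsum (fun i => Bsq b0 Cst (1 + i)%nat) n) with (Cst * rsum (fun i => / (INR (S i) * INR (S i))) n)%R
    by (rewrite <- rsum_scal; reflexivity).
  assert (h := inv_sq_sum n). change (rsum (Bsq b0 Cst) 1) with (0 + b0)%R. nra.
Qed.

(** Let $K\to\infty$ in [dbl_sum] by dominated convergence. Pairs with $j\ge1$ are dominated by a
    multiple of $1/j^2$; the pair $j=0$ is bounded merely because it converges. *)
Lemma pf_expansion (t : nat -> C -> C) (v : C -> C) (z : C) (K0 : nat) (Cst : R) :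
  dbl t -> ok z -> (forall w, ok w -> CL (fun K => t K w) (v w)) ->
  (forall K j, (K0 <= K)%nat -> (S j < 2 ^ K)%nat ->
     (Cmod (t (S K) (z + nR (S j))%C + t (S K) (z - 1 - nR (S j))%C) <= Cst * / (INR (S j) * INR (S j)))%R) ->
  (0 <= Cst)%R ->
  CS (fun j => v (z + nR j) + v (z - 1 - nR j)) (t 0%nat z).
Proof.
  intros Hd hz Hv HB hC.
  assert (hok : forall j, ok (z - 1 - nR j)).
  { intros j. apply ok_sub. replace (z - 1) with (z - nR 1) by (unfold nR; simpl; ring). apply ok_sub; auto. }
  set (f := fun K j => t (S K) (z + nR j) + t (S K) (z - 1 - nR j)).
  (* The finite sum at level [K], padded by zeros to an infinite series. *)
  set (u := fun K j => if lt_dec j (2 ^ K) then f K j else 0).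
  assert (Hf : forall j, CL (fun K => f K j) (v (z + nR j) + v (z - 1 - nR j))).
  { intros j. apply CL_plus; apply (CL_S (fun K => t K _)); apply Hv; auto. apply ok_add; auto. }
  assert (Hu : forall j, CL (fun K => u K j) (v (z + nR j) + v (z - 1 - nR j))).
  { intros j. apply (CL_eventually (fun K => f K j) _ _ j); [|apply Hf].
    intros K hK. unfold u. destruct (lt_dec j (2 ^ K)) as [|n]; auto.
    exfalso. apply n. apply Nat.le_lt_trans with K; [lia|]. apply Nat.pow_gt_lin_r. lia. }
  destruct (CL_bounded _ _ (Hu 0%nat)) as [K1 hK1].
  set (b0 := (Cmod (v (z + nR 0)%C + v (z - 1 - nR 0)%C) + 1)%R) in *.
  assert (hb0 : (0 <= b0)%R) by (unfold b0; assert (h := Cmod_ge_0 (v (z + nR 0) + v (z - 1 - nR 0))); lra).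
  assert (Hb : forall K j, (max K0 K1 <= K)%nat -> (Cmod (u K j) <= Bsq b0 Cst j)%R).
  { intros K j hK. destruct j as [|j]; [apply hK1; lia|]. unfold u.
    destruct (lt_dec (S j) (2 ^ K)) as [l|l]; [apply HB; [lia|auto]|].
    rewrite Cmod_0. apply (Bsq_ge0 b0 Cst (S j)); auto. }
  assert (HS : forall K, CS (u K) (t 0%nat z)).
  { intros K. rewrite (dbl_sum t K z Hd hz).
    replace (psum (fun j => t (S K) (z + nR j) + t (S K) (z - 1 - nR j)) (2 ^ K)) with (psum (u K) (2 ^ K)).
    - apply CS_finite. intros i hi. unfold u. destruct (lt_dec i (2 ^ K)); [lia|auto].
    - apply psum_ext. intros i hi. unfold u. destruct (lt_dec i (2 ^ K)); [auto|lia]. }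
  assert (Hvb : forall j, (Cmod (v (z + nR j)%C + v (z - 1 - nR j)%C) <= Bsq b0 Cst j)%R).
  { intros j. apply (CL_mod_le _ _ _ (max K0 K1) (fun K hK => Hb K j hK) (Hu j)). }
  destruct (CS_dom _ _ _ Hvb (fun n => Bsq_sum b0 Cst n hb0 hC)) as [l hl].
  replace (t 0%nat z) with l; [exact hl|].
  apply (CL_unique (fun _ => t 0%nat z)); [|apply CL_const].
  apply (tannery u (fun j => v (z + nR j) + v (z - 1 - nR j)) (Bsq b0 Cst) (b0 + 2 * Cst) (max K0 K1)); auto.
  - intros i; apply Bsq_ge0; auto.
  - intros n; apply Bsq_sum; auto.
Qed.

Lemma inv_p2_lim : CL (fun K => / p2 K) 0.
Proof.
  apply (CL_squeeze _ _ (fun K => (/ 2) ^ K)%R 0).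
  - intros K _. replace (/ p2 K - 0) with (/ p2 K) by ring. rewrite Cmod_inv by apply p2_nz.
    unfold p2, nR. rewrite Cmod_R, Rabs_right by (apply Rle_ge, pos_INR).
    rewrite pow_INR, pow_inv. replace (INR 2) with 2%R by (simpl; ring). apply Rle_refl.
  - apply is_lim_seq_geom. rewrite Rabs_right; lra.
Qed.

Lemma nome_p2_lim (z : C) : CL (fun K => nome (z / p2 K)) 1.
Proof.
  rewrite <- nome_0. unfold nome. rewrite Cmult_0_r.
  apply (cder_CL Cexp 0 1 (fun K => two_pi_i * (z / p2 K))); [apply cder_Cexp_0|].
  replace (RtoC 0) with (two_pi_i * z * 0) by ring.
  apply CL_ext with (fun K => two_pi_i * z * / p2 K); [intros; unfold Cdiv; ring|].
  apply CL_scal, inv_p2_lim.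
Qed.

Lemma nome_p2_diff_lim (z : C) : CL (fun K => p2 K * (nome (z / p2 K) - 1)) (two_pi_i * z).
Proof.
  intros eps he.
  assert (hm := Cmod_ge_0 (two_pi_i * z)).
  destruct (cder_Cexp_0 (eps / (Cmod (two_pi_i * z) + 1))%R) as [d [hd H]]; [apply Rdiv_lt_0_compat; lra|].
  assert (L : CL (fun K => two_pi_i * z * / p2 K) 0).
  { replace (RtoC 0) with (two_pi_i * z * 0) by ring. apply CL_scal, inv_p2_lim. }
  destruct (L d hd) as [N hN]. exists N. intros K hK. specialize (hN K hK).
  replace (two_pi_i * z * / p2 K - 0) with (two_pi_i * z * / p2 K) in hN by ring.
  specialize (H _ hN). rewrite Cplus_0_l, Cexp_0 in H.
  assert (n2 := p2_nz K). assert (n3 := proj1 (Cmod_gt_0 _) n2).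
  replace (p2 K * (nome (z / p2 K) - 1) - two_pi_i * z) with
    (p2 K * (Cexp (two_pi_i * z * / p2 K) - 1 - 1 * (two_pi_i * z * / p2 K))).
  - rewrite Cmod_mult. rewrite (Cmod_mult (two_pi_i * z)), Cmod_inv in H by auto.
    apply Rle_lt_trans with (Cmod (p2 K) * (eps / (Cmod (two_pi_i * z) + 1) * (Cmod (two_pi_i * z) * / Cmod (p2 K))))%R.
    + apply Rmult_le_compat_l; lra.
    + replace (Cmod (p2 K) * (eps / (Cmod (two_pi_i * z) + 1) * (Cmod (two_pi_i * z) * / Cmod (p2 K))))%R
        with (eps * (Cmod (two_pi_i * z) / (Cmod (two_pi_i * z) + 1)))%R by (field; lra).
      rewrite <- (Rmult_1_r eps) at 2. apply Rmult_lt_compat_l; [auto|]. apply Rlt_div_l; lra.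
  - unfold nome. replace (two_pi_i * (z / p2 K)) with (two_pi_i * z * / p2 K) by (field; auto). field. auto.
Qed.

Lemma tK_s_lim (z : C) : ok z -> CL (fun K => tK sfun 2 K z) (/ (z * z)).
Proof.
  intros h. assert (hz := ok_nz z h). assert (ht := tpi_nz).
  replace (/ (z * z)) with (two_pi_i * two_pi_i * 1 * / (two_pi_i * z * (two_pi_i * z))) by (field; auto).
  apply CL_ext with (fun K => two_pi_i * two_pi_i * nome (z / p2 K) *
     / ((p2 K * (nome (z / p2 K) - 1)) * (p2 K * (nome (z / p2 K) - 1)))).
  - intros K. unfold tK, sfun. assert (n2 := p2_nz K).
    assert (n1 := sub1_nz _ (ok_p2 z K h)). assert (n1' := sub1_nz' _ (ok_p2 z K h)).
    field. repeat split; auto.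
  - apply CL_mult; [apply CL_scal, nome_p2_lim|]. apply CL_inv; [apply Cmult_neq_0; apply Cmult_neq_0; auto|].
    apply CL_mult; apply nome_p2_diff_lim.
Qed.

Lemma tK_ct_lim (z : C) : ok z -> CL (fun K => tK ctf 1 K z) (/ z).
Proof.
  intros h. assert (hz := ok_nz z h). assert (ht := tpi_nz).
  replace (/ z) with (two_pi_i / 2 * (1 + 1) * / (two_pi_i * z)) by (field; auto).
  apply CL_ext with (fun K => two_pi_i / 2 * (nome (z / p2 K) + 1) * / (p2 K * (nome (z / p2 K) - 1))).
  - intros K. unfold tK, ctf. assert (n2 := p2_nz K). assert (n1' := sub1_nz' _ (ok_p2 z K h)).
    simpl. field. repeat split; auto.
  - apply CL_mult; [|apply CL_inv; [apply Cmult_neq_0; auto|apply nome_p2_diff_lim]].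
    apply CL_scal. apply CL_plus; [apply nome_p2_lim|apply CL_const].
Qed.

(** From $\sin y\ge y-y^3/6$ and $y^2\le4$, which holds because $\pi\le4$. *)
Lemma sin_lower (y : R) : (0 <= y <= PI / 2)%R -> (y / 3 <= sin y)%R.
Proof.
  intros [h1 h2]. assert (h3 := PI_4). assert (h4 := PI_RGT_0).
  assert (h := proj1 (sin_bound y 0 h1 ltac:(lra))).
  unfold sin_approx, sin_term in h. simpl in h.
  assert (hy : (y * y <= 4)%R) by nra.
  assert (hy3 : (y * (y * y) <= y * 4)%R) by (apply Rmult_le_compat_l; lra).
  lra.
Qed.

(** With $\rho=|q|$ and $x=\mathrm{Re}\,w$ one has $|1-q|^2=(1-\rho)^2+4\rho\sin^2\pi x$, and
    $|\sin\pi x|\ge|x|$ on this range. *)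
Lemma one_sub_nome (w : C) : (Rabs (Re w) <= / 2)%R ->
  (4 * (Re w * Re w) * Cmod (nome w) <= Cmod (1 - nome w) ^ 2)%R.
Proof.
  intros hw. rewrite Cmod2_alt, Cmod_nome.
  unfold nome, Cexp. rewrite Re_tpi, Im_tpi. set (rho := exp (- (2 * PI * Im w))).
  assert (hr : (0 < rho)%R) by apply exp_pos.
  set (x := Re w) in *.
  unfold Re, Im. simpl.
  replace (2 * PI * x)%R with (2 * (PI * x))%R by ring. rewrite cos_2a, sin_2a.
  assert (hs : (x * x <= sin (PI * x) * sin (PI * x))%R).
  { assert (hp := PI_RGT_0). assert (hp3 := PI2_3_2).
    assert (G : forall u, (0 <= u <= / 2)%R -> (u * u <= sin (PI * u) * sin (PI * u))%R).
    { intros u hu. assert (l := sin_lower (PI * u) ltac:(nra)).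
      assert (u <= sin (PI * u))%R by nra. nra. }
    destruct (Rle_dec 0 x) as [c|c].
    - apply G. rewrite Rabs_right in hw; lra.
    - assert (g := G (- x)%R). rewrite Rabs_left in hw by lra. specialize (g ltac:(lra)).
      replace (PI * - x)%R with (- (PI * x))%R in g by ring. rewrite sin_neg in g. nra. }
  assert (E := sin2_cos2 (PI * x)). unfold Rsqr in E.
  set (s := sin (PI * x)) in *. set (c := cos (PI * x)) in *.
  assert (hc : (c * c = 1 - s * s)%R) by lra.
  match goal with |- (_ <= ?r)%R => replace r with ((1 - rho) * (1 - rho) + 4 * rho * (s * s))%R end.
  - assert (0 <= (1 - rho) * (1 - rho))%R by (apply Rle_0_sqr). nra.
  - transitivity (1 - 2 * rho * (c * c - s * s) + rho * rho * ((c * c - s * s) * (c * c - s * s) + 4 * (c * c) * (s * s)))%R.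
    + rewrite hc. ring.
    + ring.
Qed.

Lemma Cmod_tpi : Cmod two_pi_i = (2 * PI)%R.
Proof.
  unfold two_pi_i. rewrite Cmod_mult, Cmod_Ci, Cmod_R, Rabs_right; [ring|].
  assert (h := PI_RGT_0). lra.
Qed.

Lemma p2_R (K : nat) : exists P : R, p2 K = RtoC P /\ (0 < P)%R /\ P = INR (2 ^ K).
Proof.
  exists (INR (2 ^ K)). split; [reflexivity|]. split; [|reflexivity].
  destruct (p2_pos K) as [n ->]. apply lt_0_INR. lia.
Qed.

Lemma Re_div_R (z : C) (P : R) : (0 < P)%R -> Re (z / RtoC P) = (Re z / P)%R.
Proof.
  intros h. replace (z / RtoC P) with (RtoC (/ P) * z).
  - rewrite re_scal_l. unfold Rdiv. ring.
  - rewrite RtoC_inv by lra. unfold Cdiv. ring.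
Qed.

Lemma sfun_bound (w : C) : ok w -> (Rabs (Re w) <= / 2)%R -> Re w <> 0%R ->
  (Cmod (sfun w) <= PI * PI / (Re w * Re w))%R.
Proof.
  intros h hw h0. assert (B := one_sub_nome w hw).
  assert (n1 := proj1 (Cmod_gt_0 _) (sub1_nz w h)).
  unfold sfun. rewrite Cmod_div by (apply Cmult_neq_0; apply sub1_nz; auto).
  rewrite !Cmod_mult, Cmod_tpi.
  assert (hx : (0 < Re w * Re w)%R) by nra.
  assert (hp := PI_RGT_0).
  replace (Cmod (1 - nome w) * Cmod (1 - nome w))%R with (Cmod (1 - nome w) ^ 2)%R by ring.
  assert (hd : (0 < Cmod (1 - nome w) ^ 2)%R) by (apply pow_lt; auto).
  apply Rle_div_l; [auto|].
  replace (PI * PI / (Re w * Re w) * Cmod (1 - nome w) ^ 2)%R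
    with (PI * PI * (Cmod (1 - nome w) ^ 2 / (Re w * Re w)))%R by (field; auto).
  replace (2 * PI * (2 * PI) * Cmod (nome w))%R with (PI * PI * (4 * Cmod (nome w)))%R by ring.
  apply Rmult_le_compat_l; [nra|].
  apply (proj1 (Rle_div_r (4 * Cmod (nome w)) (Cmod (1 - nome w) ^ 2) (Re w * Re w) hx)).
  replace (4 * Cmod (nome w) * (Re w * Re w))%R with (4 * (Re w * Re w) * Cmod (nome w))%R by ring. auto.
Qed.

Lemma Re_add_nR (z : C) (n : nat) : Re (z + nR n) = (Re z + INR n)%R.
Proof. unfold Re, nR. simpl. auto. Qed.

Lemma Re_sub_nR (z : C) (n : nat) : Re (z - 1 - nR n) = (Re z - 1 - INR n)%R.
Proof. unfold Re, nR. simpl. ring. Qed.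

Lemma ok_sub1 (z : C) (n : nat) : ok z -> ok (z - 1 - nR n).
Proof.
  intros h. apply ok_sub. replace (z - 1) with (z - nR 1) by (unfold nR; simpl; ring). apply ok_sub; auto.
Qed.

(** For [z] in the unit strip the shifted arguments, divided by $2^{K+1}$, have real part of modulus
    at most $1/2$, as required by the lower bound on $|1-q|$. *)
Lemma range_bounds (z : C) (K j : nat) : (0 <= Re z < 1)%R -> (S j < 2 ^ K)%nat ->
  (INR (S j) <= Re z + INR (S j) <= INR (2 ^ S K) / 2)%R /\
  (INR (S j) <= 1 + INR (S j) - Re z <= INR (2 ^ S K) / 2)%R.
Proof.
  intros hz hj. change (2 ^ S K)%nat with (2 * 2 ^ K)%nat. rewrite mult_INR.
  replace (INR 2) with 2%R by (simpl; ring).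
  assert (h : (INR (S (S j)) <= INR (2 ^ K))%R) by (apply le_INR; lia).
  rewrite (S_INR (S j)) in h. lra.
Qed.

Lemma inv_le_sq (a b : R) : (0 < a)%R -> (a <= b)%R -> (/ (b * b) <= / (a * a))%R.
Proof. intros h1 h2. apply Rinv_le_contravar; nra. Qed.

Lemma tK_s_bound (w : C) (K j : nat) : ok w ->
  (INR (S j) <= Rabs (Re w) <= INR (2 ^ S K) / 2)%R ->
  (Cmod (tK sfun 2 (S K) w) <= PI * PI * / (INR (S j) * INR (S j)))%R.
Proof.
  intros h hw. assert (hok := ok_p2 w (S K) h).
  unfold tK. destruct (p2_R (S K)) as [P [E [hP HP]]]. rewrite E in *. rewrite <- HP in hw.
  assert (hj : (0 < INR (S j))%R) by (apply lt_0_INR; lia).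
  assert (R1 := Re_div_R w P hP).
  assert (hw0 : Re w <> 0%R) by (intros F; rewrite F, Rabs_R0 in hw; lra).
  assert (B := sfun_bound (w / RtoC P) hok). rewrite R1 in B.
  assert (B' : (Cmod (sfun (w / RtoC P)) <= PI * PI / (Re w / P * (Re w / P)))%R).
  { apply B.
    - unfold Rdiv. rewrite Rabs_mult, Rabs_inv, (Rabs_right P) by lra.
      apply Rle_div_l; lra.
    - apply Rmult_integral_contrapositive_currified; [auto|]. apply Rinv_neq_0_compat. lra. }
  assert (hP0 : P <> 0%R) by lra.
  rewrite Cmod_mult, Cmod_inv by (apply Cpow_nz, RtoC_nz; auto).
  rewrite Cmod_pow, Cmod_R, (Rabs_right P) by lra.
  apply Rle_trans with (/ P ^ 2 * (PI * PI / (Re w / P * (Re w / P))))%R.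
  { apply Rmult_le_compat_l; [left; apply Rinv_0_lt_compat, pow_lt; auto|auto]. }
  replace (/ P ^ 2 * (PI * PI / (Re w / P * (Re w / P))))%R with (PI * PI * / (Rabs (Re w) * Rabs (Re w)))%R.
  - apply Rmult_le_compat_l; [assert (q := PI_RGT_0); nra|]. apply inv_le_sq; lra.
  - rewrite <- Rabs_mult, (Rabs_right (Re w * Re w)) by nra. field. split; [auto|lra].
Qed.

Lemma sfun_pf (z : C) : ok z -> (0 <= Re z < 1)%R ->
  CS (fun j => / ((z + nR j) * (z + nR j)) + / ((z - 1 - nR j) * (z - 1 - nR j))) (sfun z).
Proof.
  intros h hz.
  replace (sfun z) with (tK sfun 2 0 z).
  2:{ unfold tK. replace (p2 0) with (RtoC 1) by reflexivity. replace (z / 1) with z by field. simpl. field. }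
  apply (pf_expansion (tK sfun 2) (fun x => / (x * x)) z 0 (2 * (PI * PI))); auto.
  - apply tK_dbl. intros w hw. replace ((RtoC 2) ^ 2) with (RtoC 4) by (simpl; rewrite Cmult_1_r, <- RtoC_mult; f_equal; ring).
    apply sfun_dbl. auto.
  - intros w hw. apply tK_s_lim; auto.
  - intros K j _ hj. destruct (range_bounds z K j hz hj) as [b1 b2].
    assert (hj0 : (0 < INR (S j))%R) by (apply lt_0_INR; lia).
    eapply Rle_trans; [apply Cmod_triangle|].
    assert (t1 := tK_s_bound (z + nR (S j)) K j (ok_add _ _ h)). rewrite Re_add_nR, Rabs_right in t1 by lra.
    assert (t2 := tK_s_bound (z - 1 - nR (S j)) K j (ok_sub1 _ _ h)). rewrite Re_sub_nR, Rabs_left in t2 by lra.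
    specialize (t1 b1). specialize (t2 ltac:(lra)). lra.
  - assert (q := PI_RGT_0). nra.
Qed.

Lemma ctf_pair (a b : C) : ok a -> ok b ->
  ctf a + ctf b = two_pi_i * (nome (a + b) - 1) / ((nome a - 1) * (nome b - 1)).
Proof.
  intros ha hb. rewrite nome_plus. unfold ctf. assert (h1 := sub1_nz' a ha). assert (h2 := sub1_nz' b hb).
  field. auto.
Qed.

(** A single cotangent term is only of order $1/j$. The two members of a pair have arguments adding
    up to $(2z-1)/2^{K+1}$, so by [ctf_pair] their sum has a numerator of order $2^{-K}$, and this
    yields the summable bound $1/j^2$. *)
Lemma ctf_pf (z : C) : ok z -> (0 <= Re z < 1)%R ->
  CS (fun j => / (z + nR j) + / (z - 1 - nR j)) (ctf z).
Proof.
  intros h hz. assert (hpi := PI_RGT_0).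
  replace (ctf z) with (tK ctf 1 0 z).
  2:{ unfold tK. replace (p2 0) with (RtoC 1) by reflexivity. replace (z / 1) with z by field. simpl. field. }
  set (y := 2 * z - 1).
  destruct (CL_bounded _ _ (nome_p2_diff_lim y)) as [K1 hK1]. set (M0 := (Cmod (two_pi_i * y) + 1)%R) in *.
  destruct (nome_p2_lim y (3 / 4)%R ltac:(lra)) as [K2 hK2].
  assert (hM0 : (0 <= M0)%R) by (unfold M0; assert (q := Cmod_ge_0 (two_pi_i * y)); lra).
  apply (pf_expansion (tK ctf 1) (fun x => / x) z (max K1 K2) (PI * M0)); auto.
  - apply tK_dbl. intros w hw. rewrite Cpow_1_r. apply ctf_dbl. auto.
  - intros w hw. apply tK_ct_lim; auto.
  - intros K j hK hj. destruct (range_bounds z K j hz hj) as [b1 b2].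
    assert (hj0 : (0 < INR (S j))%R) by (apply lt_0_INR; lia).
    unfold tK. rewrite <- Cmult_plus_distr_l.
    assert (oka := ok_p2 _ (S K) (ok_add z (S j) h)). assert (okb := ok_p2 _ (S K) (ok_sub1 z (S j) h)).
    rewrite ctf_pair by auto.
    replace ((z + nR (S j)) / p2 (S K) + (z - 1 - nR (S j)) / p2 (S K)) with (y / p2 (S K))
      by (unfold y; field; apply p2_nz).
    specialize (hK1 (S K) ltac:(lia)). specialize (hK2 (S K) ltac:(lia)).
    destruct (p2_R (S K)) as [P [E [hP HP]]]. rewrite E in *. rewrite <- HP in b1, b2.
    set (a := (z + nR (S j)) / RtoC P) in *. set (b := (z - 1 - nR (S j)) / RtoC P) in *.
    set (q := nome (y / RtoC P)) in *.
    assert (Eq : q = nome a * nome b).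
    { unfold q, a, b. rewrite <- nome_plus. f_equal. unfold y. field. apply RtoC_nz. lra. }
    assert (Ra : Re a = ((Re z + INR (S j)) / P)%R) by (unfold a; rewrite Re_div_R, Re_add_nR; auto).
    assert (Rb : Re b = (- ((1 + INR (S j) - Re z) / P))%R).
    { unfold b. rewrite Re_div_R, Re_sub_nR by auto. field. lra. }
    set (xa := ((Re z + INR (S j)) / P)%R) in *. set (xb := ((1 + INR (S j) - Re z) / P)%R) in *.
    assert (hxa : (0 < xa <= / 2)%R).
    { unfold xa. split; [apply Rdiv_lt_0_compat; lra|apply Rle_div_l; lra]. }
    assert (hxb : (0 < xb <= / 2)%R).
    { unfold xb. split; [apply Rdiv_lt_0_compat; lra|apply Rle_div_l; lra]. }
    assert (Ba := one_sub_nome a). rewrite Ra, Rabs_right in Ba by lra. specialize (Ba ltac:(lra)).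
    assert (Bb := one_sub_nome b). rewrite Rb, Rabs_Ropp, Rabs_right in Bb by lra. specialize (Bb ltac:(lra)).
    rewrite Cmod_minus_sym in Ba, Bb.
    set (A := Cmod (nome a - 1)) in *. set (B := Cmod (nome b - 1)) in *.
    assert (hA : (0 < A)%R) by (apply Cmod_gt_0, sub1_nz'; auto).
    assert (hB : (0 < B)%R) by (apply Cmod_gt_0, sub1_nz'; auto).
    assert (hq : (/ 4 <= Cmod q)%R).
    { rewrite Cmod_minus_sym in hK2. assert (t := Cmod_rev_tri 1 (1 - q)).
      replace (1 - (1 - q)) with q in t by ring. rewrite Cmod_1 in t. lra. }
    rewrite Eq, Cmod_mult in hq.
    (* Multiplying the two squared lower bounds leaves the factor $|q|=|q_aq_b|$, which is at least
       $1/4$ by the tolerance $3/4$ fixed above. *)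
    assert (hAB : (2 * (xa * xb) <= A * B)%R).
    { assert (hab : (0 < xa * xb)%R) by nra.
      apply Rsqr_incr_0_var; [|nra]. unfold Rsqr.
      assert (na := Cmod_ge_0 (nome a)). assert (nb := Cmod_ge_0 (nome b)).
      replace (A * B * (A * B))%R with (A ^ 2 * B ^ 2)%R by ring.
      apply Rle_trans with ((4 * (xa * xa) * Cmod (nome a)) * (4 * (- xb * - xb) * Cmod (nome b)))%R.
      - replace ((4 * (xa * xa) * Cmod (nome a)) * (4 * (- xb * - xb) * Cmod (nome b)))%R
          with (16 * ((xa * xb) * (xa * xb)) * (Cmod (nome a) * Cmod (nome b)))%R by ring. nra.
      - apply Rmult_le_compat; auto; apply Rmult_le_pos; nra. }
    rewrite Cmod_mult, Cmod_inv by (rewrite Cpow_1_r; apply RtoC_nz; lra).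
    rewrite Cpow_1_r, Cmod_R, Rabs_right by lra.
    rewrite Cmod_div by (apply Cmult_neq_0; apply sub1_nz'; auto).
    rewrite !Cmod_mult, Cmod_tpi. fold A B.
    rewrite Cmod_mult, Cmod_R, Rabs_right in hK1 by lra.
    assert (hab : (0 < xa * xb)%R) by nra.
    apply Rle_trans with (/ P * (2 * PI * (M0 / P) / (2 * (xa * xb))))%R.
    { apply Rmult_le_compat_l; [left; apply Rinv_0_lt_compat; auto|].
      unfold Rdiv. apply Rmult_le_compat.
      - apply Rmult_le_pos; [lra|apply Cmod_ge_0].
      - left. apply Rinv_0_lt_compat. nra.
      - apply Rmult_le_compat_l; [lra|]. apply (proj1 (Rle_div_r (Cmod (q - 1)) M0 P hP)). lra.
      - apply Rinv_le_contravar; lra. }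
    replace (/ P * (2 * PI * (M0 / P) / (2 * (xa * xb))))%R
      with (PI * M0 * / ((Re z + INR (S j)) * (1 + INR (S j) - Re z)))%R.
    2:{ unfold xa, xb. field. repeat split; lra. }
    apply Rmult_le_compat_l; [nra|]. apply Rinv_le_contravar; [nra|]. apply Rmult_le_compat; lra.
  - nra.
Qed.

(* Partial sums over the symmetric window [-M, M], which unlike the one-sided ones move well under integer shifts. *)
Definition sym (v : C -> C) (z : C) (M : nat) : C :=
  v z + psum (fun m => v (z + nR (S m)) + v (z - nR (S m))) M.

Lemma sym_pf (v : C -> C) (z : C) (M : nat) :
  psum (fun j => v (z + nR j) + v (z - 1 - nR j)) (S M) = sym v z M + v (z - 1 - nR M).
Proof.
  unfold sym. induction M as [|M IH].
  - simpl. replace (z + nR 0) with z by (unfold nR; simpl; ring). ring.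
  - change (psum (fun j => v (z + nR j) + v (z - 1 - nR j)) (S (S M))) with
      (psum (fun j => v (z + nR j) + v (z - 1 - nR j)) (S M) + (v (z + nR (S M)) + v (z - 1 - nR (S M)))).
    rewrite IH. simpl psum. replace (z - 1 - nR M) with (z - nR (S M)) by (rewrite nR_S; ring). ring.
Qed.

Lemma sym_shift (v : C -> C) (z : C) (M : nat) :
  sym v (z + 1) M = sym v z M + v (z + 1 + nR M) - v (z - nR M).
Proof.
  unfold sym. induction M as [|M IH].
  - simpl. replace (z + 1 + nR 0) with (z + 1) by (unfold nR; simpl; ring).
    replace (z - nR 0) with z by (unfold nR; simpl; ring). ring.
  - simpl psum. rewrite Cplus_assoc, IH.
    replace (z + 1 - nR (S M)) with (z - nR M) by (rewrite nR_S; ring).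
    replace (z + nR (S M)) with (z + 1 + nR M) by (rewrite nR_S; ring). ring.
Qed.

Lemma inv_add_nR_lim (z : C) : CL (fun M => / (z + nR M)) 0.
Proof.
  destruct (INR_unbounded (Cmod z)) as [N hN].
  apply (CL_squeeze _ _ (fun M => / INR (M - N))%R (S N)).
  - intros n hn. replace (/ (z + nR n) - 0) with (/ (z + nR n)) by ring.
    assert (h1 : (0 < INR (n - N))%R) by (apply lt_0_INR; lia).
    assert (h2 : (INR (n - N) <= Cmod (z + nR n))%R).
    { rewrite minus_INR by lia. assert (t := Cmod_rev_tri_plus (nR n) z). rewrite Cplus_comm in t.
      unfold nR in t at 1. rewrite Cmod_R, Rabs_right in t by (apply Rle_ge, pos_INR). lra. }
    rewrite Cmod_inv by (apply Cmod_gt_0; lra). apply Rinv_le_contravar; auto.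
  - apply (is_lim_seq_incr_n _ N).
    apply (is_lim_seq_ext (fun n => / INR n)%R); [intros n; do 2 f_equal; lia|].
    apply (is_lim_seq_inv INR p_infty); [apply is_lim_seq_INR|discriminate].
Qed.

Lemma inv_sub_nR_lim (z : C) : CL (fun M => / (z - nR M)) 0.
Proof.
  assert (H := inv_add_nR_lim (- z)). apply (CL_scal (-(1))) in H.
  replace (- (1) * 0) with (RtoC 0) in H by ring.
  eapply CL_ext; [|exact H]. intros n. simpl. replace (z - nR n) with (- (- z + nR n)) by ring.
  destruct (classic (- z + nR n = 0)) as [E|E]; [rewrite E|].
  - replace (- (0)) with (RtoC 0) by ring. unfold Cinv, RtoC, Copp, Cmult. simpl. f_equal; unfold Rdiv; ring.
  - field. auto.
Qed.

Definition decays (v : C -> C) : Prop := forall z, CL (fun M => v (z + nR M)) 0 /\ CL (fun M => v (z - nR M)) 0.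

Lemma decays_inv : decays (fun x => / x).
Proof. intros z. split; [apply inv_add_nR_lim|apply inv_sub_nR_lim]. Qed.

Lemma inv_mult_total (z : C) : / (z * z) = / z * / z.
Proof.
  destruct (classic (z = 0)) as [->|h]; [|field; auto].
  unfold Cinv, RtoC, Cmult. simpl. f_equal; unfold Rdiv; ring.
Qed.

Lemma decays_inv2 : decays (fun x => / (x * x)).
Proof.
  intros z. replace (RtoC 0) with (RtoC 0 * RtoC 0) by ring.
  split; (eapply CL_ext; [intros n; symmetry; apply inv_mult_total|]); apply CL_mult; apply decays_inv.
Qed.

(** Extends an expansion from the unit strip to all nonintegers: under a unit translation the
    symmetric window changes only by its two boundary terms, which tend to zero, while [F] is
    periodic. *)
Lemma symmetric_pf (v F : C -> C) : decays v -> (forall z, F (z + 1) = F z) ->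
  (forall z, ok z -> (0 <= Re z < 1)%R -> CS (fun j => v (z + nR j) + v (z - 1 - nR j)) (F z)) ->
  forall z, ok z -> CS (fun m => v (z + nR (S m)) + v (z - nR (S m))) (F z - v z).
Proof.
  intros Hv HF H.
  assert (H0 : forall z, ok z -> (0 <= Re z < 1)%R -> CL (sym v z) (F z)).
  { intros z hz hr. assert (h := H z hz hr). apply (proj1 (CL_S _ _)) in h.
    replace (F z) with (F z - 0) by ring.
    apply CL_ext with (fun M => psum (fun j => v (z + nR j) + v (z - 1 - nR j)) (S M) - v (z - 1 - nR M)).
    - intros M. rewrite sym_pf. ring.
    - apply CL_minus; [exact h|apply Hv]. }
  assert (HS : forall z, CL (sym v z) (F z) <-> CL (sym v (z + 1)) (F (z + 1))).
  { intros z. rewrite HF. split; intros h.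
    - replace (F z) with (F z + 0 - 0) by ring.
      eapply CL_ext; [intros n; symmetry; apply sym_shift|].
      apply CL_minus; [apply CL_plus; [exact h|]|]; apply Hv.
    - replace (F z) with (F z - 0 + 0) by ring.
      apply CL_ext with (fun M => sym v (z + 1) M - v (z + 1 + nR M) + v (z - nR M)).
      + intros M. rewrite sym_shift. ring.
      + apply CL_plus; [apply CL_minus; [exact h|]|]; apply Hv. }
  assert (HN : forall n z, CL (sym v z) (F z) <-> CL (sym v (z + nR n)) (F (z + nR n))).
  { induction n as [|n IH]; intros z.
    - replace (z + nR 0) with z by (unfold nR; simpl; ring). tauto.
    - rewrite nR_S. replace (z + (nR n + 1)) with (z + nR n + 1) by ring. rewrite <- HS. apply IH. }
  assert (HA : forall z, ok z -> CL (sym v z) (F z)).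
  { intros z hz. set (k := Int_part (Re z)).
    assert (hk := base_Int_part (Re z)). fold k in hk.
    destruct (Z_le_dec 0 k) as [c|c].
    - set (n := Z.to_nat k). assert (En : INR n = IZR k) by (unfold n; rewrite INR_IZR_INZ, Z2Nat.id; auto).
      replace z with ((z - nR n) + nR n) by ring. apply HN. apply H0; [apply ok_sub; auto|].
      replace (Re (z - nR n)) with (Re z - INR n)%R by (unfold Re, nR; simpl; ring). rewrite En. lra.
    - set (n := Z.to_nat (- k)). assert (En : INR n = (- IZR k)%R).
      { unfold n. rewrite INR_IZR_INZ, Z2Nat.id by lia. apply opp_IZR. }
      apply (HN n). apply H0; [apply ok_add; auto|]. rewrite Re_add_nR, En. lra. }
  intros z hz. apply CL_ext with (fun M => sym v z M - v z); [intros; unfold sym; ring|].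
  apply CL_minus; [apply HA; auto|apply CL_const].
Qed.

Lemma nome_per (z : C) : nome (z + 1) = nome z.
Proof. rewrite nome_plus, nome_1. ring. Qed.

Lemma sfun_sym (z : C) : ok z ->
  CS (fun m => / ((z + nR (S m)) * (z + nR (S m))) + / ((z - nR (S m)) * (z - nR (S m)))) (sfun z - / (z * z)).
Proof.
  apply (symmetric_pf (fun x => / (x * x)) sfun decays_inv2).
  - intros w. unfold sfun. rewrite nome_per. auto.
  - apply sfun_pf.
Qed.

Lemma ctf_sym (z : C) : ok z -> CS (fun m => / (z + nR (S m)) + / (z - nR (S m))) (ctf z - / z).
Proof.
  apply (symmetric_pf (fun x => / x) ctf decays_inv).
  - intros w. unfold ctf. rewrite nome_per. auto.
  - apply ctf_pf.
Qed.

(** The expansion of [sfun] at $1/2$, where its value is $\pi^2$, gives the sum $\pi^2/8$ over odd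
    squares; even squares contribute a quarter of the whole. *)
Lemma basel : CS (fun n => / (nR (S n) * nR (S n))) (RtoC (PI * PI / 6)).
Proof.
  assert (hok : ok (/ 2)).
  { unfold ok. rewrite nome_half. intros E. apply (f_equal fst) in E. simpl in E. lra. }
  assert (hre : (0 <= Re (/ 2) < 1)%R).
  { rewrite <- RtoC_inv by lra. unfold Re, RtoC. simpl. lra. }
  assert (H := sfun_pf (/ 2) hok hre).
  assert (E : sfun (/ 2) = RtoC (PI * PI)).
  { unfold sfun, two_pi_i. rewrite nome_half, !RtoC_mult.
    replace (2 * RtoC PI * Ci * (2 * RtoC PI * Ci) * - (1)) with (4 * (RtoC PI * RtoC PI) * - (Ci * Ci)) by ring.
    rewrite Ci_sq. field. }
  rewrite E in H. clear E.
  set (o := fun j => 2 * nR j + 1).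
  assert (ho : forall j, o j <> 0).
  { intros j F. unfold o, nR in F. apply (f_equal fst) in F. simpl in F. assert (h := pos_INR j). lra. }
  assert (two : RtoC 2 <> 0) by (apply RtoC_nz; lra).
  assert (Ho : CS (fun j => / (o j * o j)) (RtoC (PI * PI / 8))).
  { replace (RtoC (PI * PI / 8)) with (/ 8 * RtoC (PI * PI)).
    - apply CS_ext with (fun j => / 8 * (/ ((/ 2 + nR j) * (/ 2 + nR j)) + / ((/ 2 - 1 - nR j) * (/ 2 - 1 - nR j)))).
      + intros j. replace (/ 2 + nR j) with (o j / 2) by (unfold o; field; auto).
        replace (/ 2 - 1 - nR j) with (- (o j / 2)) by (unfold o; field; auto).
        specialize (ho j). field. auto.
      + apply CS_scal. exact H.
    - rewrite RtoC_div, !RtoC_mult by lra. field. }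
  assert (hb : forall i, (Cmod (/ (nR (S i) * nR (S i))) <= / (INR (S i) * INR (S i)))%R).
  { intros i. rewrite Cmod_inv by (apply Cmult_neq_0; apply nR_nz). rewrite Cmod_mult. unfold nR.
    rewrite Cmod_R, Rabs_right by (apply Rle_ge, pos_INR). lra. }
  destruct (CS_dom _ _ _ hb inv_sq_sum) as [Z hZ].
  assert (P : forall M, psum (fun n => / (nR (S n) * nR (S n))) (2 * M) =
     psum (fun j => / (o j * o j)) M + / 4 * psum (fun n => / (nR (S n) * nR (S n))) M).
  { induction M as [|M IH]; [simpl; ring|].
    replace (2 * S M)%nat with (S (S (2 * M))) by lia. cbn [psum]. rewrite IH.
    replace (nR (S (2 * M))) with (o M).
    - replace (nR (S (S (2 * M)))) with (2 * nR (S M)).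
      + assert (h1 := nR_nz M). specialize (ho M). field. auto.
      + unfold nR. rewrite <- RtoC_mult. f_equal. replace (S (S (2 * M))) with (2 * S M)%nat by lia.
        rewrite mult_INR. simpl. ring.
    - unfold o, nR. rewrite S_INR, mult_INR, RtoC_plus, RtoC_mult. reflexivity. }
  assert (L : CL (fun M => psum (fun n => / (nR (S n) * nR (S n))) (2 * M)) Z).
  { apply (CL_sub (psum (fun n => / (nR (S n) * nR (S n)))) Z (fun M => (2 * M)%nat)); [intros; lia|exact hZ]. }
  assert (L2 : CL (fun M => psum (fun n => / (nR (S n) * nR (S n))) (2 * M)) (RtoC (PI * PI / 8) + / 4 * Z)).
  { eapply CL_ext; [intros n; symmetry; apply P|]. apply CL_plus; [exact Ho|apply CL_scal; exact hZ]. }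
  assert (E := CL_unique _ _ _ L L2).
  replace (RtoC (PI * PI / 6)) with Z; [exact hZ|].
  (* [E] states $Z=\pi^2/8+Z/4$. *)
  transitivity (4 / 3 * (Z - / 4 * Z)); [field|].
  rewrite E at 1. rewrite !RtoC_div, !RtoC_mult by lra. field.
Qed.

(** * The weight 2 Eisenstein series *)

Definition dvb (D K : nat) : bool := Nat.eqb (Nat.modulo K D) 0.

Lemma sigma1_sum (n : nat) :
  nR (sigma1 (S n)) = psum (fun d => if dvb (S d) (S n) then nR (S d) else 0) (S n).
Proof.
  unfold sigma1. generalize (S n) as K. intros K.
  assert (H : forall m, nR (list_sum (filter (fun d => Nat.eqb (Nat.modulo K d) 0) (seq 1 m))) =
     psum (fun d => if dvb (S d) K then nR (S d) else 0) m).
  { induction m as [|m IH]; [unfold nR; reflexivity|].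
    rewrite seq_S, filter_app, list_sum_app. unfold nR in *. rewrite plus_INR, RtoC_plus, IH.
    cbn [psum]. f_equal. unfold dvb. cbn [filter]. change (1 + m)%nat with (S m).
    destruct (Nat.eqb (Nat.modulo K (S m)) 0); cbn [list_sum fold_right]; [f_equal; f_equal; lia|reflexivity]. }
  apply H.
Qed.

Lemma dvb_gt (D n : nat) : (n < D)%nat -> dvb (S D) (S n) = false.
Proof. intros h. unfold dvb. rewrite Nat.mod_small by lia. reflexivity. Qed.

Lemma sparse_psum (x : C) (d M : nat) :
  psum (fun k => if dvb (S d) (S k) then x ^ (S k) else 0) (S d * M) = psum (fun m => (x ^ S d) ^ S m) M.
Proof.
  induction M as [|M IH]; [rewrite Nat.mul_0_r; reflexivity|].
  replace (S d * S M)%nat with (S d * M + S d)%nat by lia. rewrite psum_add, IH.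
  cbn [psum]. f_equal. rewrite psum_zero.
  - replace (S (S d * M + d)) with (S M * S d)%nat by lia. unfold dvb. rewrite Nat.Div0.mod_mul.
    simpl Nat.eqb. cbn iota. rewrite Nat.mul_comm, Cpow_mult_r. ring.
  - intros i hi. unfold dvb. replace (S (S d * M + i)) with (S i + M * S d)%nat by lia.
    rewrite Nat.Div0.mod_add, Nat.mod_small by lia. reflexivity.
Qed.

Lemma geom1_CS (y : C) : (Cmod y < 1)%R -> CS (fun m => y ^ S m) (y / (1 - y)).
Proof. intros h. apply (CS_scal y (fun m => y ^ m)), geom_CS, h. Qed.

Lemma geom_deriv_CS (y : C) : (Cmod y < 1)%R -> CS (fun d => nR (S d) * y ^ S d) (y / ((1 - y) * (1 - y))).
Proof.
  intros h.
  assert (P1 : PSR (fun _ => 1) 1).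
  { split; [lra|]. exists 1%R. intros n. rewrite Cmod_1, pow1. lra. }
  assert (E := PSum_eq (fun _ => 1) y _ (CS_ext _ _ _ (fun n => eq_sym (Cmult_1_l (y ^ n))) (geom_CS y h))).
  assert (H := cauchy_product _ _ 1 y P1 P1 h). rewrite E in H.
  assert (n1 : 1 - y <> 0).
  { intros F. assert (y = 1) by (replace y with (1 - (1 - y)) by ring; rewrite F; ring).
    subst y. rewrite Cmod_1 in h. lra. }
  replace (y / ((1 - y) * (1 - y))) with (y * (/ (1 - y) * / (1 - y))) by (field; auto).
  eapply CS_ext; [|apply (CS_scal y); exact H]. intros n. simpl.
  assert (G : forall m, psum (fun _ => 1 * 1) m = nR m).
  { induction m as [|m IH]; [reflexivity|]. cbn [psum]. rewrite IH, nR_S. ring. }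
  rewrite G, nR_S. ring.
Qed.

Lemma Cmod_nR (n : nat) : Cmod (nR n) = INR n.
Proof. unfold nR. rewrite Cmod_R, Rabs_right; auto. apply Rle_ge, pos_INR. Qed.

Lemma n_geom_bound (r : R) : (0 <= r < 1)%R -> exists B, (0 <= B)%R /\
  forall n, (rsum (fun d => INR (S d) * r ^ S d) n <= B)%R.
Proof.
  intros hr.
  assert (P : PSR nR ((r + 1) / 2)).
  { split; [lra|]. exists (/ (1 - (r + 1) / 2))%R. intros n. unfold nR.
    rewrite Cmod_R, Rabs_right by (apply Rle_ge, pos_INR). apply n_pow_bound. lra. }
  destruct (PSR_rsum nR _ r P ltac:(lra)) as [B hB]. exists B.
  assert (h : forall n, (rsum (fun d => INR (S d) * r ^ S d) n <= B)%R).
  { intros n. eapply Rle_trans; [|apply (hB (S n))].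
    replace (S n) with (1 + n)%nat by lia. rewrite rsum_add.
    assert (E : rsum (fun i => Cmod (nR i) * r ^ i)%R 1 = 0%R).
    { cbn [rsum]. rewrite Cmod_nR. simpl. ring. }
    rewrite E, Rplus_0_l. apply rsum_le. intros i _. unfold nR. rewrite Cmod_R, Rabs_right; [apply Rle_refl|].
    apply Rle_ge, pos_INR. }
  split; [apply (h 0%nat)|exact h].
Qed.

Lemma Cmod_pow_lt (q : C) (n : nat) : (Cmod q < 1)%R -> (Cmod (q ^ S n) < 1)%R.
Proof.
  intros h. rewrite Cmod_pow. assert (t := Cmod_ge_0 q).
  destruct (Req_dec (Cmod q) 0) as [E|E]; [rewrite E, pow_i by lia; lra|].
  apply pow_lt_1_compat; [lra|lia].
Qed.

(** Both series rearrange $\sum_{n,d}d\,q^{nd}$ and are compared through $\sum_d d\,q^d/(1-q^d)$,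
    the sequence [mid]. Grouping by the product $nd$ gives the divisor sums; summing over $d$ for
    fixed $n$ gives the derivative of a geometric series. *)
Lemma lambert (q : C) : (Cmod q < 1)%R -> exists L,
  CS (fun n => nR (sigma1 (S n)) * q ^ S n) L /\
  CS (fun n => q ^ S n / ((1 - q ^ S n) * (1 - q ^ S n))) L.
Proof.
  intros hq. set (r := Cmod q) in *. assert (hr0 : (0 <= r)%R) by apply Cmod_ge_0.
  destruct (n_geom_bound r ltac:(lra)) as [B [hB0 hB]].
  set (mid := fun d => nR (S d) * (q ^ S d / (1 - q ^ S d))).
  assert (sp_row : forall d n, (rsum (fun k => Cmod (if dvb (S d) (S k) then q ^ (S k) else 0)) n <= r ^ S d * / (1 - r))%R).
  { intros d n. apply Rle_trans with (rsum (fun k => Cmod (if dvb (S d) (S k) then q ^ S k else 0)) (d + n)).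
    - apply rsum_incr; [intros; apply Cmod_ge_0|lia].
    - rewrite rsum_add.
      assert (E : (rsum (fun k => Cmod (if dvb (S d) (S k) then q ^ S k else 0)) d <= 0)%R).
      { apply Rle_trans with (rsum (fun _ => 0%R) d).
        - apply rsum_le. intros i hi. rewrite dvb_gt by lia. cbn beta iota. rewrite Cmod_0. lra.
        - right. clear. induction d as [|d IH]; simpl; [auto|rewrite IH; ring]. }
      apply Rle_trans with (rsum (fun i => r ^ S d * r ^ i) n)%R.
      + assert (F : (rsum (fun i => Cmod (if dvb (S d) (S (d + i)) then q ^ S (d + i) else 0)) n
                     <= rsum (fun i => r ^ S d * r ^ i) n)%R).
        { apply rsum_le. intros i _. rewrite <- pow_add. change (S d + i)%nat with (S (d + i)).
          destruct (dvb (S d) (S (d + i))); [rewrite Cmod_pow; apply Rle_refl|].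
          rewrite Cmod_0. apply pow_le. auto. }
        lra.
      + rewrite rsum_scal. apply Rmult_le_compat_l; [apply pow_le; auto|]. apply rgeom_bound. lra. }
  destruct (fubini (fun d k => if dvb (S d) (S k) then nR (S d) * q ^ (S k) else 0)
     (fun d => INR (S d) * (r ^ S d * / (1 - r)))%R (B * / (1 - r))
     mid (fun n => nR (sigma1 (S n)) * q ^ S n)) as [L [h1 h2]].
  - intros d n. eapply Rle_trans; [|apply Rmult_le_compat_l; [apply pos_INR|apply (sp_row d n)]].
    rewrite <- rsum_scal. apply rsum_le. intros k _.
    destruct (dvb (S d) (S k)); [rewrite Cmod_mult, Cmod_nR; apply Rle_refl|rewrite Cmod_0, Rmult_0_r; apply Rle_refl].
  - intros n. apply Rle_trans with (/ (1 - r) * rsum (fun d => INR (S d) * r ^ S d) n)%R.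
    + rewrite <- rsum_scal. apply rsum_le. intros; right; ring.
    + rewrite Rmult_comm. apply Rmult_le_compat_r; [left; apply Rinv_0_lt_compat; lra|apply hB].
  - intros d. unfold mid.
    apply CS_ext with (fun k => nR (S d) * (if dvb (S d) (S k) then q ^ S k else 0)).
    { intros k. destruct (dvb (S d) (S k)); ring. }
    apply CS_scal. destruct (CS_abs _ _ (sp_row d)) as [l hl].
    replace (q ^ S d / (1 - q ^ S d)) with l; [exact hl|].
    apply (CL_unique (fun M => psum (fun m => (q ^ S d) ^ S m) M)).
    + apply CL_ext with (fun M => psum (fun k => if dvb (S d) (S k) then q ^ (S k) else 0) (S d * M)).
      * intros M. apply sparse_psum.
      * apply (CL_sub (psum (fun k => if dvb (S d) (S k) then q ^ (S k) else 0)) l (fun M => (S d * M)%nat)); [intros; nia|exact hl].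
    + apply (geom1_CS (q ^ S d)). apply Cmod_pow_lt; auto.
  - intros k. rewrite sigma1_sum.
    replace (psum (fun d => if dvb (S d) (S k) then nR (S d) else 0) (S k) * q ^ S k)
      with (psum (fun d => if dvb (S d) (S k) then nR (S d) * q ^ S k else 0) (S k)).
    + apply (CS_finite (fun i => if dvb (S i) (S k) then nR (S i) * q ^ S k else 0)).
      intros i hi. rewrite dvb_gt by lia. auto.
    + rewrite (Cmult_comm _ (q ^ S k)), <- psum_scal. apply psum_ext. intros i _.
      destruct (dvb (S i) (S k)); ring.
  - exists L. split; [exact h2|].
    destruct (fubini (fun n d => nR (S d) * (q ^ S n) ^ S d) (fun n => r ^ n * B)%R (/ (1 - r) * B)
       (fun n => q ^ S n / ((1 - q ^ S n) * (1 - q ^ S n))) mid) as [L' [h3 h4]].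
    + intros n m. eapply Rle_trans; [|apply Rmult_le_compat_l; [apply pow_le; auto|apply (hB m)]].
      rewrite <- rsum_scal. apply rsum_le. intros d _. rewrite Cmod_mult, Cmod_nR, !Cmod_pow, <- pow_mult.
      fold r. replace (r ^ n * (INR (S d) * r ^ S d))%R with (INR (S d) * r ^ (n + S d))%R by (rewrite pow_add; ring).
      apply Rmult_le_compat_l; [apply pos_INR|].
      (* Dropping the factor $r^{nd}\le1$ separates the variables of the majorant. *)
      replace (S n * S d)%nat with ((n + S d) + n * d)%nat by lia. rewrite (pow_add r (n + S d)).
      rewrite <- (Rmult_1_r (r ^ (n + S d))) at 2. apply Rmult_le_compat_l; [apply pow_le; auto|].
      rewrite <- (pow1 (n * d)). apply pow_incr. lra.
    + intros n. apply Rle_trans with (B * rsum (fun i => r ^ i) n)%R.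
      * rewrite <- rsum_scal. apply rsum_le. intros; right; ring.
      * rewrite Rmult_comm. apply Rmult_le_compat_r; [auto|]. apply rgeom_bound. lra.
    + intros n. apply geom_deriv_CS, Cmod_pow_lt, hq.
    + intros d. unfold mid. apply CS_scal.
      apply CS_ext with (fun n => (q ^ S d) ^ S n).
      * intros n. rewrite <- !Cpow_mult_r. f_equal. lia.
      * apply geom1_CS, Cmod_pow_lt, hq.
    + rewrite (CS_unique _ _ _ h1 h4). exact h3.
Qed.

(** * Transformation of $E_2$ under $S$ by Eisenstein summation *)

Lemma sfun_nome (z : C) : sfun z = two_pi_i * two_pi_i * (nome z / ((1 - nome z) * (1 - nome z))).
Proof. unfold sfun, Cdiv. ring. Qed.

Lemma tpi_sq : two_pi_i * two_pi_i = - RtoC (4 * (PI * PI)).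
Proof.
  unfold two_pi_i. rewrite !RtoC_mult.
  replace (2 * RtoC PI * Ci * (2 * RtoC PI * Ci)) with (2 * 2 * (RtoC PI * RtoC PI) * (Ci * Ci)) by ring.
  rewrite Ci_sq. replace (RtoC 4) with (2 * 2) by (rewrite <- RtoC_mult; f_equal; ring). ring.
Qed.

(** The Lambert form of $E_2$ is a sum of values of $\pi^2/\sin^2$ at multiples of $\tau$; the
    constant is $(2\pi i)^2=-24\cdot\pi^2/6$. *)
Lemma E2_sfun (tau : C) : (0 < Im tau)%R ->
  CS (fun n => sfun (nR (S n) * tau)) (RtoC (PI * PI / 6) * (E2 tau - 1)).
Proof.
  intros h. destruct (lambert (nome tau) (Cmod_nome_lt tau h)) as [L [h1 h2]].
  assert (E : E2 tau = 1 - 24 * L) by (unfold E2; f_equal; f_equal; exact (Cseries_CS _ _ h1)).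
  rewrite E. replace (RtoC (PI * PI / 6) * (1 - 24 * L - 1)) with (two_pi_i * two_pi_i * L).
  - eapply CS_ext; [|apply CS_scal; exact h2]. intros n. simpl. rewrite sfun_nome, nome_nR. reflexivity.
  - rewrite tpi_sq, RtoC_div, !RtoC_mult by lra. 
    replace (RtoC 24) with (6 * 4) by (rewrite <- RtoC_mult; f_equal; ring). field.
Qed.

Lemma Im_scal (r : R) (z : C) : Im (RtoC r * z) = (r * Im z)%R.
Proof. unfold Im. destruct z; simpl. ring. Qed.

(** With $w=x\tau+y$, the imaginary parts of $w$ and of $w\bar\tau$ bound $|w|$ below by multiples
    of $|x|$ and of $|y|$; the product of the two bounds makes $|w|^{-4}$ summable over both indices
    separately. *)
Lemma lattice_lower (tau : C) : (0 < Im tau)%R -> exists kap, (0 < kap)%R /\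
  forall x y : R, (kap * (Rabs x * Rabs y) <= Cmod (RtoC x * tau + RtoC y) ^ 2)%R.
Proof.
  intros h.
  assert (ht : tau <> 0) by (intros E; rewrite E in h; unfold Im in h; simpl in h; lra).
  assert (hm := proj1 (Cmod_gt_0 tau) ht).
  exists (Im tau * (Im tau / Cmod tau))%R. split.
  { apply Rmult_lt_0_compat; [auto|apply Rdiv_lt_0_compat; auto]. }
  intros x y. set (w := RtoC x * tau + RtoC y).
  assert (h1 : (Rabs x * Im tau <= Cmod w)%R).
  { eapply Rle_trans; [|apply im_le_Cmod]. unfold w.
    replace (Im (RtoC x * tau + RtoC y)) with (x * Im tau)%R by (unfold Im; destruct tau; simpl; ring).
    rewrite Rabs_mult, (Rabs_right (Im tau)) by lra. lra. }
  assert (h2 : (Rabs y * (Im tau / Cmod tau) <= Cmod w)%R).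
  { replace (Rabs y * (Im tau / Cmod tau))%R with (Rabs y * Im tau / Cmod tau)%R by (unfold Rdiv; ring).
    apply Rle_div_l; [auto|]. rewrite <- (Cmod_conj tau), <- Cmod_mult.
    eapply Rle_trans; [|apply im_le_Cmod]. unfold w.
    replace (Im ((RtoC x * tau + RtoC y) * Cconj tau)) with (- (y * Im tau))%R
      by (unfold Im, Cconj; destruct tau; simpl; ring).
    rewrite Rabs_Ropp, Rabs_mult, (Rabs_right (Im tau)) by lra. lra. }
  replace (Im tau * (Im tau / Cmod tau) * (Rabs x * Rabs y))%R
    with ((Rabs x * Im tau) * (Rabs y * (Im tau / Cmod tau)))%R by ring.
  simpl. rewrite Rmult_1_r. apply Rmult_le_compat; auto; apply Rmult_le_pos; try apply Rabs_pos; try lra.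
  left. apply Rdiv_lt_0_compat; auto.
Qed.

(** Closed form of $\sum_{n\ge1}\big(1/(n\tau+y)-1/(n\tau-y)\big)$, read off the cotangent expansion
    at $y/\tau$. *)
Definition Gsum (tau : C) (y : R) : C := ctf (RtoC y / tau) / tau - / RtoC y.

Lemma Im_div_tau (tau : C) (y : R) : (0 < Im tau)%R -> y <> 0%R -> Im (RtoC y / tau) <> 0%R.
Proof.
  intros h hy.
  assert (ht : tau <> 0) by (intros E; rewrite E in h; unfold Im in h; simpl in h; lra).
  unfold Cdiv. rewrite Im_scal. apply Rmult_integral_contrapositive_currified; [auto|].
  destruct tau as [u v]. unfold Im, Cinv in *. simpl in *.
  unfold Rdiv. apply Rmult_integral_contrapositive_currified; [lra|].
  apply Rinv_neq_0_compat. nra.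
Qed.

Lemma Gsum_CS (tau : C) (y : R) : (0 < Im tau)%R -> y <> 0%R ->
  CS (fun n => / (nR (S n) * tau + RtoC y) - / (nR (S n) * tau - RtoC y)) (Gsum tau y).
Proof.
  intros h hy.
  assert (ht : tau <> 0) by (intros E; rewrite E in h; unfold Im in h; simpl in h; lra).
  assert (hok := ok_Im _ (Im_div_tau tau y h hy)).
  assert (H := ctf_sym _ hok). apply (CS_scal (/ tau)) in H.
  unfold Gsum. replace (ctf (RtoC y / tau) / tau - / RtoC y) with (/ tau * (ctf (RtoC y / tau) - / (RtoC y / tau))).
  2:{ field. split; auto. apply RtoC_nz; auto. }
  eapply CS_ext; [|exact H]. intros n. simpl.
  assert (n1 : nR (S n) * tau + RtoC y <> 0) by (apply autom_nz; auto).
  assert (n2 : nR (S n) * tau - RtoC y <> 0).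
  { replace (nR (S n) * tau - RtoC y) with (nR (S n) * tau + RtoC (- y)) by (rewrite RtoC_opp; ring).
    apply autom_nz; auto. right. lra. }
  assert (n3 : RtoC y + nR (S n) * tau <> 0) by (rewrite Cplus_comm; auto).
  assert (n4 : RtoC y - nR (S n) * tau <> 0).
  { intros E. apply n2. replace (nR (S n) * tau - RtoC y) with (- (RtoC y - nR (S n) * tau)) by ring. rewrite E. ring. }
  field. repeat split; auto.
Qed.

Lemma Im_S (tau : C) : (0 < Im tau)%R -> (0 < Im (- / tau))%R.
Proof.
  intros h. destruct tau as [u v]. unfold Im, Cinv, Copp in *. simpl in *.
  replace (- (- v / (u * (u * 1) + v * (v * 1))))%R with (v / (u * u + v * v))%R.
  - apply Rdiv_lt_0_compat; nra.
  - field. nra.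
Qed.

Lemma nz_H (tau : C) : (0 < Im tau)%R -> tau <> 0.
Proof. intros h E. rewrite E in h. unfold Im in h. simpl in h. lra. Qed.

(** Half-integers place the integer $m+1$ in the middle of a telescoping step:
    $1/(w-\frac12)-1/(w+\frac12)=1/(w^2-\frac14)$ differs from $1/w^2$ only to fourth order. *)
Definition mid_R (m : nat) : R := (INR m + / 2)%R.

(** As $y\to+\infty$ the imaginary part of $y/\tau$ tends to $-\infty$ and $\pi\cot(\pi y/\tau)$ to
    $\pi i$. This nonzero limit is the source of the anomaly of $E_2$. *)
Lemma Gsum_lim (tau : C) : (0 < Im tau)%R -> CL (fun m => Gsum tau (mid_R m)) (two_pi_i / 2 / tau).
Proof.
  intros h. assert (ht := nz_H tau h).
  set (q := nome (- / tau)). assert (hq : (Cmod q < 1)%R) by (apply Cmod_nome_lt, Im_S, h).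
  set (e := fun m => q ^ m * nome (- / tau * / 2)).
  assert (He : CL e 0).
  { replace (RtoC 0) with (0 * nome (- / tau * / 2)) by ring. apply CL_mult; [|apply CL_const].
    apply (CL_squeeze _ _ (fun n => (Cmod q) ^ n)%R 0).
    - intros n _. replace (q ^ n - 0) with (q ^ n) by ring. rewrite Cmod_pow. lra.
    - apply is_lim_seq_geom. rewrite Rabs_right; auto. apply Rle_ge, Cmod_ge_0. }
  assert (hm : forall m, mid_R m <> 0%R) by (intros m; unfold mid_R; assert (t := pos_INR m); lra).
  assert (E : forall m, e m = / nome (RtoC (mid_R m) / tau)).
  { intros m. rewrite <- nome_opp. unfold e, q. rewrite <- nome_nR, <- nome_plus. f_equal.
    unfold mid_R. rewrite RtoC_plus, RtoC_inv by lra. unfold nR. field. auto. }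
  replace (two_pi_i / 2 / tau) with (two_pi_i / 2 * (1 + 0) * / (1 - 0) * / tau - 0) by (field; auto).
  apply CL_ext with (fun m => two_pi_i / 2 * (1 + e m) * / (1 - e m) * / tau - / RtoC (mid_R m)).
  - intros m. unfold Gsum, ctf. rewrite E. f_equal.
    assert (n0 := nome_nz (RtoC (mid_R m) / tau)).
    assert (n1 := sub1_nz' _ (ok_Im _ (Im_div_tau tau _ h (hm m)))).
    field. repeat split; auto.
  - apply CL_minus.
    + apply CL_mult; [|apply CL_const]. apply CL_mult.
      * apply CL_scal. apply CL_plus; [apply CL_const|exact He].
      * apply CL_inv; [|apply CL_minus; [apply CL_const|exact He]].
        replace (1 - 0) with (RtoC 1) by ring. apply RtoC_nz. lra.
    + apply CL_ext with (fun m => / (/ 2 + nR m)).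
      * intros m. f_equal. unfold mid_R. rewrite RtoC_plus, RtoC_inv by lra. unfold nR. ring.
      * apply inv_add_nR_lim.
Qed.

Lemma mid_S (m : nat) : RtoC (mid_R m) = nR (S m) - / 2 /\ RtoC (mid_R (S m)) = nR (S m) + / 2.
Proof.
  unfold mid_R, nR. rewrite S_INR, !RtoC_plus, RtoC_inv by lra. split; [|reflexivity]. field.
Qed.

Lemma telescope_CS (f : nat -> C) (l : C) : CL f l -> CS (fun m => f m - f (S m)) (f 0%nat - l).
Proof.
  intros H. apply CL_ext with (fun n => f 0%nat - f n).
  - intros n. induction n as [|n IH]; simpl; [ring|]. rewrite <- IH. ring.
  - apply CL_minus; [apply CL_const|exact H].
Qed.


(* [aT] is the Eisenstein summand; [bT] telescopes in both variables and [aT - bT] is absolutely summable. *)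
Definition aT (tau : C) (n m : nat) : C :=
  / ((nR (S n) * tau + nR (S m)) * (nR (S n) * tau + nR (S m))) +
  / ((nR (S n) * tau - nR (S m)) * (nR (S n) * tau - nR (S m))).

Definition gT (tau : C) (n : nat) (y : R) : C :=
  / (nR (S n) * tau + RtoC y) - / (nR (S n) * tau - RtoC y).

Definition bT (tau : C) (n m : nat) : C := gT tau n (mid_R m) - gT tau n (mid_R (S m)).

Lemma nz_lat (tau : C) (n : nat) (y : R) : (0 < Im tau)%R -> nR (S n) * tau + RtoC y <> 0.
Proof. intros h. apply autom_nz; auto. left. apply not_0_INR. lia. Qed.

Lemma nz_lat_m (tau : C) (n : nat) (y : R) : (0 < Im tau)%R -> nR (S n) * tau - RtoC y <> 0.
Proof.
  intros h. replace (nR (S n) * tau - RtoC y) with (nR (S n) * tau + RtoC (- y)) by (rewrite RtoC_opp; ring).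
  apply nz_lat; auto.
Qed.

Lemma diff_term_bound (z : C) (k N M : R) : (0 < k)%R -> (0 < N)%R -> (0 < M)%R ->
  (k * (N * M) <= Cmod z ^ 2)%R -> (k * (N * M) / 2 <= Cmod (z + / 2) ^ 2)%R ->
  (k * (N * M) / 2 <= Cmod (z - / 2) ^ 2)%R ->
  (Cmod (/ (z * z) - / ((z + / 2) * (z - / 2))) <= / (k * k) / 2 * / (N * N) * / (M * M))%R.
Proof.
  intros hk hN hM h1 h2 h3.
  assert (hX : (0 < k * (N * M))%R) by (repeat apply Rmult_lt_0_compat; auto).
  assert (nz : forall w, (0 < Cmod w ^ 2)%R -> w <> 0 /\ (0 < Cmod w)%R).
  { intros w hw. assert (w <> 0) by (intros E; rewrite E, Cmod_0 in hw; simpl in hw; lra).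
    split; auto. apply Cmod_gt_0; auto. }
  destruct (nz z ltac:(lra)) as [z0 z1]. destruct (nz (z + / 2) ltac:(lra)) as [z2 z3].
  destruct (nz (z - / 2) ltac:(lra)) as [z4 z5].
  assert (two : RtoC 2 <> 0) by (apply RtoC_nz; lra).
  replace (/ (z * z) - / ((z + / 2) * (z - / 2))) with (- (/ 4 * / ((z * z) * ((z + / 2) * (z - / 2))))).
  2:{ assert (a1 : z * 2 + 1 <> 0).
      { intros E. apply z2. replace (z + / 2) with ((z * 2 + 1) / 2) by (field; auto). rewrite E. field. }
      assert (a2 : z * 2 - 1 <> 0).
      { intros E. apply z4. replace (z - / 2) with ((z * 2 - 1) / 2) by (field; auto). rewrite E. field. }
      field. repeat split; auto. }
  rewrite Cmod_opp, Cmod_mult, Cmod_inv by (apply RtoC_nz; lra).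
  rewrite Cmod_inv by (repeat apply Cmult_neq_0; auto).
  rewrite !Cmod_mult, Cmod_R, Rabs_right by lra.
  assert (hp : (k * (N * M) / 2 <= Cmod (z + / 2) * Cmod (z - / 2))%R).
  { apply Rsqr_incr_0_var; [|apply Rmult_le_pos; lra]. unfold Rsqr.
    replace (Cmod (z + / 2) * Cmod (z - / 2) * (Cmod (z + / 2) * Cmod (z - / 2)))%R
      with (Cmod (z + / 2) ^ 2 * Cmod (z - / 2) ^ 2)%R by ring.
    apply Rmult_le_compat; lra. }
  replace (/ (k * k) / 2 * / (N * N) * / (M * M))%R with (/ 4 * / ((k * (N * M)) * (k * (N * M) / 2)))%R by (field; lra).
  apply Rmult_le_compat_l; [lra|]. apply Rinv_le_contravar.
  - apply Rmult_lt_0_compat; lra.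
  - apply Rmult_le_compat; try lra. 
Qed.

Lemma ab_bound (tau : C) : (0 < Im tau)%R -> exists A, (0 <= A)%R /\ forall n m,
  (Cmod (aT tau n m - bT tau n m) <= A * / (INR (S n) * INR (S n)) * / (INR (S m) * INR (S m)))%R.
Proof.
  intros h. destruct (lattice_lower tau h) as [k [hk H]].
  assert (hA : (0 < / (k * k))%R) by (apply Rinv_0_lt_compat; nra).
  exists (/ (k * k))%R. split; [lra|]. intros n m.
  set (N := INR (S n)). set (M := INR (S m)).
  assert (hN : (1 <= N)%R) by (unfold N; rewrite S_INR; assert (t := pos_INR n); lra).
  assert (hM : (1 <= M)%R) by (unfold M; rewrite S_INR; assert (t := pos_INR m); lra).
  assert (two : RtoC 2 <> 0) by (apply RtoC_nz; lra).
  destruct (mid_S m) as [e1 e2].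
  set (zp := nR (S n) * tau + nR (S m)). set (zm := nR (S n) * tau - nR (S m)).
  assert (q1 := nz_lat tau n (mid_R m) h). assert (q2 := nz_lat tau n (mid_R (S m)) h).
  assert (q3 := nz_lat_m tau n (mid_R m) h). assert (q4 := nz_lat_m tau n (mid_R (S m)) h).
  rewrite e1 in q1, q3. rewrite e2 in q2, q4.
  replace (nR (S n) * tau + (nR (S m) - / 2)) with (zp - / 2) in q1 by (unfold zp; ring).
  replace (nR (S n) * tau + (nR (S m) + / 2)) with (zp + / 2) in q2 by (unfold zp; ring).
  replace (nR (S n) * tau - (nR (S m) - / 2)) with (zm + / 2) in q3 by (unfold zm; ring).
  replace (nR (S n) * tau - (nR (S m) + / 2)) with (zm - / 2) in q4 by (unfold zm; ring).
  assert (E : aT tau n m - bT tau n m = (/ (zp * zp) - / ((zp + / 2) * (zp - / 2))) +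
              (/ (zm * zm) - / ((zm + / 2) * (zm - / 2)))).
  { unfold aT, bT, gT. rewrite e1, e2. fold zp zm.
    replace (nR (S n) * tau + (nR (S m) - / 2)) with (zp - / 2) by (unfold zp; ring).
    replace (nR (S n) * tau + (nR (S m) + / 2)) with (zp + / 2) by (unfold zp; ring).
    replace (nR (S n) * tau - (nR (S m) - / 2)) with (zm + / 2) by (unfold zm; ring).
    replace (nR (S n) * tau - (nR (S m) + / 2)) with (zm - / 2) by (unfold zm; ring).
    assert (T : forall w, w + / 2 <> 0 -> w - / 2 <> 0 -> / ((w + / 2) * (w - / 2)) = / (w - / 2) - / (w + / 2)).
    { intros w w1 w2.
      transitivity (((w + / 2) - (w - / 2)) * / ((w + / 2) * (w - / 2))).
      - replace (w + / 2 - (w - / 2)) with (/ 2 + / 2) by ring. replace (/ 2 + / 2) with (RtoC 1) by (field; auto). ring.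
      - generalize dependent (w + / 2). generalize dependent (w - / 2). intros a ha b hb. field. auto. }
    rewrite !T by auto. ring. }
  rewrite E.
  assert (Habs : forall y : R, (0 <= y)%R -> (k * (N * y) <= Cmod (nR (S n) * tau + RtoC y) ^ 2)%R /\
                                             (k * (N * y) <= Cmod (nR (S n) * tau - RtoC y) ^ 2)%R).
  { intros y hy. split.
    - assert (t := H N y). rewrite !Rabs_right in t by lra. exact t.
    - assert (t := H N (- y)%R). rewrite Rabs_Ropp, !Rabs_right in t by lra.
      replace (nR (S n) * tau - RtoC y) with (RtoC N * tau + RtoC (- y)) by (rewrite RtoC_opp; unfold N, nR; ring). exact t. }
  assert (hy0 : (M / 2 <= mid_R m)%R) by (unfold mid_R, M; rewrite S_INR; unfold M in hM; rewrite S_INR in hM; lra).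
  assert (hy1 : (M / 2 <= mid_R (S m))%R) by (unfold mid_R; fold M; lra).
  assert (hkN : (0 < k * N)%R) by nra.
  assert (G : forall y, (M / 2 <= y)%R -> (k * (N * M) / 2 <= k * (N * y))%R).
  { intros y hy. replace (k * (N * M) / 2)%R with (k * N * (M / 2))%R by field.
    replace (k * (N * y))%R with (k * N * y)%R by ring. apply Rmult_le_compat_l; lra. }
  destruct (Habs M ltac:(lra)) as [A1 A2]. destruct (Habs (mid_R m) ltac:(lra)) as [A3 A4].
  destruct (Habs (mid_R (S m)) ltac:(lra)) as [A5 A6].
  assert (G0 := G _ hy0). assert (G1 := G _ hy1).
  rewrite e1 in A3, A4. rewrite e2 in A5, A6.
  replace (nR (S n) * tau + (nR (S m) - / 2)) with (zp - / 2) in A3 by (unfold zp; ring).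
  replace (nR (S n) * tau + (nR (S m) + / 2)) with (zp + / 2) in A5 by (unfold zp; ring).
  replace (nR (S n) * tau - (nR (S m) - / 2)) with (zm + / 2) in A4 by (unfold zm; ring).
  replace (nR (S n) * tau - (nR (S m) + / 2)) with (zm - / 2) in A6 by (unfold zm; ring).
  fold (nR (S m)) in A1, A2. change (RtoC M) with (nR (S m)) in A1, A2. fold zp in A1. fold zm in A2.
  eapply Rle_trans; [apply Cmod_triangle|].
  assert (B1 := diff_term_bound zp k N M hk ltac:(lra) ltac:(lra) A1 ltac:(lra) ltac:(lra)).
  assert (B2 := diff_term_bound zm k N M hk ltac:(lra) ltac:(lra) A2 ltac:(lra) ltac:(lra)).
  lra.
Qed.


Lemma nR_Im (tau : C) (n : nat) : (0 < Im tau)%R -> Im (nR (S n) * tau) <> 0%R.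
Proof.
  intros h. unfold nR. rewrite Im_scal. apply Rgt_not_eq, Rmult_lt_0_compat; [|auto].
  apply lt_0_INR. lia.
Qed.

(** Eisenstein's argument: [aT - bT] is absolutely summable, so its two iterated sums agree. For
    [aT] they give $E_2(\tau)$ and $E_2(-1/\tau)$; for the telescoping [bT] they differ by the limit
    of [Gsum], that is by $\pi i/\tau$. *)
Theorem E2_S (tau : C) : (0 < Im tau)%R ->
  E2 (- / tau) = tau * tau * E2 tau + 12 * tau / two_pi_i.
Proof.
  intros h. assert (ht := nz_H tau h). assert (h' := Im_S tau h).
  destruct (ab_bound tau h) as [A [hA0 hA]].
  set (Z := RtoC (PI * PI / 6)).
  (* Row sums, over $m\ge1$ of both signs. The term $m=0$ is missing from [aT], so it is subtracted
     here and enters the total through the Basel sum; [c] below does the same for columns. *)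
  set (r := fun n => (sfun (nR (S n) * tau) - / ((nR (S n) * tau) * (nR (S n) * tau))) - gT tau n (mid_R 0)).
  set (c := fun m => (/ (tau * tau) * sfun (nR (S m) * (- / tau)) - / (nR (S m) * nR (S m))) -
                     (Gsum tau (mid_R m) - Gsum tau (mid_R (S m)))).
  assert (hm : forall m, mid_R m <> 0%R) by (intros m; unfold mid_R; assert (t := pos_INR m); lra).
  destruct (fubini (fun n m => aT tau n m - bT tau n m)
     (fun n => (A * / (INR (S n) * INR (S n))) * 2)%R (A * 2 * 2) r c) as [t [H1 H2]].
  - intros n m. apply Rle_trans with (A * / (INR (S n) * INR (S n)) * rsum (fun j => / (INR (S j) * INR (S j))) m)%R.
    + rewrite <- rsum_scal. apply rsum_le. intros j _. apply hA.
    + apply Rmult_le_compat_l; [|apply inv_sq_sum]. apply Rmult_le_pos; [auto|]. left.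
      apply Rinv_0_lt_compat. assert (0 < INR (S n))%R by (apply lt_0_INR; lia). nra.
  - intros n. apply Rle_trans with (A * 2 * rsum (fun j => / (INR (S j) * INR (S j))) n)%R.
    + rewrite <- rsum_scal. apply rsum_le. intros; right; ring.
    + apply Rmult_le_compat_l; [lra|apply inv_sq_sum].
  - intros n. unfold r. apply CS_minus.
    + apply (sfun_sym (nR (S n) * tau)). apply ok_Im, nR_Im, h.
    + replace (gT tau n (mid_R 0)) with (gT tau n (mid_R 0) - 0) by ring.
      apply (telescope_CS (fun m => gT tau n (mid_R m))). unfold gT.
      replace (RtoC 0) with (RtoC 0 - RtoC 0) by ring. apply CL_minus.
      * apply CL_ext with (fun m => / ((nR (S n) * tau + / 2) + nR m)).
        -- intros m. f_equal. unfold mid_R. rewrite RtoC_plus, RtoC_inv by lra. unfold nR. ring.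
        -- apply inv_add_nR_lim.
      * apply CL_ext with (fun m => / ((nR (S n) * tau - / 2) - nR m)).
        -- intros m. f_equal. unfold mid_R. rewrite RtoC_plus, RtoC_inv by lra. unfold nR. ring.
        -- apply inv_sub_nR_lim.
  - intros m. unfold c. apply CS_minus.
    + assert (Hs := sfun_sym (nR (S m) * (- / tau)) (ok_Im _ (nR_Im _ m h'))).
      apply (CS_scal (/ (tau * tau))) in Hs.
      replace (/ (tau * tau) * sfun (nR (S m) * (- / tau)) - / (nR (S m) * nR (S m)))
        with (/ (tau * tau) * (sfun (nR (S m) * (- / tau)) - / (nR (S m) * - / tau * (nR (S m) * - / tau)))).
      2:{ assert (q := nR_nz m). field. auto. }
      eapply CS_ext; [|exact Hs]. intros n. simpl. unfold aT.
      assert (q1 := nz_lat tau n (INR (S m)) h). assert (q2 := nz_lat_m tau n (INR (S m)) h).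
      fold (nR (S m)) in q1, q2.
      assert (q3 : nR (S m) - nR (S n) * tau <> 0).
      { intros E. apply q2. replace (nR (S n) * tau - nR (S m)) with (- (nR (S m) - nR (S n) * tau)) by ring. rewrite E. ring. }
      replace (nR (S m) * - / tau + nR (S n)) with ((nR (S n) * tau - nR (S m)) / tau) by (field; auto).
      replace (nR (S m) * - / tau - nR (S n)) with (- ((nR (S n) * tau + nR (S m)) / tau)) by (field; auto).
      field. repeat split; auto.
    + unfold bT. apply CS_minus; apply Gsum_CS; auto.
  - assert (T1 : t = Z * (E2 tau - 1) - / (tau * tau) * Z - Gsum tau (mid_R 0)).
    { apply (CS_unique _ _ _ H1). unfold r. apply CS_minus; [|apply Gsum_CS; auto].
      apply CS_minus; [apply E2_sfun; auto|].
      apply CS_ext with (fun n => / (tau * tau) * / (nR (S n) * nR (S n))).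
      - intros n. assert (q := nR_nz n). field. auto.
      - apply CS_scal, basel. }
    assert (T2 : t = / (tau * tau) * (Z * (E2 (- / tau) - 1)) - Z - (Gsum tau (mid_R 0) - two_pi_i / 2 / tau)).
    { apply (CS_unique _ _ _ H2). unfold c. apply CS_minus.
      - apply CS_minus; [apply CS_scal, E2_sfun; auto|apply basel].
      - apply (telescope_CS (fun m => Gsum tau (mid_R m))). apply Gsum_lim; auto. }
    assert (hZ : Z <> 0).
    { apply RtoC_nz. assert (q := PI_RGT_0). apply Rgt_not_eq, Rdiv_lt_0_compat; nra. }
    assert (K : Z * (E2 tau - 1) - / (tau * tau) * Z - Gsum tau (mid_R 0) =
       / (tau * tau) * (Z * (E2 (- / tau) - 1)) - Z - (Gsum tau (mid_R 0) - two_pi_i / 2 / tau)) by congruence.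
    assert (hpi := tpi_nz).
    (* Division by $Z=\pi^2/6$ turns the discrepancy $\pi i\tau$ into the normalized term
       $12\tau/(2\pi i)$. *)
    assert (W : two_pi_i * two_pi_i = - (24 * Z)).
    { rewrite tpi_sq. unfold Z. rewrite <- RtoC_mult, <- RtoC_opp. rewrite <- RtoC_opp. f_equal. field. }
    assert (K2 : Z * E2 (- / tau) = tau * tau * (Z * E2 tau) - two_pi_i / 2 * tau).
    { transitivity (tau * tau * ((/ (tau * tau) * (Z * (E2 (- / tau) - 1)) - Z - (Gsum tau (mid_R 0) - two_pi_i / 2 / tau))
         + Z + Gsum tau (mid_R 0) - two_pi_i / 2 / tau) + Z); [field; auto|].
      rewrite <- K. field. auto. }
    assert (Zv : Z = - (two_pi_i * two_pi_i) / 24) by (rewrite W; field).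
    transitivity (/ Z * (Z * E2 (- / tau))); [field; auto|]. rewrite K2.
    transitivity (tau * tau * E2 tau - two_pi_i / 2 * tau / Z); [field; auto|].
    rewrite Zv. field. auto.
Qed.

(** * Expansion of $E_2$ in $q$, its derivative, and its behaviour at the cusp and on the imaginary
    axis *)

Definition alpha (n : nat) : C := match n with O => 1 | S _ => - (24) * nR (sigma1 n) end.

(** The derivative $q\,d/dq$ of $E_2$, given by its series so that its own differentiability and its
    limit at the cusp are immediate. *)
Definition E2p (tau : C) : C := nome tau * PSum (dps alpha) (nome tau).

Lemma PSR_alpha (r : R) : (0 < r < 1)%R -> PSR alpha r.
Proof.
  intros hr. split; [lra|].
  destruct (lambert (RtoC r)) as [L [h _]]; [rewrite Cmod_R, Rabs_right; lra|].
  destruct (CS_terms_bounded _ _ h) as [B hB]. exists (Rmax 1 (24 * B)). intros [|n].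
  - simpl. rewrite Cmod_1. eapply Rle_trans; [|apply Rmax_l]. lra.
  - eapply Rle_trans; [|apply Rmax_r]. specialize (hB n). unfold alpha.
    rewrite Cmod_mult, Cmod_pow, Cmod_R, (Rabs_right r) in hB by lra.
    rewrite Cmod_mult, Cmod_opp, Cmod_R, Rabs_right by lra. lra.
Qed.

Lemma PSR_alpha_q (q : C) : (Cmod q < 1)%R -> exists r, PSR alpha r /\ (Cmod q < r < 1)%R.
Proof.
  intros h. exists ((Cmod q + 1) / 2)%R. assert (t := Cmod_ge_0 q). split; [apply PSR_alpha|]; lra.
Qed.

Lemma E2_PSum (tau : C) : (0 < Im tau)%R -> E2 tau = PSum alpha (nome tau).
Proof.
  intros h. destruct (lambert (nome tau) (Cmod_nome_lt tau h)) as [L [h1 _]].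
  transitivity (1 - 24 * L).
  { unfold E2. f_equal. f_equal. exact (Cseries_CS _ _ h1). }
  symmetry. apply PSum_eq. apply CS_S.
  replace (1 - 24 * L - alpha 0 * nome tau ^ 0) with (- (24) * L) by (simpl; ring).
  apply CS_ext with (fun n => - (24) * (nR (sigma1 (S n)) * nome tau ^ S n)).
  - intros n. unfold alpha. ring.
  - apply CS_scal, h1.
Qed.

Lemma cder_nome (z : C) : cder nome z (two_pi_i * nome z).
Proof.
  unfold nome. rewrite Cmult_comm. apply (cder_comp Cexp); [apply cder_Cexp|].
  apply cder_eq with (two_pi_i * 1); [ring|]. apply cder_scal, cder_id.
Qed.

Lemma Im_disc (tau h : C) : (Cmod h < Im tau)%R -> (0 < Im (tau + h))%R.
Proof.
  intros hh. assert (t := im_le_Cmod h). apply Rabs_le_between in t.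
  replace (Im (tau + h)) with (Im tau + Im h)%R by (unfold Im; simpl; ring). lra.
Qed.

Lemma cder_E2 (tau : C) : (0 < Im tau)%R -> cder E2 tau (two_pi_i * E2p tau).
Proof.
  intros h. apply (cder_ext_loc (fun z => PSum alpha (nome z)) _ _ _ (Im tau) h).
  - intros u hu. symmetry. apply E2_PSum, Im_disc, hu.
  - apply cder_eq with (PSum (dps alpha) (nome tau) * (two_pi_i * nome tau)); [unfold E2p; ring|].
    destruct (PSR_alpha_q _ (Cmod_nome_lt tau h)) as [r [hr hr']].
    apply cder_comp; [apply (PSum_cder alpha r); [auto|lra]|apply cder_nome].
Qed.

Lemma cder_E2p (tau : C) : (0 < Im tau)%R -> exists l, cder E2p tau l.
Proof.
  intros h. destruct (PSR_alpha_q _ (Cmod_nome_lt tau h)) as [r [hr hr']].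
  assert (t := Cmod_ge_0 (nome tau)).
  assert (P : PSR (dps alpha) ((Cmod (nome tau) + r) / 2)) by (apply (PSR_dps alpha r); [auto|lra]).
  eexists. unfold E2p. apply cder_mult; [apply cder_nome|].
  apply (cder_comp (PSum (dps alpha)) nome); [apply (PSum_cder _ _ _ P); lra|apply cder_nome].
Qed.

Lemma Dtau_E2 (tau : C) : (0 < Im tau)%R -> Dtau E2 tau = E2p tau.
Proof.
  intros h. unfold Dtau. rewrite (cder_C_derive _ _ _ (cder_E2 tau h)). assert (q := tpi_nz). field. auto.
Qed.

Lemma E2_per (tau : C) : E2 (tau + 1) = E2 tau.
Proof. unfold E2. rewrite nome_per. auto. Qed.

Lemma E2p_per (tau : C) : E2p (tau + 1) = E2p tau.
Proof. unfold E2p. rewrite nome_per. auto. Qed.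

Lemma cder_S (tau : C) : (0 < Im tau)%R -> cder (fun x => - / x) tau (/ (tau * tau)).
Proof.
  intros h. assert (hz := nz_H tau h).
  apply (cder_ext_loc (fun x => - (1) * / x) _ _ _ 1); [lra|intros; ring|].
  apply cder_eq with (- (1) * - / (tau * tau)); [ring|]. apply cder_scal, cder_Cinv, hz.
Qed.

Lemma E2p_S (tau : C) : (0 < Im tau)%R ->
  E2p (- / tau) = tau * tau * (2 * tau * E2 tau + tau * tau * (two_pi_i * E2p tau) + 12 / two_pi_i) / two_pi_i.
Proof.
  intros h. assert (hz := nz_H tau h). assert (hp := tpi_nz).
  assert (D1 := cder_comp E2 (fun x => - / x) _ _ _ (cder_E2 _ (Im_S tau h)) (cder_S tau h)).
  assert (D2 : cder (fun x => x * x * E2 x + 12 / two_pi_i * x) tau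
     ((1 * tau + tau * 1) * E2 tau + tau * tau * (two_pi_i * E2p tau) + 12 / two_pi_i * 1)).
  { apply cder_plus; [apply (cder_mult (fun x => x * x) E2); [apply cder_mult; apply cder_id|apply cder_E2, h]|].
    apply cder_scal, cder_id. }
  assert (D3 : cder (fun x => E2 (- / x)) tau
     ((1 * tau + tau * 1) * E2 tau + tau * tau * (two_pi_i * E2p tau) + 12 / two_pi_i * 1)).
  { apply (cder_ext_loc (fun x => x * x * E2 x + 12 / two_pi_i * x) _ _ _ (Im tau) h); [|exact D2].
    intros u hu. rewrite (E2_S (tau + u) (Im_disc _ _ hu)). field. auto. }
  assert (E := cder_unique _ _ _ _ D1 D3).
  transitivity (tau * tau * (two_pi_i * E2p (- / tau) * / (tau * tau)) / two_pi_i); [field; auto|].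
  rewrite E. field. auto.
Qed.

Lemma nome_small (d : R) : (0 < d)%R -> exists A, forall tau, (A < Im tau)%R -> (Cmod (nome tau) < d)%R.
Proof.
  intros hd. exists (- ln d / (2 * PI))%R. intros tau h. rewrite Cmod_nome.
  assert (hp := PI_RGT_0). rewrite <- (exp_ln d hd) at 1. apply exp_increasing.
  apply Rlt_div_l in h; [|lra]. lra.
Qed.

Lemma E2_infty (eps : R) : (0 < eps)%R -> exists A, (0 < A)%R /\ forall tau, (A < Im tau)%R ->
  (Cmod (E2 tau - 1) < eps)%R /\ (Cmod (E2p tau) < eps)%R.
Proof.
  intros he. assert (P := PSR_alpha (/ 2) ltac:(lra)).
  assert (P' := PSR_dps alpha (/ 2) (/ 4) P ltac:(lra)).
  destruct (cder_cont _ _ _ (PSum_cder alpha (/ 2) 0 P ltac:(rewrite Cmod_0; lra)) eps he) as [d [hd H]].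
  destruct (PSum_bound _ _ (/ 8) P' ltac:(lra)) as [B hB].
  assert (hB0 : (0 <= B)%R) by (eapply Rle_trans; [apply Cmod_ge_0|apply (hB 0); rewrite Cmod_0; lra]).
  assert (he' : (0 < eps / (B + 1))%R) by (apply Rdiv_lt_0_compat; lra).
  destruct (nome_small (Rmin d (Rmin (/ 8) (eps / (B + 1))))) as [A hA]; [repeat apply Rmin_pos; lra|].
  exists (Rmax A 1). split; [eapply Rlt_le_trans; [|apply Rmax_r]; lra|].
  intros tau h. assert (a1 := Rmax_l A 1). assert (a2 := Rmax_r A 1).
  specialize (hA tau ltac:(lra)).
  assert (m1 := Rmin_l d (Rmin (/ 8) (eps / (B + 1)))). assert (m2 := Rmin_r d (Rmin (/ 8) (eps / (B + 1)))).
  assert (m3 := Rmin_l (/ 8) (eps / (B + 1))). assert (m4 := Rmin_r (/ 8) (eps / (B + 1))).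
  split.
  - rewrite E2_PSum by lra. specialize (H (nome tau) ltac:(lra)).
    rewrite PSum_0, Cplus_0_l in H. exact H.
  - unfold E2p. rewrite Cmod_mult. specialize (hB (nome tau) ltac:(lra)).
    assert (q : (Cmod (nome tau) < eps / (B + 1))%R) by lra.
    apply Rlt_div_r in q; [|lra]. assert (t := Cmod_ge_0 (nome tau)). assert (t' := Cmod_ge_0 (PSum (dps alpha) (nome tau))). nra.
Qed.

Lemma CL_Re_le (u : nat -> C) (l : C) (b : R) : (forall n, Re (u n) <= b)%R -> CL u l -> (Re l <= b)%R.
Proof.
  intros h H. apply Rnot_lt_le. intros c. destruct (H (Re l - b)%R ltac:(lra)) as [N hN].
  specialize (hN N ltac:(lia)). specialize (h N). assert (t := re_le_Cmod (u N - l)).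
  replace (Re (u N - l)) with (Re (u N) - Re l)%R in t by (unfold Re; simpl; ring).
  apply Rabs_le_between in t. lra.
Qed.

Lemma CL_Im_0 (u : nat -> C) (l : C) : (forall n, Im (u n) = 0)%R -> CL u l -> Im l = 0%R.
Proof.
  intros h H. assert (E : forall eps, (0 < eps)%R -> (Rabs (Im l) < eps)%R).
  { intros eps he. destruct (H eps he) as [N hN]. specialize (hN N ltac:(lia)).
    assert (t := im_le_Cmod (u N - l)).
    replace (Im (u N - l)) with (Im (u N) - Im l)%R in t by (unfold Im; simpl; ring).
    rewrite h, Rminus_0_l, Rabs_Ropp in t. lra. }
  destruct (Req_dec (Im l) 0) as [e|e]; auto.
  assert (p := E _ (Rabs_pos_lt _ e)). lra.
Qed.

Definition axis (t : R) : C := RtoC t * Ci.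

Lemma Im_axis (t : R) : Im (axis t) = t.
Proof. unfold axis, Im, Ci. simpl. ring. Qed.

Lemma nome_axis (t : R) : nome (axis t) = RtoC (exp (- (2 * PI * t))).
Proof.
  unfold nome, Cexp. rewrite Re_tpi, Im_tpi, Im_axis. replace (Re (axis t)) with 0%R by (unfold axis, Re, Ci; simpl; ring).
  rewrite Rmult_0_r, cos_0, sin_0. unfold Cmult, RtoC. simpl. f_equal; ring.
Qed.

Lemma real_psum (a : nat -> R) (n : nat) : psum (fun i => RtoC (a i)) n = RtoC (rsum a n).
Proof. induction n as [|n IH]; [reflexivity|]. cbn [psum rsum]. rewrite IH, RtoC_plus. auto. Qed.

(** On the axis $q$ is real in $(0,1)$, and all coefficients of $E_2$ other than the constant term
    $1$ are nonpositive. *)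
Lemma E2_axis (t : R) : (0 < t)%R -> Im (E2 (axis t)) = 0%R /\ (Re (E2 (axis t)) <= 1)%R /\
  Im (E2p (axis t)) = 0%R /\ (Re (E2p (axis t)) <= 0)%R.
Proof.
  intros ht. assert (hH : (0 < Im (axis t))%R) by (rewrite Im_axis; auto).
  rewrite (E2_PSum _ hH). unfold E2p. assert (hq := Cmod_nome_lt _ hH).
  rewrite nome_axis in *. set (q := exp (- (2 * PI * t))) in *.
  assert (hq0 : (0 < q)%R) by apply exp_pos.
  rewrite Cmod_R, Rabs_right in hq by lra.
  set (al := fun n => match n with O => 1%R | S _ => (- 24 * INR (sigma1 n))%R end).
  assert (hal : forall n, alpha n = RtoC (al n)).
  { intros [|n]; simpl; [reflexivity|]. unfold nR. rewrite RtoC_mult. f_equal. unfold Copp, RtoC. simpl. f_equal; ring. }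
  assert (hal0 : forall n, (al (S n) <= 0)%R).
  { intros n. change (al (S n)) with (- 24 * INR (sigma1 (S n)))%R. assert (p := pos_INR (sigma1 (S n))). lra. }
  assert (P := PSR_alpha ((q + 1) / 2) ltac:(lra)).
  assert (C1 := PSR_CS alpha _ (RtoC q) P ltac:(rewrite Cmod_R, Rabs_right; lra)).
  assert (C2 := PSR_CS _ _ (RtoC q) (PSR_dps alpha _ ((3 * q + 1) / 4) P ltac:(lra)) ltac:(rewrite Cmod_R, Rabs_right; lra)).
  assert (S1 : forall n, psum (fun n => alpha n * RtoC q ^ n) n = RtoC (rsum (fun n => al n * q ^ n)%R n)).
  { intros n. rewrite <- real_psum. apply psum_ext. intros i _. rewrite hal, RtoC_mult, RtoC_pow. auto. }
  assert (S2 : forall n, psum (fun n => dps alpha n * RtoC q ^ n) n = RtoC (rsum (fun n => INR (S n) * al (S n) * q ^ n)%R n)).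
  { intros n. rewrite <- real_psum. apply psum_ext. intros i _. unfold dps. rewrite hal, !RtoC_mult, RtoC_pow. auto. }
  repeat split.
  - apply (CL_Im_0 _ _ (fun n => eq_trans (f_equal Im (S1 n)) eq_refl) C1).
  - apply (fun h => CL_Re_le _ _ 1 h C1). intros n. rewrite S1. unfold Re, RtoC. simpl.
    destruct n as [|n]; [simpl; lra|]. replace (S n) with (1 + n)%nat by lia. rewrite rsum_add.
    assert (E : (rsum (fun i => al (1 + i)%nat * q ^ (1 + i))%R n <= 0)%R).
    { apply Rle_trans with (rsum (fun _ => 0%R) n).
      - apply rsum_le. intros i _. assert (p := hal0 i). assert (0 < q ^ (1 + i))%R by (apply pow_lt; auto).
        change (1 + i)%nat with (S i) in *. nra.
      - right. clear. induction n as [|n IH]; simpl; [auto|rewrite IH; ring]. }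
    assert (F : rsum (fun n => al n * q ^ n)%R 1 = 1%R) by (simpl; ring). lra.
  - assert (I := CL_Im_0 _ _ (fun n => eq_trans (f_equal Im (S2 n)) eq_refl) C2).
    rewrite Im_scal, I. ring.
  - assert (I : (Re (PSum (dps alpha) (RtoC q)) <= 0)%R).
    { apply (fun h => CL_Re_le _ _ 0 h C2). intros n. rewrite S2. change (rsum (fun n => INR (S n) * al (S n) * q ^ n)%R n <= 0)%R.
      apply Rle_trans with (rsum (fun _ => 0%R) n).
      - apply rsum_le. intros i _. assert (p := hal0 i). assert (0 < q ^ i)%R by (apply pow_lt; auto).
        assert (0 <= INR (S i))%R by apply pos_INR.
        assert (INR (S i) * al (S i) <= 0)%R by nra. cbv beta. set (X := (INR (S i) * al (S i))%R) in *. nra.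
      - right. clear. induction n as [|n IH]; simpl; [auto|rewrite IH; ring]. }
    rewrite re_scal_l. nra.
Qed.

(** * The Kaneko-Zagier equation as a first order system *)

(** This coefficient is also the second exponent of the equation at the cusp, besides $0$. *)
Definition kc (k : R) : R := ((k + 1) / 6)%R.
Definition ke (k : R) : R := (k * (k + 1) / 12)%R.

Definition Sol (k : R) (y y1 : C -> C) : Prop := forall tau, (0 < Im tau)%R ->
  cder y tau (two_pi_i * y1 tau) /\
  cder y1 tau (two_pi_i * (RtoC (kc k) * E2 tau * y1 tau - RtoC (ke k) * E2p tau * y tau)).

Lemma Sol_lin (k : R) (a b : C) (y y1 z z1 : C -> C) : Sol k y y1 -> Sol k z z1 ->
  Sol k (fun t => a * y t + b * z t) (fun t => a * y1 t + b * z1 t).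
Proof.
  intros H H' tau h. destruct (H tau h) as [h1 h2]. destruct (H' tau h) as [h3 h4]. split.
  - eapply cder_eq; [|apply cder_plus; apply cder_scal; eauto]. ring.
  - eapply cder_eq; [|apply cder_plus; apply cder_scal; eauto]. ring.
Qed.

Lemma bounded_line (f : C -> C) (z d : C) :
  (forall t, (0 <= t <= 1)%R -> exists l, cder f (z + RtoC t * d) l) ->
  exists K, (0 <= K)%R /\ forall t, (0 <= t <= 1)%R -> (Cmod (f (z + RtoC t * d)%C) <= K)%R.
Proof.
  intros H.
  assert (C : forall t, (0 <= t <= 1)%R -> continuity_pt (fun s => Re (f (z + RtoC s * d)%C) ^ 2 + Im (f (z + RtoC s * d)%C) ^ 2)%R t).
  { intros t ht. destruct (H t ht) as [l hl]. destruct (cder_Re_line f z d l t hl) as [h1 h2].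
    assert (c1 : continuity_pt (fun s => Re (f (z + RtoC s * d)%C)) t).
    { apply derivable_continuous_pt. eexists. apply is_derive_Reals. exact h1. }
    assert (c2 : continuity_pt (fun s => Im (f (z + RtoC s * d)%C)) t).
    { apply derivable_continuous_pt. eexists. apply is_derive_Reals. exact h2. }
    simpl. apply continuity_pt_plus; apply continuity_pt_mult; auto; apply continuity_pt_mult; auto;
      apply continuity_pt_const; intros ? ?; reflexivity. }
  destruct (continuity_ab_maj _ 0 1 ltac:(lra) C) as [m [hm _]].
  set (M := (Re (f (z + RtoC m * d)%C) ^ 2 + Im (f (z + RtoC m * d)%C) ^ 2)%R) in *.
  assert (hM : (0 <= M)%R) by (unfold M; nra).
  exists (M + 1)%R. split; [lra|]. intros t ht. specialize (hm t ht). simpl in hm.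
  assert (E := Cmod2_alt (f (z + RtoC t * d))). assert (p := Cmod_ge_0 (f (z + RtoC t * d))).
  simpl in E. nra.
Qed.

Lemma dot_bound (a b : C) : (Rabs (Re a * Re b + Im a * Im b) <= Cmod a * Cmod b)%R.
Proof.
  replace (Re a * Re b + Im a * Im b)%R with (Re (Cconj a * b)) by (unfold Re, Im; destruct a, b; simpl; ring).
  eapply Rle_trans; [apply re_le_Cmod|]. rewrite Cmod_mult, Cmod_conj. lra.
Qed.

Lemma is_derive_normsq (p q p' q' : R -> R) (t : R) : is_derive p t (p' t) -> is_derive q t (q' t) ->
  is_derive (fun s => p s ^ 2 + q s ^ 2)%R t (2 * (p t * p' t + q t * q' t))%R.
Proof.
  intros h1 h2. auto_derive.
  - repeat split; eexists; eauto.
  - replace (Derive (fun x => p x) t) with (p' t) by (symmetry; apply is_derive_unique; exact h1).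
    replace (Derive (fun x => q x) t) with (q' t) by (symmetry; apply is_derive_unique; exact h2). ring.
Qed.

Lemma is_derive_exp_mult (g : R -> R) (l K t : R) : is_derive g t l ->
  is_derive (fun s => g s * exp (- K * s))%R t ((l - K * g t) * exp (- K * t))%R.
Proof.
  intros D. auto_derive; [exists l; exact D|].
  replace (Derive (fun x => g x) t) with l by (symmetry; apply is_derive_unique; exact D). ring.
Qed.

(** Gronwall along the segment from [z] to [w]: with $g=|y|^2+|y_1|^2$, boundedness of $E_2$ and of
    its derivative there gives $g'\le Kg$, so $g\,e^{-Kt}$ cannot rise from zero. *)
Lemma Sol_uniq (k : R) (y y1 : C -> C) (z : C) : Sol k y y1 -> (0 < Im z)%R -> y z = 0 -> y1 z = 0 ->
  forall w, (0 < Im w)%R -> y w = 0 /\ y1 w = 0.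
Proof.
  intros H hz e0 e1 w hw. set (d := w - z).
  assert (hl : forall t, (0 <= t <= 1)%R -> (0 < Im (z + RtoC t * d))%R) by (intros; apply H_convex; auto).
  destruct (bounded_line E2 z d) as [K1 [hK1 HK1]].
  { intros t ht. eexists. apply cder_E2, hl, ht. }
  destruct (bounded_line E2p z d) as [K2 [hK2 HK2]].
  { intros t ht. apply cder_E2p, hl, ht. }
  set (Y := fun t => y (z + RtoC t * d)). set (Y1 := fun t => y1 (z + RtoC t * d)).
  set (dY := fun t => two_pi_i * Y1 t * d).
  set (dY1 := fun t => two_pi_i * (RtoC (kc k) * E2 (z + RtoC t * d) * Y1 t - RtoC (ke k) * E2p (z + RtoC t * d) * Y t) * d).
  set (g := fun t => (Re (Y t) ^ 2 + Im (Y t) ^ 2 + (Re (Y1 t) ^ 2 + Im (Y1 t) ^ 2))%R).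
  set (g' := fun t => (2 * (Re (Y t) * Re (dY t) + Im (Y t) * Im (dY t)) + 2 * (Re (Y1 t) * Re (dY1 t) + Im (Y1 t) * Im (dY1 t)))%R).
  set (c1 := (2 * PI * Cmod d)%R). set (c2 := (Rabs (kc k) * K1)%R). set (c3 := (Rabs (ke k) * K2)%R).
  assert (hp := PI_RGT_0). assert (hd := Cmod_ge_0 d).
  assert (p2 : (0 <= c2)%R) by (apply Rmult_le_pos; [apply Rabs_pos|auto]).
  assert (p3 : (0 <= c3)%R) by (apply Rmult_le_pos; [apply Rabs_pos|auto]).
  assert (p1 : (0 <= c1)%R) by (unfold c1; nra).
  (* The mixed terms $2|y||y_1|$ occur with factor $1+c_3$ and are bounded by $|y|^2+|y_1|^2$; the
     term $2c_2|y_1|^2$ comes from the coefficient of $y_1$. *)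
  set (K := (c1 * (1 + 2 * c2 + c3))%R).
  assert (Dg : forall t, (0 <= t <= 1)%R -> is_derive g t (g' t)).
  { intros t ht. destruct (H _ (hl t ht)) as [h1 h2].
    destruct (cder_Re_line _ _ _ _ _ h1) as [q1 q2]. destruct (cder_Re_line _ _ _ _ _ h2) as [q3 q4].
    apply (is_derive_plus (K := R_AbsRing) (V := R_NormedModule)).
    - apply (is_derive_normsq (fun s => Re (Y s)) (fun s => Im (Y s)) (fun s => Re (dY s)) (fun s => Im (dY s))); auto.
    - apply (is_derive_normsq (fun s => Re (Y1 s)) (fun s => Im (Y1 s)) (fun s => Re (dY1 s)) (fun s => Im (dY1 s))); auto. }
  assert (gE : forall t, g t = (Cmod (Y t) ^ 2 + Cmod (Y1 t) ^ 2)%R) by (intros t; unfold g; rewrite !Cmod2_alt; auto).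
  assert (Bg : forall t, (0 <= t <= 1)%R -> (g' t <= K * g t)%R).
  { intros t ht. rewrite gE. unfold g'.
    assert (b1 := dot_bound (Y t) (dY t)). assert (b2 := dot_bound (Y1 t) (dY1 t)).
    apply Rabs_le_between in b1, b2.
    assert (a0 := Cmod_ge_0 (Y t)). assert (a1 := Cmod_ge_0 (Y1 t)).
    assert (b3 : Cmod (dY t) = (c1 * Cmod (Y1 t))%R).
    { unfold dY. rewrite !Cmod_mult, Cmod_tpi. unfold c1. ring. }
    assert (b4 : (Cmod (dY1 t) <= c1 * (c2 * Cmod (Y1 t) + c3 * Cmod (Y t)))%R).
    { unfold dY1. rewrite !Cmod_mult, Cmod_tpi. unfold c1.
      replace (2 * PI * Cmod d * (c2 * Cmod (Y1 t) + c3 * Cmod (Y t)))%R with (2 * PI * (c2 * Cmod (Y1 t) + c3 * Cmod (Y t)) * Cmod d)%R by ring.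
      apply Rmult_le_compat_r; [auto|]. apply Rmult_le_compat_l; [lra|].
      eapply Rle_trans; [apply Cmod_sub_le|]. rewrite !Cmod_mult, !Cmod_R.
      specialize (HK1 t ht). specialize (HK2 t ht).
      apply Rplus_le_compat; apply Rmult_le_compat_r; auto; apply Rmult_le_compat_l; auto; apply Rabs_pos. }
    rewrite b3 in b1. set (u := Cmod (Y t)) in *. set (v := Cmod (Y1 t)) in *.
    assert (b5 : (v * Cmod (dY1 t) <= v * (c1 * (c2 * v + c3 * u)))%R) by (apply Rmult_le_compat_l; auto).
    apply Rle_trans with (2 * (u * (c1 * v)) + 2 * (v * (c1 * (c2 * v + c3 * u))))%R; [lra|].
    unfold K.
    assert (uv : (2 * (u * v) <= u ^ 2 + v ^ 2)%R).
    { assert (sq : (0 <= (u - v) ^ 2)%R) by apply pow2_ge_0.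
      replace ((u - v) ^ 2)%R with (u ^ 2 + v ^ 2 - 2 * (u * v))%R in sq by ring. lra. }
    replace (2 * (u * (c1 * v)) + 2 * (v * (c1 * (c2 * v + c3 * u))))%R
      with (c1 * ((1 + c3) * (2 * (u * v)) + 2 * c2 * v ^ 2))%R by ring.
    replace (c1 * (1 + 2 * c2 + c3) * (u ^ 2 + v ^ 2))%R
      with (c1 * ((1 + c3) * (u ^ 2 + v ^ 2) + 2 * c2 * (u ^ 2 + v ^ 2)))%R by ring.
    apply Rmult_le_compat_l; [auto|].
    assert (w1 : ((1 + c3) * (2 * (u * v)) <= (1 + c3) * (u ^ 2 + v ^ 2))%R) by (apply Rmult_le_compat_l; [lra|exact uv]).
    assert (w2 : (2 * c2 * v ^ 2 <= 2 * c2 * (u ^ 2 + v ^ 2))%R).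
    { apply Rmult_le_compat_l; [lra|]. assert (0 <= u ^ 2)%R by apply pow2_ge_0. lra. }
    lra. }
  assert (Dh : forall t, (0 <= t <= 1)%R -> is_derive (fun s => g s * exp (- K * s))%R t ((g' t - K * g t) * exp (- K * t))%R).
  { intros t ht. apply is_derive_exp_mult, Dg, ht. }
  destruct (MVT_gen (fun s => g s * exp (- K * s))%R 0 1 (fun t => (g' t - K * g t) * exp (- K * t))%R) as [c [hc E]].
  - intros x hx. rewrite Rmin_left, Rmax_right in hx by lra. apply Dh. lra.
  - intros x hx. rewrite Rmin_left, Rmax_right in hx by lra.
    apply derivable_continuous_pt. exists ((g' x - K * g x) * exp (- K * x))%R. apply (proj1 (is_derive_Reals (fun s => g s * exp (- K * s))%R x _)). apply Dh. lra.
  - rewrite Rmin_left, Rmax_right in hc by lra.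
    assert (g0 : g 0%R = 0%R).
    { rewrite gE. unfold Y, Y1. replace (z + RtoC 0 * d) with z by ring. rewrite e0, e1, Cmod_0. ring. }
    rewrite g0 in E. assert (b := Bg c hc). assert (ex := exp_pos (- K * c)). assert (ex1 := exp_pos (- K * 1)).
    assert (g1 : (g 1%R <= 0)%R) by nra. rewrite gE in g1.
    assert (n0 := Cmod_ge_0 (Y 1%R)). assert (n1 := Cmod_ge_0 (Y1 1%R)).
    assert (z0 : Cmod (Y 1%R) = 0%R) by nra. assert (z1 : Cmod (Y1 1%R) = 0%R) by nra.
    apply Cmod_eq_0 in z0, z1. unfold Y, Y1 in z0, z1.
    replace (z + RtoC 1 * d) with w in z0, z1 by (unfold d; ring). auto.
Qed.

(** * Solutions have no poles in the upper half-plane *)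

Lemma Q2R_kc (k : Q) : Q2R ((k + 1) / 6) = kc (Q2R k).
Proof.
  unfold kc. rewrite Q2R_div, Q2R_plus by discriminate.
  replace (Q2R 1) with 1%R by (unfold Q2R; simpl; field). replace (Q2R 6) with 6%R by (unfold Q2R; simpl; field). auto.
Qed.

Lemma Q2R_ke (k : Q) : Q2R (k * (k + 1) / 12) = ke (Q2R k).
Proof.
  unfold ke. rewrite Q2R_div, Q2R_mult, Q2R_plus by discriminate.
  replace (Q2R 1) with 1%R by (unfold Q2R; simpl; field). replace (Q2R 12) with 12%R by (unfold Q2R; simpl; field). auto.
Qed.

(** Rewrites the equation in terms of explicit derivatives. The first one is needed on a whole disc
    because [Dtau] is applied twice. *)
Lemma KZ_at (k : Q) (f f1 : C -> C) (z f2 : C) (r : R) : KZ_solution k f -> (0 < Im z)%R -> HA f z ->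
  (0 < r)%R -> (forall h, (Cmod h < r)%R -> cder f (z + h) (f1 (z + h))) -> cder f1 z f2 ->
  f2 / (two_pi_i * two_pi_i) - RtoC (kc (Q2R k)) * E2 z * (f1 z / two_pi_i)
   + RtoC (ke (Q2R k)) * E2p z * f z = 0.
Proof.
  intros H hz ha hr h1 h2. assert (ht := tpi_nz).
  specialize (H z hz (proj2 (holomorphic_HA f z) ha)). rewrite Q2R_kc, Q2R_ke, Dtau_E2 in H by auto.
  assert (e1 : forall h, (Cmod h < r)%R -> Dtau f (z + h) = / two_pi_i * f1 (z + h)).
  { intros h hh. unfold Dtau. rewrite (cder_C_derive _ _ _ (h1 h hh)). unfold Cdiv. ring. }
  assert (e2 : cder (Dtau f) z (/ two_pi_i * f2)).
  { apply (cder_ext_loc (fun x => / two_pi_i * f1 x) _ _ _ r hr).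
    - intros h hh. symmetry. apply e1. auto.
    - apply cder_scal. auto. }
  unfold Dtau at 1 in H. rewrite (cder_C_derive _ _ _ e2) in H.
  assert (e0 := e1 0 ltac:(rewrite Cmod_0; auto)). rewrite Cplus_0_r in e0. rewrite e0 in H.
  rewrite <- H. field. auto.
Qed.

Lemma PSum_HA (a : nat -> C) (R : R) (w : C) : PSR a R -> (Cmod w < R)%R -> HA (PSum a) w.
Proof.
  intros H hw.
  assert (P : HA (PSum a) 0).
  { exists a, R. split; auto. intros h _. rewrite Cplus_0_l. auto. }
  destruct (recenter a R ((R - Cmod w) / 2) w H ltac:(lra) ltac:(lra)) as [b [h1 [h2 _]]].
  exists b, ((R - Cmod w) / 2)%R. split; [exact h1|]. intros h hh. symmetry. apply PSum_eq, h2. lra.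
Qed.

Lemma HA_shift (f : C -> C) (z0 w : C) : HA f w -> HA (fun z => f (z - z0)) (z0 + w).
Proof.
  intros [b [r [H h]]]. exists b, r. split; auto. intros u hu.
  replace (z0 + w + u - z0) with (w + u) by ring. apply h; auto.
Qed.

Lemma HA_pow (f : C -> C) (z : C) (m : nat) : HA f z -> HA (fun x => f x ^ m) z.
Proof.
  intros H. induction m as [|m IH]; simpl.
  - exists (fun n => match n with O => 1 | S _ => 0 end), 1%R. split.
    + split; [lra|]. exists 1%R. intros [|n]; simpl; [rewrite Cmod_1; lra|rewrite Cmod_0; lra].
    + intros h _. symmetry. apply PSum_eq.
      match goal with |- CS ?a _ => replace (RtoC 1) with (psum a 1) by (simpl; ring) end.
      apply CS_finite. intros [|i] hi; [lia|ring].
  - apply HA_mult; auto.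
Qed.

Lemma cder_pow (f : C -> C) (z l : C) (m : nat) : cder f z l ->
  cder (fun x => f x ^ S m) z (nR (S m) * f z ^ m * l).
Proof.
  intros H. induction m as [|m IH].
  - apply (cder_ext_loc f _ _ _ 1); [lra|intros; simpl; ring|]. apply cder_eq with l; [unfold nR; simpl; ring|auto].
  - change (fun x => f x ^ S (S m)) with (fun x => f x * f x ^ S m).
    eapply cder_eq; [|apply cder_mult; [exact H|exact IH]]. rewrite (nR_S (S m)). simpl. ring.
Qed.

Lemma cder_shift (f : C -> C) (z0 h l : C) : cder f h l -> cder (fun z => f (z - z0)) (z0 + h) l.
Proof.
  intros H eps he. destruct (H eps he) as [d [hd Hd]]. exists d. split; auto. intros u hu.
  replace (z0 + h + u - z0) with (h + u) by ring. replace (z0 + h - z0) with h by ring. apply Hd; auto.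
Qed.

(** Nonzero points tending to $0$ inside the disc of radius [r], used to pass from punctured discs
    to their centre. They are real, so adding them does not change the height of a point. *)
Definition small_seq (r : R) (n : nat) : C := RtoC (r / 2) * / nR (S n).

Lemma small_seq_spec (r : R) : (0 < r)%R -> CL (small_seq r) 0 /\
  forall n, (0 < Cmod (small_seq r n) < r)%R.
Proof.
  intros hr. split.
  - replace (RtoC 0) with (RtoC (r / 2) * 0) by ring. apply CL_scal.
    apply CL_ext with (fun n => / (1 + nR n)); [intros n; f_equal; rewrite nR_S; ring|]. apply inv_add_nR_lim.
  - intros n. unfold small_seq. rewrite Cmod_mult, Cmod_inv, Cmod_nR, Cmod_R, Rabs_right by (try apply nR_nz; lra).
    assert (h : (1 <= INR (S n))%R) by (rewrite S_INR; assert (t := pos_INR n); lra).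
    assert (i1 : (0 < / INR (S n))%R) by (apply Rinv_0_lt_compat; lra).
    assert (i2 : (/ INR (S n) <= 1)%R) by (rewrite <- Rinv_1; apply Rinv_le_contravar; lra).
    split; nra.
Qed.

Lemma CL_PSum_small (a : nat -> C) (R r : R) : PSR a R -> (0 < r)%R ->
  CL (fun n => PSum a (small_seq r n)) (a 0%nat).
Proof.
  intros H hr. rewrite <- PSum_0. eapply cder_CL; [apply (PSum_cder a R); [auto|rewrite Cmod_0; apply H]|].
  apply small_seq_spec; auto.
Qed.

Lemma CL_shift_small (f : C -> C) (z l : C) (r : R) : cder f z l -> (0 < r)%R ->
  CL (fun n => f (z + small_seq r n)) (f z).
Proof.
  intros H hr. apply (cder_CL f z l (fun n => z + small_seq r n)); auto.
  assert (h := proj1 (small_seq_spec r hr)). replace z with (z + 0) at 1 by ring. apply CL_plus; [apply CL_const|auto].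
Qed.

(* If [f] had a pole of order [m + 1], the leading term [(m+1)(m+2) a_0] of [f''] could not cancel. *)
Lemma KZ_no_pole (k : Q) (f : C -> C) (z0 : C) (m : nat) (a : nat -> C) (R : R) :
  KZ_solution k f -> (0 < Im z0)%R -> PSR a R ->
  (forall h, (0 < Cmod h < R)%R -> h ^ S m * f (z0 + h) = PSum a h) -> a 0%nat = 0.
Proof.
  intros H hz HP hf. assert (ht := tpi_nz). assert (hR := proj1 HP).
  set (r := Rmin (R / 4) (Im z0)).
  assert (r1 : (r <= R / 4)%R) by apply Rmin_l. assert (r2 : (r <= Im z0)%R) by apply Rmin_r.
  assert (hr : (0 < r)%R) by (apply Rmin_pos; lra).
  assert (P1 : PSR (dps a) (R / 2)) by (apply (PSR_dps a R); [auto|lra]).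
  assert (P2 : PSR (dps (dps a)) (R / 4)) by (apply (PSR_dps _ (R / 2)); [auto|lra]).
  set (u := fun z => / (z - z0)).
  set (A := fun z => PSum a (z - z0)). set (A1 := fun z => PSum (dps a) (z - z0)). set (A2 := fun z => PSum (dps (dps a)) (z - z0)).
  assert (fE : forall h, (0 < Cmod h < R)%R -> f (z0 + h) = A (z0 + h) * u (z0 + h) ^ S m).
  { intros h hh. unfold A, u. replace (z0 + h - z0) with h by ring. rewrite <- hf by auto.
    assert (h0 : h <> 0) by (apply Cmod_gt_0; lra). rewrite Cpow_inv by auto. field. apply Cpow_nz; auto. }
  assert (du : forall h : C, h <> 0 -> cder u (z0 + h) (- (u (z0 + h) * u (z0 + h)))).
  { intros h h0. assert (E : z0 + h - z0 = h) by ring. unfold u. rewrite E.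
    apply (cder_shift (fun z : C => / z)).
    apply cder_eq with (- / (h * h)); [field; auto|apply cder_Cinv; auto]. }
  set (f1 := fun z => A1 z * u z ^ S m + A z * (nR (S m) * u z ^ m * - (u z * u z))).
  assert (Df : forall h, (0 < Cmod h < R)%R -> cder f (z0 + h) (f1 (z0 + h))).
  { intros h hh. assert (h0 : h <> 0) by (apply Cmod_gt_0; lra).
    apply (cder_ext_loc (fun z => A z * u z ^ S m) _ _ _ (Rmin (Cmod h) (R - Cmod h))).
    - apply Rmin_pos; lra.
    - intros v hv. assert (m1 := Rmin_l (Cmod h) (R - Cmod h)). assert (m2 := Rmin_r (Cmod h) (R - Cmod h)).
      replace (z0 + h + v) with (z0 + (h + v)) by ring. symmetry. apply fE.
      assert (t1 := Cmod_rev_tri_plus h v). assert (t2 := Cmod_triangle h v). lra.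
    - unfold f1. apply cder_mult.
      + unfold A1. replace (z0 + h - z0) with h by ring. apply cder_shift, (PSum_cder a R); [auto|lra].
      + apply cder_pow, du, h0. }
  assert (Df1 : forall h, (0 < Cmod h < r)%R -> cder f1 (z0 + h)
     (A2 (z0 + h) * u (z0 + h) ^ S m - 2 * nR (S m) * A1 (z0 + h) * u (z0 + h) ^ S (S m)
       + nR (S m) * nR (S (S m)) * A (z0 + h) * u (z0 + h) ^ S (S (S m)))).
  { intros h hh. assert (h0 : h <> 0) by (apply Cmod_gt_0; lra).
    assert (dA : cder A (z0 + h) (A1 (z0 + h))).
    { unfold A1. replace (z0 + h - z0) with h by ring. apply cder_shift, (PSum_cder a R); [auto|lra]. }
    assert (dA1 : cder A1 (z0 + h) (A2 (z0 + h))).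
    { unfold A2. replace (z0 + h - z0) with h by ring. apply cder_shift, (PSum_cder _ (R / 2)); [auto|lra]. }
    apply (cder_ext_loc (fun z => A1 z * u z ^ S m + - nR (S m) * (A z * u z ^ S (S m))) _ _ _ 1); [lra| |].
    { intros v _. unfold f1. simpl. ring. }
    eapply cder_eq; [|apply cder_plus; [apply cder_mult; [exact dA1|apply cder_pow, du, h0]|
      apply cder_scal, cder_mult; [exact dA|apply cder_pow, du, h0]]].
    rewrite (nR_S (S m)). simpl. ring. }
  assert (HAf : forall h, (0 < Cmod h < r)%R -> HA f (z0 + h)).
  { intros h hh. assert (h0 : h <> 0) by (apply Cmod_gt_0; lra).
    apply (HA_ext (fun z => A z * u z ^ S m) _ _ (Rmin (Cmod h) (R - Cmod h))).
    - apply Rmin_pos; lra.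
    - intros v hv. assert (m1 := Rmin_l (Cmod h) (R - Cmod h)). assert (m2 := Rmin_r (Cmod h) (R - Cmod h)).
      replace (z0 + h + v) with (z0 + (h + v)) by ring. symmetry. apply fE.
      assert (t1 := Cmod_rev_tri_plus h v). assert (t2 := Cmod_triangle h v). lra.
    - apply HA_mult; [apply HA_shift, (PSum_HA a R); [auto|lra]|]. apply HA_pow, HA_inv.
      intros E. apply h0. replace h with (z0 + h - z0) by ring. rewrite E. ring. }
  set (K := kc (Q2R k)). set (L := ke (Q2R k)).
  (* The equation at $z_0+h$ multiplied by $h^{m+3}$; this expression stays continuous at $h=0$,
     where only the leading term survives. *)
  set (X := fun h : C => (PSum (dps (dps a)) h * h * h - 2 * nR (S m) * PSum (dps a) h * h + nR (S m) * nR (S (S m)) * PSum a h) / (two_pi_i * two_pi_i)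
      - RtoC K * E2 (z0 + h) * ((PSum (dps a) h * h * h - nR (S m) * PSum a h * h) / two_pi_i)
      + RtoC L * E2p (z0 + h) * (PSum a h * h * h)).
  assert (X0 : forall h, (0 < Cmod h < r)%R -> X h = 0).
  { intros h hh. assert (h0 : h <> 0) by (apply Cmod_gt_0; lra).
    assert (G2 : forall v, (Cmod v < Rmin (Cmod h) (R - Cmod h))%R -> cder f (z0 + h + v) (f1 (z0 + h + v))).
    { intros v hv. assert (m1 := Rmin_l (Cmod h) (R - Cmod h)). assert (m2 := Rmin_r (Cmod h) (R - Cmod h)).
      replace (z0 + h + v) with (z0 + (h + v)) by ring. apply Df.
      assert (t1 := Cmod_rev_tri_plus h v). assert (t2 := Cmod_triangle h v). lra. }
    assert (G0 : (0 < Rmin (Cmod h) (R - Cmod h))%R) by (apply Rmin_pos; lra).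
    assert (G := KZ_at k f f1 (z0 + h) _ _ H (Im_disc z0 h ltac:(lra)) (HAf h hh) G0 G2 (Df1 h hh)). rewrite fE in G by lra. fold K L in G.
    unfold f1, A, A1, A2, u in G. replace (z0 + h - z0) with h in G by ring.
    transitivity (h ^ S (S (S m)) * 0); [rewrite <- G|ring].
    unfold X. assert (hn : h ^ m <> 0) by (apply Cpow_nz; auto). simpl Cpow.
    rewrite Cpow_inv by auto. field. repeat split; auto. }
  assert (LX : CL (fun n => X (small_seq r n)) (nR (S m) * nR (S (S m)) * a 0%nat / (two_pi_i * two_pi_i))).
  { assert (s0 := proj1 (small_seq_spec r hr)).
    assert (c0 := CL_PSum_small a R r HP hr). assert (c1 := CL_PSum_small _ _ r P1 hr). assert (c2 := CL_PSum_small _ _ r P2 hr).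
    assert (e2 := CL_shift_small E2 z0 _ r (cder_E2 z0 hz) hr).
    destruct (cder_E2p z0 hz) as [l hl]. assert (e3 := CL_shift_small E2p z0 _ r hl hr).
    replace (nR (S m) * nR (S (S m)) * a 0%nat / (two_pi_i * two_pi_i)) with
     ((dps (dps a) 0%nat * 0 * 0 - 2 * nR (S m) * dps a 0%nat * 0 + nR (S m) * nR (S (S m)) * a 0%nat) * / (two_pi_i * two_pi_i)
      - RtoC K * E2 z0 * ((dps a 0%nat * 0 * 0 - nR (S m) * a 0%nat * 0) * / two_pi_i)
      + RtoC L * E2p z0 * (a 0%nat * 0 * 0)) by (field; auto).
    unfold X, Cdiv.
    apply CL_plus; [apply CL_minus|].
    - apply CL_mult; [|apply CL_const]. apply CL_plus; [apply CL_minus|].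
      + apply CL_mult; [apply CL_mult|]; auto.
      + apply CL_mult; [|auto]. apply CL_scal; auto.
      + apply CL_scal; auto.
    - apply CL_mult; [apply CL_scal; auto|]. apply CL_mult; [|apply CL_const]. apply CL_minus.
      + apply CL_mult; [apply CL_mult|]; auto.
      + apply CL_mult; [|auto]. apply CL_scal; auto.
    - apply CL_mult; [apply CL_scal; auto|]. apply CL_mult; [apply CL_mult|]; auto. }
  assert (E : nR (S m) * nR (S (S m)) * a 0%nat / (two_pi_i * two_pi_i) = 0).
  { apply (CL_unique _ _ _ LX). apply CL_ext with (fun _ => 0); [|apply CL_const].
    intros n. symmetry. apply X0. apply small_seq_spec; auto. }
  assert (n1 := nR_nz m). assert (n2 := nR_nz (S m)).
  transitivity (nR (S m) * nR (S (S m)) * a 0%nat / (two_pi_i * two_pi_i) * (two_pi_i * two_pi_i) / (nR (S m) * nR (S (S m)))).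
  - field. auto.
  - rewrite E. field. auto.
Qed.

(** * Holomorphic extension across the excluded points *)

Definition pexp (f : C -> C) (z0 : C) (a : nat -> C) (R : R) : Prop :=
  PSR a R /\ forall h, (0 < Cmod h < R)%R -> f (z0 + h) = PSum a h.

(** Induction on the claimed pole order: by [KZ_no_pole] the leading coefficient vanishes, so the
    series may be divided by [h]. *)
Lemma KZ_pexp (k : Q) (f : C -> C) (z0 : C) : KZ_solution k f -> meromorphic_on_H f -> (0 < Im z0)%R ->
  exists a R, pexp f z0 a R.
Proof.
  intros H Hm hz. destruct (Hm z0 hz) as [m [a Ha]].
  unfold locally', within in Ha. apply locally_C_disc in Ha. destruct Ha as [d [hd Ha]].
  assert (G : exists R, PSR a R /\ forall h, (0 < Cmod h < R)%R -> h ^ m * f (z0 + h) = PSum a h).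
  { assert (Q : forall h, (0 < Cmod h < d)%R -> CS (fun n => a n * h ^ n) (h ^ m * f (z0 + h))).
    { intros h hh. assert (h0 : h <> 0) by (apply Cmod_gt_0; lra).
      assert (hne : z0 + h <> z0).
      { intros E. apply h0. replace h with (z0 + h - z0) by ring. rewrite E. ring. }
      specialize (Ha h ltac:(lra) hne). apply is_pseries_CS in Ha.
      replace (z0 + h - z0) with h in Ha by ring. exact Ha. }
    exists (d / 2)%R. split.
    - eapply CS_PSR; [lra|]. apply Q. rewrite Cmod_R, Rabs_right; lra.
    - intros h hh. symmetry. apply PSum_eq, Q. lra. }
  clear Ha hd d. destruct G as [R [HP hf]].
  revert a HP hf. induction m as [|m IH]; intros a HP hf.
  - exists a, R. split; auto. intros h hh. rewrite <- hf by auto. simpl. ring.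
  - assert (a0 := KZ_no_pole k f z0 m a R H hz HP hf).
    apply (IH (fun n => a (S n))); [apply PSR_shift; auto|]. intros h hh.
    assert (h0 : h <> 0) by (apply Cmod_gt_0; lra).
    specialize (hf h hh). rewrite (PSum_shift a R) in hf by (auto; lra). rewrite a0, Cplus_0_l in hf.
    transitivity (h ^ S m * f (z0 + h) / h); [simpl; field; auto|]. rewrite hf. field. auto.
Qed.

Lemma pexp_unique (f : C -> C) (z0 : C) (a b : nat -> C) (R R' : R) :
  pexp f z0 a R -> pexp f z0 b R' -> a 0%nat = b 0%nat.
Proof.
  intros [Ha ha] [Hb hb]. assert (p1 := proj1 Ha). assert (p2 := proj1 Hb).
  assert (hr : (0 < Rmin R R')%R) by (apply Rmin_pos; auto).
  assert (m1 := Rmin_l R R'). assert (m2 := Rmin_r R R').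
  apply (CL_unique (fun n => f (z0 + small_seq (Rmin R R') n))).
  - apply CL_ext with (fun n => PSum a (small_seq (Rmin R R') n)); [|apply (CL_PSum_small a R); auto].
    intros n. symmetry. apply ha. assert (t := proj2 (small_seq_spec _ hr) n). lra.
  - apply CL_ext with (fun n => PSum b (small_seq (Rmin R R') n)); [|apply (CL_PSum_small b R'); auto].
    intros n. symmetry. apply hb. assert (t := proj2 (small_seq_spec _ hr) n). lra.
Qed.

(** The extension takes at [z] the constant coefficient of an expansion on a punctured disc;
    [pexp_unique] makes the choice irrelevant. *)
Definition fill (f : C -> C) (z : C) : C :=
  epsilon (inhabits (RtoC 0)) (fun v => exists a R, pexp f z a R /\ v = a 0%nat).

Lemma fill_eq (f : C -> C) (z : C) (a : nat -> C) (R : R) : pexp f z a R -> fill f z = a 0%nat.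
Proof.
  intros H. unfold fill.
  assert (S := epsilon_spec (inhabits (RtoC 0)) (fun v => exists a R, pexp f z a R /\ v = a 0%nat)
     (ex_intro _ (a 0%nat) (ex_intro _ a (ex_intro _ R (conj H eq_refl))))).
  destruct S as [b [R' [H' E]]]. rewrite E. apply (pexp_unique f z b a R' R); auto.
Qed.

Lemma pexp_nearby (f : C -> C) (z0 : C) (a : nat -> C) (R : R) (w : C) : pexp f z0 a R ->
  (0 < Cmod w < R)%R -> HA f (z0 + w) /\ fill f (z0 + w) = PSum a w.
Proof.
  intros [HP hf] hw.
  set (r := Rmin (Cmod w) ((R - Cmod w) / 2)).
  assert (r1 : (r <= Cmod w)%R) by apply Rmin_l. assert (r2 : (r <= (R - Cmod w) / 2)%R) by apply Rmin_r.
  assert (hr : (0 < r)%R) by (apply Rmin_pos; lra).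
  destruct (recenter a R r w HP hr ltac:(lra)) as [b [h1 [h2 [h3 _]]]].
  assert (E : forall h, (Cmod h < r)%R -> f (z0 + w + h) = PSum b h).
  { intros h hh. replace (z0 + w + h) with (z0 + (w + h)) by ring. rewrite hf.
    - symmetry. apply PSum_eq, h2. lra.
    - assert (t1 := Cmod_rev_tri_plus w h). assert (t2 := Cmod_triangle w h). lra. }
  split.
  - exists b, r. split; auto.
  - rewrite <- h3. apply (fill_eq f (z0 + w) b r). split; auto. intros h hh. apply E. lra.
Qed.

Lemma fill_expansion (f : C -> C) (z0 : C) (a : nat -> C) (R : R) : pexp f z0 a R ->
  forall h, (Cmod h < R)%R -> fill f (z0 + h) = PSum a h.
Proof.
  intros H h hh. destruct (Req_dec (Cmod h) 0) as [E|E].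
  - apply Cmod_eq_0 in E. subst h. rewrite PSum_0, Cplus_0_r. apply (fill_eq f z0 a R H).
  - apply (pexp_nearby f z0 a R); auto. assert (t := Cmod_ge_0 h). lra.
Qed.

Lemma fill_HA (f : C -> C) (z : C) : HA f z -> f z = fill f z.
Proof.
  intros [a [R [H hf]]]. rewrite (fill_eq f z a R).
  - rewrite <- (PSum_0 a), <- hf by (rewrite Cmod_0; apply H). f_equal. ring.
  - split; auto. intros h hh. apply hf. lra.
Qed.

(** The system then holds at every point of the half-plane, although [KZ_solution] says nothing
    where [f] itself is not holomorphic. The last clause lets other identities for [f] be
    transferred to the extension. *)
Lemma KZ_ext (k : Q) (f : C -> C) : KZ_solution k f -> meromorphic_on_H f -> exists y1,
  Sol (Q2R k) (fill f) y1 /\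
  (forall z, (0 < Im z)%R -> exists r, (0 < r)%R /\ forall h, (0 < Cmod h < r)%R ->
     holomorphic_at f (z + h) /\ f (z + h) = fill f (z + h)).
Proof.
  intros H Hm. assert (ht := tpi_nz). exists (Dtau (fill f)).
  assert (HX := fun z hz => KZ_pexp k f z H Hm hz). split.
  - intros z hz. destruct (HX z hz) as [a [R hp]]. assert (hp' := hp). destruct hp' as [HP hf].
    assert (hR := proj1 HP).
    assert (FE := fill_expansion f z a R hp).
    assert (P1 : PSR (dps a) (R / 2)) by (apply (PSR_dps a R); [auto|lra]).
    assert (P2 : PSR (dps (dps a)) (R / 4)) by (apply (PSR_dps _ (R / 2)); [auto|lra]).
    assert (D1 : forall h, (Cmod h < R)%R -> cder (fill f) (z + h) (PSum (dps a) h)).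
    { intros h hh. apply (cder_ext_loc (fun x => PSum a (x - z)) _ _ _ (R - Cmod h)); [lra| |].
      - intros v hv. replace (z + h + v) with (z + (h + v)) by ring. rewrite FE.
        + f_equal. ring.
        + assert (t := Cmod_triangle h v). lra.
      - apply cder_shift, (PSum_cder a R); auto. }
    assert (E1 : forall h, (Cmod h < R)%R -> Dtau (fill f) (z + h) = / two_pi_i * PSum (dps a) h).
    { intros h hh. unfold Dtau. rewrite (cder_C_derive _ _ _ (D1 h hh)). unfold Cdiv. ring. }
    assert (z0 : z + 0 = z) by ring.
    assert (E10 := E1 0 ltac:(rewrite Cmod_0; auto)). rewrite z0, PSum_0 in E10.
    assert (D2 : cder (Dtau (fill f)) z (/ two_pi_i * dps (dps a) 0%nat)).
    { apply (cder_ext_loc (fun x => / two_pi_i * PSum (dps a) (x - z)) _ _ _ R hR).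
      - intros h hh. rewrite E1 by auto. do 2 f_equal. ring.
      - apply cder_scal. assert (q := PSum_cder (dps a) (R / 2) 0 P1 ltac:(rewrite Cmod_0; lra)).
        rewrite PSum_0 in q. apply (cder_shift _ z) in q. rewrite z0 in q. exact q. }
    split.
    + rewrite E10. eapply cder_eq; [|rewrite <- z0; apply D1; rewrite Cmod_0; auto]. rewrite PSum_0. field. auto.
    + eapply cder_eq; [|exact D2]. rewrite E10.
      replace (fill f z) with (a 0%nat) by (symmetry; apply (fill_eq f z a R hp)).
      set (K := kc (Q2R k)). set (L := ke (Q2R k)).
      set (r := Rmin (R / 4) (Im z)).
      assert (r1 : (r <= R / 4)%R) by apply Rmin_l. assert (r2 : (r <= Im z)%R) by apply Rmin_r.
      assert (hr : (0 < r)%R) by (apply Rmin_pos; lra).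
      (* The equation is known only for $h\ne0$; continuity of this expression gives it at the
         centre. *)
      set (X := fun h => PSum (dps (dps a)) h * / (two_pi_i * two_pi_i) - RtoC K * E2 (z + h) * (PSum (dps a) h * / two_pi_i)
          + RtoC L * E2p (z + h) * PSum a h).
      assert (X0 : forall h, (0 < Cmod h < r)%R -> X h = 0).
      { intros h hh. destruct (pexp_nearby f z a R h hp ltac:(lra)) as [hh1 _].
        assert (G := KZ_at k f (fun x => PSum (dps a) (x - z)) (z + h) (PSum (dps (dps a)) h) (Rmin (Cmod h) (R - Cmod h))
           H (Im_disc z h ltac:(lra)) hh1 ltac:(apply Rmin_pos; lra)).
        assert (G2 : forall v, (Cmod v < Rmin (Cmod h) (R - Cmod h))%R -> cder f (z + h + v) (PSum (dps a) (z + h + v - z))).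
        { intros v hv. assert (m1 := Rmin_l (Cmod h) (R - Cmod h)). assert (m2 := Rmin_r (Cmod h) (R - Cmod h)).
          assert (t1 := Cmod_rev_tri_plus h v). assert (t2 := Cmod_triangle h v).
          replace (z + h + v - z) with (h + v) by ring. replace (z + h + v) with (z + (h + v)) by ring.
          set (w := h + v) in *. assert (hw : (0 < Cmod w < R)%R) by lra.
          apply (cder_ext_loc (fill f) _ _ _ (Rmin (Cmod w) (R - Cmod w))); [apply Rmin_pos; lra| |apply D1; lra].
          intros e he. assert (n1 := Rmin_l (Cmod w) (R - Cmod w)). assert (n2 := Rmin_r (Cmod w) (R - Cmod w)).
          assert (s1 := Cmod_rev_tri_plus w e). assert (s2 := Cmod_triangle w e).
          replace (z + w + e) with (z + (w + e)) by ring. rewrite FE, hf by lra. auto. }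
        specialize (G G2). specialize (G (cder_shift _ _ _ _ (PSum_cder _ (R / 2) h P1 ltac:(lra)))).
        rewrite hf in G by lra. replace (z + h - z) with h in G by ring. exact G. }
      assert (LX : CL (fun n => X (small_seq r n)) (dps (dps a) 0%nat * / (two_pi_i * two_pi_i) - RtoC K * E2 z * (dps a 0%nat * / two_pi_i)
          + RtoC L * E2p z * a 0%nat)).
      { assert (e2 := CL_shift_small E2 z _ r (cder_E2 z hz) hr).
        destruct (cder_E2p z hz) as [l hl]. assert (e3 := CL_shift_small E2p z _ r hl hr).
        unfold X. apply CL_plus; [apply CL_minus|].
        - apply CL_mult; [apply (CL_PSum_small _ (R / 4)); auto|apply CL_const].
        - apply CL_mult; [apply CL_scal; auto|]. apply CL_mult; [apply (CL_PSum_small _ (R / 2)); auto|apply CL_const].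
        - apply CL_mult; [apply CL_scal; auto|apply (CL_PSum_small _ R); auto]. }
      assert (E : dps (dps a) 0%nat * / (two_pi_i * two_pi_i) - RtoC K * E2 z * (dps a 0%nat * / two_pi_i)
          + RtoC L * E2p z * a 0%nat = 0).
      { apply (CL_unique _ _ _ LX). apply CL_ext with (fun _ => 0); [|apply CL_const].
        intros n. symmetry. apply X0. apply small_seq_spec; auto. }
      transitivity (two_pi_i * (dps (dps a) 0%nat * / (two_pi_i * two_pi_i))); [field; auto|].
      replace (dps (dps a) 0%nat * / (two_pi_i * two_pi_i)) with
        ((dps (dps a) 0%nat * / (two_pi_i * two_pi_i) - RtoC K * E2 z * (dps a 0%nat * / two_pi_i)
          + RtoC L * E2p z * a 0%nat) + RtoC K * E2 z * (dps a 0%nat * / two_pi_i)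
          - RtoC L * E2p z * a 0%nat) by ring.
      rewrite E. ring.
  - intros z hz. destruct (HX z hz) as [a [R hp]]. exists R. split; [apply hp|]. intros h hh.
    destruct (pexp_nearby f z a R h hp hh) as [h1 h2]. split; [apply holomorphic_HA; auto|].
    apply fill_HA; auto.
Qed.

(** * Bases of solutions *)

(** Independence is expressed by a Wronskian without zeros, which gives Cramer's rule at any chosen
    point. *)
Definition IsBasis (k : R) (u v : C -> C) : Prop := exists u1 v1, Sol k u u1 /\ Sol k v v1 /\
  forall tau, (0 < Im tau)%R -> u tau * v1 tau - u1 tau * v tau <> 0.

Lemma Im_Ci : (0 < Im Ci)%R.
Proof. unfold Im, Ci. simpl. lra. Qed.

Lemma C10 : RtoC 1 <> 0.
Proof. apply RtoC_nz. lra. Qed.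

Lemma Cmult_integral (a b : C) : a * b = 0 -> a = 0 \/ b = 0.
Proof.
  intros E. destruct (classic (a = 0)) as [h|h]; [auto|]. right.
  replace b with (/ a * (a * b)) by (field; auto). rewrite E. ring.
Qed.

Lemma Sol_zero (k : R) (y y1 : C -> C) : Sol k y y1 -> (forall t, (0 < Im t)%R -> y t = 0) ->
  forall t, (0 < Im t)%R -> y1 t = 0.
Proof.
  intros H E t ht. destruct (H t ht) as [h1 _].
  assert (h2 : cder y t 0).
  { apply (cder_ext_loc (fun _ => 0) _ _ _ (Im t) ht); [|apply cder_const].
    intros h hh. symmetry. apply E, Im_disc, hh. }
  assert (q := cder_unique _ _ _ _ h1 h2). apply Cmult_integral in q. destruct q as [q|q]; [|auto].
  exfalso. exact (tpi_nz q).
Qed.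

Lemma indep_basis (k : R) (u u1 v v1 : C -> C) : Sol k u u1 -> Sol k v v1 ->
  (forall a b : C, (forall t, (0 < Im t)%R -> a * u t + b * v t = 0) -> a = 0 /\ b = 0) -> IsBasis k u v.
Proof.
  intros Hu Hv H. exists u1, v1. repeat split; try apply Hu; try apply Hv; auto.
  intros t ht E.
  assert (G : forall a b : C, a * u t + b * v t = 0 -> a * u1 t + b * v1 t = 0 -> a = 0 /\ b = 0).
  { intros a b e1 e2. apply H. intros w hw.
    apply (Sol_uniq k (fun x => a * u x + b * v x) (fun x => a * u1 x + b * v1 x) t); auto.
    apply Sol_lin; auto. }
  assert (n1 := C10).
  (* At a zero of the Wronskian the pairs $(v,-u)$ and $(v_1,-u_1)$ give combinations with zero
     initial data. So all four values vanish, and then the pair $(1,0)$ qualifies as well. *)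
  destruct (G (v t) (- u t)) as [z1 z2]; [ring| |].
  { replace (v t * u1 t + - u t * v1 t) with (- (u t * v1 t - u1 t * v t)) by ring. rewrite E. ring. }
  assert (z3 : u t = 0) by (replace (u t) with (- - u t) by ring; rewrite z2; ring).
  destruct (G (v1 t) (- u1 t)) as [z4 z5]; [rewrite z1, z3; ring|ring|].
  assert (z6 : u1 t = 0) by (replace (u1 t) with (- - u1 t) by ring; rewrite z5; ring).
  destruct (G 1 0) as [z7 _]; [rewrite z3; ring|rewrite z6; ring|]. exact (n1 z7).
Qed.

(** The coefficients are found by Cramer's rule from the initial data at $i$; uniqueness then
    propagates the identity. *)
Lemma basis_span (k : R) (u v y y1 : C -> C) : IsBasis k u v -> Sol k y y1 ->
  exists a b : C, forall t, (0 < Im t)%R -> y t = a * u t + b * v t.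
Proof.
  intros [u1 [v1 [Hu [Hv HW]]]] Hy. assert (hi := Im_Ci). specialize (HW Ci hi).
  set (W := u Ci * v1 Ci - u1 Ci * v Ci) in *.
  exists ((y Ci * v1 Ci - y1 Ci * v Ci) / W), ((u Ci * y1 Ci - u1 Ci * y Ci) / W).
  set (a := (y Ci * v1 Ci - y1 Ci * v Ci) / W). set (b := (u Ci * y1 Ci - u1 Ci * y Ci) / W).
  assert (S := Sol_lin k 1 (-(1)) _ _ _ _ Hy (Sol_lin k a b _ _ _ _ Hu Hv)).
  intros t ht. destruct (Sol_uniq k _ _ Ci S hi) with (w := t) as [E _]; auto.
  - simpl. unfold a, b. unfold W in *. field. auto.
  - simpl. unfold a, b. unfold W in *. field. auto.
  - simpl in E. replace (y t) with ((1 * y t + - (1) * (a * u t + b * v t)) + (a * u t + b * v t)) by ring.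
    rewrite E. ring.
Qed.

Lemma basis_indep (k : R) (u v : C -> C) (a b : C) : IsBasis k u v ->
  (forall t, (0 < Im t)%R -> a * u t + b * v t = 0) -> a = 0 /\ b = 0.
Proof.
  intros [u1 [v1 [Hu [Hv HW]]]] E. assert (hi := Im_Ci). specialize (HW Ci hi).
  assert (E1 := Sol_zero k _ _ (Sol_lin k a b _ _ _ _ Hu Hv) E Ci hi). simpl in E1.
  specialize (E Ci hi).
  set (W := u Ci * v1 Ci - u1 Ci * v Ci) in *. split.
  - transitivity ((v1 Ci * (a * u Ci + b * v Ci) - v Ci * (a * u1 Ci + b * v1 Ci)) / W).
    + unfold W in *. field. auto.
    + rewrite E, E1. field. auto.
  - transitivity ((u Ci * (a * u1 Ci + b * v1 Ci) - u1 Ci * (a * u Ci + b * v Ci)) / W).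
    + unfold W in *. field. auto.
    + rewrite E, E1. field. auto.
Qed.

Lemma basis_eq (k : R) (u v : C -> C) (a b a' b' : C) : IsBasis k u v ->
  (forall t, (0 < Im t)%R -> a * u t + b * v t = a' * u t + b' * v t) -> a = a' /\ b = b'.
Proof.
  intros H E. destruct (basis_indep k u v (a - a') (b - b') H) as [e1 e2].
  - intros t ht. replace ((a - a') * u t + (b - b') * v t) with ((a * u t + b * v t) - (a' * u t + b' * v t)) by ring.
    rewrite E by auto. ring.
  - split; [replace a with (a - a' + a') by ring; rewrite e1|replace b with (b - b' + b') by ring; rewrite e2]; ring.
Qed.

Lemma basis_change (k : R) (u v : C -> C) (a b c d : C) : IsBasis k u v -> a * d - b * c <> 0 ->
  IsBasis k (fun t => a * u t + b * v t) (fun t => c * u t + d * v t).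
Proof.
  intros [u1 [v1 [Hu [Hv HW]]]] hd.
  exists (fun t => a * u1 t + b * v1 t), (fun t => c * u1 t + d * v1 t).
  split; [apply Sol_lin; auto|split; [apply Sol_lin; auto|]].
  intros t ht E. specialize (HW t ht).
  replace ((a * u t + b * v t) * (c * u1 t + d * v1 t) - (a * u1 t + b * v1 t) * (c * u t + d * v t))
    with ((a * d - b * c) * (u t * v1 t - u1 t * v t)) in E by ring.
  apply Cmult_integral in E. tauto.
Qed.

Lemma basis_swap (k : R) (u v : C -> C) : IsBasis k u v -> IsBasis k v u.
Proof.
  intros [u1 [v1 [Hu [Hv HW]]]]. exists v1, u1. split; auto. split; auto. intros t ht E. apply (HW t ht).
  replace (u t * v1 t - u1 t * v t) with (- (v t * u1 t - v1 t * u t)) by ring. rewrite E. ring.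
Qed.

(** * Action of SL_2(Z) on solutions *)

Record M2 := mk2 { m11 : C; m12 : C; m21 : C; m22 : C }.

Definition mmul (A B : M2) : M2 :=
  mk2 (m11 A * m11 B + m12 A * m21 B) (m11 A * m12 B + m12 A * m22 B)
      (m21 A * m11 B + m22 A * m21 B) (m21 A * m12 B + m22 A * m22 B).
Definition mdet (A : M2) : C := m11 A * m22 A - m12 A * m21 A.
Definition madj (A : M2) : M2 := mk2 (m22 A) (- m12 A) (- m21 A) (m11 A).

Lemma mdet_mul (A B : M2) : mdet (mmul A B) = mdet A * mdet B.
Proof. unfold mdet, mmul. simpl. ring. Qed.

Lemma mdet_adj (A : M2) : mdet (madj A) = mdet A.
Proof. unfold mdet, madj. simpl. ring. Qed.

Definition ZC (z : Z) : C := RtoC (IZR z).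
Definition mob (a b c d : Z) (tau : C) : C := (ZC a * tau + ZC b) / (ZC c * tau + ZC d).

Lemma ZC_plus (a b : Z) : ZC (a + b) = ZC a + ZC b.
Proof. unfold ZC. rewrite plus_IZR, RtoC_plus. auto. Qed.
Lemma ZC_mult (a b : Z) : ZC (a * b) = ZC a * ZC b.
Proof. unfold ZC. rewrite mult_IZR, RtoC_mult. auto. Qed.
Lemma ZC_opp (a : Z) : ZC (- a) = - ZC a.
Proof. unfold ZC. rewrite opp_IZR, RtoC_opp. auto. Qed.
Lemma ZC_sub (a b : Z) : ZC (a - b) = ZC a - ZC b.
Proof. unfold ZC. rewrite minus_IZR, RtoC_minus. auto. Qed.

Lemma den_nz (a b c d : Z) (tau : C) : (a * d - b * c = 1)%Z -> (0 < Im tau)%R -> ZC c * tau + ZC d <> 0.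
Proof.
  intros hd h. apply autom_nz; auto.
  destruct (Z.eq_dec c 0) as [->|hc]; [right|left; apply not_0_IZR; auto].
  apply not_0_IZR. intros E. subst d. lia.
Qed.

Lemma Im_mob (a b c d : Z) (tau : C) : (a * d - b * c = 1)%Z -> (0 < Im tau)%R -> (0 < Im (mob a b c d tau))%R.
Proof.
  intros hd h. assert (n := den_nz a b c d tau hd h).
  set (D := ZC c * tau + ZC d) in *. assert (n' := proj1 (Cmod_gt_0 D) n).
  assert (E : mob a b c d tau = RtoC (/ (Cmod D ^ 2)) * ((ZC a * tau + ZC b) * Cconj D)).
  { unfold mob. fold D. rewrite RtoC_inv by (apply Rgt_not_eq, pow_lt; auto). rewrite Cmod2_conj.
    assert (Cconj D <> 0). { intros F. apply n. rewrite <- (Cconj_conj D), F. unfold Cconj, RtoC. simpl. f_equal; ring. }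
    field. auto. }
  rewrite E, Im_scal. apply Rmult_lt_0_compat; [apply Rinv_0_lt_compat, pow_lt; auto|].
  replace (Im ((ZC a * tau + ZC b) * Cconj D)) with (IZR (a * d - b * c) * Im tau)%R.
  - rewrite hd. lra.
  - rewrite minus_IZR, !mult_IZR. unfold D, ZC, Im, Cconj. destruct tau as [x y]. simpl. ring.
Qed.

Lemma cder_mob (a b c d : Z) (tau : C) : (a * d - b * c = 1)%Z -> (0 < Im tau)%R ->
  cder (mob a b c d) tau (/ ((ZC c * tau + ZC d) * (ZC c * tau + ZC d))).
Proof.
  intros hd h. assert (n := den_nz a b c d tau hd h).
  unfold mob. eapply cder_eq; [|apply cder_div; [auto|apply cder_affine|apply cder_affine]]. cbv beta.
  replace (ZC a * (ZC c * tau + ZC d) - (ZC a * tau + ZC b) * ZC c) with (ZC (a * d - b * c)).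
  - rewrite hd. unfold ZC. field. auto.
  - rewrite ZC_sub, !ZC_mult. ring.
Qed.

(** A nowhere zero multiple of $(c\tau+d)^k$, characterized by its logarithmic derivative so that no
    branch need be fixed and products and inverses of such factors are again of this kind. *)
Definition jfac (k : R) (c d : Z) (j : C -> C) : Prop := forall tau, (0 < Im tau)%R ->
  j tau <> 0 /\ cder j tau (RtoC k * ZC c / (ZC c * tau + ZC d) * j tau).

(** As [jfac] leaves a constant free, [M] is meaningful only up to a nonzero scalar: a projective
    representation. *)
Definition acts (k : R) (u v : C -> C) (a b c d : Z) (M : M2) : Prop :=
  (a * d - b * c = 1)%Z /\ mdet M <> 0 /\ exists j, jfac k c d j /\
  forall tau, (0 < Im tau)%R ->
    u (mob a b c d tau) = j tau * (m11 M * u tau + m12 M * v tau) /\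
    v (mob a b c d tau) = j tau * (m21 M * u tau + m22 M * v tau).

Lemma mob_mul (a b c d a' b' c' d' : Z) (tau : C) : (a * d - b * c = 1)%Z -> (a' * d' - b' * c' = 1)%Z ->
  (0 < Im tau)%R ->
  mob (a * a' + b * c') (a * b' + b * d') (c * a' + d * c') (c * b' + d * d') tau = mob a b c d (mob a' b' c' d' tau)
  /\ ZC (c * a' + d * c') * tau + ZC (c * b' + d * d') = (ZC c * mob a' b' c' d' tau + ZC d) * (ZC c' * tau + ZC d').
Proof.
  intros h h' ht. assert (n' := den_nz a' b' c' d' tau h' ht).
  assert (n := den_nz a b c d _ h (Im_mob a' b' c' d' tau h' ht)).
  assert (E : ZC (c * a' + d * c') * tau + ZC (c * b' + d * d') = (ZC c * mob a' b' c' d' tau + ZC d) * (ZC c' * tau + ZC d')).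
  { unfold mob. rewrite !ZC_plus, !ZC_mult. field. auto. }
  split; [|exact E].
  assert (F : ZC (a * a' + b * c') * tau + ZC (a * b' + b * d') = (ZC a * mob a' b' c' d' tau + ZC b) * (ZC c' * tau + ZC d')).
  { unfold mob. rewrite !ZC_plus, !ZC_mult. field. auto. }
  set (w := mob a' b' c' d' tau) in *. unfold mob. rewrite E, F. field. auto.
Qed.

Lemma acts_mul (k : R) (u v : C -> C) (a b c d a' b' c' d' : Z) (M M' : M2) :
  acts k u v a b c d M -> acts k u v a' b' c' d' M' ->
  acts k u v (a * a' + b * c') (a * b' + b * d') (c * a' + d * c') (c * b' + d * d') (mmul M M').
Proof.
  intros [h [hM [j [Hj H]]]] [h' [hM' [j' [Hj' H']]]]. split; [|split].
  - transitivity ((a * d - b * c) * (a' * d' - b' * c'))%Z; [ring|rewrite h, h'; ring].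
  - rewrite mdet_mul. apply Cmult_neq_0; auto.
  - exists (fun t => j (mob a' b' c' d' t) * j' t). split.
    + intros t ht. assert (ht' := Im_mob _ _ _ _ _ h' ht).
      destruct (Hj _ ht') as [n1 d1]. destruct (Hj' _ ht) as [n2 d2]. split; [apply Cmult_neq_0; auto|].
      destruct (mob_mul _ _ _ _ _ _ _ _ t h h' ht) as [_ E].
      eapply cder_eq; [|apply cder_mult; [apply (cder_comp j); [exact d1|apply cder_mob; auto]|exact d2]].
      rewrite E. assert (n3 := den_nz _ _ _ _ _ h ht'). assert (n4 := den_nz _ _ _ _ _ h' ht).
      set (D := ZC c * mob a' b' c' d' t + ZC d) in *.
      (* The derivative of $(c\,\gamma'\tau+d)(c'\tau+d')$, split according to the product rule; it
         uses that $\gamma'$ has determinant 1. *)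
      assert (E2 : ZC (c * a' + d * c') = ZC c * / (ZC c' * t + ZC d') + ZC c' * D).
      { unfold D, mob. rewrite !ZC_plus, !ZC_mult.
        assert (E3 : ZC a' * ZC d' - ZC b' * ZC c' = 1) by (rewrite <- !ZC_mult, <- ZC_sub, h'; reflexivity).
        replace (/ (ZC c' * t + ZC d')) with ((ZC a' * ZC d' - ZC b' * ZC c') / (ZC c' * t + ZC d')) by (rewrite E3; field; auto).
        field. auto. }
      rewrite E2. field. auto.
    + intros t ht. assert (ht' := Im_mob _ _ _ _ _ h' ht).
      destruct (mob_mul _ _ _ _ _ _ _ _ t h h' ht) as [E _]. rewrite E.
      destruct (H _ ht') as [e1 e2]. destruct (H' _ ht) as [e3 e4]. rewrite e1, e2, e3, e4.
      unfold mmul. simpl. split; ring.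
Qed.

(** The adjugate replaces the inverse; the determinant goes into the automorphy factor. *)
Lemma acts_inv (k : R) (u v : C -> C) (a b c d : Z) (M : M2) :
  acts k u v a b c d M -> acts k u v d (- b) (- c) a (madj M).
Proof.
  intros [h [hM [j [Hj H]]]].
  assert (h' : (d * a - - b * - c = 1)%Z) by lia.
  assert (I : forall t, (0 < Im t)%R -> mob a b c d (mob d (- b) (- c) a t) = t /\
     (ZC c * mob d (- b) (- c) a t + ZC d) * (ZC (- c) * t + ZC a) = 1).
  { intros t ht. destruct (mob_mul a b c d d (- b) (- c) a t h h' ht) as [E1 E2].
    rewrite <- E1, <- E2. replace (a * d + b * - c)%Z with 1%Z by lia. replace (a * - b + b * a)%Z with 0%Z by lia.
    replace (c * d + d * - c)%Z with 0%Z by lia. replace (c * - b + d * a)%Z with 1%Z by lia.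
    unfold mob, ZC. split; [field|ring]. }
  split; [exact h'|split; [rewrite mdet_adj; auto|]].
  exists (fun t => / (j (mob d (- b) (- c) a t) * mdet M)). split.
  - intros t ht. assert (ht' := Im_mob _ _ _ _ _ h' ht). destruct (Hj _ ht') as [n1 d1].
    assert (n2 : j (mob d (- b) (- c) a t) * mdet M <> 0) by (apply Cmult_neq_0; auto).
    split.
    + intros E. apply C10. rewrite <- (Cinv_r _ n2), E. ring.
    + assert (D0 := cder_comp j (mob d (- b) (- c) a) _ _ _ d1 (cder_mob _ _ _ _ _ h' ht)).
      assert (D := cder_inv (fun x => j (mob d (- b) (- c) a x) * mdet M) t _ n2 (cder_mult (fun x => j (mob d (- b) (- c) a x)) (fun _ => mdet M) _ _ _ D0 (cder_const (mdet M) t))).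
      eapply cder_eq; [|exact D].
      destruct (I t ht) as [_ E]. assert (n3 := den_nz _ _ _ _ _ h ht'). assert (n4 := den_nz _ _ _ _ _ h' ht).
      set (A := ZC c * mob d (- b) (- c) a t + ZC d) in *. set (B := ZC (- c) * t + ZC a) in *.
      set (J := j (mob d (- b) (- c) a t)) in *. rewrite ZC_opp.
      assert (EB : B = / A) by (transitivity (A * B / A); [field; auto|rewrite E; field; auto]).
      rewrite EB. field. repeat split; auto.
  - intros t ht. assert (ht' := Im_mob _ _ _ _ _ h' ht). destruct (H _ ht') as [e1 e2].
    destruct (I t ht) as [E _]. rewrite E in e1, e2. destruct (Hj _ ht') as [n1 _].
    rewrite e1, e2. unfold madj. simpl. unfold mdet in *. split; field; auto.
Qed.

(** Here $a=\pm1$: the Moebius action is trivial and the factor constant, so independence of the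
    basis makes [M] scalar. *)
Lemma acts_pm1 (k : R) (u v : C -> C) (a : Z) (M : M2) : IsBasis k u v -> acts k u v a 0 0 a M ->
  m12 M = 0 /\ m21 M = 0 /\ m11 M = m22 M.
Proof.
  intros HB [h [hM [j [Hj H]]]].
  assert (hj : forall t, (0 < Im t)%R -> j t = j Ci).
  { intros t ht. apply cder0_const; auto using Im_Ci. intros x hx. destruct (Hj x hx) as [_ d].
    eapply cder_eq; [|exact d]. unfold ZC, Cdiv. ring. }
  assert (ha : ZC a <> 0) by (apply RtoC_nz, not_0_IZR; intros E; subst a; lia).
  assert (hm : forall t, mob a 0 0 a t = t).
  { intros t. unfold mob. change (ZC 0) with (RtoC 0). field. replace (0 * t + ZC a) with (ZC a) by ring; auto. }
  destruct (Hj Ci Im_Ci) as [n _]. set (J := j Ci) in *.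
  destruct (basis_eq k u v (J * m11 M) (J * m12 M) 1 0 HB) as [e1 e2].
  { intros t ht. destruct (H t ht) as [q _]. rewrite hm, hj in q by auto.
    transitivity (J * (m11 M * u t + m12 M * v t)); [ring|]. rewrite <- q. ring. }
  destruct (basis_eq k u v (J * m21 M) (J * m22 M) 0 1 HB) as [e3 e4].
  { intros t ht. destruct (H t ht) as [_ q]. rewrite hm, hj in q by auto.
    transitivity (J * (m21 M * u t + m22 M * v t)); [ring|]. rewrite <- q. ring. }
  apply Cmult_integral in e2, e3. split; [tauto|]. split; [tauto|].
  transitivity (/ J * (J * m11 M)); [field; auto|]. rewrite e1, <- e4. field. auto.
Qed.

Lemma acts_change (k : R) (u v : C -> C) (p q r s : C) (a b c d : Z) (M : M2) :
  p * s - q * r <> 0 -> acts k u v a b c d M ->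
  acts k (fun t => p * u t + q * v t) (fun t => r * u t + s * v t) a b c d
    (mmul (mk2 p q r s) (mmul M (madj (mk2 p q r s)))).
Proof.
  intros hd [h [hM [j [Hj H]]]]. split; [auto|split].
  - rewrite !mdet_mul, mdet_adj. unfold mdet at 1 3. simpl. repeat apply Cmult_neq_0; auto.
  - exists (fun t => / (p * s - q * r) * j t). split.
    + intros t ht. destruct (Hj t ht) as [n1 d1]. split.
      * apply Cmult_neq_0; auto. intros E. apply C10. rewrite <- (Cinv_r _ hd), E. ring.
      * eapply cder_eq; [|apply cder_scal; exact d1]. ring.
    + intros t ht. destruct (H t ht) as [e1 e2]. rewrite e1, e2. unfold mmul, madj. simpl. split; field; auto.
Qed.

(** * Diagonality on Gamma(N) *)

(** [transforms_under_Gamma] for functions without singularities, in terms of integer entries. *)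
Definition gm (N : nat) (w : R) (f : C -> C) : Prop := forall a b c d : Z, (a * d - b * c = 1)%Z ->
  (Z.of_nat N | a - 1)%Z -> (Z.of_nat N | b)%Z -> (Z.of_nat N | c)%Z -> (Z.of_nat N | d - 1)%Z ->
  exists v : C, v <> 0 /\ forall tau, (0 < Im tau)%R ->
    f (mob a b c d tau) = v * Crpower (ZC c * tau + ZC d) w * f tau.

Lemma Crpower_1 (w : R) : Crpower 1 w = 1.
Proof.
  unfold Crpower, Clog, Carg. rewrite Cmod_1, ln_1. simpl.
  destruct (Rle_dec 0 0) as [_|h]; [|exfalso; lra].
  replace (1 / 1)%R with 1%R by field. rewrite acos_1.
  replace (RtoC w * (0%R, 0%R)) with (RtoC 0).
  - apply Cexp_0.
  - unfold Cmult, RtoC. simpl. f_equal; ring.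
Qed.

Lemma gm_T (N : nat) (w : R) (f : C -> C) : gm N w f -> exists p : C, p <> 0 /\
  forall tau, (0 < Im tau)%R -> f (tau + nR N) = p * f tau.
Proof.
  intros H. destruct (H 1%Z (Z.of_nat N) 0%Z 1%Z) as [p [hp E]]; try lia; try (exists 0%Z; lia); try (exists 1%Z; lia).
  exists p. split; auto. intros t ht. specialize (E t ht).
  assert (E1 : ZC 0 * t + ZC 1 = 1) by (unfold ZC; ring).
  unfold mob in E. rewrite E1, Crpower_1 in E. rewrite Cmult_1_r in E. rewrite <- E. f_equal.
  replace (ZC (Z.of_nat N)) with (nR N) by (unfold ZC, nR; rewrite INR_IZR_INZ; auto). unfold ZC. field.
Qed.

Lemma nonzero_disc (f : C -> C) (z l : C) : cder f z l -> f z <> 0 ->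
  exists r, (0 < r)%R /\ forall h, (Cmod h < r)%R -> f (z + h) <> 0.
Proof.
  intros H h0. assert (h1 := proj1 (Cmod_gt_0 _) h0). destruct (cder_cont _ _ _ H _ h1) as [d [hd Hd]].
  exists d. split; auto. intros h hh E. specialize (Hd h hh). rewrite E in Hd.
  replace (0 - f z) with (- f z) in Hd by ring. rewrite Cmod_opp in Hd. lra.
Qed.

Lemma basis_nonzero (k : R) (u v : C -> C) : IsBasis k u v -> exists z, (0 < Im z)%R /\ u z <> 0.
Proof.
  intros H. apply NNPP. intros E. destruct (basis_indep k u v 1 0 H) as [h _].
  - intros t ht. destruct (classic (u t = 0)) as [e|e]; [rewrite e; ring|].
    exfalso. apply E. exists t. auto.
  - exact (C10 h).
Qed.

(* If B12 <> 0 then g = f * (h - B11) / B12 where h is a power of an affine function, which is incompatible with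
   f and g being both multiplied by constants under the translation by N. *)
Lemma gamma_B12 (N : nat) (k w1 w2 : R) (f g : C -> C) (a b c d : Z) (B : M2) : (1 <= N)%nat ->
  IsBasis k f g -> gm N w1 f -> gm N w2 g ->
  (Z.of_nat N | a - 1)%Z -> (Z.of_nat N | b)%Z -> (Z.of_nat N | c)%Z -> (Z.of_nat N | d - 1)%Z ->
  acts k f g a b c d B -> m12 B = 0.
Proof.
  intros hN HB Hf Hg g1 g2 g3 g4 [hd [_ [j [Hj H]]]].
  destruct (Hf a b c d hd g1 g2 g3 g4) as [v0 [hv0 Ef]].
  destruct (gm_T N w1 f Hf) as [p [hp Ep]]. destruct (gm_T N w2 g Hg) as [q [hq Eq]].
  apply NNPP. intros hB.
  assert (hNn : nR N <> 0) by (destruct N; [lia|apply nR_nz]).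
  set (s := RtoC w1 - RtoC k).
  (* Up to a constant this is $(c\tau+d)^{w_1-k}$: the quotient of the modular weight of [f] by the
     weight of the action. *)
  set (h := fun t => v0 * Crpower (ZC c * t + ZC d) w1 * / j t).
  assert (hnz : forall t, (0 < Im t)%R -> h t <> 0).
  { intros t ht. destruct (Hj t ht) as [n _]. unfold h. apply Cmult_neq_0; [apply Cmult_neq_0; [auto|apply Crpower_nz]|].
    intros E. apply C10. rewrite <- (Cinv_r _ n), E. ring. }
  assert (dnz : forall t, (0 < Im t)%R -> ZC c * t + ZC d <> 0) by (intros; apply (den_nz a b); auto).
  assert (Dh : forall t, (0 < Im t)%R -> cder h t (s * ZC c / (ZC c * t + ZC d) * h t)).
  { intros t ht. destruct (Hj t ht) as [n dj]. specialize (dnz t ht).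
    unfold h. eapply cder_eq; [|apply cder_mult; [apply cder_scal, cder_Crpower; exact ht|apply cder_inv; [exact n|exact dj]]].
    unfold s. unfold ZC in *. field. auto. }
  assert (R1 : forall t, (0 < Im t)%R -> f t * h t = m11 B * f t + m12 B * g t).
  { intros t ht. destruct (Hj t ht) as [n _]. destruct (H t ht) as [e _]. rewrite Ef in e by auto.
    unfold h. transitivity (v0 * Crpower (ZC c * t + ZC d) w1 * f t / j t); [field; auto|].
    rewrite e. field. auto. }
  assert (ImN : forall t, (0 < Im t)%R -> (0 < Im (t + nR N))%R).
  { intros t ht. replace (Im (t + nR N)) with (Im t) by (unfold Im, nR; simpl; ring). auto. }
  assert (R2 : forall t, (0 < Im t)%R -> f t * (p * h (t + nR N) - q * h t - m11 B * (p - q)) = 0).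
  { intros t ht. assert (e1 := R1 t ht). assert (e2 := R1 _ (ImN t ht)). rewrite Ep, Eq in e2 by auto.
    transitivity (p * f t * h (t + nR N) - q * (f t * h t) - m11 B * (p - q) * f t); [ring|].
    rewrite e1, e2. ring. }
  destruct (basis_nonzero k f g HB) as [t0 [ht0 hf0]].
  assert (Df : exists l, cder f t0 l).
  { destruct HB as [f1 [_ [Hs _]]]. destruct (Hs t0 ht0) as [q1 _]. eauto. }
  destruct Df as [l Df]. destruct (nonzero_disc f t0 l Df hf0) as [r [hr Hr]].
  set (rr := Rmin r (Im t0)). assert (r1 : (rr <= r)%R) by apply Rmin_l. assert (r2 : (rr <= Im t0)%R) by apply Rmin_r.
  assert (hrr : (0 < rr)%R) by (apply Rmin_pos; auto).
  assert (Phi : forall x, (Cmod x < rr)%R -> p * h (t0 + x + nR N) - q * h (t0 + x) = m11 B * (p - q)).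
  { intros x hx. assert (e := R2 (t0 + x) (Im_disc t0 x ltac:(lra))). apply Cmult_integral in e.
    destruct e as [e|e]; [exfalso; apply (Hr x); [lra|auto]|].
    replace (p * h (t0 + x + nR N) - q * h (t0 + x)) with ((p * h (t0 + x + nR N) - q * h (t0 + x) - m11 B * (p - q)) + m11 B * (p - q)) by ring.
    rewrite e. ring. }
  assert (DN : forall t, (0 < Im t)%R -> cder (fun x => h (x + nR N)) t (s * ZC c / (ZC c * (t + nR N) + ZC d) * h (t + nR N))).
  { intros t ht. eapply cder_eq; [|apply (cder_comp h (fun x => x + nR N)); [apply Dh, ImN, ht|apply cder_plus; [apply cder_id|apply cder_const]]].
    ring. }
  (* Then [h] is constant, and [R1] contradicts the independence of [f] and [g]. *)
  destruct (classic (s * ZC c = 0)) as [sc|sc].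
  { assert (hc : forall t, (0 < Im t)%R -> h t = h Ci).
    { intros t ht. apply cder0_const; auto using Im_Ci. intros x hx. eapply cder_eq; [|apply Dh; auto].
      rewrite sc. unfold Cdiv. ring. }
    destruct (basis_eq k f g (h Ci) 0 (m11 B) (m12 B) HB) as [_ e]; [|apply hB; rewrite <- e; auto].
    intros t ht. rewrite <- (R1 t ht), (hc t ht). ring. }
  assert (Psi : forall x, (Cmod x < rr)%R -> p * h (t0 + x + nR N) / (ZC c * (t0 + x + nR N) + ZC d) - q * h (t0 + x) / (ZC c * (t0 + x) + ZC d) = 0).
  { intros x hx. assert (ht : (0 < Im (t0 + x))%R) by (apply Im_disc; lra).
    assert (D1 := cder_minus _ _ _ _ _ (cder_scal p _ _ _ (DN _ ht)) (cder_scal q _ _ _ (Dh _ ht))).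
    assert (D2 : cder (fun y => p * h (y + nR N) - q * h y) (t0 + x) 0).
    { apply (cder_ext_loc (fun _ => m11 B * (p - q)) _ _ _ (rr - Cmod x)); [lra| |apply cder_const].
      intros y hy. replace (t0 + x + y) with (t0 + (x + y)) by ring. symmetry. apply Phi.
      assert (t := Cmod_triangle x y). lra. }
    assert (E := cder_unique _ _ _ _ D1 D2). simpl in E.
    transitivity (/ (s * ZC c) * (p * (s * ZC c / (ZC c * (t0 + x + nR N) + ZC d) * h (t0 + x + nR N)) -
                   q * (s * ZC c / (ZC c * (t0 + x) + ZC d) * h (t0 + x)))).
    - assert (n1 := dnz _ ht). assert (n2 := dnz _ (ImN _ ht)). field.
      assert (s <> 0 /\ ZC c <> 0) by (split; intros F; apply sc; rewrite F; ring). intuition.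
    - rewrite E. ring. }
  assert (hs : s <> 0 /\ ZC c <> 0) by (split; intros F; apply sc; rewrite F; ring).
  assert (n0 := dnz _ ht0). assert (n1 := dnz _ (ImN _ ht0)).
  assert (m01 : ZC c * (t0 + nR N) + ZC d - (ZC c * t0 + ZC d) <> 0).
  { replace (ZC c * (t0 + nR N) + ZC d - (ZC c * t0 + ZC d)) with (ZC c * nR N) by ring. apply Cmult_neq_0; tauto. }
  assert (P0 := Psi 0 ltac:(rewrite Cmod_0; auto)). rewrite Cplus_0_r in P0.
  set (m0 := ZC c * t0 + ZC d) in *. set (m1 := ZC c * (t0 + nR N) + ZC d) in *.
  (* For $s=1$, [h] is a multiple of $c\tau+d$: [P0] gives $p=q$, and then [Phi] makes [h] invariant
     under translation by [N]. For $s\ne1$ one more differentiation yields a second linear equation,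
     and as $m_0\ne m_1$ the two force $p\,h(t_0+N)=0$. *)
  destruct (classic (s = 1)) as [s1|s1].
  - assert (hk : forall t, (0 < Im t)%R -> h t / (ZC c * t + ZC d) = h Ci / (ZC c * Ci + ZC d)).
    { intros t ht. apply (cder0_const (fun x => h x / (ZC c * x + ZC d))); auto using Im_Ci. intros x hx.
      eapply cder_eq; [|apply cder_div; [apply dnz; auto|apply Dh; auto|apply cder_affine]].
      rewrite s1. field. apply dnz; auto. }
    set (kp := h Ci / (ZC c * Ci + ZC d)) in *.
    assert (e0 : h t0 = kp * m0) by (rewrite <- (hk t0 ht0); unfold m0; field; auto).
    assert (e1 : h (t0 + nR N) = kp * m1) by (rewrite <- (hk _ (ImN t0 ht0)); unfold m1; field; auto).
    assert (hkp : kp <> 0) by (intros F; apply (hnz t0 ht0); rewrite e0, F; ring).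
    rewrite e0, e1 in P0.
    assert (pq : p - q = 0).
    { transitivity (/ kp * (p * (kp * m1) / m1 - q * (kp * m0) / m0)); [field; auto|rewrite P0; ring]. }
    assert (F0 := Phi 0 ltac:(rewrite Cmod_0; auto)). rewrite Cplus_0_r in F0. rewrite e0, e1, pq in F0.
    assert (pq' : q = p) by (replace q with (p - (p - q)) by ring; rewrite pq; ring). rewrite pq' in F0.
    apply m01. transitivity (/ (p * kp) * (p * (kp * m1) - p * (kp * m0))); [field; auto|rewrite F0; ring].
  - assert (D1 : cder (fun y => p * h (y + nR N) / (ZC c * (y + nR N) + ZC d) - q * h y / (ZC c * y + ZC d)) t0
       ((s - 1) * ZC c * (p * h (t0 + nR N) / (m1 * m1) - q * h t0 / (m0 * m0)))).
    { eapply cder_eq; [|apply cder_minus; [apply (cder_div (fun y => p * h (y + nR N)) (fun y => ZC c * (y + nR N) + ZC d));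
         [exact n1|apply cder_scal, DN, ht0|]|apply (cder_div (fun y => q * h y) (fun y => ZC c * y + ZC d));
         [exact n0|apply cder_scal, Dh, ht0|apply cder_affine]]].
      2:{ apply (cder_ext_loc (fun y => ZC c * y + (ZC c * nR N + ZC d)) _ _ _ 1); [lra|intros; ring|apply cder_affine]. }
      fold m0 m1. field. auto. }
    assert (D2 : cder (fun y => p * h (y + nR N) / (ZC c * (y + nR N) + ZC d) - q * h y / (ZC c * y + ZC d)) t0 0).
    { apply (cder_ext_loc (fun _ => 0) _ _ _ rr hrr); [|apply cder_const]. intros x hx. symmetry. apply Psi; auto. }
    assert (E := cder_unique _ _ _ _ D1 D2).
    assert (s1' : s - 1 <> 0) by (intros F; apply s1; replace s with (s - 1 + 1) by ring; rewrite F; ring).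
    apply Cmult_integral in E. destruct E as [E|E]; [apply Cmult_integral in E; tauto|].
    assert (hX : p * h (t0 + nR N) <> 0) by (apply Cmult_neq_0; [auto|apply hnz, ImN, ht0]).
    apply hX.
    transitivity (m0 * m1 * m1 / (m1 - m0) * ((p * h (t0 + nR N) / m1 - q * h t0 / m0) / m0 - (p * h (t0 + nR N) / (m1 * m1) - q * h t0 / (m0 * m0)))).
    + field. auto.
    + rewrite P0, E. field. auto.
Qed.

Lemma acts_swap (k : R) (u v : C -> C) (a b c d : Z) (M : M2) : acts k u v a b c d M ->
  acts k v u a b c d (mk2 (m22 M) (m21 M) (m12 M) (m11 M)).
Proof.
  intros [h [hM [j [Hj H]]]]. split; auto. split.
  - intros E. apply hM. rewrite <- E. unfold mdet. simpl. ring.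
  - exists j. split; auto. intros t ht. destruct (H t ht) as [e1 e2]. simpl. rewrite e1, e2. split; ring.
Qed.

Lemma gamma_diag (N : nat) (k w1 w2 : R) (f g : C -> C) (a b c d : Z) (B : M2) : (1 <= N)%nat ->
  IsBasis k f g -> gm N w1 f -> gm N w2 g ->
  (Z.of_nat N | a - 1)%Z -> (Z.of_nat N | b)%Z -> (Z.of_nat N | c)%Z -> (Z.of_nat N | d - 1)%Z ->
  acts k f g a b c d B -> m12 B = 0 /\ m21 B = 0.
Proof.
  intros hN HB Hf Hg g1 g2 g3 g4 H. split.
  - apply (gamma_B12 N k w1 w2 f g a b c d B); auto.
  - apply (gamma_B12 N k w2 w1 g f a b c d _ hN (basis_swap _ _ _ HB) Hg Hf g1 g2 g3 g4 (acts_swap _ _ _ _ _ _ _ _ H)).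
Qed.

(** * The generators S and T *)

Lemma Sol_T (k : R) (y y1 : C -> C) : Sol k y y1 -> Sol k (fun t => y (t + 1)) (fun t => y1 (t + 1)).
Proof.
  intros H t ht. assert (ht' : (0 < Im (t + 1))%R) by (replace (Im (t + 1)) with (Im t) by (unfold Im; simpl; ring); auto).
  destruct (H _ ht') as [h1 h2].
  assert (D : cder (fun x => x + 1) t 1).
  { eapply cder_eq; [|apply cder_plus; [apply cder_id|apply cder_const]]. ring. }
  rewrite E2_per, E2p_per in h2. split.
  - eapply cder_eq; [|apply (cder_comp y (fun x => x + 1)); [exact h1|exact D]]. ring.
  - eapply cder_eq; [|apply (cder_comp y1 (fun x => x + 1)); [exact h2|exact D]]. ring.
Qed.

(** The anomaly of $E_2$ and that of its derivative cancel the terms created by differentiating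
    $\tau^{-k}$ twice; the coefficients of the equation are exactly those for which this happens. *)
Lemma Sol_S (k : R) (y y1 : C -> C) : Sol k y y1 -> exists z1,
  Sol k (fun t => Crpower (RtoC 1 * t + RtoC 0) (- k) * y (- / t)) z1.
Proof.
  intros H. assert (tz := tpi_nz).
  set (J := fun t => Crpower (RtoC 1 * t + RtoC 0) (- k)).
  exists (fun t => J t * (- RtoC k / (two_pi_i * t) * y (- / t) + / (t * t) * y1 (- / t))).
  intros t ht. assert (t0 := nz_H t ht). destruct (H _ (Im_S t ht)) as [h1 h2].
  assert (DJ : cder J t (- RtoC k / t * J t)).
  { assert (D := cder_Crpower 1 0 (- k) t ht).
    apply cder_eq with (RtoC (- k) * RtoC 1 / (RtoC 1 * t + RtoC 0) * J t); [|exact D].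
    rewrite RtoC_opp. replace (RtoC 1 * t + RtoC 0) with t by ring. field. auto. }
  assert (DS := cder_S t ht).
  assert (Dy := cder_comp y (fun x => - / x) t _ _ h1 DS).
  assert (Dy1 := cder_comp y1 (fun x => - / x) t _ _ h2 DS).
  split.
  - eapply cder_eq; [|apply cder_mult; [exact DJ|exact Dy]]. cbv beta. fold (J t). field. auto.
  - assert (Dk : cder (fun x => - RtoC k / (two_pi_i * x)) t (RtoC k / (two_pi_i * (t * t)))).
    { apply (cder_ext_loc (fun x => - RtoC k / two_pi_i * / x) _ _ _ (Im t) ht).
      - intros h hh. assert (n := nz_H _ (Im_disc t h hh)). field. auto.
      - eapply cder_eq; [|apply cder_scal, cder_Cinv; auto]. cbv beta. field. auto. }
    assert (Dt : cder (fun x => / (x * x)) t (- (t + t) / ((t * t) * (t * t)))).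
    { eapply cder_eq; [|apply cder_inv; [apply Cmult_neq_0; auto|apply cder_mult; apply cder_id]]. cbv beta. field. auto. }
    eapply cder_eq; [|apply cder_mult; [exact DJ|apply cder_plus; [apply cder_mult; [exact Dk|exact Dy]|apply cder_mult; [exact Dt|exact Dy1]]]].
    cbv beta. fold (J t). rewrite (E2_S t ht), (E2p_S t ht). unfold kc, ke.
    rewrite !RtoC_div, !RtoC_mult, !RtoC_plus by lra. field. auto.
Qed.

(** * Behaviour at the cusp at infinity *)

(** An expansion $e^{2\pi i\kappa\tau}\sum_n b_nq_N^n$ high in the half-plane. A finite principal
    part is absorbed into the complex exponent, and $b_0$ may vanish. *)
Definition cusp (N : nat) (f : C -> C) (kap : C) (b : nat -> C) (R A : R) : Prop :=
  PSR b R /\ forall tau, (A < Im tau)%R -> (0 < Im tau)%R -> (Cmod (nome (tau / nR N)) < R)%R /\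
    f tau = Cexp (two_pi_i * kap * tau) * PSum b (nome (tau / nR N)).

Lemma PSR_lin (a b : nat -> C) (R : R) (x y : C) : PSR a R -> PSR b R -> PSR (fun n => x * a n + y * b n) R.
Proof.
  intros [hR [B1 h1]] [_ [B2 h2]]. split; auto. exists (Cmod x * B1 + Cmod y * B2)%R. intros n.
  assert (p := pow_le R n ltac:(lra)).
  apply Rle_trans with ((Cmod x * Cmod (a n) + Cmod y * Cmod (b n)) * R ^ n)%R.
  - apply Rmult_le_compat_r; auto. eapply Rle_trans; [apply Cmod_triangle|]. rewrite !Cmod_mult. lra.
  - replace ((Cmod x * Cmod (a n) + Cmod y * Cmod (b n)) * R ^ n)%R
      with (Cmod x * (Cmod (a n) * R ^ n) + Cmod y * (Cmod (b n) * R ^ n))%R by ring.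
    apply Rplus_le_compat; apply Rmult_le_compat_l; auto using Cmod_ge_0.
Qed.

Lemma PSum_lin (a b : nat -> C) (R : R) (x y z : C) : PSR a R -> PSR b R -> (Cmod z < R)%R ->
  PSum (fun n => x * a n + y * b n) z = x * PSum a z + y * PSum b z.
Proof.
  intros h1 h2 hz. apply PSum_eq.
  apply CS_ext with (fun n => x * (a n * z ^ n) + y * (b n * z ^ n)); [intros; ring|].
  apply CS_plus; apply CS_scal; apply (PSR_CS _ R); auto.
Qed.

Lemma PSR_nb (b : nat -> C) (R r : R) : PSR b R -> (0 < r < R)%R -> PSR (fun n => nR n * b n) r.
Proof.
  intros H hr. destruct (PSR_dps b R r H hr) as [_ [B hB]]. split; [lra|]. exists (Rmax 0 (B * r)). intros [|n].
  - replace (nR 0 * b 0%nat) with (RtoC 0) by (unfold nR; simpl; ring). rewrite Cmod_0, Rmult_0_l. apply Rmax_l.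
  - eapply Rle_trans; [|apply Rmax_r]. specialize (hB n). unfold dps in hB.
    simpl pow. replace (Cmod (nR (S n) * b (S n)) * (r * r ^ n))%R with (Cmod (nR (S n) * b (S n)) * r ^ n * r)%R by ring.
    apply Rmult_le_compat_r; [lra|exact hB].
Qed.

Lemma PSum_nb (b : nat -> C) (R r : R) (z : C) : PSR b R -> (0 < r < R)%R -> (Cmod z < r)%R ->
  z * PSum (dps b) z = PSum (fun n => nR n * b n) z.
Proof.
  intros H hr hz. symmetry. apply PSum_eq. apply CS_S.
  replace (z * PSum (dps b) z - nR 0 * b 0%nat * z ^ 0) with (z * PSum (dps b) z) by (unfold nR; simpl; ring).
  apply CS_ext with (fun n => z * (dps b n * z ^ n)).
  - intros n. unfold dps, nR. simpl. ring.
  - apply CS_scal. apply (PSR_CS _ r); [apply (PSR_dps b R); auto|auto].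
Qed.

Lemma nome_N_small (N : nat) (d : R) : (1 <= N)%nat -> (0 < d)%R -> exists A, forall tau, (A < Im tau)%R ->
  (Cmod (nome (tau / nR N)) < d)%R.
Proof.
  intros hN hd. destruct (nome_small d hd) as [A hA]. exists (A * INR N)%R. intros tau h. apply hA.
  assert (hn : (0 < INR N)%R) by (apply lt_0_INR; lia).
  replace (Im (tau / nR N)) with (Im tau / INR N)%R.
  - apply (proj1 (Rlt_div_r A (Im tau) (INR N) hn)). lra.
  - unfold Cdiv, nR. rewrite <- RtoC_inv by lra. rewrite Cmult_comm, Im_scal. unfold Rdiv. ring.
Qed.

Lemma cder_nome_N (N : nat) (t : C) : cder (fun x => nome (x / nR N)) t (two_pi_i * nome (t / nR N) * / nR N).
Proof.
  apply (cder_comp nome (fun x => x / nR N)); [apply cder_nome|].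
  unfold Cdiv. eapply cder_eq; [|apply cder_mult; [apply cder_id|apply cder_const]]. cbv beta. ring.
Qed.

Lemma cder_expk (kap t : C) : cder (fun x => Cexp (two_pi_i * kap * x)) t (two_pi_i * kap * Cexp (two_pi_i * kap * t)).
Proof.
  apply cder_eq with (Cexp (two_pi_i * kap * t) * (two_pi_i * kap)); [ring|].
  apply (cder_comp Cexp); [apply cder_Cexp|].
  eapply cder_eq; [|apply cder_scal, cder_id]. ring.
Qed.

(** Coefficients of the derivative $(2\pi i)^{-1}d/d\tau$ of such an expansion: the exponent of the
    [n]-th term is $\kappa+n/N$. *)
Definition tb (N : nat) (kap : C) (b : nat -> C) (n : nat) : C := kap * b n + / nR N * (nR n * b n).

Lemma cusp_der (N : nat) (f f1 : C -> C) (kap : C) (b : nat -> C) (R A : R) : (1 <= N)%nat ->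
  (forall t, (0 < Im t)%R -> cder f t (two_pi_i * f1 t)) -> cusp N f kap b R A ->
  exists A', cusp N f1 kap (tb N kap b) (R / 2) A'.
Proof.
  intros hN Hd [HP H]. assert (tz := tpi_nz). assert (hR := proj1 HP).
  assert (n0 : nR N <> 0) by (destruct N; [lia|apply nR_nz]).
  destruct (nome_N_small N (R / 2) hN ltac:(lra)) as [A0 hA0].
  assert (P1 : PSR b (R / 2)) by (apply (PSR_le b R); [auto|lra]).
  assert (P2 : PSR (fun n => nR n * b n) (R / 2)) by (apply (PSR_nb b R); [auto|lra]).
  exists (Rmax A A0). split; [apply PSR_lin; auto|]. intros t ht ht0.
  assert (m1 := Rmax_l A A0). assert (m2 := Rmax_r A A0).
  assert (hq := hA0 t ltac:(lra)). split; [exact hq|].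
  set (q := nome (t / nR N)) in *.
  assert (D : cder f t (two_pi_i * kap * Cexp (two_pi_i * kap * t) * PSum b q +
     Cexp (two_pi_i * kap * t) * (PSum (dps b) q * (two_pi_i * q * / nR N)))).
  { apply (cder_ext_loc (fun x => Cexp (two_pi_i * kap * x) * PSum b (nome (x / nR N))) _ _ _ (Rmin (Im t) (Im t - A))).
    - apply Rmin_pos; lra.
    - intros h hh. assert (m3 := Rmin_l (Im t) (Im t - A)). assert (m4 := Rmin_r (Im t) (Im t - A)).
      assert (u := im_le_Cmod h). apply Rabs_le_between in u.
      assert (e : Im (t + h) = (Im t + Im h)%R) by (unfold Im; simpl; ring).
      symmetry. apply H; rewrite e; lra.
    - apply (cder_mult (fun x => Cexp (two_pi_i * kap * x)) (fun x => PSum b (nome (x / nR N)))); [apply cder_expk|].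
      apply (cder_comp (PSum b) (fun x => nome (x / nR N))); [|apply cder_nome_N].
      apply (PSum_cder b R); [auto|]. fold q. lra. }
  assert (E := cder_unique _ _ _ _ (Hd t ht0) D).
  transitivity (/ two_pi_i * (two_pi_i * f1 t)); [field; auto|]. rewrite E. unfold tb.
  rewrite (PSum_lin b (fun n => nR n * b n) (R / 2)) by auto.
  rewrite <- (PSum_nb b R (R / 2)) by (auto; lra). field. auto.
Qed.

Definition seqt (x : R) (n : nat) : C := axis (INR n) + RtoC x.

Lemma Im_seqt (x : R) (n : nat) : Im (seqt x n) = INR n.
Proof.
  unfold seqt. replace (Im (axis (INR n) + RtoC x)) with (Im (axis (INR n))) by (unfold Im; simpl; ring). apply Im_axis.
Qed.

Lemma Cmod_expk (rho : R) (t : C) : Cmod (Cexp (two_pi_i * RtoC rho * t)) = exp (- (2 * PI * rho * Im t)).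
Proof.
  rewrite Cmod_Cexp. f_equal. replace (two_pi_i * RtoC rho * t) with (two_pi_i * (RtoC rho * t)) by ring.
  rewrite Re_tpi, Im_scal. ring.
Qed.

Lemma exp_decay (s x : R) : (0 < s)%R -> CL (fun n => Cexp (two_pi_i * RtoC s * seqt x n)) 0.
Proof.
  intros hs. apply (CL_squeeze _ _ (fun n => exp (- (2 * PI * s)) ^ n)%R 0).
  - intros n _. replace (Cexp (two_pi_i * RtoC s * seqt x n) - 0) with (Cexp (two_pi_i * RtoC s * seqt x n)) by ring.
    rewrite Cmod_expk, Im_seqt. right. clear. induction n as [|n IH].
    + simpl. rewrite Rmult_0_r, Ropp_0. apply exp_0.
    + cbn [pow]. rewrite <- IH, <- exp_plus, S_INR. f_equal. ring.
  - apply is_lim_seq_geom. assert (p := PI_RGT_0). rewrite Rabs_right by (left; apply exp_pos).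
    rewrite <- exp_0. apply exp_increasing. nra.
Qed.

Lemma nome_seqt (N : nat) (x : R) : (1 <= N)%nat -> CL (fun n => nome (seqt x n / nR N)) 0.
Proof.
  intros hN. assert (hn : (0 < INR N)%R) by (apply lt_0_INR; lia).
  eapply CL_ext; [|apply (exp_decay (/ INR N) x)]; [|apply Rinv_0_lt_compat; auto].
  intros n. unfold nome. f_equal. unfold nR. rewrite RtoC_inv by lra. field. apply RtoC_nz. lra.
Qed.

Lemma PSum_seqt (N : nat) (x : R) (b : nat -> C) (R : R) : (1 <= N)%nat -> PSR b R ->
  CL (fun n => PSum b (nome (seqt x n / nR N))) (b 0%nat).
Proof.
  intros hN H. rewrite <- PSum_0. eapply cder_CL; [apply (PSum_cder b R); [auto|rewrite Cmod_0; apply H]|].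
  apply nome_seqt; auto.
Qed.

Lemma E2_seqt (x : R) : CL (fun n => E2 (seqt x n)) 1 /\ CL (fun n => E2p (seqt x n)) 0.
Proof.
  split; intros eps he; destruct (E2_infty eps he) as [A [_ hA]]; destruct (INR_unbounded A) as [M hM];
    exists M; intros n hn; assert (INR M <= INR n)%R by (apply le_INR; auto);
    destruct (hA (seqt x n)) as [h1 h2]; rewrite ?Im_seqt; try lra.
  replace (E2p (seqt x n) - 0) with (E2p (seqt x n)) by ring. auto.
Qed.

Lemma large_seqt (x A : R) : exists M, forall n, (M <= n)%nat -> (A < Im (seqt x n))%R /\ (0 < Im (seqt x n))%R.
Proof.
  destruct (INR_unbounded A) as [M hM]. exists (S M). intros n hn.
  assert (h : (INR (S M) <= INR n)%R) by (apply le_INR; auto). rewrite S_INR in h. assert (q := pos_INR M).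
  rewrite Im_seqt. lra.
Qed.

Lemma cusp_shift (N : nat) (f : C -> C) (kap : C) (b : nat -> C) (R A : R) : (1 <= N)%nat -> b 0%nat = 0 ->
  cusp N f kap b R A -> cusp N f (kap + / nR N) (fun n => b (S n)) R A.
Proof.
  intros hN b0 [HP H]. split; [apply PSR_shift; auto|]. intros t ht ht0. destruct (H t ht ht0) as [h1 h2].
  split; auto. rewrite h2, (PSum_shift b R) by auto. rewrite b0, Cplus_0_l.
  replace (two_pi_i * (kap + / nR N) * t) with (two_pi_i * kap * t + two_pi_i * (t / nR N)) by (unfold Cdiv; ring).
  rewrite Cexp_plus. fold (nome (t / nR N)). ring.
Qed.

(** At the cusp $E_2\to1$ and its derivative tends to $0$, so comparing leading terms leaves
    $\kappa(\kappa-(k+1)/6)\,b_0=0$. *)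
Lemma indicial (N : nat) (k : R) (f f1 : C -> C) (kap : C) (b : nat -> C) (R A : R) : (1 <= N)%nat ->
  Sol k f f1 -> cusp N f kap b R A -> b 0%nat <> 0 -> kap = RtoC 0 \/ kap = RtoC (kc k).
Proof.
  intros hN HS Hc b0.
  destruct (cusp_der N f f1 kap b R A hN (fun t ht => proj1 (HS t ht)) Hc) as [A1 Hc1].
  destruct (cusp_der N f1 _ kap _ _ A1 hN (fun t ht => proj2 (HS t ht)) Hc1) as [A2 Hc2].
  set (b1 := tb N kap b) in *. set (b2 := tb N kap b1) in *.
  destruct Hc as [P0 H0]. destruct Hc1 as [P1 H1]. destruct Hc2 as [P2 H2].
  destruct (large_seqt 0 (Rmax A (Rmax A1 A2))) as [M hM].
  destruct (E2_seqt 0) as [l1 l2].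
  assert (L1 : CL (fun n => PSum b2 (nome (seqt 0 n / nR N))) (b2 0%nat)) by (apply (PSum_seqt N 0 b2 (R / 2 / 2)); auto).
  assert (L2 : CL (fun n => RtoC (kc k) * E2 (seqt 0 n) * PSum b1 (nome (seqt 0 n / nR N)) - RtoC (ke k) * E2p (seqt 0 n) * PSum b (nome (seqt 0 n / nR N)))
      (RtoC (kc k) * 1 * b1 0%nat - RtoC (ke k) * 0 * b 0%nat)).
  { apply CL_minus; apply CL_mult; try (apply CL_scal; auto).
    - apply (PSum_seqt N 0 b1 (R / 2)); auto.
    - apply (PSum_seqt N 0 b R); auto. }
  assert (E : b2 0%nat = RtoC (kc k) * 1 * b1 0%nat - RtoC (ke k) * 0 * b 0%nat).
  { apply (CL_unique _ _ _ L1). apply (CL_eventually _ _ _ M) with (2 := L2). intros n hn.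
    destruct (hM n hn) as [q1 q2]. assert (m1 := Rmax_l A (Rmax A1 A2)). assert (m2 := Rmax_r A (Rmax A1 A2)).
    assert (m3 := Rmax_l A1 A2). assert (m4 := Rmax_r A1 A2).
    destruct (H0 (seqt 0 n) ltac:(lra) q2) as [_ e0]. destruct (H1 (seqt 0 n) ltac:(lra) q2) as [_ e1].
    destruct (H2 (seqt 0 n) ltac:(lra) q2) as [_ e2].
    set (ex := Cexp (two_pi_i * kap * seqt 0 n)) in *. assert (hex : ex <> 0) by apply Cexp_nz.
    rewrite e0, e1 in e2.
    transitivity (/ ex * (ex * PSum b2 (nome (seqt 0 n / nR N)))); [rewrite <- e2|]; field; auto. }
  assert (n0 : nR 0 = 0) by reflexivity.
  unfold b2, b1, tb in E. rewrite n0 in E.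
  assert (F : kap * (kap - RtoC (kc k)) * b 0%nat = 0).
  { transitivity (kap * (kap * b 0%nat + / nR N * (0 * b 0%nat)) + / nR N * (0 * (kap * b 0%nat + / nR N * (0 * b 0%nat)))
      - RtoC (kc k) * kap * b 0%nat); [ring|]. rewrite E. ring. }
  apply Cmult_integral in F. destruct F as [F|F]; [|tauto].
  apply Cmult_integral in F. destruct F as [F|F]; [auto|right].
  replace kap with (kap - RtoC (kc k) + RtoC (kc k)) by ring. rewrite F. ring.
Qed.

(** Leading zero coefficients are stripped one at a time, each raising the exponent by $1/N$, until
    the indicial equation applies. *)
Lemma cusp_lead (N : nat) (k : R) (f f1 : C -> C) (kap : C) (b : nat -> C) (R A : R) : (1 <= N)%nat ->
  Sol k f f1 -> (exists z, (0 < Im z)%R /\ f z <> 0) -> cusp N f kap b R A ->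
  exists (rho : C) b', cusp N f rho b' R A /\ b' 0%nat <> 0 /\ (rho = RtoC 0 \/ rho = RtoC (kc k)).
Proof.
  intros hN HS [z [hz hf]] Hc.
  (* Otherwise [f] and its derivative vanish high up, hence everywhere by uniqueness. *)
  assert (Hn : exists n, b n <> 0).
  { apply NNPP. intros E. destruct Hc as [HP H].
    assert (Z : forall t, (A < Im t)%R -> (0 < Im t)%R -> f t = 0).
    { intros t h1 h2. destruct (H t h1 h2) as [_ e]. rewrite e.
      replace (PSum b (nome (t / nR N))) with (RtoC 0); [ring|]. symmetry. apply PSum_eq.
      apply (CS_finite _ 0). intros i _. destruct (classic (b i = 0)) as [q|q]; [rewrite q; ring|].
      exfalso. apply E. eauto. }
    set (t0 := axis (Rmax A 0 + 1)).
    assert (i0 : (A < Im t0)%R /\ (0 < Im t0)%R).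
    { unfold t0. rewrite Im_axis. assert (m1 := Rmax_l A 0). assert (m2 := Rmax_r A 0). lra. }
    assert (z0 := Z t0 (proj1 i0) (proj2 i0)).
    assert (z1 : f1 t0 = 0).
    { destruct (HS t0 (proj2 i0)) as [d _].
      assert (d0 : cder f t0 0).
      { apply (cder_ext_loc (fun _ => 0) _ _ _ (Rmin (Im t0) (Im t0 - A))); [apply Rmin_pos; lra| |apply cder_const].
        intros h hh. assert (m3 := Rmin_l (Im t0) (Im t0 - A)). assert (m4 := Rmin_r (Im t0) (Im t0 - A)).
        assert (u := im_le_Cmod h). apply Rabs_le_between in u.
        assert (e : Im (t0 + h) = (Im t0 + Im h)%R) by (unfold Im; simpl; ring).
        symmetry. apply Z; rewrite e; lra. }
      assert (e := cder_unique _ _ _ _ d d0). apply Cmult_integral in e. destruct e as [e|e]; auto.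
      exfalso. exact (tpi_nz e). }
    apply hf. apply (Sol_uniq k f f1 t0 HS (proj2 i0) z0 z1 z hz). }
  destruct Hn as [n hn]. revert kap b Hc hn. induction n as [|n IH]; intros kap b Hc hn.
  - exists kap, b. split; auto. split; auto. apply (indicial N k f f1 kap b R A); auto.
  - destruct (classic (b 0%nat = 0)) as [e|e].
    + apply (IH _ _ (cusp_shift N f kap b R A hN e Hc) hn).
    + exists kap, b. split; auto. split; auto. apply (indicial N k f f1 kap b R A); auto.
Qed.

(** The limits along vertical lines determine how $T$ acts, and so are required for every real part
    [x]; the uniform bound feeds the energy argument. *)
Definition Asy (f : C -> C) (rho : R) (C0 : C) : Prop :=
  (forall x, CL (fun n => f (seqt x n) * Cexp (- (two_pi_i * RtoC rho * seqt x n))) C0) /\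
  exists K A, (0 < A)%R /\ (0 <= K)%R /\ forall t, (A < Im t)%R -> (Cmod (f t) <= K * exp (- (2 * PI * rho * Im t)))%R.

Lemma cusp_Asy (N : nat) (f : C -> C) (rho : R) (b : nat -> C) (R A : R) : (1 <= N)%nat ->
  cusp N f (RtoC rho) b R A -> Asy f rho (b 0%nat).
Proof.
  intros hN [HP H]. assert (hR := proj1 HP). split.
  - intros x. destruct (large_seqt x A) as [M hM].
    apply (CL_eventually (fun n => PSum b (nome (seqt x n / nR N))) _ _ M).
    + intros n hn. destruct (hM n hn) as [q1 q2]. destruct (H _ q1 q2) as [_ e]. rewrite e, Cexp_opp.
      field. apply Cexp_nz.
    + apply (PSum_seqt N x b R); auto.
  - destruct (PSum_bound b R (R / 2) HP ltac:(lra)) as [B hB].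
    destruct (nome_N_small N (R / 2) hN ltac:(lra)) as [A0 hA0].
    assert (hB0 : (0 <= B)%R) by (eapply Rle_trans; [apply Cmod_ge_0|apply (hB 0); rewrite Cmod_0; lra]).
    exists B, (Rmax 1 (Rmax A A0)). split; [eapply Rlt_le_trans; [|apply Rmax_l]; lra|]. split; auto.
    intros t ht. assert (m1 := Rmax_l 1 (Rmax A A0)). assert (m2 := Rmax_r 1 (Rmax A A0)).
    assert (m3 := Rmax_l A A0). assert (m4 := Rmax_r A A0).
    destruct (H t ltac:(lra) ltac:(lra)) as [_ e]. rewrite e, Cmod_mult, Cmod_expk, Rmult_comm.
    apply Rmult_le_compat_r; [left; apply exp_pos|]. apply hB. left. apply hA0. lra.
Qed.

Lemma cusp_lin (N : nat) (f g : C -> C) (kap : C) (b1 b2 : nat -> C) (R1 R2 A1 A2 : R) (x y : C) : (1 <= N)%nat ->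
  cusp N f kap b1 R1 A1 -> cusp N g kap b2 R2 A2 ->
  exists R A, cusp N (fun t => x * f t + y * g t) kap (fun n => x * b1 n + y * b2 n) R A.
Proof.
  intros hN [P1 H1] [P2 H2]. assert (r1 := proj1 P1). assert (r2 := proj1 P2).
  assert (m1 := Rmin_l R1 R2). assert (m2 := Rmin_r R1 R2).
  assert (m0 : (0 < Rmin R1 R2)%R) by (apply Rmin_pos; auto).
  destruct (nome_N_small N (Rmin R1 R2) hN m0) as [A0 hA0].
  assert (Q1 : PSR b1 (Rmin R1 R2)) by (apply (PSR_le b1 R1); [auto|lra]).
  assert (Q2 : PSR b2 (Rmin R1 R2)) by (apply (PSR_le b2 R2); [auto|lra]).
  exists (Rmin R1 R2), (Rmax A0 (Rmax A1 A2)). split; [apply PSR_lin; auto|].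
  intros t ht ht0. assert (m3 := Rmax_l A0 (Rmax A1 A2)). assert (m4 := Rmax_r A0 (Rmax A1 A2)).
  assert (m5 := Rmax_l A1 A2). assert (m6 := Rmax_r A1 A2).
  assert (hq := hA0 t ltac:(lra)). split; auto.
  destruct (H1 t ltac:(lra) ht0) as [_ e1]. destruct (H2 t ltac:(lra) ht0) as [_ e2].
  rewrite e1, e2, (PSum_lin b1 b2 (Rmin R1 R2)) by auto. ring.
Qed.

Lemma two_exponents (N : nat) (k : R) (f g : C -> C) (k1 k2 : C) (b1 b2 : nat -> C) (R1 R2 A1 A2 : R) :
  (1 <= N)%nat -> IsBasis k f g -> kc k <> 0%R -> cusp N f k1 b1 R1 A1 -> cusp N g k2 b2 R2 A2 ->
  exists u v Cu Cv, IsBasis k u v /\ Asy u 0 Cu /\ Asy v (kc k) Cv /\ Cu <> 0 /\ Cv <> 0.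
Proof.
  intros hN HB hk Hf Hg. assert (HB' := HB). destruct HB' as [f1 [g1 [Sf [Sg _]]]].
  destruct (cusp_lead N k f f1 k1 b1 R1 A1 hN Sf (basis_nonzero _ _ _ HB) Hf) as [r1 [a1 [C1 [n1 c1]]]].
  destruct (cusp_lead N k g g1 k2 b2 R2 A2 hN Sg (basis_nonzero _ _ _ (basis_swap _ _ _ HB)) Hg) as [r2 [a2 [C2 [n2 c2]]]].
  assert (hkC : RtoC (kc k) <> 0) by (apply RtoC_nz; auto).
  (* If both solutions have the same exponent, the combination that cancels the leading coefficients
     must have the other one. *)
  assert (Same : forall rho other : R, rho <> other -> r1 = RtoC rho -> r2 = RtoC rho ->
     (forall r : C, (r = RtoC 0 \/ r = RtoC (kc k)) -> r = RtoC rho \/ r = RtoC other) ->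
     exists v Cv, IsBasis k f v /\ Asy f rho (a1 0%nat) /\ Asy v other Cv /\ Cv <> 0).
  { intros rho other hro e1 e2 hall. subst r1 r2.
    set (v := fun t => a2 0%nat * f t + - a1 0%nat * g t).
    assert (HBv : IsBasis k f v).
    { assert (q := basis_change k f g 1 0 (a2 0%nat) (- a1 0%nat) HB).
      assert (d : 1 * - a1 0%nat - 0 * a2 0%nat <> 0).
      { intros E. apply n1. replace (a1 0%nat) with (- (1 * - a1 0%nat - 0 * a2 0%nat)) by ring. rewrite E. ring. }
      specialize (q d). replace (fun t => 1 * f t + 0 * g t) with f in q by (apply functional_extensionality; intros; ring).
      exact q. }
    destruct (cusp_lin N f g (RtoC rho) a1 a2 R1 R2 A1 A2 (a2 0%nat) (- a1 0%nat) hN C1 C2) as [R3 [A3 C3]].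
    fold v in C3.
    destruct (cusp_lead N k v _ _ _ R3 A3 hN (Sol_lin k (a2 0%nat) (- a1 0%nat) _ _ _ _ Sf Sg) (basis_nonzero _ _ _ (basis_swap _ _ _ HBv)) C3)
      as [r3 [a3 [C4 [n4 c4]]]].
    exists v, (a3 0%nat). split; auto. split; [apply (cusp_Asy N f rho a1 R1 A1); auto|].
    destruct (hall r3 c4) as [e|e]; subst r3.
    - exfalso. apply n4. destruct (cusp_Asy N v rho a3 R3 A3 hN C4) as [q1 _].
      destruct (cusp_Asy N v rho _ R3 A3 hN C3) as [q2 _].
      rewrite (CL_unique _ _ _ (q1 0%R) (q2 0%R)). ring.
    - split; auto. apply (cusp_Asy N v other a3 R3 A3); auto. }
  destruct c1 as [e1|e1]; destruct c2 as [e2|e2].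
  - destruct (Same 0%R (kc k)) as [v [Cv [h1 [h2 [h3 h4]]]]]; auto.
    exists f, v, (a1 0%nat), Cv. auto.
  - subst r1 r2. exists f, g, (a1 0%nat), (a2 0%nat). split; auto. split; [apply (cusp_Asy N f 0 a1 R1 A1); auto|].
    split; [apply (cusp_Asy N g (kc k) a2 R2 A2); auto|auto].
  - subst r1 r2. exists g, f, (a2 0%nat), (a1 0%nat). split; [apply basis_swap; auto|]. split; [apply (cusp_Asy N g 0 a2 R2 A2); auto|].
    split; [apply (cusp_Asy N f (kc k) a1 R1 A1); auto|auto].
  - destruct (Same (kc k) 0%R) as [v [Cv [h1 [h2 [h3 h4]]]]]; auto; [intros r [?|?]; auto|].
    exists v, f, Cv, (a1 0%nat). split; [apply basis_swap; auto|auto].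
Qed.

Lemma seqt_S (x : R) (n : nat) : seqt x n + 1 = seqt (x + 1) n.
Proof. unfold seqt. rewrite RtoC_plus. ring. Qed.

Definition ek (s : R) : C := Cexp (two_pi_i * RtoC s).

Lemma Asy_cross (q : C -> C) (rp rq : R) (Cq : C) (x y : R) : Asy q rq Cq -> (rp < rq)%R ->
  CL (fun n => q (seqt x n) * Cexp (- (two_pi_i * RtoC rp * seqt y n))) 0.
Proof.
  intros [H _] h.
  apply CL_ext with (fun n => q (seqt x n) * Cexp (- (two_pi_i * RtoC rq * seqt x n)) *
     (Cexp (two_pi_i * RtoC rp * RtoC (x - y)) * Cexp (two_pi_i * RtoC (rq - rp) * seqt x n))).
  - intros n. rewrite <- !Cmult_assoc. f_equal. rewrite <- !Cexp_plus. f_equal.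
    unfold seqt. rewrite !RtoC_minus. ring.
  - replace (RtoC 0) with (Cq * (Cexp (two_pi_i * RtoC rp * RtoC (x - y)) * 0)) by ring.
    apply CL_mult; [apply H|]. apply CL_scal, exp_decay. lra.
Qed.

(** [Q] decays faster than [P], so [P] cannot occur in $Q(\tau+1)$ and [Q] is an eigenvector of $T$.
    Thus $T$ is triangular with distinct eigenvalues, and only [P] has to be corrected, by the
    multiple $\beta/(\alpha-\delta)$ of [Q]. *)
Lemma dominance (k : R) (P Q : C -> C) (rp rq : R) (Cp Cq : C) : IsBasis k P Q ->
  Asy P rp Cp -> Asy Q rq Cq -> Cp <> 0 -> Cq <> 0 -> (rp < rq)%R -> ek rp <> ek rq ->
  exists P', IsBasis k P' Q /\ (forall t, (0 < Im t)%R -> P' (t + 1) = ek rp * P' t) /\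
    (forall t, (0 < Im t)%R -> Q (t + 1) = ek rq * Q t).
Proof.
  intros HB HP HQ hp hq hr hne. assert (HB' := HB). destruct HB' as [P1 [Q1 [SP [SQ _]]]].
  destruct (basis_span k P Q _ _ HB (Sol_T k P P1 SP)) as [al [be EP]].
  destruct (basis_span k P Q _ _ HB (Sol_T k Q Q1 SQ)) as [ga [de EQ]].
  assert (pos : forall n, (1 <= n)%nat -> (0 < Im (seqt 0 n))%R).
  { intros n hn. rewrite Im_seqt. apply lt_0_INR. lia. }
  assert (e01 : forall n, seqt 0 n + 1 = seqt 1 n).
  { intros n. rewrite seqt_S. f_equal. ring. }
  assert (twist : forall (q : C -> C) r Cq0, Asy q r Cq0 -> CL (fun n => q (seqt 1 n) * Cexp (- (two_pi_i * RtoC r * seqt 0 n))) (ek r * Cq0)).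
  { intros q r Cq0 [h _]. apply CL_ext with (fun n => ek r * (q (seqt 1 n) * Cexp (- (two_pi_i * RtoC r * seqt 1 n)))).
    - intros n. unfold ek. rewrite Cmult_assoc, (Cmult_comm _ (q _)), <- Cmult_assoc. f_equal. rewrite <- Cexp_plus. f_equal.
      rewrite <- e01. ring.
    - apply CL_scal, h. }
  assert (G : ga = 0).
  { assert (L1 : CL (fun n => Q (seqt 1 n) * Cexp (- (two_pi_i * RtoC rp * seqt 0 n))) (ga * Cp + de * 0)).
    { apply (CL_eventually (fun n => ga * (P (seqt 0 n) * Cexp (- (two_pi_i * RtoC rp * seqt 0 n))) +
          de * (Q (seqt 0 n) * Cexp (- (two_pi_i * RtoC rp * seqt 0 n)))) _ _ 1).
      - intros n hn. rewrite <- e01, EQ by auto. ring.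
      - apply CL_plus; apply CL_scal; [apply HP|apply (Asy_cross Q rp rq Cq); auto]. }
    assert (E := CL_unique _ _ _ L1 (Asy_cross Q rp rq Cq 1 0 HQ hr)).
    assert (E' : ga * Cp = 0) by (rewrite <- E; ring). apply Cmult_integral in E'. tauto. }
  assert (D : de = ek rq).
  { assert (L1 : CL (fun n => Q (seqt 1 n) * Cexp (- (two_pi_i * RtoC rq * seqt 0 n))) (de * Cq)).
    { apply (CL_eventually (fun n => de * (Q (seqt 0 n) * Cexp (- (two_pi_i * RtoC rq * seqt 0 n)))) _ _ 1).
      - intros n hn. rewrite <- e01, EQ, G by auto. ring.
      - apply CL_scal, HQ. }
    assert (E := CL_unique _ _ _ L1 (twist Q rq Cq HQ)).
    transitivity (de * Cq / Cq); [field; auto|]. rewrite E. field. auto. }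
  assert (A : al = ek rp).
  { assert (L1 : CL (fun n => P (seqt 1 n) * Cexp (- (two_pi_i * RtoC rp * seqt 0 n))) (al * Cp + be * 0)).
    { apply (CL_eventually (fun n => al * (P (seqt 0 n) * Cexp (- (two_pi_i * RtoC rp * seqt 0 n))) +
          be * (Q (seqt 0 n) * Cexp (- (two_pi_i * RtoC rp * seqt 0 n)))) _ _ 1).
      - intros n hn. rewrite <- e01, EP by auto. ring.
      - apply CL_plus; apply CL_scal; [apply HP|apply (Asy_cross Q rp rq Cq); auto]. }
    assert (E := CL_unique _ _ _ L1 (twist P rp Cp HP)).
    transitivity ((al * Cp + be * 0) / Cp); [field; auto|]. rewrite E. field. auto. }
  assert (nd : al - de <> 0).
  { rewrite A, D. intros E. apply hne. replace (ek rp) with (ek rp - ek rq + ek rq) by ring. rewrite E. ring. }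
  set (s := be / (al - de)).
  exists (fun t => 1 * P t + s * Q t). split; [|split].
  - assert (q := basis_change k P Q 1 s 0 1 HB). replace (fun t => 0 * P t + 1 * Q t) with Q in q by (apply functional_extensionality; intros; ring).
    apply q. replace (1 * 1 - s * 0) with (RtoC 1) by ring. apply C10.
  - intros t ht. rewrite EP, EQ, G, <- A by auto. unfold s. field. auto.
  - intros t ht. rewrite EQ, G, D by auto. ring.
Qed.

(** The solution with the larger exponent is left unchanged by [dominance] and keeps its growth
    bound: it is [v] when the nonzero exponent is positive and [u] when it is negative. *)
Lemma eigenbasis (N : nat) (k : R) (f g : C -> C) (k1 k2 : C) (b1 b2 : nat -> C) (R1 R2 A1 A2 : R) :
  (1 <= N)%nat -> IsBasis k f g -> ek (kc k) <> 1 -> cusp N f k1 b1 R1 A1 -> cusp N g k2 b2 R2 A2 ->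
  exists u v, IsBasis k u v /\ (forall t, (0 < Im t)%R -> u (t + 1) = u t) /\
    (forall t, (0 < Im t)%R -> v (t + 1) = ek (kc k) * v t) /\
    ((0 < kc k)%R -> exists K A, (0 < A)%R /\ (0 <= K)%R /\ forall t, (A < Im t)%R -> (Cmod (v t) <= K * exp (- (2 * PI * kc k * Im t)))%R) /\
    ((kc k < 0)%R -> exists K A, (0 < A)%R /\ (0 <= K)%R /\ forall t, (A < Im t)%R -> (Cmod (u t) <= K)%R).
Proof.
  intros hN HB hne Hf Hg.
  assert (e0 : ek 0 = 1) by (unfold ek; replace (two_pi_i * 0) with (RtoC 0) by ring; apply Cexp_0).
  assert (hk : kc k <> 0%R) by (intros E; apply hne; rewrite E; auto).
  destruct (two_exponents N k f g k1 k2 b1 b2 R1 R2 A1 A2 hN HB hk Hf Hg) as [u [v [Cu [Cv [HB2 [Hu [Hv [nu nv]]]]]]]].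
  destruct (Rlt_dec 0 (kc k)) as [c|c].
  - destruct (dominance k u v 0 (kc k) Cu Cv) as [u' [q1 [q2 q3]]]; auto; [rewrite e0; auto|].
    exists u', v. split; auto. split; [intros t ht; rewrite q2, e0 by auto; ring|]. split; auto.
    split; [intros _; apply Hv|intros; exfalso; lra].
  - destruct (dominance k v u (kc k) 0 Cv Cu) as [v' [q1 [q2 q3]]]; auto; [apply basis_swap; auto|lra|rewrite e0; auto|].
    exists u, v'. split; [apply basis_swap; auto|]. split; [intros t ht; rewrite q3, e0 by auto; ring|]. split; auto.
    split; [intros; exfalso; lra|]. intros _. destruct Hu as [_ [K [A [h1 [h2 h3]]]]]. exists K, A. split; auto. split; auto.
    intros t ht. specialize (h3 t ht). replace (- (2 * PI * 0 * Im t))%R with 0%R in h3 by ring. rewrite exp_0 in h3. lra.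
Qed.

Definition idm : SL2Z := mkSL2Z 1 0 0 1 eq_refl.

(** The factor $q_N^m$ is moved into the exponent $\kappa-m/N$. The given expansion holds only where
    [f] is holomorphic; it is carried to all points of the same height by continuity along
    [small_seq]. *)
Lemma fill_cusp (N : nat) (k : Q) (w : R) (f : C -> C) : (1 <= N)%nat -> KZ_solution k f -> meromorphic_on_H f ->
  meromorphic_at_cusp N w f idm -> exists kap b R A, cusp N (fill f) kap b R A.
Proof.
  intros hN HK Hm [kap [m [a [A [hA H]]]]].
  assert (n0 : nR N <> 0) by (destruct N; [lia|apply nR_nz]).
  destruct (KZ_ext k f HK Hm) as [y1 [HS HG]].
  assert (mo : forall t, moebius idm t = t).
  { intros t. unfold moebius, autom, idm. simpl. field. }
  assert (sl : forall t, slash w f idm t = f t).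
  { intros t. unfold slash. rewrite mo. unfold autom, idm. simpl. replace (0 * t + 1) with (RtoC 1) by ring.
    rewrite Crpower_1. ring. }
  assert (H' : forall t, (A < Im t)%R -> holomorphic_at f t ->
     CS (fun n => a n * nome (t / nR N) ^ n) (Cexp (- (two_pi_i * (kap - nR m / nR N) * t)) * f t)).
  { intros t ht hol. assert (q := H t ht). rewrite mo, sl in q. specialize (q hol). apply is_pseries_CS in q.
    replace (Cexp (- (two_pi_i * (kap - nR m / nR N) * t)) * f t)
      with (nome (t / nR N) ^ m * (Cexp (- (two_pi_i * kap * t)) * f t)); [exact q|].
    rewrite <- nome_nR. unfold nome. rewrite Cmult_assoc, <- Cexp_plus. f_equal. f_equal. field. auto. }
  (* Convergence at one holomorphic point of height $A+1$ bounds the terms and supplies the radius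
     for all higher points. *)
  set (z := axis (A + 1)).
  assert (hz : Im z = (A + 1)%R) by apply Im_axis.
  destruct (HG z ltac:(lra)) as [r [hr Hr]].
  destruct (Hr (small_seq r 0)) as [hol _]; [apply small_seq_spec; auto|].
  set (z' := z + small_seq r 0) in *.
  assert (hz' : Im z' = (A + 1)%R).
  { unfold z'. rewrite <- hz. unfold small_seq, nR. replace (INR 1) with 1%R by reflexivity.
    rewrite <- RtoC_inv, <- RtoC_mult by lra. unfold Im. simpl. ring. }
  assert (CS0 := H' z' ltac:(lra) hol).
  assert (P := CS_PSR_C a _ _ (nome_nz (z' / nR N)) CS0).
  set (R := Cmod (nome (z' / nR N))) in *.
  exists (kap - nR m / nR N), a, R, (A + 1)%R. split; auto. intros t ht ht0.
  assert (hn : (0 < INR N)%R) by (apply lt_0_INR; lia).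
  assert (ImN : forall x, Im (x / nR N) = (Im x / INR N)%R).
  { intros x. unfold Cdiv, nR. rewrite <- RtoC_inv by lra. rewrite Cmult_comm, Im_scal. unfold Rdiv. ring. }
  assert (hq : (Cmod (nome (t / nR N)) < R)%R).
  { unfold R. rewrite !Cmod_nome, !ImN, hz'. apply exp_increasing. assert (p := PI_RGT_0).
    assert (q : ((A + 1) / INR N < Im t / INR N)%R) by (apply Rmult_lt_compat_r; [apply Rinv_0_lt_compat; auto|auto]). nra. }
  split; auto.
  destruct (HG t ht0) as [r1 [hr1 Hr1]].
  assert (ss := small_seq_spec r1 hr1).
  assert (Ims : forall n, Im (t + small_seq r1 n) = Im t).
  { intros n. unfold small_seq, nR. rewrite <- RtoC_inv by (apply not_0_INR; lia). rewrite <- RtoC_mult. unfold Im. simpl. ring. }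
  destruct (HS t ht0) as [d1 _]. assert (c1 := CL_shift_small _ _ _ r1 d1 hr1).
  assert (d2 := cder_mult _ _ _ _ _ (cder_expk (kap - nR m / nR N) t)
     (cder_comp (PSum a) (fun x => nome (x / nR N)) t _ _ (PSum_cder a R _ P hq) (cder_nome_N N t))).
  assert (c2 := CL_shift_small _ _ _ r1 d2 hr1).
  apply (CL_unique _ _ _ c1). eapply CL_ext; [|exact c2]. intros n. cbv beta.
  destruct (Hr1 (small_seq r1 n) (proj2 ss n)) as [hol1 e1]. rewrite <- e1.
  assert (q := H' _ ltac:(rewrite Ims; lra) hol1). apply PSum_eq in q. rewrite q, Cexp_opp. field. apply Cexp_nz.
Qed.

(** * Energy argument on the imaginary axis *)

(** At the fixed point $i$ of $S$ the transformation law reads $E_2(i)=-E_2(i)+6/\pi$. *)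
Lemma E2_Ci : E2 Ci = RtoC (3 / PI).
Proof.
  assert (H := E2_S Ci Im_Ci). assert (ci := Ci_nz). assert (p := PI_RGT_0).
  assert (pz : RtoC PI <> 0) by (apply RtoC_nz; lra).
  assert (E : - / Ci = Ci).
  { transitivity ((Ci * Ci) / Ci); [rewrite Ci_sq|]; field; auto. }
  rewrite E, Ci_sq in H.
  assert (E3 : 12 * Ci / two_pi_i = RtoC (6 / PI)).
  { unfold two_pi_i. rewrite RtoC_mult, RtoC_div by lra. field. auto. }
  rewrite E3 in H.
  transitivity (/ 2 * (E2 Ci + E2 Ci)); [field|]. rewrite H at 1.
  rewrite !RtoC_div by lra. field. auto.
Qed.

Lemma axis_1 : axis 1 = Ci.
Proof. unfold axis. ring. Qed.

Lemma axis_line (t : R) : axis t = 0 + RtoC t * Ci.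
Proof. unfold axis. ring. Qed.

Lemma tpi_Ci (z : C) : two_pi_i * z * Ci = RtoC (- (2 * PI)) * z.
Proof.
  unfold two_pi_i. rewrite RtoC_opp. transitivity (RtoC (2 * PI) * z * (Ci * Ci)); [ring|]. rewrite Ci_sq. ring.
Qed.

Lemma axis_der (f : C -> C) (t : R) (l : C) : cder f (axis t) (two_pi_i * l) ->
  is_derive (fun s => Re (f (axis s))) t (- (2 * PI) * Re l)%R /\
  is_derive (fun s => Im (f (axis s))) t (- (2 * PI) * Im l)%R.
Proof.
  intros H. rewrite axis_line in H. destruct (cder_Re_line f 0 Ci _ t H) as [h1 h2].
  rewrite tpi_Ci, re_scal_l in h1. rewrite tpi_Ci, Im_scal in h2.
  split; [eapply is_derive_ext; [|exact h1]|eapply is_derive_ext; [|exact h2]];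
    intros s; cbv beta; rewrite axis_line; auto.
Qed.

Lemma nonincr (f f' : R -> R) (a b : R) : (a <= b)%R ->
  (forall t, (a <= t <= b)%R -> is_derive f t (f' t)) -> (forall t, (a <= t <= b)%R -> (f' t <= 0)%R) ->
  (f b <= f a)%R.
Proof.
  intros hab H h. destruct (MVT_gen f a b f') as [c [hc E]].
  - intros x hx. rewrite Rmin_left, Rmax_right in hx by lra. apply H. lra.
  - intros x hx. rewrite Rmin_left, Rmax_right in hx by lra.
    apply derivable_continuous_pt. exists (f' x). apply is_derive_Reals, H. lra.
  - rewrite Rmin_left, Rmax_right in hc by lra. specialize (h c hc). nra.
Qed.

(** With $\theta=Dy-\frac{k}{12}E_2y$ the equation becomes
    $D\theta-\frac{k+2}{12}E_2\theta=\frac{k(k+2)}{144}(E_2^2-12DE_2)\,y$, where the bracket is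
    $E_4$. The exponential is the integrating factor for $\mathrm{Re}(\bar y\theta)$, and on the
    axis $d/dt=-2\pi D$. *)
Lemma der_R (a b a1 b1 e p EI : R -> R) (k t : R) :
  is_derive a t (- (2 * PI) * a1 t)%R -> is_derive b t (- (2 * PI) * b1 t)%R ->
  is_derive a1 t (- (2 * PI) * ((k + 1) / 6 * e t * a1 t - k * (k + 1) / 12 * p t * a t))%R ->
  is_derive b1 t (- (2 * PI) * ((k + 1) / 6 * e t * b1 t - k * (k + 1) / 12 * p t * b t))%R ->
  is_derive e t (- (2 * PI) * p t)%R -> is_derive EI t (e t) ->
  is_derive (fun s => (a s * (a1 s - k / 12 * e s * a s) + b s * (b1 s - k / 12 * e s * b s)) * exp (2 * PI * ((k + 1) / 6) * EI s))%R t
   (- (2 * PI) * ((a1 t - k / 12 * e t * a t) ^ 2 + (b1 t - k / 12 * e t * b t) ^ 2 + k * (k + 2) / 144 * (e t ^ 2 - 12 * p t) * (a t ^ 2 + b t ^ 2)) * exp (2 * PI * ((k + 1) / 6) * EI t))%R.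
Proof.
  intros d1 d2 d3 d4 d5 d6. auto_derive.
  - repeat split; eexists; eassumption.
  - replace (Derive (fun x => a x) t) with (- (2 * PI) * a1 t)%R by (symmetry; apply is_derive_unique; exact d1).
    replace (Derive (fun x => b x) t) with (- (2 * PI) * b1 t)%R by (symmetry; apply is_derive_unique; exact d2).
    replace (Derive (fun x => a1 x) t) with (- (2 * PI) * ((k + 1) / 6 * e t * a1 t - k * (k + 1) / 12 * p t * a t))%R by (symmetry; apply is_derive_unique; exact d3).
    replace (Derive (fun x => b1 x) t) with (- (2 * PI) * ((k + 1) / 6 * e t * b1 t - k * (k + 1) / 12 * p t * b t))%R by (symmetry; apply is_derive_unique; exact d4).
    replace (Derive (fun x => e x) t) with (- (2 * PI) * p t)%R by (symmetry; apply is_derive_unique; exact d5).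
    replace (Derive (fun x => EI x) t) with (e t) by (symmetry; apply is_derive_unique; exact d6).
    field.
Qed.

Lemma der_G (a b a1 b1 e EI : R -> R) (k t : R) :
  is_derive a t (- (2 * PI) * a1 t)%R -> is_derive b t (- (2 * PI) * b1 t)%R -> is_derive EI t (e t) ->
  is_derive (fun s => - ((a s ^ 2 + b s ^ 2) * exp (PI * k / 3 * EI s)))%R t
   (4 * PI * (a t * (a1 t - k / 12 * e t * a t) + b t * (b1 t - k / 12 * e t * b t)) * exp (PI * k / 3 * EI t))%R.
Proof.
  intros d1 d2 d6. auto_derive.
  - repeat split; eexists; eassumption.
  - replace (Derive (fun x => a x) t) with (- (2 * PI) * a1 t)%R by (symmetry; apply is_derive_unique; exact d1).
    replace (Derive (fun x => b x) t) with (- (2 * PI) * b1 t)%R by (symmetry; apply is_derive_unique; exact d2).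
    replace (Derive (fun x => EI x) t) with (e t) by (symmetry; apply is_derive_unique; exact d6).
    field.
Qed.

(* With theta = D y - (k/12) E2 y the function Re (conj y * theta) exp(2 pi (k+1)/6 int E2) is nonincreasing since
   E2^2 - 12 D E2 > 0 on the axis; it vanishes at i, so |y|^2 exp(pi k/3 int E2) is nondecreasing on [1, oo). *)
Lemma axis_vanish (k : R) (y y1 : C -> C) (K A : R) : Sol k y y1 ->
  (y Ci = 0 \/ y1 Ci = RtoC (k / (4 * PI)) * y Ci) -> (0 <= K)%R ->
  ((0 <= k /\ forall t, (A < Im t)%R -> (Cmod (y t) <= K * exp (- (2 * PI * kc k * Im t)))%R)%R \/
   (k <= -2 /\ forall t, (A < Im t)%R -> (Cmod (y t) <= K)%R)%R) ->
  forall t, (0 < Im t)%R -> y t = 0.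
Proof.
  intros HS Hi hK Hb. assert (hp := PI_RGT_0).
  set (e := fun t => Re (E2 (axis t))). set (p := fun t => Re (E2p (axis t))).
  set (a := fun t => Re (y (axis t))). set (b := fun t => Im (y (axis t))).
  set (a1 := fun t => Re (y1 (axis t))). set (b1 := fun t => Im (y1 (axis t))).
  assert (hax : forall t, (0 < t)%R -> (0 < Im (axis t))%R) by (intros; rewrite Im_axis; auto).
  assert (De : forall t, (0 < t)%R -> is_derive e t (- (2 * PI) * p t)%R).
  { intros t ht. apply (axis_der E2 t (E2p (axis t))). apply cder_E2, hax, ht. }
  assert (Da : forall t, (0 < t)%R -> is_derive a t (- (2 * PI) * a1 t)%R /\ is_derive b t (- (2 * PI) * b1 t)%R).
  { intros t ht. destruct (HS _ (hax t ht)) as [h _]. apply (axis_der y t (y1 (axis t)) h). }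
  assert (Da1 : forall t, (0 < t)%R -> is_derive a1 t (- (2 * PI) * ((k + 1) / 6 * e t * a1 t - k * (k + 1) / 12 * p t * a t))%R /\
                                       is_derive b1 t (- (2 * PI) * ((k + 1) / 6 * e t * b1 t - k * (k + 1) / 12 * p t * b t))%R).
  { intros t ht. destruct (HS _ (hax t ht)) as [_ h].
    destruct (E2_axis t ht) as [i1 [_ [i2 _]]].
    destruct (axis_der y1 t _ h) as [h1 h2].
    assert (r1 : E2 (axis t) = RtoC (e t)) by (rewrite (surjective_pairing (E2 (axis t))); unfold RtoC; f_equal; exact i1).
    assert (r2 : E2p (axis t) = RtoC (p t)) by (rewrite (surjective_pairing (E2p (axis t))); unfold RtoC; f_equal; exact i2).
    rewrite r1, r2 in h1, h2. unfold kc, ke in h1, h2. rewrite <- !RtoC_mult in h1, h2.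
    assert (q1 : forall (x x' : R) (w w' : C), Re (RtoC x * w - RtoC x' * w') = (x * Re w - x' * Re w')%R /\ Im (RtoC x * w - RtoC x' * w') = (x * Im w - x' * Im w')%R).
    { intros x x' w w'. unfold Re, Im. simpl. split; ring. }
    rewrite (proj1 (q1 _ _ _ _)) in h1. rewrite (proj2 (q1 _ _ _ _)) in h2. split; [exact h1|exact h2]. }
  assert (e1 : e 1%R = (3 / PI)%R) by (unfold e; rewrite axis_1, E2_Ci; reflexivity).
  assert (ele : forall t, (0 < t)%R -> (e t <= 1)%R) by (intros t ht; apply (E2_axis t ht)).
  assert (ple : forall t, (0 < t)%R -> (p t <= 0)%R) by (intros t ht; apply (E2_axis t ht)).
  (* $E_2(it)$ increases with $t$ because $DE_2\le0$ on the axis, and it starts from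
     $E_2(i)=3/\pi$. *)
  assert (ege : forall t, (1 <= t)%R -> (3 / PI <= e t)%R).
  { intros t ht. rewrite <- e1. apply Ropp_le_cancel.
    apply (nonincr (fun s => - e s)%R (fun s => - (- (2 * PI) * p s))%R 1 t ht).
    - intros s hs. apply (is_derive_opp (K := R_AbsRing) (V := R_NormedModule) e). apply De. lra.
    - intros s hs. assert (q := ple s ltac:(lra)). nra. }
  set (EI := fun t => (RInt e 1 t : R)).
  assert (DEI : forall t, (0 < t)%R -> is_derive EI t (e t)).
  { assert (ce : forall t, (0 < t)%R -> continuous e t).
    { intros t ht. apply (ex_derive_continuous (K := R_AbsRing) (V := R_NormedModule) e t). exists (- (2 * PI) * p t)%R. apply De, ht. }
    intros t ht. apply (is_derive_RInt e EI 1 t).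
    - exists (mkposreal t ht). intros s hs. unfold EI. apply (RInt_correct (V := R_CompleteNormedModule) e 1 s). apply ex_RInt_continuous. intros w hw. apply ce.
      assert (q : (Rabs (s - t) < t)%R) by exact hs. apply Rabs_def2 in q.
      assert (m := Rmin_glb_lt 1 s 0 ltac:(lra) ltac:(lra)). lra.
    - apply ce, ht. }
  assert (EI1 : EI 1%R = 0%R) by (unfold EI; apply (RInt_point (V := R_CompleteNormedModule))).
  assert (EIle : forall t, (1 <= t)%R -> (EI t <= t - 1)%R).
  { intros t ht. assert (q := nonincr (fun s => EI s - s)%R (fun s => e s - 1)%R 1 t ht).
    assert (q1 : (EI t - t <= EI 1 - 1)%R); [|lra]. apply q.
    - intros s hs. apply (is_derive_minus (K := R_AbsRing) (V := R_NormedModule) EI (fun s => s)); [apply DEI; lra|].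
      apply (is_derive_id (K := R_AbsRing)).
    - intros s hs. assert (u := ele s ltac:(lra)). lra. }
  assert (EIge : forall t, (1 <= t)%R -> (3 / PI * (t - 1) <= EI t)%R).
  { intros t ht. assert (q := nonincr (fun s => 3 / PI * s - EI s)%R (fun s => 3 / PI - e s)%R 1 t ht).
    assert (q1 : (3 / PI * t - EI t <= 3 / PI * 1 - EI 1)%R); [|lra]. apply q.
    - intros s hs. apply (is_derive_minus (K := R_AbsRing) (V := R_NormedModule) (fun s => 3 / PI * s)%R EI); [|apply DEI; lra].
      auto_derive; auto; ring.
    - intros s hs. assert (u := ege s ltac:(lra)). lra. }
  (* This sign makes the potential term nonnegative, and it singles out the two ranges $k\ge0$ and
     $k\le-2$. *)
  assert (hkk : (0 <= k * (k + 2))%R) by (destruct Hb as [[h _]|[h _]]; nra).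
  set (Rf := fun t => (a t * (a1 t - k / 12 * e t * a t) + b t * (b1 t - k / 12 * e t * b t))%R).
  set (beta := fun t => ((a1 t - k / 12 * e t * a t) ^ 2 + (b1 t - k / 12 * e t * b t) ^ 2 + k * (k + 2) / 144 * (e t ^ 2 - 12 * p t) * (a t ^ 2 + b t ^ 2))%R).
  assert (DRf : forall t, (0 < t)%R -> is_derive (fun s => Rf s * exp (2 * PI * ((k + 1) / 6) * EI s))%R t
     (- (2 * PI) * beta t * exp (2 * PI * ((k + 1) / 6) * EI t))%R).
  { intros t ht. destruct (Da t ht) as [d1 d2]. destruct (Da1 t ht) as [d3 d4].
    apply (der_R a b a1 b1 e p EI k t); auto. }
  assert (hbeta : forall t, (0 < t)%R -> (0 <= beta t)%R).
  { intros t ht. unfold beta. assert (q := ple t ht).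
    assert (0 <= e t ^ 2)%R by apply pow2_ge_0.
    assert (0 <= (a1 t - k / 12 * e t * a t) ^ 2)%R by apply pow2_ge_0.
    assert (0 <= (b1 t - k / 12 * e t * b t) ^ 2)%R by apply pow2_ge_0.
    assert (0 <= a t ^ 2)%R by apply pow2_ge_0. assert (0 <= b t ^ 2)%R by apply pow2_ge_0.
    assert (0 <= k * (k + 2) / 144 * (e t ^ 2 - 12 * p t) * (a t ^ 2 + b t ^ 2))%R.
    { apply Rmult_le_pos; [apply Rmult_le_pos|]; lra. }
    lra. }
  (* At $i$ one has $\frac{k}{12}E_2(i)=\frac{k}{4\pi}$, so [Hi] says that $y$ or $\theta$ vanishes
     there. *)
  assert (Rf1 : Rf 1%R = 0%R).
  { unfold Rf. rewrite e1. unfold a, b, a1, b1. rewrite axis_1. destruct Hi as [h|h].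
    - rewrite h. unfold Re, Im, RtoC. simpl. ring.
    - rewrite h, re_scal_l, Im_scal. field. lra. }
  assert (Rle : forall t, (1 <= t)%R -> (Rf t <= 0)%R).
  { intros t ht. assert (q := nonincr _ _ 1 t ht (fun s hs => DRf s ltac:(lra))).
    assert (q1 : (Rf t * exp (2 * PI * ((k + 1) / 6) * EI t) <= Rf 1 * exp (2 * PI * ((k + 1) / 6) * EI 1))%R).
    { apply q. intros s hs. assert (u := hbeta s ltac:(lra)). assert (u' := exp_pos (2 * PI * ((k + 1) / 6) * EI s)). 
      assert (0 <= beta s * exp (2 * PI * ((k + 1) / 6) * EI s))%R by (apply Rmult_le_pos; lra). nra. }
    rewrite Rf1, Rmult_0_l in q1. assert (u' := exp_pos (2 * PI * ((k + 1) / 6) * EI t)). nra. }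
  set (G := fun t => ((a t ^ 2 + b t ^ 2) * exp (PI * k / 3 * EI t))%R).
  assert (DG : forall t, (0 < t)%R -> is_derive (fun s => - G s)%R t (4 * PI * Rf t * exp (PI * k / 3 * EI t))%R).
  { intros t ht. destruct (Da t ht) as [d1 d2]. apply (der_G a b a1 b1 e EI k t); auto. }
  assert (Gmon : forall s t, (1 <= s <= t)%R -> (G s <= G t)%R).
  { intros s t hst. apply Ropp_le_cancel. apply (nonincr (fun s => - G s)%R _ s t ltac:(lra) (fun w hw => DG w ltac:(lra))).
    intros w hw. assert (u := Rle w ltac:(lra)). assert (u' := exp_pos (PI * k / 3 * EI w)). 
    assert (Rf w * exp (PI * k / 3 * EI w) <= 0)%R by nra. nra. }
  assert (yn : forall t, (a t ^ 2 + b t ^ 2 = Cmod (y (axis t)) ^ 2)%R) by (intros t; unfold a, b; rewrite Cmod2_alt; auto).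
  (* For $k\ge0$ the decay of $|y|^2$ outweighs the weight, whose exponent is at most $\pi
     k(t-1)/3$. For $k\le-2$ the weight itself decays, by $\int E_2\ge\frac3\pi(t-1)$, and
     $k(t-1)\le2-t$ explains the constant $e^2$. *)
  assert (Gdec : exists K', (0 <= K')%R /\ forall t, (1 <= t)%R -> (A < t)%R -> (G t <= K' * exp (- t))%R).
  { destruct Hb as [[h0 h]|[h0 h]].
    - exists (K ^ 2)%R. split; [apply pow2_ge_0|]. intros t t1 tA. specialize (h (axis t) ltac:(rewrite Im_axis; auto)). rewrite Im_axis in h.
      unfold G. rewrite yn. assert (c0 := Cmod_ge_0 (y (axis t))).
      apply Rle_trans with (K ^ 2 * (exp (- (2 * PI * kc k * t)) ^ 2) * exp (PI * k / 3 * EI t))%R.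
      + apply Rmult_le_compat_r; [left; apply exp_pos|]. rewrite <- Rpow_mult_distr. apply pow_incr. split; auto.
      + rewrite Rmult_assoc. apply Rmult_le_compat_l; [apply pow2_ge_0|].
        simpl. rewrite Rmult_1_r, <- !exp_plus.
        assert (u := EIle t t1). unfold kc.
        assert (v : (PI * k / 3 * EI t <= PI * k / 3 * (t - 1))%R) by (apply Rmult_le_compat_l; [|auto]; assert (0 <= PI * k)%R by nra; lra).
        assert (w : (- (2 * PI * ((k + 1) / 6) * t) + - (2 * PI * ((k + 1) / 6) * t) + PI * k / 3 * EI t <= - t)%R).
        { assert (p3 := PI2_3_2). assert (0 <= PI * k)%R by nra. assert (3 * t <= PI * t)%R by (apply Rmult_le_compat_r; lra). 
          replace (- (2 * PI * ((k + 1) / 6) * t) + - (2 * PI * ((k + 1) / 6) * t) + PI * k / 3 * EI t)%R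
            with (- (2 / 3) * (PI * k * t) - 2 / 3 * (PI * t) + PI * k / 3 * EI t)%R by field.
          assert (0 <= PI * k * t)%R by (apply Rmult_le_pos; lra). nra. }
        destruct w as [w|w]; [left; apply exp_increasing; auto|right; f_equal; auto].
    - exists (K ^ 2 * exp 2)%R. split; [apply Rmult_le_pos; [apply pow2_ge_0|left; apply exp_pos]|].
      intros t t1 tA. specialize (h (axis t) ltac:(rewrite Im_axis; auto)).
      unfold G. rewrite yn. assert (c0 := Cmod_ge_0 (y (axis t))).
      apply Rle_trans with (K ^ 2 * exp (PI * k / 3 * EI t))%R.
      + apply Rmult_le_compat_r; [left; apply exp_pos|]. apply pow_incr. split; auto.
      + rewrite Rmult_assoc. apply Rmult_le_compat_l; [apply pow2_ge_0|]. rewrite <- exp_plus.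
        assert (u := EIge t t1).
        assert (v : (PI * k / 3 * EI t <= PI * k / 3 * (3 / PI * (t - 1)))%R).
        { apply Rmult_le_compat_neg_l; [|auto]. assert (PI * k <= 0)%R by nra. lra. }
        replace (PI * k / 3 * (3 / PI * (t - 1)))%R with (k * (t - 1))%R in v by (field; lra).
        assert (w : (PI * k / 3 * EI t <= 2 + - t)%R) by nra.
        destruct w as [w|w]; [left; apply exp_increasing; auto|right; f_equal; auto]. }
  destruct Gdec as [K' [hK' Gd]].
  (* A nondecreasing function bounded by $K'e^{-t}$ cannot be positive: compare at a [t] beyond
     $K'/G(s)$ and use $e^t\ge1+t$. *)
  assert (G0 : forall s, (1 <= s)%R -> (G s <= 0)%R).
  { intros s hs. apply Rnot_lt_le. intros g.
    set (t := (Rmax s (Rmax (A + 1) (K' / G s)))%R).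
    assert (m1 := Rmax_l s (Rmax (A + 1) (K' / G s))). assert (m2 := Rmax_r s (Rmax (A + 1) (K' / G s))).
    assert (m3 := Rmax_l (A + 1) (K' / G s)). assert (m4 := Rmax_r (A + 1) (K' / G s)). fold t in m1, m2.
    assert (q1 := Gmon s t ltac:(lra)). assert (q2 := Gd t ltac:(lra) ltac:(lra)).
    assert (q3 : (K' <= t * G s)%R) by (apply (Rle_div_l K' t (G s) g); lra).
    assert (q4 := exp_ineq1_le t). rewrite exp_Ropp in q2.
    assert (q5 : (0 < exp t)%R) by apply exp_pos.
    assert (q6 : (G s * exp t <= K')%R) by (apply (Rle_div_r (G s) K' (exp t) q5); unfold Rdiv; lra).
    nra. }
  assert (yz : forall s, (1 <= s)%R -> a s = 0%R /\ b s = 0%R).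
  { intros s hs. assert (g := G0 s hs). unfold G in g. assert (u := exp_pos (PI * k / 3 * EI s)).
    assert (u1 := pow2_ge_0 (a s)). assert (u2 := pow2_ge_0 (b s)).
    assert (v : (a s ^ 2 + b s ^ 2 <= 0)%R) by nra.
    split; apply Rsqr_0_uniq; unfold Rsqr; nra. }
  (* The height 2 is interior to $[1,\infty)$, so the derivative vanishes there too and uniqueness
     applies at $2i$. *)
  assert (L2 : forall f : R -> R, (forall s, (1 <= s)%R -> f s = 0%R) -> is_derive f 2 0%R).
  { intros f hf. apply (is_derive_ext_loc (fun _ => 0%R)); [|apply (is_derive_const (K := R_AbsRing) (V := R_NormedModule))].
    exists (mkposreal 1 Rlt_0_1). intros s hs. symmetry. apply hf. assert (q : (Rabs (s - 2) < 1)%R) by exact hs.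
    apply Rabs_def2 in q. lra. }
  destruct (Da 2%R ltac:(lra)) as [d1 d2].
  assert (x1 := is_derive_unique _ _ _ d1). assert (x2 := is_derive_unique _ _ _ d2).
  rewrite (is_derive_unique _ _ _ (L2 a (fun s hs => proj1 (yz s hs)))) in x1.
  rewrite (is_derive_unique _ _ _ (L2 b (fun s hs => proj2 (yz s hs)))) in x2.
  assert (x1' : a1 2%R = 0%R) by nra. assert (x2' : b1 2%R = 0%R) by nra.
  destruct (yz 2%R ltac:(lra)) as [x3 x4].
  intros t ht. apply (Sol_uniq k y y1 (axis 2) HS (hax 2%R ltac:(lra))); auto.
  - rewrite (surjective_pairing (y (axis 2))). unfold RtoC. f_equal; auto.
  - rewrite (surjective_pairing (y1 (axis 2))). unfold RtoC. f_equal; auto.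
Qed.

(** * Transfer of the hypotheses to the holomorphic extensions *)

Lemma mob_diff (a b c d : Z) (s t : C) : (a * d - b * c = 1)%Z -> (0 < Im s)%R -> (0 < Im t)%R ->
  mob a b c d s - mob a b c d t = (s - t) / ((ZC c * s + ZC d) * (ZC c * t + ZC d)).
Proof.
  intros h hs ht. assert (n1 := den_nz a b c d s h hs). assert (n2 := den_nz a b c d t h ht).
  assert (E : ZC a * ZC d - ZC b * ZC c = 1) by (rewrite <- !ZC_mult, <- ZC_sub, h; reflexivity).
  transitivity ((ZC a * ZC d - ZC b * ZC c) * (s - t) / ((ZC c * s + ZC d) * (ZC c * t + ZC d))).
  - unfold mob. field. auto.
  - rewrite E. field. auto.
Qed.

(** The law is known where [f] is holomorphic at both the point and its image. The Moebius map is
    injective and continuous, so nearby points $t+x$ with $x\ne0$ and their images lie in punctured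
    discs where this holds. *)
Lemma gm_fill (N : nat) (k : Q) (w : R) (f : C -> C) : KZ_solution k f -> meromorphic_on_H f ->
  transforms_under_Gamma N w f -> gm N w (fill f).
Proof.
  intros HK Hm [v Hv] a b c d h g1 g2 g3 g4.
  destruct (KZ_ext k f HK Hm) as [y1 [HS HG]].
  set (g := mkSL2Z a b c d h).
  destruct (Hv g (conj g1 (conj g2 (conj g3 g4)))) as [hv Hg].
  exists (v g). split; auto. intros t ht. assert (ht' := Im_mob a b c d t h ht).
  destruct (HG t ht) as [r1 [hr1 Hr1]]. destruct (HG _ ht') as [r2 [hr2 Hr2]].
  destruct (cder_cont _ _ _ (cder_mob a b c d t h ht) r2 hr2) as [d1 [hd1 Hd1]].
  set (r := Rmin (Rmin r1 d1) (Im t)).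
  assert (m1 := Rmin_l (Rmin r1 d1) (Im t)). assert (m2 := Rmin_r (Rmin r1 d1) (Im t)).
  assert (m3 := Rmin_l r1 d1). assert (m4 := Rmin_r r1 d1). fold r in m1, m2.
  assert (hr : (0 < r)%R) by (apply Rmin_pos; [apply Rmin_pos; auto|auto]).
  assert (ss := small_seq_spec r hr).
  destruct (HS t ht) as [e1 _]. destruct (HS _ ht') as [e2 _].
  assert (L1 := CL_shift_small (fun x => fill f (mob a b c d x)) t _ r (cder_comp (fill f) (mob a b c d) t _ _ e2 (cder_mob a b c d t h ht)) hr).
  assert (D := cder_mult (fun x => v g * Crpower (ZC c * x + ZC d) w) (fill f) t _ _ (cder_scal (v g) _ _ _ (cder_Crpower (IZR c) (IZR d) w t ht)) e1).
  assert (L2 := CL_shift_small _ t _ r D hr). cbv beta in L1, L2.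
  apply (CL_unique _ _ _ L1). eapply CL_ext; [|exact L2]. intros n. cbv beta.
  set (x := small_seq r n). destruct (proj2 ss n) as [s1 s2]. fold x in s1, s2.
  assert (htx : (0 < Im (t + x))%R) by (apply Im_disc; lra).
  destruct (Hr1 x ltac:(lra)) as [hol1 q1].
  set (mx := mob a b c d (t + x) - mob a b c d t).
  assert (hmx : (0 < Cmod mx < r2)%R).
  { split; [|apply Hd1; lra]. apply Cmod_gt_0. unfold mx. rewrite mob_diff by auto.
    assert (n1 := den_nz a b c d t h ht). assert (n2 := den_nz a b c d _ h htx).
    intros E. apply (proj2 (Cmod_gt_0 x) s1).
    transitivity ((t + x - t) / ((ZC c * (t + x) + ZC d) * (ZC c * t + ZC d)) * ((ZC c * (t + x) + ZC d) * (ZC c * t + ZC d))).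
    - field. auto.
    - rewrite E. ring. }
  destruct (Hr2 mx hmx) as [hol2 q2].
  replace (mob a b c d t + mx) with (mob a b c d (t + x)) in hol2, q2 by (unfold mx; ring).
  assert (E := Hg (t + x) htx hol1 hol2). change (moebius g (t + x)) with (mob a b c d (t + x)) in E.
  change (autom g (t + x)) with (ZC c * (t + x) + ZC d) in E.
  rewrite <- q1, <- q2, E. reflexivity.
Qed.

Lemma acts_T (k : R) (u v : C -> C) (zeta : C) : zeta <> 0 -> (forall t, (0 < Im t)%R -> u (t + 1) = u t) ->
  (forall t, (0 < Im t)%R -> v (t + 1) = zeta * v t) -> forall n, acts k u v 1 (Z.of_nat n) 0 1 (mk2 1 0 0 (zeta ^ n)).
Proof.
  intros hz hu hv.
  assert (E1 : acts k u v 1 1 0 1 (mk2 1 0 0 zeta)).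
  { split; [reflexivity|]. split; [unfold mdet; simpl; replace (1 * zeta - 0 * 0) with zeta by ring; auto|].
    exists (fun _ => 1). split.
    - intros t ht. split; [apply C10|]. eapply cder_eq; [|apply cder_const]. unfold ZC, Cdiv. ring.
    - intros t ht. assert (E : mob 1 1 0 1 t = t + 1) by (unfold mob, ZC; field).
      rewrite E, hu, hv by auto. simpl. split; ring. }
  induction n as [|n IH].
  - split; [reflexivity|]. split; [unfold mdet; simpl; replace (1 * 1 - 0 * 0) with (RtoC 1) by ring; apply C10|].
    exists (fun _ => 1). split.
    + intros t ht. split; [apply C10|]. eapply cder_eq; [|apply cder_const]. unfold ZC, Cdiv. ring.
    + intros t ht. assert (E : mob 1 (Z.of_nat 0) 0 1 t = t) by (unfold mob, ZC; simpl Z.of_nat; field).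
      rewrite E. simpl. split; ring.
  - assert (P := acts_mul k u v _ _ _ _ _ _ _ _ _ _ IH E1).
    replace (1 * 1 + Z.of_nat n * 0)%Z with 1%Z in P by lia.
    replace (1 * 1 + Z.of_nat n * 1)%Z with (Z.of_nat (S n)) in P by lia.
    replace (0 * 1 + 1 * 0)%Z with 0%Z in P by lia. replace (0 * 1 + 1 * 1)%Z with 1%Z in P by lia.
    replace (mk2 1 0 0 (zeta ^ S n)) with (mmul (mk2 1 0 0 (zeta ^ n)) (mk2 1 0 0 zeta)); [exact P|].
    unfold mmul. simpl. f_equal; ring.
Qed.

Lemma mob_S (t : C) : (0 < Im t)%R -> mob 0 (-1) 1 0 t = - / t.
Proof.
  intros ht. assert (n := nz_H t ht). unfold mob. change (ZC (-1)) with (RtoC (-1)). change (ZC 0) with (RtoC 0). change (ZC 1) with (RtoC 1).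
  replace (RtoC (-1)) with (- RtoC 1) by (rewrite <- RtoC_opp; reflexivity). field. auto.
Qed.

(** Since $-1/\tau$ fixes $i$ with derivative $-1$, the matrix of $S$ times $j(i)$ is, in terms of
    initial data at $i$, triangular with diagonal entries $1$ and $-1$; its trace vanishes. The
    proof expresses the trace through the Wronskian. *)
Lemma S_acts (k : R) (u v : C -> C) : IsBasis k u v -> exists M, acts k u v 0 (-1) 1 0 M /\ m11 M + m22 M = 0.
Proof.
  intros HB. assert (HB' := HB). destruct HB' as [u1 [v1 [Su [Sv HW]]]].
  assert (tz := tpi_nz).
  destruct (Sol_S k u u1 Su) as [z1 Z1]. destruct (Sol_S k v v1 Sv) as [z2 Z2].
  destruct (basis_span k u v _ _ HB Z1) as [a [b Eu]]. destruct (basis_span k u v _ _ HB Z2) as [c [d Ev]].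
  set (j := fun t => Crpower (ZC 1 * t + ZC 0) k).
  assert (jn : forall t, j t <> 0) by (intros; apply Crpower_nz).
  assert (inv : forall t, j t * Crpower (RtoC 1 * t + RtoC 0) (- k) = 1).
  { intros t. unfold j, Crpower. change (ZC 1) with (RtoC 1). change (ZC 0) with (RtoC 0).
    rewrite <- Cexp_plus, <- Cexp_0. f_equal. rewrite RtoC_opp. ring. }
  assert (Ru : forall t, (0 < Im t)%R -> u (- / t) = j t * (a * u t + b * v t)).
  { intros t ht. rewrite <- Eu by auto. rewrite Cmult_assoc, inv. ring. }
  assert (Rv : forall t, (0 < Im t)%R -> v (- / t) = j t * (c * u t + d * v t)).
  { intros t ht. rewrite <- Ev by auto. rewrite Cmult_assoc, inv. ring. }
  assert (Dj : jfac k 1 0 j).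
  { intros t ht. split; [apply jn|]. apply cder_Crpower; auto. }
  assert (hi := Im_Ci). specialize (HW Ci hi).
  assert (Sc : - / Ci = Ci).
  { assert (n := Ci_nz). transitivity ((Ci * Ci) / Ci); [rewrite Ci_sq|]; field; auto. }
  assert (Der : forall (y y1 : C -> C) (p q : C), cder y Ci (two_pi_i * y1 Ci) ->
     (forall t, (0 < Im t)%R -> y (- / t) = j t * (p * u t + q * v t)) ->
     - (two_pi_i * y1 Ci) = RtoC k / Ci * y Ci + j Ci * (two_pi_i * (p * u1 Ci + q * v1 Ci))).
  { intros y y1 p q dy E.
    assert (dy' : cder y (- / Ci) (two_pi_i * y1 Ci)) by (rewrite Sc; exact dy).
    assert (D1 := cder_comp y (fun x => - / x) Ci _ _ dy' (cder_S Ci hi)).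
    assert (D2 := cder_mult _ _ _ _ _ (proj2 (Dj Ci hi)) (cder_plus _ _ _ _ _ (cder_scal p _ _ _ (proj1 (Su Ci hi))) (cder_scal q _ _ _ (proj1 (Sv Ci hi))))).
    assert (D3 : cder (fun x => y (- / x)) Ci (RtoC k * ZC 1 / (ZC 1 * Ci + ZC 0) * j Ci * (p * u Ci + q * v Ci) + j Ci * (p * (two_pi_i * u1 Ci) + q * (two_pi_i * v1 Ci)))).
    { apply (cder_ext_loc (fun x => j x * (p * u x + q * v x)) _ _ _ (Im Ci) hi); [|exact D2].
      intros h hh. symmetry. apply E, Im_disc, hh. }
    assert (F := cder_unique _ _ _ _ D1 D3). rewrite Ci_sq in F.
    assert (G := E Ci hi). rewrite Sc in G. assert (n := Ci_nz).
    transitivity (two_pi_i * y1 Ci * / - (1)); [field; intros Q; apply C10; replace (RtoC 1) with (- - RtoC 1) by ring; rewrite Q; ring|].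
    rewrite F, G. change (ZC 1) with (RtoC 1). change (ZC 0) with (RtoC 0). field.
    replace (1 * Ci + 0) with Ci by ring. auto. }
  assert (Du := Der u u1 a b (proj1 (Su Ci hi)) Ru). assert (Dv := Der v v1 c d (proj1 (Sv Ci hi)) Rv).
  assert (Vu := Ru Ci hi). assert (Vv := Rv Ci hi). rewrite Sc in Vu, Vv.
  set (J := j Ci) in *. assert (Jn : J <> 0) by apply jn.
  set (s := RtoC k / Ci / two_pi_i) in *.
  assert (Du' : J * (a * u1 Ci + b * v1 Ci) = - u1 Ci - s * u Ci).
  { transitivity (/ two_pi_i * (RtoC k / Ci * u Ci + J * (two_pi_i * (a * u1 Ci + b * v1 Ci))) - s * u Ci);
      [unfold s; field; split; auto using Ci_nz|]. rewrite <- Du. field. auto. }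
  assert (Dv' : J * (c * u1 Ci + d * v1 Ci) = - v1 Ci - s * v Ci).
  { transitivity (/ two_pi_i * (RtoC k / Ci * v Ci + J * (two_pi_i * (c * u1 Ci + d * v1 Ci))) - s * v Ci);
      [unfold s; field; split; auto using Ci_nz|]. rewrite <- Dv. field. auto. }
  set (W := u Ci * v1 Ci - u1 Ci * v Ci) in *.
  set (U := u Ci) in *. set (U1 := u1 Ci) in *. set (V := v Ci) in *. set (V1 := v1 Ci) in *.
  assert (Ta : J * a * W = (J * (a * U + b * V)) * V1 - (J * (a * U1 + b * V1)) * V) by (unfold W; ring).
  assert (Td : J * d * W = U * (J * (c * U1 + d * V1)) - U1 * (J * (c * U + d * V))) by (unfold W; ring).
  rewrite <- Vu, Du' in Ta. rewrite <- Vv, Dv' in Td.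
  assert (Tr : (a + d) * (J * W) = 0).
  { transitivity (J * a * W + J * d * W); [ring|]. rewrite Ta, Td. ring. }
  assert (JW : J * W <> 0) by (apply Cmult_neq_0; auto).
  assert (Dt : (a * d - b * c) * (J * J * W) = - W).
  { transitivity ((J * (a * U + b * V)) * (J * (c * U1 + d * V1)) - (J * (a * U1 + b * V1)) * (J * (c * U + d * V))); [unfold W; ring|].
    rewrite <- Vu, <- Vv, Du', Dv'. unfold W. ring. }
  exists (mk2 a b c d). simpl. split.
  - split; [reflexivity|]. split.
    + unfold mdet. simpl. intros E. rewrite E in Dt. apply HW. replace W with (- - W) by ring. rewrite <- Dt. ring.
    + exists j. split; [exact Dj|]. intros t ht. rewrite mob_S by auto. simpl. split; auto.
  - apply Cmult_integral in Tr. tauto.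
Qed.

(** If $y(i)\ne0$ the eigenvalue is normalized by $j(i)\,l=1$; differentiating the eigenvalue
    equation at the fixed point then determines $y_1(i)$. *)
Lemma eigen_at_i (k : R) (y y1 j : C -> C) (l : C) : Sol k y y1 -> jfac k 1 0 j ->
  (forall t, (0 < Im t)%R -> y (mob 0 (-1) 1 0 t) = j t * (l * y t)) ->
  y Ci = 0 \/ y1 Ci = RtoC (k / (4 * PI)) * y Ci.
Proof.
  intros HS Hj H. destruct (classic (y Ci = 0)) as [e|e]; [auto|right].
  assert (tz := tpi_nz). assert (hi := Im_Ci). assert (n := Ci_nz).
  assert (Sc : - / Ci = Ci).
  { transitivity ((Ci * Ci) / Ci); [rewrite Ci_sq|]; field; auto. }
  assert (dy : cder y (- / Ci) (two_pi_i * y1 Ci)) by (rewrite Sc; apply HS, hi).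
  assert (D1 := cder_comp y (fun x => - / x) Ci _ _ dy (cder_S Ci hi)).
  assert (D2 := cder_mult _ _ _ _ _ (proj2 (Hj Ci hi)) (cder_scal l _ _ _ (proj1 (HS Ci hi)))).
  assert (D3 : cder (fun x => y (- / x)) Ci (RtoC k * ZC 1 / (ZC 1 * Ci + ZC 0) * j Ci * (l * y Ci) + j Ci * (l * (two_pi_i * y1 Ci)))).
  { apply (cder_ext_loc (fun x => j x * (l * y x)) _ _ _ (Im Ci) hi); [|exact D2].
    intros h hh. assert (q := Im_disc Ci h hh). rewrite <- H, mob_S by auto. auto. }
  assert (F := cder_unique _ _ _ _ D1 D3). rewrite Ci_sq in F.
  assert (G := H Ci hi). rewrite mob_S, Sc in G by auto.
  assert (L : j Ci * l = 1).
  { transitivity (j Ci * (l * y Ci) / y Ci); [field; auto|]. rewrite <- G. field. auto. }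
  assert (m1 : - (1) <> RtoC 0) by (intros Q; apply C10; replace (RtoC 1) with (- - RtoC 1) by ring; rewrite Q; ring).
  assert (F2 : two_pi_i * y1 Ci * / - (1) = RtoC k / Ci * y Ci + two_pi_i * y1 Ci).
  { rewrite F. change (ZC 1) with (RtoC 1). change (ZC 0) with (RtoC 0).
    transitivity (RtoC k / Ci * (j Ci * l) * y Ci + (j Ci * l) * (two_pi_i * y1 Ci)).
    - field. replace (1 * Ci + 0) with Ci by ring. auto.
    - rewrite L. field. auto. }
  assert (F3 : two_pi_i * y1 Ci = - (/ 2) * (RtoC k / Ci * y Ci)).
  { transitivity (- (/ 2) * ((RtoC k / Ci * y Ci + two_pi_i * y1 Ci) - two_pi_i * y1 Ci)); [|f_equal; ring].
    rewrite <- F2. field. }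
  transitivity (/ two_pi_i * (two_pi_i * y1 Ci)); [field; auto|]. rewrite F3.
  assert (pz : RtoC PI <> 0) by (apply RtoC_nz; assert (p := PI_RGT_0); lra).
  unfold two_pi_i. rewrite !RtoC_div, !RtoC_mult by (assert (p := PI_RGT_0); lra).
  transitivity (- RtoC k * y Ci / (4 * RtoC PI * (Ci * Ci))); [|rewrite Ci_sq]; field; auto.
Qed.

(** * Two by two matrices *)

Definition PD (P M : M2) : Prop := m12 (mmul P (mmul M (madj P))) = 0 /\ m21 (mmul P (mmul M (madj P))) = 0.

(** Writes [M] as the adjugate of [P] times a diagonal matrix times [P], entry by entry, so that the
    consequences of diagonalizability become polynomial identities. *)
Lemma PD_form (P M : M2) : mdet P <> 0 -> PD P M -> exists e1 e2,
  M = mk2 (m22 P * m11 P * e1 - m12 P * m21 P * e2) (m22 P * m12 P * e1 - m12 P * m22 P * e2)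
          (- m21 P * m11 P * e1 + m11 P * m21 P * e2) (- m21 P * m12 P * e1 + m11 P * m22 P * e2).
Proof.
  intros hP [h1 h2]. destruct P as [p q r s], M as [a b c d]. unfold mdet, mmul, madj in *. simpl in *.
  set (D := p * s - q * r) in *.
  exists ((p * (a * s + b * - r) + q * (c * s + d * - r)) / (D * D)), ((r * (a * - q + b * p) + s * (c * - q + d * p)) / (D * D)).
  set (X := p * (a * - q + b * p) + q * (c * - q + d * p)) in *. set (Y := r * (a * s + b * - r) + s * (c * s + d * - r)) in *.
  f_equal.
  - transitivity ((s * p * (p * (a * s + b * - r) + q * (c * s + d * - r)) - q * r * (r * (a * - q + b * p) + s * (c * - q + d * p)) + s * r * X - q * p * Y) / (D * D)).
    + unfold X, Y, D in *. field. auto.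
    + rewrite h1, h2. unfold D in *. field. auto.
  - transitivity ((s * q * (p * (a * s + b * - r) + q * (c * s + d * - r)) - q * s * (r * (a * - q + b * p) + s * (c * - q + d * p)) + s * s * X - q * q * Y) / (D * D)).
    + unfold X, Y, D in *. field. auto.
    + rewrite h1, h2. unfold D in *. field. auto.
  - transitivity ((- r * p * (p * (a * s + b * - r) + q * (c * s + d * - r)) + p * r * (r * (a * - q + b * p) + s * (c * - q + d * p)) - r * r * X + p * p * Y) / (D * D)).
    + unfold X, Y, D in *. field. auto.
    + rewrite h1, h2. unfold D in *. field. auto.
  - transitivity ((- r * q * (p * (a * s + b * - r) + q * (c * s + d * - r)) + p * s * (r * (a * - q + b * p) + s * (c * - q + d * p)) - r * s * X + p * q * Y) / (D * D)).
    + unfold X, Y, D in *. field. auto.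
    + rewrite h1, h2. unfold D in *. field. auto.
Qed.

Lemma PD_comm (P M M' : M2) : mdet P <> 0 -> PD P M -> PD P M' -> mmul M M' = mmul M' M.
Proof.
  intros hP h h'. destruct (PD_form P M hP h) as [e1 [e2 E]]. destruct (PD_form P M' hP h') as [e3 [e4 E']].
  rewrite E, E'. unfold mmul. simpl. f_equal; ring.
Qed.

(** The hypotheses make the discriminant $(m_{11}-m_{22})^2+4m_{12}m_{21}$ vanish; a diagonalizable
    matrix with a double eigenvalue is scalar. *)
Lemma PD_unip (P M : M2) : mdet P <> 0 -> PD P M -> m11 M = m22 M -> m12 M * m21 M = 0 -> m12 M = 0 /\ m21 M = 0.
Proof.
  intros hP h hd h0. destruct (PD_form P M hP h) as [e1 [e2 E]]. rewrite E in *. destruct P as [p q r s]. unfold mdet in hP. simpl in *.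
  assert (Z : (p * s - q * r) * (p * s - q * r) * ((e1 - e2) * (e1 - e2)) = 0).
  { transitivity (((s * p * e1 - q * r * e2) - (- r * q * e1 + p * s * e2)) * ((s * p * e1 - q * r * e2) - (- r * q * e1 + p * s * e2))
     + 4 * ((s * q * e1 - q * s * e2) * (- r * p * e1 + p * r * e2))).
    - replace (RtoC 4) with (1 + 1 + (1 + 1)) by (rewrite <- !RtoC_plus; f_equal; ring). ring.
    - rewrite h0, hd. ring. }
  apply Cmult_integral in Z. destruct Z as [Z|Z]; [apply Cmult_integral in Z; tauto|].
  assert (e : e1 - e2 = 0) by (apply Cmult_integral in Z; tauto).
  split; [transitivity (s * q * (e1 - e2)); [ring|]|transitivity (- r * p * (e1 - e2)); [ring|]]; rewrite e; ring.
Qed.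

Lemma basis_matrix (k : R) (u v f g : C -> C) : IsBasis k u v -> IsBasis k f g -> exists p q r s : C,
  p * s - q * r <> 0 /\ (forall t, (0 < Im t)%R -> f t = p * u t + q * v t) /\ (forall t, (0 < Im t)%R -> g t = r * u t + s * v t).
Proof.
  intros HB HF. assert (HF' := HF). destruct HF' as [f1 [g1 [Sf [Sg _]]]].
  destruct (basis_span k u v f f1 HB Sf) as [p [q E1]]. destruct (basis_span k u v g g1 HB Sg) as [r [s E2]].
  exists p, q, r, s. split; auto. intros E.
  assert (X : forall x y : C, (forall t, (0 < Im t)%R -> x * f t + y * g t = 0) -> x = 0 /\ y = 0).
  { intros x y. apply (basis_indep k f g x y HF). }
  destruct (X s (- q)) as [s0 q0].
  { intros t ht. rewrite E1, E2 by auto. transitivity ((p * s - q * r) * u t); [ring|rewrite E; ring]. }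
  destruct (X r (- p)) as [r0 p0].
  { intros t ht. rewrite E1, E2 by auto. transitivity (- (p * s - q * r) * v t); [ring|rewrite E; ring]. }
  destruct (X 0 1) as [_ o].
  - intros t ht. rewrite E2, s0, r0 by auto. ring.
  - exact (C10 o).
Qed.

(* From (ST)^3 = -1; the other alternative is ST scalar, i.e. y = z = 0 and zeta = -1. *)
Lemma ST_rel (k : R) (u v : C -> C) (zeta x y z w : C) : IsBasis k u v -> zeta <> 0 -> zeta + 1 <> 0 ->
  acts k u v 0 (-1) 1 0 (mk2 x y z w) -> x + w = 0 -> acts k u v 1 1 0 1 (mk2 1 0 0 zeta) ->
  w = - x /\ x * x + y * z <> 0 /\ x * x * (1 - zeta + zeta * zeta) + y * z * zeta = 0.
Proof.
  intros HB hz hz1 HS hw HT. assert (ew : w = - x) by (replace w with (x + w - x) by ring; rewrite hw; ring). subst w.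
  assert (hd : x * x + y * z <> 0).
  { destruct HS as [_ [hd _]]. intros E. apply hd. unfold mdet. simpl. replace (x * - x - y * z) with (- (x * x + y * z)) by ring. rewrite E. ring. }
  split; auto. split; auto.
  assert (HU := acts_mul k u v _ _ _ _ _ _ _ _ _ _ HS HT).
  assert (HU3 := acts_mul k u v _ _ _ _ _ _ _ _ _ _ HU (acts_mul k u v _ _ _ _ _ _ _ _ _ _ HU HU)).
  assert (H3 : acts k u v (-1) 0 0 (-1) (mmul (mmul (mk2 x y z (- x)) (mk2 1 0 0 zeta)) (mmul (mmul (mk2 x y z (- x)) (mk2 1 0 0 zeta)) (mmul (mk2 x y z (- x)) (mk2 1 0 0 zeta))))) by exact HU3.
  destruct (acts_pm1 k u v (-1) _ HB H3) as [h1 [h2 h3]]. unfold mmul in h1, h2, h3. simpl in h1, h2, h3.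
  set (X := x * x * (1 - zeta + zeta * zeta) + y * z * zeta).
  assert (i1 : X * (y * zeta) = 0) by (rewrite <- h1; unfold X; ring).
  assert (i2 : X * z = 0) by (rewrite <- h2; unfold X; ring).
  assert (i3 : X * (x * (1 + zeta)) = 0).
  { match type of h3 with ?l = ?r => transitivity (l - r); [unfold X; ring|rewrite h3; ring] end. }
  apply NNPP. intros hX.
  assert (y0 : y = 0) by (apply Cmult_integral in i1; destruct i1 as [i|i]; [tauto|apply Cmult_integral in i; tauto]).
  assert (x0 : x = 0).
  { apply Cmult_integral in i3. destruct i3 as [i|i]; [tauto|]. apply Cmult_integral in i. destruct i as [i|i]; auto.
    exfalso. apply hz1. rewrite <- i. ring. }
  apply hd. rewrite x0, y0. ring.
Qed.

(** * The multiplier matrices of the principal congruence subgroup *)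

Definition GPD (N : nat) (k : R) (u v : C -> C) (P : M2) : Prop := forall (a b c d : Z) (M : M2),
  (Z.of_nat N | a - 1)%Z -> (Z.of_nat N | b)%Z -> (Z.of_nat N | c)%Z -> (Z.of_nat N | d - 1)%Z ->
  acts k u v a b c d M -> PD P M.

Lemma acts_eq (k : R) (u v : C -> C) (a b c d a' b' c' d' : Z) (M M' : M2) : acts k u v a b c d M ->
  a = a' -> b = b' -> c = c' -> d = d' -> M = M' -> acts k u v a' b' c' d' M'.
Proof. intros; subst; auto. Qed.

Lemma gamma_PD (N : nat) (k w1 w2 : R) (f g u v : C -> C) (p q r s : C) : (1 <= N)%nat ->
  IsBasis k f g -> gm N w1 f -> gm N w2 g -> p * s - q * r <> 0 ->
  (forall t, (0 < Im t)%R -> f t = p * u t + q * v t) -> (forall t, (0 < Im t)%R -> g t = r * u t + s * v t) ->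
  GPD N k u v (mk2 p q r s).
Proof.
  intros hN HB G1 G2 hP E1 E2 a b c d M ha hb hc hd H.
  assert (A := acts_change k u v p q r s a b c d M hP H).
  refine (gamma_diag N k w1 w2 f g a b c d _ hN HB G1 G2 ha hb hc hd _).
  destruct A as [dt [hm [j [hj A]]]]. split; [exact dt|]. split; [exact hm|]. exists j. split; [exact hj|].
  intros t ht. rewrite (E1 (mob a b c d t)), (E2 (mob a b c d t)), (E1 t), (E2 t) by auto using Im_mob. apply A, ht.
Qed.

(** If $A\,\mathrm{adj}(B)$ is scalar then [A] is proportional to [B]: two words agreeing modulo [N]
    have proportional matrices. *)
Lemma mmul_adj_scalar (A B : M2) : m12 (mmul A (madj B)) = 0 -> m21 (mmul A (madj B)) = 0 ->
  m11 (mmul A (madj B)) = m22 (mmul A (madj B)) -> mdet A <> 0 -> mdet B <> 0 ->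
  exists l : C, l <> 0 /\ m11 A = l * m11 B /\ m12 A = l * m12 B /\ m21 A = l * m21 B /\ m22 A = l * m22 B.
Proof.
  destruct A as [a b c d], B as [a' b' c' d']. unfold mdet. simpl. intros h1 h2 h3 hA hB.
  set (D := a' * d' - b' * c') in *. set (L := a * d' + b * - c') in *.
  assert (e1 : D * a = L * a').
  { transitivity (L * a' + c' * (a * - b' + b * a')); [unfold D, L; ring|]. rewrite h1. ring. }
  assert (e2 : D * b = L * b').
  { transitivity (L * b' + d' * (a * - b' + b * a')); [unfold D, L; ring|]. rewrite h1. ring. }
  assert (e3 : D * c = L * c').
  { rewrite h3. transitivity ((c * - b' + d * a') * c' + a' * (c * d' + d * - c')); [unfold D; ring|]. rewrite h2. ring. }
  assert (e4 : D * d = L * d').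
  { rewrite h3. transitivity ((c * - b' + d * a') * d' + b' * (c * d' + d * - c')); [unfold D; ring|]. rewrite h2. ring. }
  exists (L / D). split.
  - intros E. apply hA. assert (L0 : L = 0) by (transitivity (L / D * D); [field; auto|rewrite E; ring]).
    rewrite L0 in *.
    assert (Z : forall x y : C, D * x = 0 * y -> x = 0).
    { intros x y e. rewrite Cmult_0_l in e. apply Cmult_integral in e. tauto. }
    rewrite (Z _ _ e1), (Z _ _ e2). ring.
  - repeat split; [transitivity (D * a / D)|transitivity (D * b / D)|transitivity (D * c / D)|transitivity (D * d / D)];
      try (field; auto); rewrite ?e1, ?e2, ?e3, ?e4; field; auto.
Qed.

Lemma one_minus_nz (a : C) : a <> 1 -> 1 - a <> 0.
Proof. intros h E. apply h. replace a with (1 - (1 - a)) by ring. rewrite E. ring. Qed.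

Section Monodromy.

Variables (N : nat) (k : R) (u v : C -> C) (P : M2) (zeta x y z : C).
Hypothesis hN : (1 <= N)%nat.
Hypothesis hB : IsBasis k u v.
Hypothesis hP : mdet P <> 0.
Hypothesis hG : GPD N k u v P.
Hypothesis z0 : zeta <> 0.
Hypothesis z1 : zeta <> 1.
Hypothesis zm1 : zeta + 1 <> 0.
Hypothesis hT : forall n : nat, acts k u v 1 (Z.of_nat n) 0 1 (mk2 1 0 0 (zeta ^ n)).
Hypothesis hS : acts k u v 0 (-1) 1 0 (mk2 x y z (- x)).
Hypothesis hd : x * x + y * z <> 0.
Hypothesis hR : x * x * (1 - zeta + zeta * zeta) + y * z * zeta = 0.

(* With N = 2^al R, R odd, the commutator of T^(3R) and S T^(2^(al+1)) S lies in Gamma(N) and acts,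
   up to a scalar, by a nontrivial unipotent matrix. *)
Lemma not_triangular : y * z = 0 -> y = 0 /\ z = 0.
Proof.
  intros hyz. rewrite hyz in hd, hR.
  assert (hx : x <> 0) by (intros E; apply hd; rewrite E; ring).
  assert (hz : 1 - zeta + zeta * zeta = 0).
  { assert (q : x * (x * (1 - zeta + zeta * zeta)) = 0) by (rewrite <- hR; ring).
    apply Cmult_integral in q. destruct q as [q|q]; [tauto|]. apply Cmult_integral in q. tauto. }
  assert (Fac : exists al R : nat, N = (2 ^ al * (2 * R + 1))%nat).
  { clear - hN. induction N as [n IH] using (well_founded_induction lt_wf).
    destruct (Nat.Even_or_Odd n) as [[m e]|[m e]].
    - destruct (IH m) as [al [R E]]; [lia|lia|]. exists (S al), R. rewrite e, E. simpl. lia.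
    - exists 0%nat, m. simpl. lia. }
  destruct Fac as [al [R EN]].
  (* As $\zeta$ is a primitive sixth root of unity, the odd multiple [n] of 3 gives $\zeta^n=-1$ and
     the power [m] of 2 gives a primitive cube root $\omega$, while $nm=6N$. *)
  set (n := (3 * (2 * R + 1))%nat). set (m := (2 ^ S al)%nat).
  assert (Enm : (Z.of_nat n * Z.of_nat m = 6 * Z.of_nat N)%Z).
  { rewrite <- Nat2Z.inj_mul. unfold n, m. rewrite EN. simpl (2 ^ S al)%nat. lia. }
  assert (hn : zeta ^ n = - (1)).
  { unfold n. rewrite Cpow_mult_r. replace (zeta ^ 3) with (- RtoC 1).
    - rewrite Cpow_add_r, Cpow_1_r, Cpow_mult_r. replace ((- RtoC 1) ^ 2) with (RtoC 1) by (simpl; ring). rewrite Cpow_1_l. ring.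
    - simpl. transitivity ((zeta + 1) * (1 - zeta + zeta * zeta) - 1); [rewrite hz; ring|ring]. }
  set (om := zeta ^ m).
  assert (hom : om * om + om + 1 = 0).
  { unfold om, m. clear - hz. induction al as [|al IH].
    - simpl. transitivity ((1 - zeta + zeta * zeta) * (1 + zeta + zeta * zeta)); [ring|rewrite hz; ring].
    - rewrite Nat.pow_succ_r', Nat.mul_comm, Cpow_mult_r. set (o := zeta ^ 2 ^ S al) in *. simpl.
      transitivity ((o * o + o + 1) * (o * o - o + 1)); [ring|rewrite IH; ring]. }
  assert (om1 : om <> 1).
  { intros E. rewrite E in hom. apply (RtoC_nz 3); [lra|]. rewrite <- hom, <- !RtoC_mult, <- !RtoC_plus. f_equal. ring. }
  assert (om0 : om <> 0) by (apply Cpow_nz, z0).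
  assert (hQ := acts_mul k u v _ _ _ _ _ _ _ _ _ _ (acts_mul k u v _ _ _ _ _ _ _ _ _ _ hS (hT m)) hS).
  assert (h1 := acts_mul k u v _ _ _ _ _ _ _ _ _ _ (hT n) hQ).
  assert (h2 := acts_mul k u v _ _ _ _ _ _ _ _ _ _ hQ (hT n)).
  assert (h := acts_mul k u v _ _ _ _ _ _ _ _ _ _ h1 (acts_inv k u v _ _ _ _ _ h2)).
  rewrite hn in h. fold om in h. unfold mmul, madj in h. simpl m11 in h. simpl m12 in h. simpl m21 in h. simpl m22 in h.
  set (Zn := Z.of_nat n) in *. set (Zm := Z.of_nat m) in *.
  (* Every entry differs from that of the identity by a multiple of $nm$. On the matrix side $yz=0$
     leaves equal diagonal entries and off-diagonal entries that are nonzero multiples of $y$ and of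
     $z$. *)
  assert (h' : acts k u v (1 + (Zn * Zm) * (Zn * Zm - 1)) ((Zn * Zm) * Zn) ((Zn * Zm) * Zm) (1 + Zn * Zm)
    (mk2 (- (x * x * x * x * om)) (2 * (x * x * x * (1 - om)) * y) (2 * (x * x * x * om * (1 - om)) * z) (- (x * x * x * x * om)))).
  { apply (acts_eq k u v _ _ _ _ _ _ _ _ _ _ h); try ring.
    replace (RtoC 2) with (RtoC 1 + 1) by (rewrite <- RtoC_plus; f_equal; ring).
    destruct (Cmult_integral y z hyz) as [E|E]; rewrite E; f_equal; ring. }
  assert (dv : forall q, (Z.of_nat N | (Zn * Zm) * q)%Z) by (intros q; exists (6 * q)%Z; rewrite Enm; ring).
  assert (pd : PD P (mk2 (- (x * x * x * x * om)) (2 * (x * x * x * (1 - om)) * y) (2 * (x * x * x * om * (1 - om)) * z) (- (x * x * x * x * om)))).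
  { refine (hG _ _ _ _ _ _ _ _ _ h'); try apply dv.
    - replace (1 + Zn * Zm * (Zn * Zm - 1) - 1)%Z with ((Zn * Zm) * (Zn * Zm - 1))%Z by ring. apply dv.
    - replace (1 + Zn * Zm - 1)%Z with (Zn * Zm * 1)%Z by ring. apply dv. }
  assert (n2 : RtoC 2 <> 0) by (apply RtoC_nz; lra).
  assert (o1 := one_minus_nz om om1).
  destruct (PD_unip P _ hP pd) as [q1 q2]; simpl in *; auto.
  - transitivity (2 * (x * x * x * (1 - om)) * (2 * (x * x * x * om * (1 - om))) * (y * z)); [ring|rewrite hyz; ring].
  - split.
    + apply Cmult_integral in q1. destruct q1 as [q|q]; auto. exfalso. revert q. repeat apply Cmult_neq_0; auto.
    + apply Cmult_integral in q2. destruct q2 as [q|q]; auto. exfalso. revert q. repeat apply Cmult_neq_0; auto.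
Qed.

(** $\Gamma(N)$ is normal, so [M] commutes with its conjugates by $T$ and by $S$. The first relation
    makes [M] scalar or diagonal with distinct entries; in the latter case the second one forces
    $xy=0$, which the relation [hR] forbids. *)
Lemma gamma_scalar : y * z <> 0 -> forall (a b c d : Z) (M : M2),
  (Z.of_nat N | a - 1)%Z -> (Z.of_nat N | b)%Z -> (Z.of_nat N | c)%Z -> (Z.of_nat N | d - 1)%Z ->
  acts k u v a b c d M -> m12 M = 0 /\ m21 M = 0 /\ m11 M = m22 M.
Proof.
  intros hyz a b c d M ha hb hc hd0 H.
  assert (pd := hG _ _ _ _ _ ha hb hc hd0 H).
  assert (hT1 := hT 1). rewrite Cpow_1_r in hT1.
  assert (s1 := one_minus_nz zeta z1).
  assert (HT := acts_mul k u v _ _ _ _ _ _ _ _ _ _ (acts_mul k u v _ _ _ _ _ _ _ _ _ _ hT1 H) (acts_inv k u v _ _ _ _ _ hT1)).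
  assert (HS := acts_mul k u v _ _ _ _ _ _ _ _ _ _ (acts_mul k u v _ _ _ _ _ _ _ _ _ _ hS H) (acts_inv k u v _ _ _ _ _ hS)).
  assert (pdT : PD P (mmul (mmul (mk2 1 0 0 zeta) M) (madj (mk2 1 0 0 zeta)))).
  { refine (hG _ _ _ _ _ _ _ _ _ HT); simpl Z.of_nat.
    - replace ((1 * a + 1 * c) * 1 + (1 * b + 1 * d) * - 0 - 1)%Z with (a - 1 + c)%Z by ring. apply Z.divide_add_r; auto.
    - replace ((1 * a + 1 * c) * - (1) + (1 * b + 1 * d) * 1)%Z with (b + (d - 1) - ((a - 1) + c))%Z by ring.
      apply Z.divide_sub_r; apply Z.divide_add_r; auto.
    - replace ((0 * a + 1 * c) * 1 + (0 * b + 1 * d) * - 0)%Z with c by ring. auto.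
    - replace ((0 * a + 1 * c) * - (1) + (0 * b + 1 * d) * 1 - 1)%Z with ((d - 1) - c)%Z by ring. apply Z.divide_sub_r; auto. }
  assert (pdS : PD P (mmul (mmul (mk2 x y z (- x)) M) (madj (mk2 x y z (- x))))).
  { refine (hG _ _ _ _ _ _ _ _ _ HS).
    - match goal with |- (_ | ?e)%Z => replace e with (d - 1)%Z by ring end. auto.
    - match goal with |- (_ | ?e)%Z => replace e with (- c)%Z by ring end. apply Z.divide_opp_r. auto.
    - match goal with |- (_ | ?e)%Z => replace e with (- b)%Z by ring end. apply Z.divide_opp_r. auto.
    - match goal with |- (_ | ?e)%Z => replace e with (a - 1)%Z by ring end. auto. }
  assert (cT := PD_comm P _ _ hP pd pdT). assert (cS := PD_comm P _ _ hP pd pdS).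
  destruct M as [A B C0 D]. unfold mmul, madj in cT, cS. simpl in cT, cS |- *.
  assert (t1 := f_equal m11 cT). assert (t2 := f_equal m12 cT). assert (t3 := f_equal m21 cT).
  assert (r2 := f_equal m12 cS). simpl in t1, t2, t3, r2. clear cT cS pdT pdS.
  assert (n2 : zeta * zeta - 1 <> 0).
  { replace (zeta * zeta - 1) with (- ((1 - zeta) * (zeta + 1))) by ring. intros E.
    apply (Cmult_neq_0 _ _ s1 zm1). transitivity (- - ((1 - zeta) * (zeta + 1))); [ring|rewrite E; ring]. }
  assert (sb : forall l r : C, l = r -> l - r = 0) by (intros l r E; rewrite E; ring).
  apply sb in t1, t2, t3, r2.
  assert (e1 : B * C0 = 0).
  { assert (q : (zeta * zeta - 1) * (B * C0) = 0) by (rewrite <- t1; ring). apply Cmult_integral in q. tauto. }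
  assert (e2 : B * (A - D) = 0).
  { assert (q : (1 - zeta) * (B * (A - D)) = 0) by (rewrite <- t2; ring). apply Cmult_integral in q. tauto. }
  assert (e3 : C0 * (A - D) = 0).
  { assert (q : zeta * (1 - zeta) * (C0 * (A - D)) = 0) by (rewrite <- t3; ring). apply Cmult_integral in q.
    destruct q as [q|q]; auto. exfalso. exact (Cmult_neq_0 _ _ z0 s1 q). }
  destruct (classic (A - D = 0)) as [E|E].
  - assert (AD : A = D) by (replace A with (A - D + D) by ring; rewrite E; ring).
    destruct (PD_unip P _ hP pd AD e1). auto.
  - exfalso. apply Cmult_integral in e2, e3. destruct e2 as [B0|]; [|tauto]. destruct e3 as [C1|]; [|tauto].
    rewrite B0, C1 in r2.
    assert (q : (A - D) * (A - D) * (x * y) = 0) by (transitivity (- - ((A - D) * (A - D) * (x * y))); [ring|]; transitivity (- RtoC 0); [f_equal; rewrite <- r2; ring|ring]).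
    apply Cmult_integral in q. destruct q as [q|q]; [exact (Cmult_neq_0 _ _ E E q)|].
    assert (x0 : x = 0).
    { apply Cmult_integral in q. destruct q as [q|q]; auto. exfalso. apply hyz. rewrite q. ring. }
    rewrite x0 in hR. apply (Cmult_neq_0 _ _ hyz z0). rewrite <- hR. ring.
Qed.

Lemma zeta_pow_N : y * z <> 0 -> zeta ^ N = 1.
Proof.
  intros hyz. assert (d0 : (Z.of_nat N | 1 - 1)%Z) by apply Z.divide_0_r.
  destruct (gamma_scalar hyz _ _ _ _ _ d0 (Z.divide_refl _) (Z.divide_0_r _) d0 (hT N)) as [_ [_ E]]. simpl in E. auto.
Qed.

(* The matrix D = T^a S T^b S T^a S is congruent to diag(-a, -b) modulo N, so D T and T^(a^2) D agree modulo N. *)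
Lemma unit_relation : y * z <> 0 -> forall a b w : nat, (a * b = 1 + N * w)%nat ->
  zeta + / zeta - 1 <> 0 /\
  (zeta ^ a + / zeta ^ a = zeta + / zeta \/ (zeta + / zeta - 1) * (zeta ^ a + / zeta ^ a - 1) = 1).
Proof.
  intros hyz a b w hab. assert (zN := zeta_pow_N hyz).
  assert (hT1 := hT 1). rewrite Cpow_1_r in hT1.
  set (et := zeta ^ a). set (th := zeta ^ b).
  assert (et0 : et <> 0) by (apply Cpow_nz, z0). assert (th0 : th <> 0) by (apply Cpow_nz, z0).
  assert (zab : zeta ^ (a * b) = zeta).
  { rewrite hab, Cpow_add_r, Cpow_1_r, Cpow_mult_r, zN, Cpow_1_l. ring. }
  (* This identifies $-yz/x^2$ with $2\cos(2\pi s)-1$ for $\zeta=e^{2\pi is}$, so the claim is a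
     statement about cosines. *)
  assert (cz : y * z = - (x * x) * (zeta + / zeta - 1)).
  { transitivity ((x * x * (1 - zeta + zeta * zeta) + y * z * zeta) / zeta - (x * x) * (zeta + / zeta - 1)); [field; auto|rewrite hR; field; auto]. }
  assert (cnz : zeta + / zeta - 1 <> 0) by (intros E; apply hyz; rewrite cz, E; ring).
  split; [exact cnz|].
  assert (xnz : x * x <> 0) by (intros E; apply hyz; rewrite cz, E; ring).
  assert (x0 : x <> 0) by (intros E; apply xnz; rewrite E; ring).
  assert (y0 : y <> 0) by (intros E; apply hyz; rewrite E; ring).
  set (D := mmul (mmul (mk2 1 0 0 et) (mk2 x y z (- x))) (mmul (mmul (mk2 1 0 0 th) (mk2 x y z (- x))) (mmul (mk2 1 0 0 et) (mk2 x y z (- x))))).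
  assert (hTS : forall n, acts k u v (Z.of_nat n) (-1) 1 0 (mmul (mk2 1 0 0 (zeta ^ n)) (mk2 x y z (- x)))).
  { intros n. apply (acts_eq k u v _ _ _ _ _ _ _ _ _ _ (acts_mul k u v _ _ _ _ _ _ _ _ _ _ (hT n) hS)); try ring; reflexivity. }
  assert (hD : acts k u v (Z.of_nat a * (Z.of_nat a * Z.of_nat b - 1) - Z.of_nat a) (1 - Z.of_nat a * Z.of_nat b) (Z.of_nat a * Z.of_nat b - 1) (- Z.of_nat b) D).
  { apply (acts_eq k u v _ _ _ _ _ _ _ _ _ _ (acts_mul k u v _ _ _ _ _ _ _ _ _ _ (hTS a) (acts_mul k u v _ _ _ _ _ _ _ _ _ _ (hTS b) (hTS a)))); try ring; reflexivity. }
  assert (h1 := acts_mul k u v _ _ _ _ _ _ _ _ _ _ hD hT1).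
  assert (h2 := acts_mul k u v _ _ _ _ _ _ _ _ _ _ (hT (a * a)%nat) hD).
  assert (h := acts_mul k u v _ _ _ _ _ _ _ _ _ _ h1 (acts_inv k u v _ _ _ _ _ h2)).
  rewrite Nat2Z.inj_mul in h. change (Z.of_nat 1) with 1%Z in h.
  assert (he : (Z.of_nat N | Z.of_nat a * Z.of_nat b - 1)%Z) by (exists (Z.of_nat w); nia).
  set (Za := Z.of_nat a) in *. set (Zb := Z.of_nat b) in *.
  assert (dv : forall q, (Z.of_nat N | (Za * Zb - 1) * q)%Z) by (intros q; apply Z.divide_mul_l; auto).
  destruct h1 as [_ [dt1 _]]. destruct h2 as [_ [dt2 _]].
  set (p := (Za * (Za * Zb - 1) - Za)%Z) in *. set (e := (Za * Zb - 1)%Z) in *.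
  refine (let q := gamma_scalar hyz _ _ _ _ _ _ _ _ _ h in _).
  Unshelve.
  2: match goal with |- (_ | ?r)%Z => replace r with (e * (e + 1 - Za * Zb - p))%Z by (unfold p, e; ring) end; apply dv.
  2: match goal with |- (_ | ?r)%Z => replace r with (e * ((p - e) * (Za * Za) + 2 * p * Za))%Z by (unfold p, e; ring) end; apply dv.
  2: match goal with |- (_ | ?r)%Z => replace r with (e * (- e))%Z by (unfold p, e; ring) end; apply dv.
  2: match goal with |- (_ | ?r)%Z => replace r with (e * (e + p + Za * Za * e + 1 - Za * Zb))%Z by (unfold p, e; ring) end; apply dv.
  clearbody q. clear h. destruct q as [g1 [g2 g3]].
  destruct (mmul_adj_scalar _ _ g1 g2 g3 dt1 dt2) as [l [l0 [q1 [q2 [q3 q4]]]]].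
  clear g1 g2 g3 dt1 dt2.
  destruct hD as [_ [dtD _]].
  set (ps := zeta ^ (a * a)) in *.
  assert (hb : ps ^ b = et).
  { unfold ps. rewrite <- Cpow_mult_r. replace (a * a * b)%nat with (a * b * a)%nat by ring. rewrite Cpow_mult_r, zab. reflexivity. }
  assert (dA : m11 D = x * (x * x + y * z * (et + th - et * th))) by (unfold D, mmul; simpl; ring).
  assert (dB : m12 D = y * (x * x * (1 - et) + th * (y * z + et * (x * x)))) by (unfold D, mmul; simpl; ring).
  clearbody D. destruct D as [A B C0 E]. unfold mdet in dtD. simpl in q1, q2, q3, q4, dA, dB, dtD.
  assert (r1 : (1 - l) * A = 0).
  { transitivity ((A * 1 + B * 0) - l * (1 * A + 0 * C0)); [ring|rewrite q1; ring]. }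
  assert (r2 : (zeta - l) * B = 0).
  { transitivity ((A * 0 + B * zeta) - l * (1 * B + 0 * E)); [ring|rewrite q2; ring]. }
  assert (r3 : (1 - l * ps) * C0 = 0).
  { transitivity ((C0 * 1 + E * 0) - l * (0 * A + ps * C0)); [ring|rewrite q3; ring]. }
  assert (r4 : (zeta - l * ps) * E = 0).
  { transitivity ((C0 * 0 + E * zeta) - l * (0 * B + ps * E)); [ring|rewrite q4; ring]. }
  assert (sb : forall s t : C, s - t = 0 -> s = t) by (intros s t h; replace s with (s - t + t) by ring; rewrite h; ring).
  (* [D T] is proportional to $T^{a^2}D$ with distinct eigenvalues of $T$, so [D] is diagonal or
     antidiagonal. The vanishing of the upper left entry gives the product relation, that of the
     upper right entry the equality. *)
  destruct (classic (A = 0)) as [A0|A0].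
  - right.
    assert (B0 : B <> 0) by (intros h; apply dtD; rewrite A0, h; ring).
    assert (C1 : C0 <> 0) by (intros h; apply dtD; rewrite A0, h; ring).
    assert (el : zeta = l) by (apply Cmult_integral in r2; destruct r2 as [r|r]; [apply sb, r|tauto]).
    assert (ep : RtoC 1 = l * ps) by (apply Cmult_integral in r3; destruct r3 as [r|r]; [apply sb, r|tauto]).
    assert (eb : th * et = 1).
    { rewrite <- hb. unfold th. rewrite <- Cpow_mult_l. replace (zeta * ps) with (RtoC 1) by (rewrite el; exact ep). apply Cpow_1_l. }
    assert (eth : th = / et) by (transitivity (th * et / et); [field; auto|rewrite eb; field; auto]).
    rewrite A0 in dA. symmetry in dA. apply Cmult_integral in dA. destruct dA as [|dA]; [tauto|].
    rewrite cz in dA.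
    assert (dA' : x * x * (1 - (zeta + / zeta - 1) * (et + / et - 1)) = 0).
    { rewrite <- dA, eth. field. auto. }
    apply Cmult_integral in dA'. destruct dA' as [|dA']; [tauto|]. symmetry. apply sb, dA'.
  - left.
    assert (el : RtoC 1 = l) by (apply Cmult_integral in r1; destruct r1 as [r|r]; [apply sb, r|tauto]).
    subst l.
    assert (B0 : B = 0).
    { apply Cmult_integral in r2. destruct r2 as [r|r]; auto. exfalso. apply z1. apply sb, r. }
    assert (E0 : E <> 0) by (intros h; apply dtD; rewrite B0, h; ring).
    assert (ep : zeta = ps).
    { apply Cmult_integral in r4. destruct r4 as [r|r]; [|tauto]. rewrite (sb _ _ r). ring. }
    assert (eb : th = et) by (unfold th; rewrite ep; exact hb).
    rewrite B0 in dB. symmetry in dB. apply Cmult_integral in dB. destruct dB as [|dB]; [tauto|].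
    rewrite cz, eb in dB.
    assert (dB' : (x * x * et) * ((et + / et) - (zeta + / zeta)) = 0).
    { rewrite <- dB. field. auto. }
    apply Cmult_integral in dB'. destruct dB' as [dB'|dB']; [|apply sb, dB'].
    exfalso. exact (Cmult_neq_0 _ _ xnz et0 dB').
Qed.

End Monodromy.

From Stdlib Require Lqa.


(** * Roots of unity *)

Lemma trig_int (n : Z) : cos (2 * PI * IZR n) = 1%R /\ sin (2 * PI * IZR n) = 0%R.
Proof.
  assert (s : sin (IZR n * PI) = 0%R) by (apply sin_eq_0_1; exists n; reflexivity).
  replace (2 * PI * IZR n)%R with (2 * (IZR n * PI))%R by ring. rewrite cos_2a_sin, sin_2a, s. split; ring.
Qed.

Lemma cos_shift (s : R) (n : Z) : cos (2 * PI * (s + IZR n)) = cos (2 * PI * s).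
Proof. rewrite Rmult_plus_distr_l, cos_plus. destruct (trig_int n) as [-> ->]. ring. Qed.

Lemma ek_val (s : R) : ek s = (cos (2 * PI * s), sin (2 * PI * s)).
Proof.
  unfold ek, Cexp. rewrite Re_tpi, Im_tpi. simpl Re. simpl Im.
  replace (- (2 * PI * 0))%R with 0%R by ring. rewrite exp_0. apply injective_projections; simpl; ring.
Qed.

Lemma ek_1 (s : R) : ek s = 1 -> exists n : Z, s = IZR n.
Proof.
  rewrite ek_val. intros E. assert (c := f_equal fst E). simpl in c.
  replace (2 * PI * s)%R with (2 * (PI * s))%R in c by ring. rewrite cos_2a_sin in c.
  assert (s0 : sin (PI * s) = 0%R) by nra.
  destruct (sin_eq_0_0 _ s0) as [n e]. exists n. assert (p := PI_RGT_0).
  apply (Rmult_eq_reg_l PI); [rewrite e; ring|Lra.lra].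
Qed.

Lemma ek_nat (s : R) (n : nat) : ek s ^ n = ek (INR n * s).
Proof. unfold ek. rewrite <- Cexp_nat. f_equal. rewrite RtoC_mult. ring. Qed.

Lemma ek_nz (s : R) : ek s <> 0.
Proof. apply Cexp_nz. Qed.

Lemma ek_sum (s : R) : ek s + / ek s = RtoC (2 * cos (2 * PI * s)).
Proof.
  assert (n := ek_nz s).
  assert (E : / ek s = ek (- s)).
  { transitivity (ek s * ek (- s) / ek s); [|field; auto].
    replace (ek s * ek (- s)) with (RtoC 1); [field; auto|].
    unfold ek. rewrite <- Cexp_plus, <- Cexp_0. f_equal. rewrite RtoC_opp. ring. }
  rewrite E, !ek_val. replace (2 * PI * - s)%R with (- (2 * PI * s))%R by ring. rewrite cos_neg, sin_neg.
  apply injective_projections; simpl; ring.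
Qed.

(** For $s=(k+1)/6$ this says $k\ge0$ or $k\le-2$, the two ranges covered by the energy argument. *)
Lemma cos_half (s : R) : cos (2 * PI * s) = (1 / 2)%R -> (1 / 6 <= s \/ s <= - (1 / 6))%R.
Proof.
  intros h. apply NNPP. intros q. assert (p := PI_RGT_0).
  assert (b : (Rabs s < 1 / 6)%R) by (apply Rabs_def1; Lra.lra).
  assert (e : cos (2 * PI * s) = cos (2 * PI * Rabs s)).
  { unfold Rabs. destruct (Rcase_abs s); auto. rewrite <- cos_neg. f_equal. ring. }
  assert (a := Rabs_pos s).
  assert (l := cos_decreasing_1 (2 * PI * Rabs s) (PI / 3) ltac:(nra) ltac:(nra) ltac:(nra) ltac:(nra) ltac:(nra)).
  rewrite <- e, h, cos_PI3 in l. Lra.lra.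
Qed.

(** * Units modulo m *)

Lemma rel_prime_shift (a b x : Z) : rel_prime a b -> rel_prime (a + b * x) b.
Proof. intros h. destruct (rel_prime_bezout _ _ h) as [p q E]. apply bezout_rel_prime. exists p (q - p * x)%Z. rewrite <- E. ring. Qed.

Lemma rel_prime_factor (a b c : Z) : rel_prime a (b * c) -> rel_prime a b.
Proof. intros h. destruct (rel_prime_bezout _ _ h) as [p q E]. apply bezout_rel_prime. exists p (q * c)%Z. rewrite <- E. ring. Qed.

(** Lifts a unit modulo [m] to a unit modulo [N] without factoring into primes. With $d=\gcd(t,N)$
    and $N=N'd$: if $N'=1$ then [N] divides [t] and $t+m$ works; otherwise solve for $N'$, and then
    for $d$ inside the class modulo $mN'$. *)
Lemma lift_unit (N : Z) : (0 <= N)%Z -> (0 < N)%Z -> forall t m, (0 < m)%Z -> rel_prime t m ->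
  exists x, (0 <= x)%Z /\ rel_prime (t + m * x) N.
Proof.
  revert N. apply (Z_lt_induction (fun N => (0 < N)%Z -> forall t m, (0 < m)%Z -> rel_prime t m ->
    exists x, (0 <= x)%Z /\ rel_prime (t + m * x) N)).
  intros N IH hN t m hm ht.
  assert (d0 := Z.gcd_nonneg t N). destruct (Z.gcd_divide_l t N) as [t' et]. destruct (Z.gcd_divide_r t N) as [N' eN].
  remember (Z.gcd t N) as d eqn:ed.
  assert (hd : (0 < d)%Z) by (destruct (Z.eq_dec d 0) as [e|]; [rewrite e, Z.mul_0_r in eN; lia|lia]).
  assert (hN' : (0 < N')%Z) by (clear et; nia).
  destruct (Z.eq_dec d 1) as [e1|n1].
  { exists 0%Z. split; [lia|]. rewrite Z.mul_0_r, Z.add_0_r. apply Zgcd_1_rel_prime. rewrite <- ed. exact e1. }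
  destruct (Z.eq_dec N' 1) as [e2|n2].
  { exists 1%Z. split; [lia|]. rewrite Z.mul_1_r.
    apply rel_prime_sym in ht. apply (rel_prime_shift m t 1) in ht. rewrite Z.mul_1_r, Z.add_comm in ht.
    rewrite eN, e2, Z.mul_1_l. apply (rel_prime_factor _ _ t'). rewrite Z.mul_comm, <- et. exact ht. }
  destruct (IH N') with (t := t) (m := m) as [x [hx px]]; auto; [split; nia|].
  destruct (IH d) with (t := (t + m * x)%Z) (m := (m * N')%Z) as [x' [hx' px']]; auto; [split; nia|nia| |].
  { apply rel_prime_mult; auto. apply rel_prime_shift, ht. }
  exists (x + N' * x')%Z. split; [nia|].
  replace (t + m * (x + N' * x'))%Z with (t + m * x + m * N' * x')%Z by ring.
  rewrite eN. apply rel_prime_mult; auto.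
  replace (t + m * x + m * N' * x')%Z with (t + m * x + N' * (m * x'))%Z by ring. apply rel_prime_shift, px.
Qed.

Lemma unit_inverse (N : nat) (a : Z) : (1 <= N)%nat -> (0 < a)%Z -> rel_prime a (Z.of_nat N) ->
  exists b w : nat, (Z.to_nat a * b = 1 + N * w)%nat.
Proof.
  intros hN ha h. destruct (rel_prime_bezout _ _ h) as [p q E].
  set (K := (Z.abs p + Z.abs q)%Z).
  exists (Z.to_nat (p + Z.of_nat N * K)), (Z.to_nat (a * K - q)).
  apply Nat2Z.inj. rewrite Nat2Z.inj_mul, Nat2Z.inj_add, Nat2Z.inj_mul, !Z2Nat.id; unfold K in *; try nia.
Qed.

(** Take $2$ for odd [m], and $2l-1$ for $m=4l$ and for $m=4l+2$; at $m=6$ this would give only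
    $1$. *)
Lemma coprime_below_half (m : Z) : (7 <= m)%Z -> exists r, (2 <= r)%Z /\ (2 * r <= m)%Z /\ rel_prime r m.
Proof.
  intros hm. destruct (Z.Even_or_Odd m) as [[h e]|[h e]].
  - destruct (Z.Even_or_Odd h) as [[l e']|[l e']].
    + exists (2 * l - 1)%Z. split; [lia|]. split; [lia|]. apply bezout_rel_prime. exists (2 * l - 1)%Z (- (l - 1))%Z. subst. ring.
    + exists (2 * l - 1)%Z. split; [lia|]. split; [lia|]. apply bezout_rel_prime.
      destruct (Z.Even_or_Odd l) as [[i ei]|[i ei]].
      * exists (- (2 * i + 1))%Z i. subst. ring.
      * exists (1 + 2 * i)%Z (- i)%Z. subst. ring.
  - exists 2%Z. split; [lia|]. split; [lia|]. apply bezout_rel_prime. exists (- h)%Z 1%Z. subst. ring.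
Qed.

(* Since c(1/m) = 2 cos(2 pi / m) - 1 lies in [0, 1), the two alternatives force c(j/m) = c(1/m), and
   then c(r/m) = c(1/m) for every unit r, which fails for some r between 2 and m / 2. *)
Lemma cosine_obstruction (N : nat) (j m : Z) : (1 <= N)%nat -> (6 <= m)%Z -> rel_prime j m -> (m | Z.of_nat N)%Z ->
  let c (s : R) := (2 * cos (2 * PI * s) - 1)%R in let s0 := (IZR j / IZR m)%R in
  c s0 <> 0%R ->
  (forall a b w : nat, (a * b = 1 + N * w)%nat -> c (INR a * s0)%R = c s0 \/ (c s0 * c (INR a * s0))%R = 1%R) -> False.
Proof.
  intros hN hm hj hmN c s0 h0 H.
  assert (pi := PI_RGT_0). assert (mR : (6 <= IZR m)%R) by (apply IZR_le; auto).
  assert (C1 : forall s, (c s <= 1)%R) by (intros s; unfold c; destruct (COS_bound (2 * PI * s)); Lra.lra).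
  (* Choose $a\equiv tp$ modulo [m], with [p] inverse to [j], so that $aj/m\equiv t/m$ modulo 1, and
     lift it to a unit modulo [N]. The multiple of [m] added in [t'] only makes it positive. *)
  assert (K : forall t, (0 < t)%Z -> rel_prime t m -> c (IZR t / IZR m)%R = c s0 \/ (c s0 * c (IZR t / IZR m))%R = 1%R).
  { intros t ht pt. destruct (rel_prime_bezout _ _ hj) as [p q E].
    assert (pp : rel_prime p m) by (apply bezout_rel_prime; exists j q; rewrite <- E; ring).
    set (t' := (t * p + m * (Z.abs (t * p) + 1))%Z).
    assert (t'0 : (0 < t')%Z) by (unfold t'; nia).
    assert (pt' : rel_prime t' m).
    { apply rel_prime_shift. apply rel_prime_sym, rel_prime_mult; apply rel_prime_sym; auto. }
    destruct (lift_unit (Z.of_nat N) ltac:(lia) ltac:(lia) t' m ltac:(lia) pt') as [x [hx px]].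
    set (a := (t' + m * x)%Z) in *. assert (a0 : (0 < a)%Z) by (unfold a; nia).
    destruct (unit_inverse N a hN a0 px) as [b [w hab]].
    assert (e : (INR (Z.to_nat a) * s0)%R = (IZR t / IZR m + IZR ((Z.abs (t * p) + 1) * j + x * j - t * q))%R).
    { rewrite INR_IZR_INZ, Z2Nat.id by lia. unfold s0.
      assert (ee : (a * j = t + m * ((Z.abs (t * p) + 1) * j + x * j - t * q))%Z).
      { unfold a, t'. replace t with (t * (p * j + q * m))%Z at 3 by (rewrite E; ring). ring. }
      apply (f_equal IZR) in ee. rewrite plus_IZR, !(mult_IZR a), (mult_IZR m) in ee.
      apply (Rmult_eq_reg_r (IZR m)); [|Lra.lra].
      transitivity (IZR a * IZR j)%R; [field; Lra.lra|rewrite ee; field; Lra.lra]. }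
    assert (H' := H _ _ _ hab). rewrite e in H'.
    assert (ec : forall s n, c (s + IZR n)%R = c s) by (intros; unfold c; rewrite cos_shift; auto).
    rewrite ec in H'. exact H'. }
  set (c1 := c (IZR 1 / IZR m)%R).
  assert (lt1 : (0 < 1 / IZR m)%R) by (apply Rdiv_lt_0_compat; Lra.lra).
  assert (le6 : (1 / IZR m <= 1 / 6)%R) by (apply Rmult_le_compat_l; [Lra.lra|apply Rinv_le_contravar; Lra.lra]).
  assert (c1lt : (c1 < 1)%R).
  { assert (l := cos_decreasing_1 0 (2 * PI * (1 / IZR m)) ltac:(Lra.lra) ltac:(Lra.lra) ltac:(nra) ltac:(nra) ltac:(nra)).
    rewrite cos_0 in l. unfold c1, c. Lra.lra. }
  assert (c1ge : (0 <= c1)%R).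
  { unfold c1, c. destruct (Req_dec (1 / IZR m) (1 / 6)) as [e|n].
    - rewrite e. replace (2 * PI * (1 / 6))%R with (PI / 3)%R by field. rewrite cos_PI3. Lra.lra.
    - assert (l := cos_decreasing_1 (2 * PI * (1 / IZR m)) (PI / 3) ltac:(nra) ltac:(nra) ltac:(nra) ltac:(nra) ltac:(nra)).
      rewrite cos_PI3 in l. Lra.lra. }
  assert (p1 : rel_prime 1 m) by (apply bezout_rel_prime; exists 1%Z 0%Z; ring).
  (* A product equal to 1 is impossible, since $0\le c(1/m)<1$ and $c\le1$ everywhere. *)
  assert (e0 : c1 = c s0).
  { destruct (K 1%Z ltac:(lia) p1) as [e|e]; [exact e|exfalso]. fold c1 in e. assert (q := C1 s0). nra. }
  (* For $m=6$ one has $c(1/6)=0$, against $c(s_0)\ne0$. *)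
  assert (m7 : (7 <= m)%Z).
  { destruct (Z.eq_dec m 6) as [e6|]; [|lia]. exfalso. apply h0. rewrite <- e0. unfold c1, c. rewrite e6.
    replace (2 * PI * (1 / 6))%R with (PI / 3)%R by field. rewrite cos_PI3. field. }
  destruct (coprime_below_half m m7) as [r [r2 [rm pr]]].
  apply IZR_le in r2. apply IZR_le in rm. rewrite mult_IZR in rm.
  assert (q := C1 (IZR r / IZR m)%R).
  destruct (K r ltac:(apply lt_IZR; Lra.lra) pr) as [e|e]; rewrite <- e0 in e; [|nra].
  assert (rr : (IZR r / IZR m <= 1 / 2)%R) by (apply (Rmult_le_reg_r (IZR m)); [Lra.lra|]; replace (IZR r / IZR m * IZR m)%R with (IZR r) by (field; Lra.lra); Lra.lra).
  assert (rl : (1 / IZR m < IZR r / IZR m)%R) by (apply Rmult_lt_compat_r; [apply Rinv_0_lt_compat|]; Lra.lra).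
  assert (l := cos_decreasing_1 (2 * PI * (1 / IZR m)) (2 * PI * (IZR r / IZR m)) ltac:(nra) ltac:(nra) ltac:(nra) ltac:(nra) ltac:(nra)).
  unfold c1, c in e. Lra.lra.
Qed.

(** * Conclusion *)

Lemma lowest_terms (k : Q) : exists j m : Z, (0 < m)%Z /\ rel_prime j m /\ ((k + 1) * inject_Z m == 6 * inject_Z j)%Q.
Proof.
  set (q := Qred ((k + 1) / 6)).
  exists (Qnum q), (Zpos (Qden q)). split; [lia|]. split.
  - apply Zgcd_1_rel_prime. unfold q, Qred. destruct ((k + 1) / 6)%Q as [a b].
    assert (g := Z.ggcd_correct_divisors a (Zpos b)). assert (g2 := Z.ggcd_gcd a (Zpos b)).
    assert (z := Z.gcd_nonneg a (Zpos b)).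
    destruct (Z.ggcd a (Zpos b)) as [g0 [aa bb]]. simpl in *. destruct g as [ea eb]. subst g0.
    remember (Z.gcd a (Zpos b)) as g eqn:eg.
    assert (gp : (0 < g)%Z) by (destruct (Z.eq_dec g 0) as [e|]; [rewrite e in eb; lia|lia]).
    assert (bp : (0 < bb)%Z) by (apply (Z.mul_pos_cancel_l g); [exact gp|lia]).
    rewrite Z2Pos.id by exact bp.
    apply (Z.mul_reg_l _ _ g); [lia|]. rewrite <- Z.gcd_mul_mono_l_nonneg by lia. rewrite <- ea, <- eb, <- eg. ring.
  - assert (E : (q == (k + 1) / 6)%Q) by apply Qred_correct.
    assert (E2 : (q * inject_Z (Zpos (Qden q)) == inject_Z (Qnum q))%Q) by (destruct q; unfold Qeq; simpl; lia).
    rewrite <- E2. set (D := inject_Z (Z.pos (Qden q))). rewrite E. field.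
Qed.

(** Here $k=6j/m-1$. Denominators 2, 3 and 4 give the residues $2$; $1,3$; $\frac12,\frac72$, and
    denominators 1 and 5 fall into the family $(6n+1)/5$. No coprimality is assumed, so reducible
    fractions land in the case of their reduced denominator. *)
Lemma small_denominator (k : Q) (j m : Z) : (0 < m < 6)%Z -> ((k + 1) * inject_Z m == 6 * inject_Z j)%Q ->
  congr6 k (1 # 2) \/ congr6 k (7 # 2) \/ congr6 k 1 \/ congr6 k 2 \/ congr6 k 3 \/
  exists n : Z, (k == (6 * inject_Z n + 1) / 5)%Q.
Proof.
  intros hm E. set (x := inject_Z j) in *.
  assert (F : forall n : Z, (5 * k == 6 * inject_Z n + 1)%Q -> exists n : Z, (k == (6 * inject_Z n + 1) / 5)%Q).
  { intros n h. exists n. rewrite <- h. field. }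
  assert (C : forall a n, (k == 6 * inject_Z n + a)%Q -> congr6 k a) by (intros a n h; exists n; rewrite h; ring).
  assert (Cm : m = 1%Z \/ m = 2%Z \/ m = 3%Z \/ m = 4%Z \/ m = 5%Z) by lia.
  destruct Cm as [e|[e|[e|[e|e]]]]; subst m.
  - change (inject_Z 1) with (1 # 1) in E. do 5 right. apply (F (5 * j - 1)%Z).
    unfold Z.sub. rewrite inject_Z_plus, inject_Z_mult. change (inject_Z 5) with (5 # 1). change (inject_Z (- (1))) with (- 1 # 1). fold x. Lqa.lra.
  - change (inject_Z 2) with (2 # 1) in E. destruct (Z.Even_or_Odd j) as [[i ei]|[i ei]]; unfold x in E; rewrite ei in E;
      rewrite ?inject_Z_plus, ?inject_Z_mult in E; change (inject_Z 2) with (2 # 1) in E; change (inject_Z 1) with (1 # 1) in E.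
    + do 5 right. apply (F (5 * i - 1)%Z).
      unfold Z.sub. rewrite inject_Z_plus, inject_Z_mult. change (inject_Z 5) with (5 # 1). change (inject_Z (- (1))) with (- 1 # 1). Lqa.lra.
    + do 3 right. left. apply (C _ i). Lqa.lra.
  - change (inject_Z 3) with (3 # 1) in E.
    assert (D := Z.div_mod j 3 ltac:(lia)). assert (B := Z.mod_pos_bound j 3 ltac:(lia)). set (i := (j / 3)%Z) in *.
    assert (Cr : (j mod 3 = 0 \/ j mod 3 = 1 \/ j mod 3 = 2)%Z) by lia. unfold x in E.
    destruct Cr as [r|[r|r]]; rewrite r in D; rewrite D in E; rewrite inject_Z_plus, inject_Z_mult in E; change (inject_Z 3) with (3 # 1) in E.
    + change (inject_Z 0) with (0 # 1) in E. do 5 right. apply (F (5 * i - 1)%Z).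
      unfold Z.sub. rewrite inject_Z_plus, inject_Z_mult. change (inject_Z 5) with (5 # 1). change (inject_Z (- (1))) with (- 1 # 1). Lqa.lra.
    + change (inject_Z 1) with (1 # 1) in E. do 2 right. left. apply (C _ i). Lqa.lra.
    + change (inject_Z 2) with (2 # 1) in E. do 4 right. left. apply (C _ i). Lqa.lra.
  - change (inject_Z 4) with (4 # 1) in E.
    assert (D := Z.div_mod j 4 ltac:(lia)). assert (B := Z.mod_pos_bound j 4 ltac:(lia)). set (i := (j / 4)%Z) in *.
    assert (Cr : (j mod 4 = 0 \/ j mod 4 = 1 \/ j mod 4 = 2 \/ j mod 4 = 3)%Z) by lia. unfold x in E.
    destruct Cr as [r|[r|[r|r]]]; rewrite r in D; rewrite D in E; rewrite inject_Z_plus, inject_Z_mult in E; change (inject_Z 4) with (4 # 1) in E.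
    + change (inject_Z 0) with (0 # 1) in E. do 5 right. apply (F (5 * i - 1)%Z).
      unfold Z.sub. rewrite inject_Z_plus, inject_Z_mult. change (inject_Z 5) with (5 # 1). change (inject_Z (- (1))) with (- 1 # 1). Lqa.lra.
    + change (inject_Z 1) with (1 # 1) in E. left. apply (C _ i). Lqa.lra.
    + change (inject_Z 2) with (2 # 1) in E. do 3 right. left. apply (C _ i). Lqa.lra.
    + change (inject_Z 3) with (3 # 1) in E. right. left. apply (C _ i). Lqa.lra.
  - change (inject_Z 5) with (5 # 1) in E. do 5 right. apply (F (j - 1)%Z).
    unfold Z.sub. rewrite inject_Z_plus. change (inject_Z (- (1))) with (- 1 # 1). fold x. Lqa.lra.
Qed.

(* A diagonal S makes both u and v eigenfunctions of S, and the energy argument then kills v if k >= 0 and u if k <= -2. *)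
Lemma not_decoupled (k : R) (u v : C -> C) (x : C) : IsBasis k u v ->
  ((0 < kc k)%R -> exists K A : R, (0 < A)%R /\ (0 <= K)%R /\ (forall t, (A < Im t)%R -> (Cmod (v t) <= K * exp (- (2 * PI * kc k * Im t)))%R)) ->
  ((kc k < 0)%R -> exists K A : R, (0 < A)%R /\ (0 <= K)%R /\ (forall t, (A < Im t)%R -> (Cmod (u t) <= K)%R)) ->
  acts k u v 0 (-1) 1 0 (mk2 x 0 0 (- x)) -> (1 / 6 <= kc k \/ kc k <= - (1 / 6))%R -> False.
Proof.
  intros HB bv bu [_ [_ [J [hJ H]]]] hk. assert (HB' := HB). destruct HB' as [u1 [v1 [Su [Sv _]]]]. unfold kc in hk.
  destruct hk as [hk|hk].
  - destruct bv as [K [A [_ [K0 bd]]]]; [unfold kc; Lra.lra|].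
    assert (ei : v Ci = 0 \/ v1 Ci = RtoC (k / (4 * PI)) * v Ci).
    { apply (eigen_at_i k v v1 J (- x) Sv hJ). intros t ht. destruct (H t ht) as [_ e]. rewrite e. simpl. ring. }
    destruct (basis_nonzero k v u (basis_swap k u v HB)) as [t [ht nt]]. apply nt.
    apply (axis_vanish k v v1 K A Sv ei K0); auto. left. split; [Lra.lra|exact bd].
  - destruct bu as [K [A [_ [K0 bd]]]]; [unfold kc; Lra.lra|].
    assert (ei : u Ci = 0 \/ u1 Ci = RtoC (k / (4 * PI)) * u Ci).
    { apply (eigen_at_i k u u1 J x Su hJ). intros t ht. destruct (H t ht) as [e _]. rewrite e. simpl. ring. }
    destruct (basis_nonzero k u v HB) as [t [ht nt]]. apply nt.
    apply (axis_vanish k u u1 K A Su ei K0); auto. right. split; [Lra.lra|exact bd].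
Qed.

Lemma modular_basis_small_denominator (N : nat) (k w1 w2 : R) (f g : C -> C) (k1 k2 : C) (b1 b2 : nat -> C) (R1 R2 A1 A2 : R) (j m : Z) :
  (1 <= N)%nat -> IsBasis k f g -> gm N w1 f -> gm N w2 g -> cusp N f k1 b1 R1 A1 -> cusp N g k2 b2 R2 A2 ->
  kc k = (IZR j / IZR m)%R -> (0 < m)%Z -> rel_prime j m -> (m < 6)%Z.
Proof.
  intros hN HF G1 G2 c1 c2 hk hm hj. destruct (Z_lt_le_dec m 6) as [|m6]; auto. exfalso.
  assert (mR : (6 <= IZR m)%R) by (apply IZR_le; auto).
  (* Coprimality of [j] and [m] makes $\zeta$ of exact order [m]; this excludes $\zeta=\pm1$ and
     later turns $\zeta^N=1$ into $m\mid N$. *)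
  assert (num : forall n : nat, ek (kc k) ^ n = 1 -> (m | Z.of_nat n)%Z).
  { intros n. rewrite ek_nat. intros e. apply ek_1 in e. destruct e as [i e].
    apply (Gauss m j); [|apply rel_prime_sym, hj]. exists i. apply eq_IZR. rewrite !mult_IZR, <- e, hk, INR_IZR_INZ. field. Lra.lra. }
  set (zeta := ek (kc k)) in *.
  assert (z0 : zeta <> 0) by apply ek_nz.
  assert (z1 : zeta <> 1).
  { intros e. assert (d : (m | 1)%Z) by (apply (num 1%nat); rewrite Cpow_1_r; exact e). apply Z.divide_pos_le in d; lia. }
  assert (zm : zeta + 1 <> 0).
  { intros e. assert (d : (m | 2)%Z).
    { apply (num 2%nat). simpl. transitivity ((zeta + 1) * (zeta - 1) + 1); [ring|rewrite e; ring]. }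
    apply Z.divide_pos_le in d; lia. }
  destruct (eigenbasis N k f g k1 k2 b1 b2 R1 R2 A1 A2 hN HF z1 c1 c2) as [u [v [HB [Tu [Tv [bv bu]]]]]].
  fold zeta in Tv.
  destruct (basis_matrix k u v f g HB HF) as [p [q [r [s [hP [Ef Eg]]]]]].
  assert (hG := gamma_PD N k w1 w2 f g u v p q r s hN HF G1 G2 hP Ef Eg).
  assert (hT := acts_T k u v zeta z0 Tu Tv).
  destruct (S_acts k u v HB) as [[x y z w] [hS tr]]. simpl in tr.
  assert (hT1 := hT 1%nat). rewrite Cpow_1_r in hT1.
  destruct (ST_rel k u v zeta x y z w HB z0 zm hS tr hT1) as [ew [hd hR]]. subst w.
  assert (es : zeta + / zeta = RtoC (2 * cos (2 * PI * kc k))) by apply ek_sum.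
  destruct (classic (y * z = 0)) as [yz|yz].
  - destruct (not_triangular N k u v (mk2 p q r s) zeta x y z hN hP hG z0 hT hS hd hR yz) as [-> ->].
    apply (not_decoupled k u v x HB bv bu hS). apply cos_half.
    (* With $y=z=0$ the relation for $(ST)^3$ leaves $1-\zeta+\zeta^2=0$. *)
    assert (hz : zeta + / zeta = 1).
    { assert (xx : x * x <> 0) by (intros e; apply hd; rewrite e; ring).
      assert (h : x * x * (1 - zeta + zeta * zeta) = 0) by (rewrite <- hR; ring).
      apply Cmult_integral in h. destruct h as [|h]; [tauto|].
      transitivity ((1 - zeta + zeta * zeta) / zeta + 1); [field; auto|rewrite h; field; auto]. }
    rewrite hz in es. apply (f_equal fst) in es. simpl in es. Lra.lra.
  - assert (rel := unit_relation N k u v (mk2 p q r s) zeta x y z hN hP hG z0 z1 zm hT hS hR yz).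
    assert (mN : (m | Z.of_nat N)%Z).
    { apply num. exact (zeta_pow_N N k u v (mk2 p q r s) zeta x y z hP hG z0 z1 zm hT hS hR yz). }
    assert (cr : forall t : R, ek t + / ek t - 1 = RtoC (2 * cos (2 * PI * t) - 1)) by (intros t; rewrite ek_sum, RtoC_minus; reflexivity).
    apply (cosine_obstruction N j m hN m6 hj mN); rewrite <- hk.
    + intros e. destruct (rel 1%nat 1%nat 0%nat ltac:(lia)) as [h _]. apply h. unfold zeta. rewrite cr, e. reflexivity.
    + intros a b w hab. destruct (rel a b w hab) as [_ [h|h]]; [left|right]; unfold zeta in h; rewrite ek_nat in h.
      * apply RtoC_inj. rewrite <- !cr, h. reflexivity.
      * rewrite !cr, <- RtoC_mult in h. apply RtoC_inj, h.
Qed.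

Local Close Scope C_scope.

Theorem mainTheorem1 (N : nat) (hN : (1 <= N)%nat) (k : Q)
  (hKZ : exists f1 f2 : C -> C,
    KZ_solution k f1 /\ KZ_solution k f2 /\
    linearly_independent_on_H f1 f2 /\
    is_modular_form N f1 /\ is_modular_form N f2) :
  congr6 k (1 # 2) \/ congr6 k (7 # 2) \/
  congr6 k 1 \/ congr6 k 2 \/ congr6 k 3 \/
  exists n : Z, (k == (6 * inject_Z n + 1) / 5)%Q.
Proof.
  destruct hKZ as [f1 [f2 [K1 [K2 [hli [[M1 [_ [w1 [T1 C1]]]] [M2 [_ [w2 [T2 C2]]]]]]]]]].
  destruct (KZ_ext k f1 K1 M1) as [y1 [S1 _]]. destruct (KZ_ext k f2 K2 M2) as [y2 [S2 _]].
  destruct (fill_cusp N k (Q2R w1) f1 hN K1 M1 (C1 idm)) as [k1 [b1 [R1 [A1 c1]]]].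
  destruct (fill_cusp N k (Q2R w2) f2 hN K2 M2 (C2 idm)) as [k2 [b2 [R2 [A2 c2]]]].
  (* A relation between the extensions restricts to one between [f1] and [f2] wherever both are
     holomorphic, and only there does the independence hypothesis speak. *)
  assert (HB : IsBasis (Q2R k) (fill f1) (fill f2)).
  { apply (indep_basis _ _ y1 _ y2 S1 S2). intros a b h. apply hli. intros t ht h1 h2.
    rewrite (fill_HA f1 t), (fill_HA f2 t) by (apply holomorphic_HA; assumption). apply h, ht. }
  destruct (lowest_terms k) as [j [m [hm [hj E]]]].
  apply (small_denominator k j m); [split; [exact hm|]|exact E].
  refine (modular_basis_small_denominator N _ _ _ _ _ _ _ _ _ _ _ _ _ j m hN HB
    (gm_fill N k _ f1 K1 M1 T1) (gm_fill N k _ f2 K2 M2 T2) c1 c2 _ hm hj).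
  apply Qeq_eqR in E. rewrite !Q2R_mult, Q2R_plus in E.
  assert (e1 : Q2R 1 = 1%R) by (unfold Q2R; simpl; field).
  assert (e6 : Q2R 6 = 6%R) by (unfold Q2R; simpl; field).
  assert (ei : forall i : Z, Q2R (inject_Z i) = IZR i) by (intros i; unfold Q2R; simpl; field).
  rewrite e1, e6, !ei in E. apply IZR_lt in hm. unfold kc.
  apply (Rmult_eq_reg_r (6 * IZR m)); [|Lra.lra].
  transitivity ((Q2R k + 1) * IZR m)%R; [field|rewrite E; field; Lra.lra].
Qed.
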